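(* Let $K,L\subset\mathbb{R}^2$ be closed convex proper subsets with nonempty interior. In the following, $\varphi,\psi$ always denote orientation preserving congruences $\mathbb{R}^2\to\mathbb{R}^2$ with $\operatorname{int}[(\varphi K)\cap(\psi L)]\neq\emptyset$. Then $(1)\Leftrightarrow(2)$, where (1) For each $\varphi,\psi$ the set $(\varphi K)\cap(\psi L)$ admits some non-trivial congruence. (2) $K$ and $L$ are (in general incongruent) circles, or one of them is a circle and the other one is a parallel strip or a half-plane, or they are two parallel strips, or they are two half-planes. In particular: for each $\varphi,\psi$ the set $(\varphi K)\cap(\psi L)$ is centrally symmetric if and only if $K$ and $L$ are either two congruent circles or two parallel strips. Similarly, for each $\varphi,\psi$ the set $(\varphi K)\cap(\psi L)$ is axially symmetric if and only if (2) holds with the addition that, in the case of two parallel strips, these strips are congruent.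
   Context: A congruence is an isometry of $\mathbb{R}^2$ onto itself; it is non-trivial if it is not the identity. A set $M$ admits a congruence $\chi$ if $\chi(M)=M$. $M$ is axially symmetric if it admits the reflection with respect to some straight line, and centrally symmetric if it admits the symmetry with respect to some point. ''Proper'' means different from $\mathbb{R}^2$. A ''circle'' as a set $K$ or $L$ means a closed disk. A parallel strip is the closed region between two distinct parallel straight lines; the two strips $K$, $L$ need not be parallel to each other or of equal width. Half-planes are closed. *)

(* Defs.v *)
From HB Require Import structures.
From mathcomp Require Import all_boot all_order all_algebra.
From mathcomp Require Import all_classical all_reals all_analysis.

Set Implicit Arguments.
Unset Strict Implicit.
Unset Printing Implicit Defensive.

Import Order.TTheory GRing.Theory Num.Theory.
Import numFieldNormedType.Exports.

Local Open Scope classical_set_scope.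
Local Open Scope ring_scope.

(* The library norm on 'rV[R]_2 is the sup norm: it induces the usual topology
   of the plane, but the metric notions below need the Euclidean one. *)

Definition dot (R : realType) (u v : 'rV[R]_2) : R := \sum_i u 0 i * v 0 i.

Definition edist (R : realType) (x y : 'rV[R]_2) : R :=
  Num.sqrt (dot (x - y) (x - y)).

Definition congruence (R : realType) (f : 'rV[R]_2 -> 'rV[R]_2) : Prop :=
  (forall x y, edist (f x) (f y) = edist x y) /\ (forall y, exists x, f x = y).

Definition orientation_preserving (R : realType)
    (f : 'rV[R]_2 -> 'rV[R]_2) : Prop :=
  exists (A : 'M[R]_2) (b : 'rV[R]_2),
    0 < \det A /\ forall x, f x = x *m A + b.

Definition congruent (R : realType) (K L : set 'rV[R]_2) : Prop :=
  exists f, congruence f /\ f @` K = L.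

Definition admits (R : realType) (M : set 'rV[R]_2)
    (f : 'rV[R]_2 -> 'rV[R]_2) : Prop := f @` M = M.

Definition admits_nontrivial_congruence (R : realType)
    (M : set 'rV[R]_2) : Prop :=
  exists f, [/\ congruence f, f <> id & admits M f].

Definition point_symmetry (R : realType) (p x : 'rV[R]_2) : 'rV[R]_2 :=
  2 *: p - x.

(* Reflection in the straight line {x | dot n x = c}, for n != 0. *)
Definition line_reflection (R : realType) (n : 'rV[R]_2) (c : R)
    (x : 'rV[R]_2) : 'rV[R]_2 :=
  x - (2 * (dot n x - c) / dot n n) *: n.

Definition centrally_symmetric (R : realType) (M : set 'rV[R]_2) : Prop :=
  exists p, admits M (point_symmetry p).

Definition axially_symmetric (R : realType) (M : set 'rV[R]_2) : Prop :=
  exists n c, n != 0 /\ admits M (line_reflection n c).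

Definition is_disk (R : realType) (M : set 'rV[R]_2) : Prop :=
  exists a r, 0 < r /\ M = [set x | edist a x <= r].

Definition is_half_plane (R : realType) (M : set 'rV[R]_2) : Prop :=
  exists n c, n != 0 /\ M = [set x | dot n x <= c].

Definition is_strip (R : realType) (M : set 'rV[R]_2) : Prop :=
  exists n c d, [/\ n != 0, c < d & M = [set x | c <= dot n x <= d]].

Definition for_all_positions (R : realType) (K L : set 'rV[R]_2)
    (P : set 'rV[R]_2 -> Prop) : Prop :=
  forall phi psi : 'rV[R]_2 -> 'rV[R]_2,
    congruence phi -> orientation_preserving phi ->
    congruence psi -> orientation_preserving psi ->
    ((phi @` K) `&` (psi @` L))° !=set0 ->
    P ((phi @` K) `&` (psi @` L)).

Definition special_pair (R : realType) (K L : set 'rV[R]_2) : Prop :=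
  [\/ is_disk K /\ is_disk L,
      (is_disk K /\ (is_strip L \/ is_half_plane L)) \/
      (is_disk L /\ (is_strip K \/ is_half_plane K)),
      is_strip K /\ is_strip L
    | is_half_plane K /\ is_half_plane L].

(* Main.v *)
(* Place L so that a short chord of its boundary coincides with a chord of the
   same length l of the boundary of K, the two sets lying on opposite sides.
   The intersection is a thin digon whose only points seeing it under an angle
   of at most 90 degrees are the two ends of the chord.  A symmetry permutes
   these ends, hence either preserves both arcs or exchanges them.  Letting the
   chord vary, all arcs of K over chords of length l are directly congruent,
   and such a curve is an arc of a circle or a segment.  This needs K to have no
   corner: truncating a corner by a flat part of the boundary of L gives a set
   with exactly three points of angle not close to 180 degrees, and these can be
   made the vertices of a scalene triangle, so that the set is asymmetric.

   Thus the boundary of K is locally a circle or a line.  Its germ at one point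
   propagates along the whole circle or line, and K is a disk, a half-plane or a
   strip.  The surviving pairs are compared in a few explicit positions. *)

Require Import Defs.
From HB Require Import structures.
From mathcomp Require Import all_boot all_order all_algebra.
From mathcomp Require Import all_classical all_reals all_analysis.
From mathcomp Require Import ring lra.
From mathcomp.real_closed Require Import complex.

Set Implicit Arguments.
Unset Strict Implicit.
Unset Printing Implicit Defensive.

Import ComplexField.
Import Order.TTheory GRing.Theory Num.Theory.
Import numFieldNormedType.Exports.

Local Open Scope classical_set_scope.
Local Open Scope ring_scope.

(** * Real functions *)

(** A symmetry of the digon may exchange the two arcs in mirrored form, so a single position need
    not yield a direct congruence. Two mechanisms repair this. If all short arcs of [K] are
    symmetric, two reflections compose to a direct congruence. Otherwise an arc of [L] of the same
    length serves as a reference: each arc of [K] is that arc or its mirror image, and continuity in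
    the starting point excludes a jump between the two. No derivative of the boundary is taken
    beyond one-sided slopes. Angles are compared through slopes or through inner and cross products,
    and the circle comes from an identity between chord directions read as unit complex numbers. The
    smallness constants have one source: turning the axes to a chord multiplies the deviation [e] of
    the slopes by at most 4. Corners have to be excluded first because thin caps around a boundary
    point require nearly constant slopes on both of its sides. *)

Lemma sup_exists (R : realType) (P : R -> Prop) (x0 M : R) :
  P x0 -> (forall x, P x -> x <= M) ->
  exists s, (forall x, P x -> x <= s) /\
    (forall t, t < s -> exists2 x, P x & t < x).
Proof.
move=> Px0 PM; have hs : has_sup (P : set R) by split; [exists x0|exists M].
exists (sup (P : set R)); split=> [x Px|t ts]; first exact: sup_upper_bound.
have e0 : 0 < sup (P : set R) - t by lra.
by have [x Px xt] := sup_adherent e0 hs; exists x => //; lra.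
Qed.

Lemma inf_exists (R : realType) (P : R -> Prop) (x0 M : R) :
  P x0 -> (forall x, P x -> M <= x) ->
  exists s, (forall x, P x -> s <= x) /\
    (forall t, s < t -> exists2 x, P x & x < t).
Proof.
move=> Px0 PM.
have [||s [s1 s2]] := @sup_exists R (fun x => P (- x)) (- x0) (- M).
- by rewrite opprK.
- by move=> x /PM; lra.
exists (- s); split=> [x Px|t ts].
  by have := s1 (- x); rewrite opprK => /(_ Px); lra.
have [|x Px tx] := s2 (- t); first by lra.
by exists (- x) => //; lra.
Qed.

(** [F] is arbitrary outside [a, b], so continuity on the whole line is not at hand. At the supremum
    of the points where [F <= v], a gap between [F c] and [v] would persist over a distance gap /
    C. *)
Lemma lipschitz_ivt (R : realType) (F : R -> R) (C a b v : R) :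
  a <= b ->
  (forall x y, a <= x -> x <= y -> y <= b -> `|F x - F y| <= C * (y - x)) ->
  F a <= v -> v <= F b -> exists2 c, a <= c <= b & F c = v.
Proof.
move=> ab lip Fa Fb.
pose P x := a <= x <= b /\ F x <= v.
have [||c [c1 c2]] := @sup_exists R P a b.
- by split=> //; lra.
- by move=> x [h _]; lra.
have ca : a <= c by apply: c1; split=> //; lra.
have cb : c <= b.
  rewrite leNgt; apply/negP => /c2[x [h _] bx]; lra.
exists c; first by lra.
(* [C] may be nonpositive; [C'] is a positive majorant by which the gap can be divided. *)
pose C' := `|C| + 1; have C0 : 0 < C' by rewrite /C' ltr_wpDl.
have CC : C <= C' by rewrite /C' (le_trans (ler_norm C)) // lerDl.
have [lt|gt|//] := ltgtP (F c) v.
- have cb' : c < b.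
    rewrite lt_neqAle cb andbT; apply/eqP => cb'; rewrite cb' in lt; lra.
  pose e := (v - F c) / C'.
  have e0 : 0 < e by rewrite divr_gt0 //; lra.
  have Ce : C' * e = v - F c by rewrite /e mulrC divfK // gt_eqF.
  pose y := Num.min b (c + e).
  have [yb yc cy] : [/\ y <= b, y <= c + e & c < y].
    by rewrite ge_min lexx ge_min lexx orbT lt_min cb'; split=> //; lra.
  have : P y.
    split; first by lra.
    have := lip c y ca (ltW cy) yb; rewrite ler_norml => /andP[h _].
    have : C * (y - c) <= C' * e by nra.
    lra.
  by move=> /c1; lra.
- pose e := (F c - v) / C'.
  have e0 : 0 < e by rewrite divr_gt0 //; lra.
  have Ce : C' * e = F c - v by rewrite /e mulrC divfK // gt_eqF.
  have [x [xab Fx] cx] := c2 (c - e) ltac:(lra).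
  have xc : x <= c by apply: c1; split.
  have := lip x c ltac:(lra) xc cb; rewrite ler_norml => /andP[h _].
  have : C * (c - x) <= C' * (c - x) by nra.
  have : C' * (c - x) < C' * e by rewrite ltr_pM2l //; lra.
  lra.
Qed.

Lemma lipschitz_ivt_decr (R : realType) (F : R -> R) (C a b v : R) :
  a <= b ->
  (forall x y, a <= x -> x <= y -> y <= b -> `|F x - F y| <= C * (y - x)) ->
  F b <= v -> v <= F a -> exists2 c, a <= c <= b & F c = v.
Proof.
move=> ab lip Fa Fb.
have [|||c h1 h2] := @lipschitz_ivt R (fun x => - F x) C a b (- v) ab.
- by move=> x y ax xy yb; rewrite -opprD normrN; exact: lip.
- lra.
- lra.
by exists c => //; lra.
Qed.

(** Connectedness of the line, later used to spread a germ along a curve. After a reflection only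
    [x >= 0] matters: at the supremum of the initial segments on which the property holds,
    closedness gives the property and openness pushes the supremum further. *)
Lemma real_induction (R : realType) (P : R -> Prop) :
  P 0 ->
  (forall x, P x -> exists2 d, 0 < d & forall y, `|y - x| < d -> P y) ->
  (forall x, (forall d, 0 < d -> exists2 y, `|y - x| < d & P y) -> P x) ->
  forall x, P x.
Proof.
suff H (Q : R -> Prop) : Q 0 ->
    (forall x, Q x -> exists2 d, 0 < d & forall y, `|y - x| < d -> Q y) ->
    (forall x, (forall d, 0 < d -> exists2 y, `|y - x| < d & Q y) -> Q x) ->
    forall x, 0 <= x -> Q x.
  move=> P0 Po Pc x; have [x0|x0] := leP 0 x; first exact: (H P).
  have /= := H (fun x => P (- x)) _ _ _ (- x); rewrite opprK; apply; last by lra.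
  - by rewrite oppr0.
  - move=> y /Po[d d0 h]; exists d => // z zy; apply: h.
    have -> : - z - - y = - (z - y) by ring.
    by rewrite normrN.
  - move=> y h; apply: Pc => d d0; have [z zy Pz] := h _ d0.
    exists (- z) => //.
    have -> : - z - - y = - (z - y) by ring.
    by rewrite normrN.
move=> Q0 Qo Qc x x0; apply: contrapT => nQx.
pose S z := 0 <= z <= x /\ forall y, 0 <= y <= z -> Q y.
have [||c [c1 c2]] := @sup_exists R S 0 x.
- by split=> [|y]; [lra|move=> ?; have -> : y = 0 by lra].
- by move=> z [h _]; lra.
have c0 : 0 <= c by apply: c1; split=> [|y]; [lra|move=> ?; have -> : y = 0 by lra].
have Qlt y : 0 <= y -> y < c -> Q y.
  by move=> y0 /c2[z [zx h] yz]; apply: h; lra.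
have Qc' : Q c.
  apply: Qc => d d0.
  have [cd|cd] := ltP c d; first by exists 0 => //; rewrite sub0r normrN ger0_norm.
  exists (c - d / 2); last by apply: Qlt; lra.
  by rewrite addrAC subrr sub0r normrN ger0_norm; lra.
have cx : c <= x by rewrite leNgt; apply/negP => /c2[z [h _] ?]; lra.
have [d d0 Qd] := Qo _ Qc'.
have cx' : c < x.
  by rewrite lt_neqAle cx andbT; apply/eqP => h; apply: nQx; rewrite -h.
pose z := Num.min x (c + d / 2).
have [zx zc cz] : [/\ z <= x, z <= c + d / 2 & c < z].
  by rewrite ge_min lexx ge_min lexx orbT lt_min cx'; split=> //; lra.
have /c1 : S z; last by lra.
split=> [|y yz]; first by lra.
have [yc|yc] := ltP y c; first by apply: Qlt => //; lra.
by apply: Qd; rewrite ger0_norm; lra.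
Qed.

Lemma le_or_lt (R : realType) (x y : R) : x <= y \/ y < x.
Proof. by case: (leP x y) => ?; [left|right]. Qed.

(** * Closed convex sets and their boundary charts *)

(** Plane sets are predicates in two real coordinates, so that every geometric step becomes
    polynomial algebra over the reals. *)
Definition pconvex (R : realType) (A : R -> R -> Prop) :=
  forall x y x' y' t, 0 <= t -> t <= 1 -> A x y -> A x' y' ->
    A (x + t * (x' - x)) (y + t * (y' - y)).

Definition pclosed (R : realType) (A : R -> R -> Prop) :=
  forall x y, (forall e, 0 < e ->
    exists x' y', [/\ `|x' - x| <= e, `|y' - y| <= e & A x' y']) -> A x y.

Definition pinterior (R : realType) (A : R -> R -> Prop) x y :=
  exists2 r, 0 < r &
    forall x' y', `|x' - x| <= r -> `|y' - y| <= r -> A x' y'.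

(** The set as seen from a moved frame: a preimage, so that [c], [s], [u], [v] describe the motion
    from the new coordinates to the old ones. *)
Definition rigid (R : realType) (c s u v : R) (A : R -> R -> Prop) x y :=
  A (c * x - s * y + u) (s * x + c * y + v).

(** Over [a, b] the set is a hypograph, known down to the depth [h] only; [f] carries no information
    outside [a, b]. *)
Definition chart (R : realType) (A : R -> R -> Prop) (f : R -> R) a b h :=
  [/\ 0 < h, forall x y, a <= x -> x <= b -> A x y -> y <= f x &
    forall x y, a <= x -> x <= b -> f x - h <= y -> y <= f x -> A x y].

Lemma rigid_convex (R : realType) c s u v (A : R -> R -> Prop) :
  pconvex A -> pconvex (rigid c s u v A).
Proof.
move=> cA x y x' y' t t0 t1; rewrite /rigid => A1 A2.
have := cA _ _ _ _ t t0 t1 A1 A2; congr (A _ _); ring.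
Qed.

(** Boxes are not invariant under rotation. The factor 2 paid here reappears as the margins
    [2 * rho] and [2 * l] around later chords. *)
Lemma norm_rotation_le (R : realType) (c s x y r : R) :
  c ^+ 2 + s ^+ 2 = 1 -> `|x| <= r -> `|y| <= r ->
  `|c * x - s * y| <= 2 * r /\ `|s * x + c * y| <= 2 * r.
Proof.
move=> cs xr yr.
have c1 : `|c| <= 1 by rewrite ler_norml; apply/andP; split; nra.
have s1 : `|s| <= 1 by rewrite ler_norml; apply/andP; split; nra.
have H a b : `|a| <= 1 -> `|b| <= r -> `|a * b| <= r.
  by move=> a1 br; rewrite normrM -(mul1r r) ler_pM.
split.
- by rewrite (le_trans (ler_normB _ _)) // mulr_natl mulr2n lerD // H.
- by rewrite (le_trans (ler_normD _ _)) // mulr_natl mulr2n lerD // H.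
Qed.

Lemma rigid_closed (R : realType) c s u v (A : R -> R -> Prop) :
  c ^+ 2 + s ^+ 2 = 1 -> pclosed A -> pclosed (rigid c s u v A).
Proof.
move=> cs cA x y h; apply: cA => e e0.
have [x' [y' [hx hy Axy]]] := h (e / 2) ltac:(lra).
exists (c * x' - s * y' + u), (s * x' + c * y' + v).
have [h1 h2] := norm_rotation_le cs hx hy.
split => //.
- have -> : c * x' - s * y' + u - (c * x - s * y + u) =
            c * (x' - x) - s * (y' - y) by ring.
  lra.
- have -> : s * x' + c * y' + v - (s * x + c * y + v) =
            s * (x' - x) + c * (y' - y) by ring.
  lra.
Qed.

Lemma rigid_interior (R : realType) c s u v (A : R -> R -> Prop) x y :
  c ^+ 2 + s ^+ 2 = 1 -> pinterior A (c * x - s * y + u) (s * x + c * y + v) ->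
  pinterior (rigid c s u v A) x y.
Proof.
move=> cs [r r0 h]; exists (r / 2); first by lra.
move=> x' y' hx hy; have [h1 h2] := norm_rotation_le cs hx hy.
apply: h.
- have -> : c * x' - s * y' + u - (c * x - s * y + u) =
            c * (x' - x) - s * (y' - y) by ring.
  lra.
- have -> : s * x' + c * y' + v - (s * x + c * y + v) =
            s * (x' - x) + c * (y' - y) by ring.
  lra.
Qed.

Lemma rigid_inv (R : realType) c s u v (A : R -> R -> Prop) :
  c ^+ 2 + s ^+ 2 = 1 ->
  rigid c (- s) (- (c * u + s * v)) (s * u - c * v) (rigid c s u v A) = A.
Proof.
move=> cs; apply/funext => x; apply/funext => y; rewrite /rigid.
congr (A _ _).
- transitivity ((c ^+ 2 + s ^+ 2) * x + (1 - (c ^+ 2 + s ^+ 2)) * u); first by ring.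
  by rewrite cs; ring.
- transitivity ((c ^+ 2 + s ^+ 2) * y + (1 - (c ^+ 2 + s ^+ 2)) * v); first by ring.
  by rewrite cs; ring.
Qed.

Lemma rigid_comp (R : realType) c s u v c' s' u' v' (A : R -> R -> Prop) :
  rigid c s u v (rigid c' s' u' v' A) =
  rigid (c' * c - s' * s) (s' * c + c' * s)
    (c' * u - s' * v + u') (s' * u + c' * v + v') A.
Proof.
by apply/funext => x; apply/funext => y; rewrite /rigid; congr (A _ _); ring.
Qed.

Lemma rigid_interior_inv (R : realType) c s u v (A : R -> R -> Prop) x y :
  c ^+ 2 + s ^+ 2 = 1 -> pinterior (rigid c s u v A) x y ->
  pinterior A (c * x - s * y + u) (s * x + c * y + v).
Proof.
move=> cs iA; rewrite -(rigid_inv u v A cs).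
apply: rigid_interior; first by rewrite sqrrN.
set X := (X in pinterior _ X _); set Y := (Y in pinterior _ _ Y).
suff [-> ->] : X = x /\ Y = y by [].
rewrite /X /Y; split.
- by transitivity ((c ^+ 2 + s ^+ 2) * x); [ring|rewrite cs mul1r].
- by transitivity ((c ^+ 2 + s ^+ 2) * y); [ring|rewrite cs mul1r].
Qed.

(** Convexity with the box around (0, -k) does everything. No point of [A] is above the cone of
    slope [k / r], for together with the box it would make the origin interior. So each vertical
    line through the box has a topmost point, and the segments from there down to the level [- k]
    fill the required depth. *)
Lemma vertical_chart (R : realType) (A : R -> R -> Prop) k :
  pclosed A -> pconvex A -> A 0 0 -> ~ pinterior A 0 0 ->
  0 < k -> pinterior A 0 (- k) ->
  exists f d h, [/\ 0 < d, chart A f (- d) d h & f 0 = 0].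
Proof.
move=> clA cA A0 bA k0 [r r0 iA].
have up x y : A x y -> r * y <= k * `|x|.
  move=> Axy; rewrite leNgt; apply/negP => ky; apply: bA.
  have y0 : 0 < y by have := normr_ge0 x; nra.
  have yk : y + k != 0 by rewrite gt_eqF //; lra.
  (* Half-size of a box around the origin inside the image of the given box under the homothety with
     centre (x, y) and ratio [y / (y + k)]. *)
  pose q := (r * y - k * `|x|) / (y + k).
  have qE : q * (y + k) = r * y - k * `|x| by rewrite /q divfK.
  exists q; first by rewrite divr_gt0 //; lra.
  move=> x' y'; rewrite !subr0 => hx hy.
  pose t := k / (y + k).
  have tE : t * (y + k) = k by rewrite /t divfK.
  pose p1 := (x' * (y + k) - k * x) / y.
  pose p2 := y' * (y + k) / y - k.
  have y1 : y != 0 by rewrite gt_eqF.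
  have xn := ler_norml x `|x|; rewrite lexx in xn.
  have /andP[xn1 xn2] := esym xn.
  rewrite ler_norml in hx; rewrite ler_norml in hy.
  have Ap : A p1 p2.
    apply: iA.
    - rewrite subr0 /p1 normrM normfV (gtr0_norm y0) ler_pdivrMr //.
      rewrite ler_norml; apply/andP; clear -hx xn1 xn2 y0 k0 qE; split; nra.
    - rewrite /p2 opprK addrNK normrM normfV (gtr0_norm y0) ler_pdivrMr //.
      rewrite ler_norml; apply/andP; clear -hy xn1 xn2 y0 k0 qE; split; nra.
  have t0 : 0 <= t by rewrite divr_ge0 ?addr_ge0 // ltW.
  have t1 : t <= 1 by rewrite ler_pdivrMr ?mul1r ?lerDr ?(ltW y0) // addr_gt0.
  have := cA _ _ _ _ t t0 t1 Ap Axy.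
  by congr (A _ _); rewrite /p1 /p2 /t; field; rewrite yk y1.
have low x : `|x| <= r -> A x (- k).
  by move=> xr; apply: iA; rewrite ?subr0 // subrr normr0 ltW.
have graph x : `|x| <= r -> exists y, A x y /\ forall z, A x z -> z <= y.
  move=> xr; have [||s [s1 s2]] := @sup_exists R (A x) (- k) (k * `|x| / r).
  - exact: low.
  - by move=> y /up; rewrite ler_pdivlMr // mulrC.
  exists s; split=> //; apply: clA => e e0.
  have [z Az sz] := s2 (s - e) ltac:(lra); have := s1 _ Az => zs.
  exists x, z; split=> //; first by rewrite subrr normr0 ltW.
    by rewrite ler_norml; lra.
pose f x := if pselect (`|x| <= r) is left h then sval (cid (graph x h)) else 0.
have fP x : `|x| <= r -> A x (f x) /\ forall z, A x z -> z <= f x.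
  by rewrite /f; case: pselect => // h _; case: cid.
(* The midpoint of the origin and of the bottom point over [2 * x] has height [- k / 2]; this leaves
   a depth of [k / 2] above the level [- k]. *)
have fge x : `|x| <= r / 2 -> - k / 2 <= f x.
  move=> xr; have [_] := fP x ltac:(lra); apply.
  have := cA 0 0 (2 * x) (- k) (1 / 2) ltac:(lra) ltac:(lra) A0 (low _ _).
  rewrite normrM ger0_norm // => /(_ ltac:(lra)).
  by congr (A _ _); field.
exists f, (r / 2), (k / 2); split; first by lra.
- split=> [|x y x1 x2 Axy|x y x1 x2 y1 y2]; first by lra.
    by have [|_] := fP x; [rewrite ler_norml; lra|apply].
  have xr : `|x| <= r / 2 by rewrite ler_norml; clear -x1 x2; lra.
  have xr' : `|x| <= r by clear -xr r0; lra.
  have [Af _] := fP x xr'; have fx := fge x xr.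
  have fk0 : 0 < f x + k by clear -fx k0; lra.
  have fk : f x + k != 0 by rewrite gt_eqF.
  pose t := (y + k) / (f x + k).
  have t0 : 0 <= t by rewrite divr_ge0 ?(ltW fk0) //; clear -fx y1; lra.
  have t1 : t <= 1 by rewrite ler_pdivrMr // mul1r lerD2r.
  have := cA _ _ _ _ t t0 t1 (low x xr') Af.
  by congr (A _ _); rewrite /t; field.
- have [|Af /(_ _ A0)] := fP 0; first by rewrite normr0 ltW.
  have := up _ _ Af.
  by rewrite normr0 mulr0 pmulr_rle0 // => ? ?; lra.
Qed.

Lemma boundary_chart (R : realType) (A : R -> R -> Prop) x0 y0 xi yi :
  pclosed A -> pconvex A -> A x0 y0 -> ~ pinterior A x0 y0 ->
  pinterior A xi yi ->
  exists c s f d h, [/\ c ^+ 2 + s ^+ 2 = 1, 0 < d,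
    chart (rigid c s x0 y0 A) f (- d) d h & f 0 = 0].
Proof.
move=> clA cA A0 bA iA.
pose k := Num.sqrt ((x0 - xi) ^+ 2 + (y0 - yi) ^+ 2).
have kE : k ^+ 2 = (x0 - xi) ^+ 2 + (y0 - yi) ^+ 2.
  by rewrite sqr_sqrtr // addr_ge0 // sqr_ge0.
have k0 : 0 < k.
  rewrite lt_neqAle sqrtr_ge0 andbT eq_sym; apply/eqP => k0; apply: bA.
  move: kE; rewrite k0 expr0n => /esym /= /eqP.
  by rewrite paddr_eq0 ?sqr_ge0 // !sqrf_eq0 !subr_eq0 => /andP[/eqP -> /eqP ->].
have k1 : k != 0 by rewrite gt_eqF.
(* The rotation that places the interior point straight below the boundary point, at distance
   [k]. *)
pose c := (y0 - yi) / k; pose s := (xi - x0) / k.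
have cs : c ^+ 2 + s ^+ 2 = 1.
  have -> : c ^+ 2 + s ^+ 2 = ((x0 - xi) ^+ 2 + (y0 - yi) ^+ 2) / k ^+ 2.
    by rewrite /c /s; field.
  by rewrite -kE divff // expf_neq0.
have [||||||f [d [h [d0 ch f0]]]] := @vertical_chart R (rigid c s x0 y0 A) k.
- exact: rigid_closed.
- exact: rigid_convex.
- by rewrite /rigid !mulr0 !subrr !add0r.
- move=> h; apply: bA; have := rigid_interior_inv cs h.
  by rewrite !mulr0 !subrr !add0r.
- by [].
- apply: rigid_interior => //.
  have -> : c * 0 - s * - k + x0 = xi by rewrite /s; field.
  by have -> : s * 0 + c * - k + y0 = yi by rewrite /c; field.
by exists c, s, f, d, h.
Qed.

(** Chord slopes are compared after cross-multiplication, so that coinciding points need no separate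
    treatment. *)
Definition concave (R : realType) (f : R -> R) a b :=
  forall x y z, a <= x -> x <= y -> y <= z -> z <= b ->
    (f z - f x) * (y - x) <= (f y - f x) * (z - x).

Definition slopes_in (R : realType) (f : R -> R) a b lo hi :=
  forall x y, a <= x -> x <= y -> y <= b ->
    lo * (y - x) <= f y - f x /\ f y - f x <= hi * (y - x).

Lemma chart_on_graph (R : realType) (A : R -> R -> Prop) f a b h x :
  chart A f a b h -> a <= x -> x <= b -> A x (f x).
Proof. by case=> h0 _ hA ax xb; apply: hA => //; lra. Qed.

Lemma chart_concave (R : realType) (A : R -> R -> Prop) f a b h :
  chart A f a b h -> pconvex A -> concave f a b.
Proof.
move=> ch cA x y z ax xy yz zb.
have [xz|xz] := leP z x; first by have [-> ->] : y = x /\ z = x by lra.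
have z0 : z - x != 0 by rewrite gt_eqF //; lra.
pose t := (y - x) / (z - x).
have tE : t * (z - x) = y - x by rewrite divfK.
have t0 : 0 <= t by rewrite divr_ge0 //; lra.
have t1 : t <= 1 by rewrite ler_pdivrMr; lra.
have := cA _ _ _ _ t t0 t1 (chart_on_graph ch ax ltac:(lra))
  (chart_on_graph ch (le_trans ax (le_trans xy yz)) zb).
have [_ hf _] := ch.
move/hf; rewrite tE => /(_ ltac:(lra) ltac:(lra)).
rewrite (addrC x) subrK -tE => H; nra.
Qed.

(** [al] is the right derivative, obtained as the supremum of the slopes from 0; the slope of the
    chord over [-d, 0] bounds them from above. *)
Lemma concave_right_slope (R : realType) (f : R -> R) d :
  0 < d -> concave f (- d) d -> f 0 = 0 ->
  exists al, [/\ forall x, 0 <= x -> x <= d -> f x <= al * x,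
    forall m, (forall x, 0 <= x -> x <= d -> f x <= m * x) -> al <= m &
    forall e, 0 < e -> exists r, [/\ 0 < r, r <= d & slopes_in f 0 r (al - e) al]].
Proof.
move=> d0 cf f0.
pose P v := exists x, [/\ 0 < x, x <= d & v * x = f x].
have d1 : d != 0 by rewrite gt_eqF.
have [||al [s1 s2]] := @sup_exists R P (f d / d) (- f (- d) / d).
- by exists d; split=> //; rewrite divfK.
- move=> v [x [x0 xd E]]; rewrite ler_pdivlMr //.
  have := cf (- d) 0 x (lexx _) ltac:(lra) (ltW x0) xd; rewrite -E f0.
  by move=> H; nra.
have ub x : 0 <= x -> x <= d -> f x <= al * x.
  move=> x0 xd; have [->|xn] := eqVneq x 0; first by rewrite f0 mulr0.
  have xp : 0 < x by rewrite lt_neqAle eq_sym xn.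
  by rewrite -ler_pdivrMr //; apply: s1; exists x; split=> //; rewrite divfK.
exists al; split=> // [m hm|e e0].
  rewrite leNgt; apply/negP => /s2[v [x [x0 xd E]] mv].
  by have := hm x (ltW x0) xd; rewrite -E; nra.
have [v [x0 [x0p x0d E]] mv] := s2 (al - e / 2) ltac:(lra).
(* With [r] half of [x0], the chord over [r, x0] has slope at least [al - e]: the value at [x0]
   exceeds [(al - e / 2) * (2 * r)] and the value at [r] is at most [al * r]. Concavity carries this
   lower bound to all slopes on [0, r]. *)
pose r := x0 / 2; pose L := al - e.
have rx : x0 = 2 * r by rewrite /r; field.
have r0 : 0 < r by lra.
have Lr : L * (x0 - r) <= f x0 - f r.
  have := ub r ltac:(lra) ltac:(lra); rewrite -E /L rx; nra.
exists r; split=> //; first by lra.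
have rx0 : r <= x0 by clear -rx r0; lra.
have nd z : 0 <= z -> - d <= z by apply: le_trans; rewrite oppr_le0 ltW.
move=> x y x1 xy yr; split.
- have x0r : 0 < x0 - r by clear -rx r0; lra.
  have h2 : L * (x0 - y) <= f x0 - f y.
    have := cf y r x0 (nd _ (le_trans x1 xy)) yr rx0 x0d.
    have : 0 <= (f x0 - f r - L * (x0 - r)) * (x0 - y).
      by rewrite mulr_ge0 // subr_ge0 // (le_trans yr).
    by move=> h3 h4; rewrite -(ler_pM2r x0r); clear -h3 h4; lra.
  have x0y : 0 < x0 - y by clear -x0r yr; lra.
  have := cf x y x0 (nd _ x1) xy (le_trans yr rx0) x0d.
  have : 0 <= (f x0 - f y - L * (x0 - y)) * (y - x) by rewrite mulr_ge0 // subr_ge0.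
  by move=> h3 h4; rewrite -/L -(ler_pM2r x0y); clear -h3 h4; lra.
- have yd : y <= d by exact: le_trans (le_trans yr rx0) x0d.
  have [xE|xn] := eqVneq x 0.
    by rewrite xE f0 !subr0; apply: ub => //; exact: le_trans xy.
  have xp : 0 < x by rewrite lt_neqAle eq_sym xn.
  have := cf 0 x y (nd _ (lexx _)) x1 xy yd; rewrite f0 !subr0.
  have U := ub x x1 (le_trans xy yd).
  have : 0 <= (al * x - f x) * (y - x) by rewrite mulr_ge0 // subr_ge0.
  by move=> h3 h4; rewrite -(ler_pM2r xp); clear -h3 h4; lra.
Qed.

(** The left derivative [be] is obtained from the mirrored function. A corner at 0 means
    [al < be]. *)
Lemma concave_slopes (R : realType) (f : R -> R) d :
  0 < d -> concave f (- d) d -> f 0 = 0 ->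
  exists al be, [/\ al <= be,
    forall x, 0 <= x -> x <= d -> f x <= al * x,
    forall x, - d <= x -> x <= 0 -> f x <= be * x &
    forall e, 0 < e -> exists r, [/\ 0 < r, r <= d,
      slopes_in f 0 r (al - e) al & slopes_in f (- r) 0 be (be + e)]].
Proof.
move=> d0 cf f0.
have [al [a1 a2 a3]] := concave_right_slope d0 cf f0.
have [||be [b1 b2 b3]] := @concave_right_slope R (fun x => f (- x)) d d0.
- move=> x y z x1 xy yz zd.
  have := cf (- z) (- y) (- x) ltac:(lra) ltac:(lra) ltac:(lra) ltac:(lra); nra.
- by rewrite oppr0.
exists al, (- be); split=> //.
- apply: a2 => x x0 xd.
  have [->|xn] := eqVneq x 0; first by rewrite f0 mulr0.
  have xp : 0 < x by rewrite lt_neqAle eq_sym xn.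
  suff : be <= - f x / x by rewrite ler_pdivlMr //; lra.
  apply: b2 => y y0 yd; rewrite -(ler_pM2r xp) mulrAC divfK //.
  have := cf (- y) 0 x ltac:(lra) ltac:(lra) x0 xd; rewrite f0; nra.
- by move=> x x1 x0; have := b1 (- x) ltac:(lra) ltac:(lra); rewrite opprK; lra.
- move=> e e0; have [r [r0 rd hr]] := a3 e e0.
  have [r' [r0' rd' hr']] := b3 e e0.
  pose q := Num.min r r'.
  have [q1 q2 q0] : [/\ q <= r, q <= r' & 0 < q].
    by rewrite ge_min lexx ge_min lexx orbT lt_min r0 r0'.
  exists q; split=> // [|x y x0 xy yq|x y x0 xy yq]; first by lra.
    by apply: hr; lra.
  have := hr' (- y) (- x) ltac:(lra) ltac:(lra) ltac:(lra).
  by rewrite !opprK; move=> []; split; lra.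
Qed.

(** * Thin caps over short chords *)

Lemma chart_above_chord (R : realType) (A : R -> R -> Prop) f a b h s t x y :
  chart A f a b h -> pconvex A -> a <= s -> s < t -> t <= b -> A x y ->
  (f t - f s) * (x - s) < (y - f s) * (t - s) ->
  [/\ s < x, x < t & y <= f x].
Proof.
move=> ch cA as_ st tb Axy lt; have [_ hf _] := ch.
have As := chart_on_graph ch as_ ltac:(lra).
have At := chart_on_graph ch (x := t) ltac:(lra) tb.
have sx : s < x.
  rewrite ltNge; apply/negP => xs.
  have tx : t - x != 0 by rewrite gt_eqF //; lra.
  pose k := (t - s) / (t - x).
  have kE : k * (t - x) = t - s by rewrite divfK.
  have k0 : 0 <= k by rewrite divr_ge0 //; lra.
  have k1 : k <= 1 by rewrite ler_pdivrMr; lra.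
  have := cA _ _ _ _ k k0 k1 At Axy.
  have -> : t + k * (x - t) = s by lra.
  move/hf => /(_ as_ ltac:(lra)) H.
  have : (f t + k * (y - f t)) * (t - x) <= f s * (t - x) by rewrite ler_wpM2r; lra.
  have -> : (f t + k * (y - f t)) * (t - x) = f t * (t - x) + (y - f t) * (k * (t - x)) by ring.
  rewrite kE; lra.
have xt : x < t.
  rewrite ltNge; apply/negP => tx.
  have xs : x - s != 0 by rewrite gt_eqF //; lra.
  pose k := (t - s) / (x - s).
  have kE : k * (x - s) = t - s by rewrite divfK.
  have k0 : 0 <= k by rewrite divr_ge0 //; lra.
  have k1 : k <= 1 by rewrite ler_pdivrMr; lra.
  have := cA _ _ _ _ k k0 k1 As Axy.
  have -> : s + k * (x - s) = t by lra.
  move/hf => /(_ ltac:(lra) tb) H.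
  have : (f s + k * (y - f s)) * (x - s) <= f t * (x - s) by rewrite ler_wpM2r; lra.
  have -> : (f s + k * (y - f s)) * (x - s) = f s * (x - s) + (y - f s) * (k * (x - s)) by ring.
  rewrite kE; lra.
by split=> //; apply: hf => //; lra.
Qed.

Lemma chart_on_chord (R : realType) (A : R -> R -> Prop) f a b h s t x y x' y' :
  chart A f a b h -> pconvex A -> a <= s -> s < t -> t <= b -> A x y ->
  (f t - f s) * (x - s) < (y - f s) * (t - s) ->
  A x' y' -> (f t - f s) * (x' - s) = (y' - f s) * (t - s) ->
  s <= x' /\ x' <= t.
Proof.
move=> ch cA as_ st tb Axy lt Axy' E; have [_ hf _] := ch.
have [sx xt _] := chart_above_chord ch cA as_ st tb Axy lt.
split; rewrite leNgt; apply/negP => lt'.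
- have xx : x - x' != 0 by rewrite gt_eqF //; lra.
  pose k := (x - s) / (x - x').
  have kE : k * (x - x') = x - s by rewrite divfK.
  have k0 : 0 <= k by rewrite divr_ge0 //; lra.
  have k1 : k < 1 by rewrite ltr_pdivrMr; lra.
  have := cA _ _ _ _ k k0 (ltW k1) Axy Axy'.
  have -> : x + k * (x' - x) = s by lra.
  move/hf => /(_ as_ ltac:(lra)) H.
  have : (y + k * (y' - y)) * (t - s) <= f s * (t - s) by rewrite ler_wpM2r; lra.
  have : 0 < ((y - f s) * (t - s) - (f t - f s) * (x - s)) * (1 - k) by rewrite mulr_gt0; lra.
  have : k * ((f t - f s) * (x' - s)) = k * ((y' - f s) * (t - s)) by rewrite E.
  have : (f t - f s) * (k * (x - x')) = (f t - f s) * (x - s) by rewrite kE.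
  lra.
- have xx : x' - x != 0 by rewrite gt_eqF //; lra.
  pose k := (t - x) / (x' - x).
  have kE : k * (x' - x) = t - x by rewrite divfK.
  have k0 : 0 <= k by rewrite divr_ge0 //; lra.
  have k1 : k < 1 by rewrite ltr_pdivrMr; lra.
  have := cA _ _ _ _ k k0 (ltW k1) Axy Axy'.
  have -> : x + k * (x' - x) = t by lra.
  move/hf => /(_ ltac:(lra) tb) H.
  have : (y + k * (y' - y)) * (t - s) <= f t * (t - s) by rewrite ler_wpM2r; lra.
  have : 0 < ((y - f s) * (t - s) - (f t - f s) * (x - s)) * (1 - k) by rewrite mulr_gt0; lra.
  have : k * ((f t - f s) * (x' - s)) = k * ((y' - f s) * (t - s)) by rewrite E.
  have : (f t - f s) * (k * (x' - x)) = (f t - f s) * (t - x) by rewrite kE.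
  lra.
Qed.

(** For slopes [k], [k'] within [e] of [m], [k * k' = ((k + k') ^+ 2 - (k - k') ^+ 2) / 4 >= - e ^+
    2 >= - 1 / 4]. This is the source of the constant 3/4. *)
Lemma near_slopes_dot (R : realType) (m e k dx dy : R) :
  0 <= e -> e <= 1 / 2 -> m - e <= k -> k <= m + e -> 0 <= dx ->
  (m - e) * dx <= dy -> dy <= (m + e) * dx -> 3 / 4 * dx <= dx + k * dy.
Proof.
move=> e0 e1 k1 k2 d0 h1 h2.
have [d1|d1] := eqVneq dx 0; first by rewrite d1 !mulr0 in h1 h2 *; rewrite (@le_anti _ _ dy 0) ?mulr0 ?addr0 // h2.
have dp : 0 < dx by rewrite lt_neqAle eq_sym d1.
have kd1 : 0 <= (k - (m - e)) * dx by rewrite mulr_ge0; lra.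
have kd2 : 0 <= (m + e - k) * dx by rewrite mulr_ge0; lra.
have P1 : 0 <= (2 * e * dx - (k * dx - dy)) * (2 * e * dx + (k * dx - dy)).
  by rewrite mulr_ge0; lra.
have P2 : 0 <= (k * dx + dy) * (k * dx + dy) by rewrite -expr2 sqr_ge0.
have P3 : 0 <= (1 / 4 - e * e) * (dx * dx).
  by rewrite mulr_ge0 ?mulr_ge0 // ?(ltW dp) //; nra.
by rewrite -(ler_pM2r dp); lra.
Qed.

(* Frame of a chord from (0, 0) to (l, 0): above the chord, A is a cap of slope at
   most e; below it, A is complete at the scale rho. *)
Definition framed (R : realType) (A : R -> R -> Prop) l e rho :=
  [/\ forall X Y, A X Y -> 0 < Y ->
        [/\ 0 < X, X < l, Y <= e * X & Y <= e * (l - X)],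
      forall X Y, - rho <= X -> X <= rho -> - rho <= Y -> Y <= 0 ->
        Y <= e * X -> Y <= e * (l - X) -> A X Y &
      forall X Y X', A X Y -> 0 < Y -> A X' 0 -> 0 <= X' /\ X' <= l].

(** Along and across a chord of slope [k], the vector (dx, dy) has the coordinates
    [c * (dx + k * dy)] and [c * (dy - k * dx)]. The first is at least [3 / 4 * c * dx], the second
    at most [2 * e * c * dx], and 8/3 is below 4. *)
Lemma chord_slope_upper (R : realType) (c k m e dx dy : R) :
  0 <= e -> e <= 1 / 2 -> m - e <= k -> k <= m + e -> 0 < c -> 0 < dx ->
  k * dx < dy -> dy <= (m + e) * dx ->
  0 < c * (dx + k * dy) /\
  c * (dy - k * dx) <= 4 * e * (c * (dx + k * dy)).
Proof.
move=> e0 e1 k1 k2 c0 d0 h1 h2.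
have h3 : (m - e) * dx <= k * dx by rewrite ler_pM2r.
have h4 : (m - e) * dx <= dy by lra.
have D := near_slopes_dot e0 e1 k1 k2 (ltW d0) h4 h2.
split; first by rewrite mulr_gt0 //; lra.
rewrite mulrCA ler_pM2l //.
have : 0 <= e * (dx + k * dy - 3 / 4 * dx) by rewrite mulr_ge0 //; lra.
have : 0 <= e * dx by rewrite mulr_ge0 // ltW.
lra.
Qed.

(** The opposite change of axes: the cone of slope [4 * e] below a chord, turned back to the
    original axes, stays below the line of the largest admissible slope. *)
Lemma chord_slope_lower (R : realType) (k m e X Y : R) :
  0 <= e -> e <= 1 / 2 -> m - e <= k -> k <= m + e -> Y <= 0 ->
  Y <= 4 * e * X -> k * X + Y <= (m + e) * (X - k * Y).
Proof.
move=> e0 e1 k1 k2 Y0 YX.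
have q := @near_slopes_dot R m e k 1 (m + e) e0 e1 k1 k2
  ltac:(lra) ltac:(lra) ltac:(lra).
have [X0|X0] := le_or_lt X 0; last first.
  have : 0 <= (m + e - k) * X by rewrite mulr_ge0; lra.
  have : (1 + k * (m + e)) * Y <= 0 by rewrite mulr_ge0_le0 //; lra.
  lra.
have : 0 <= (m + e - k - 2 * e) * X by rewrite mulr_le0 //; lra.
have : 0 <= (4 * e * X - Y) * (1 + k * (m + e)) by rewrite mulr_ge0; lra.
have : 0 <= (1 + k * (m + e) - 3 / 4) * (- (4 * e * X)).
  by rewrite mulr_ge0 ?oppr_ge0 ?mulr_ge0_le0 ?mulr_ge0 //; lra.
have : e * X <= 0 by rewrite mulr_ge0_le0.
lra.
Qed.

Lemma slopes_lipschitz (R : realType) (f : R -> R) a b m e x y :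
  slopes_in f a b (m - e) (m + e) -> a <= x -> x <= y -> y <= b ->
  `|f x - f y| <= (`|m| + e) * (y - x).
Proof.
move=> sl ax xy yb; have [h1 h2] := sl x y ax xy yb.
have mn := ler_norm m; have mn' := ler_norm (- m); rewrite normrN in mn'.
have : 0 <= (`|m| - m) * (y - x) by rewrite mulr_ge0; lra.
have : 0 <= (`|m| + m) * (y - x) by rewrite mulr_ge0; lra.
by rewrite ler_norml => *; apply/andP; split; lra.
Qed.

(** A box of size [rho] may double under rotation, hence the margins [2 * rho]. Over that width the
    graph varies by at most [(|m| + e) * (2 * rho)], hence the depth required of the chart. *)
Lemma framed_of_chart (R : realType) (A : R -> R -> Prop) f a b h m e s t l rho :
  chart A f a b h -> pconvex A -> slopes_in f a b (m - e) (m + e) ->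
  0 <= e -> e <= 1 / 2 -> s < t -> 0 < l ->
  l ^+ 2 = (t - s) ^+ 2 + (f t - f s) ^+ 2 ->
  0 < rho -> a + 2 * rho <= s -> t <= b - 2 * rho ->
  2 * rho * (1 + `|m| + e) <= h ->
  framed (rigid ((t - s) / l) ((f t - f s) / l) s (f s) A) l (4 * e) rho.
Proof.
move=> ch cA sl e0 e1 st l0 lE r0 sa tb rh.
have ln : l != 0 by rewrite gt_eqF.
set c := (t - s) / l; set g := (f t - f s) / l.
have cl : c * l = t - s by rewrite /c divfK.
have gl : g * l = f t - f s by rewrite /g divfK.
have c0 : 0 < c by rewrite divr_gt0 //; lra.
have cg : c ^+ 2 + g ^+ 2 = 1.
  by rewrite /c /g !expr_div_n -mulrDl -lE divff // expf_neq0.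
pose k := (f t - f s) / (t - s).
have ts : t - s != 0 by rewrite gt_eqF //; lra.
have ts0 : 0 < t - s by lra.
have kE : g = k * c by rewrite /g /k /c; field; rewrite ln.
have kts : k * (t - s) = f t - f s by rewrite /k divfK.
have as_ : a <= s by lra.
have tb' : t <= b by lra.
have [k1 k2] : m - e <= k /\ k <= m + e.
  by have [] := sl s t as_ (ltW st) tb'; rewrite -kts !ler_pM2r.
clearbody k c g; clear lE ln ts.
(* The determinant that locates a point relative to the line of the chord is [l * Y], so its sign is
   that of the frame coordinate [Y]. *)
have chord x y X Y : x = c * X - g * Y + s -> y = g * X + c * Y + f s ->
    (y - f s) * (t - s) - (f t - f s) * (x - s) = l * Y.
  by move=> -> ->; rewrite -gl -cl -[RHS]mul1r -cg; ring.
have above x y X Y : 0 < Y -> x = c * X - g * Y + s -> y = g * X + c * Y + f s ->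
    (f t - f s) * (x - s) < (y - f s) * (t - s).
  by move=> Y0 xE yE; rewrite -subr_gt0 (chord _ _ X Y) // mulr_gt0.
split.
- move=> X Y AXY Y0; have := above _ _ X Y Y0 erefl erefl.
  have [xE yE] : (c * X - g * Y + s - s = c * X - g * Y) /\
    (g * X + c * Y + f s - f s = g * X + c * Y) by split; ring.
  have := @chart_above_chord R A f a b h s t _ _ ch cA as_ st tb' AXY.
  move: xE yE; set x := c * X - g * Y + s; set y := g * X + c * Y + f s.
  clearbody x y => xE yE H lt; have [sx xt yf] := H lt.
  have [_ u1] := sl s x as_ (ltW sx) (le_trans (ltW xt) tb').
  have [u2 _] := sl x t (le_trans as_ (ltW sx)) (ltW xt) tb'.
  have kx : k * (x - s) < y - f s by rewrite -(ltr_pM2r ts0) mulrAC kts.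
  have sx0 : 0 < x - s by rewrite subr_gt0.
  have xt0 : 0 < t - x by rewrite subr_gt0.
  clear H ch sl above chord AXY cA.
  have X1 : X = c * (x - s + k * (y - f s)).
    by rewrite mulrDr mulrA (mulrC c k) -kE xE yE -[LHS]mul1r -cg; ring.
  have Y1 : Y = c * (y - f s - k * (x - s)).
    by rewrite mulrBr mulrA (mulrC c k) -kE xE yE -[LHS]mul1r -cg; ring.
  have X2 : l - X = c * (t - x + - k * (f s + k * (t - s) - y) * -1).
    have -> : t - x + - k * (f s + k * (t - s) - y) * -1 =
      (t - s) + k * (k * (t - s)) - (x - s + k * (y - f s)) by ring.
    rewrite mulrBr -X1; congr (_ - _); rewrite -cl.
    have -> : c * (c * l + k * (k * (c * l))) = (c ^+ 2 + (k * c) ^+ 2) * l by ring.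
    by rewrite -kE cg mul1r.
  have [|d1 d2] := @chord_slope_upper R c k m e (x - s) (y - f s) e0 e1 k1 k2 c0 sx0 kx.
  + by clear - u1 yf; lra.
  + have [||||d3 d4] := @chord_slope_upper R c (- k) (- m) e (t - x) (y - f t) e0 e1 _ _ c0 xt0.
    * by clear -k2; lra.
    * by clear -k1; lra.
    * by clear -kx kts; lra.
    * by clear -u2 yf; lra.
    have E1 : c * (y - f t - - k * (t - x)) = Y by rewrite Y1 -[f t](subrK (f s)) -kts; ring.
    have E2 : c * (t - x + - k * (y - f t)) = l - X.
      by rewrite X2 kts; ring.
    rewrite E1 E2 in d3 d4; rewrite -X1 -Y1 in d1 d2.
    by clear -d1 d2 d3 d4; split=> //; rewrite ?subr_gt0 // -subr_gt0.
- move=> X Y X1 X2 Y1 Y2 YX YlX; have [_ _ hA] := ch.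
  have [||dx dy] := @norm_rotation_le R c g X Y rho cg;
    [by rewrite ler_norml X1|by rewrite ler_norml Y1 /= (le_trans Y2 (ltW r0))|].
  have := chord _ _ X Y erefl erefl.
  have L1 := chord_slope_lower e0 e1 k1 k2 Y2 YX.
  have [k1' k2'] : - m - e <= - k /\ - k <= - m + e.
    by clear -k1 k2; split; lra.
  have L2 := chord_slope_lower e0 e1 k1' k2' Y2 YlX.
  rewrite /rigid.
  have [xE yE] : (c * X - g * Y + s - s = c * X - g * Y) /\
    (g * X + c * Y + f s - f s = g * X + c * Y) by split; ring.
  rewrite ler_norml -xE in dx; rewrite ler_norml -yE in dy.
  move: xE yE dx dy; set x := c * X - g * Y + s; set y := g * X + c * Y + f s.
  clearbody x y => xE yE dx dy yfs.
  have ax : a <= x by clear -dx sa; lra.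
  have xb : x <= b by clear -dx tb st; lra.
  have lY : l * Y <= 0 by rewrite mulr_ge0_le0 // ltW.
  have fxs : `|f x - f s| <= (`|m| + e) * (2 * rho).
    have me : 0 <= `|m| + e by rewrite addr_ge0.
    have [sx|xs] := le_or_lt s x.
      rewrite distrC (le_trans (slopes_lipschitz sl as_ sx xb)) //.
      by rewrite ler_wpM2l //; clear -dx; lra.
    rewrite (le_trans (slopes_lipschitz sl ax (ltW xs) (le_trans (ltW st) tb'))) //.
    by rewrite ler_wpM2l //; clear -dx; lra.
  apply: hA => //.
  + by rewrite ler_norml in fxs; clear -fxs dy rh; lra.
  (* Left of [s] and right of [t] the extreme slopes bound the graph from below; in between,
     concavity keeps the graph above the chord. *)
  + have [xs|sx] := le_or_lt x s.
      have [_ u] := sl x s ax xs (le_trans (ltW st) tb').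
      suff : y - f s <= (m + e) * (x - s) by clear -u; lra.
      rewrite yE xE kE.
      have -> : k * c * X + c * Y = c * (k * X + Y) by ring.
      have -> : (m + e) * (c * X - k * c * Y) = c * ((m + e) * (X - k * Y)) by ring.
      by rewrite ler_pM2l.
    have [tx|xt] := le_or_lt t x.
      have [u _] := sl t x (le_trans as_ (ltW st)) tx xb.
      suff : y - f t <= (m - e) * (x - t) by clear -u; lra.
      have -> : y - f t = c * (- k * (l - X) + Y).
        have -> : y - f t = (y - f s) - (f t - f s) by ring.
        by rewrite yE -gl kE; ring.
      have -> : x - t = - (c * (l - X - - k * Y)).
        have -> : x - t = (x - s) - (t - s) by ring.
        by rewrite xE -cl kE; ring.
      have -> : (m - e) * - (c * (l - X - - k * Y)) =
                c * ((- m + e) * (l - X - - k * Y)) by ring.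
      by rewrite ler_pM2l.
    have cc := chart_concave ch cA as_ (ltW sx) (ltW xt) tb'.
    by clear -lY cc yfs ts0; rewrite -(ler_pM2r ts0); lra.
- move=> X Y X' AXY Y0 AX'; have lt := above _ _ X Y Y0 erefl erefl.
  have [|u1 u2] := chart_on_chord ch cA as_ st tb' AXY lt AX'.
    by rewrite -cl -gl; ring.
  have v1 : 0 <= c * X' by clear -u1; lra.
  have v2 : 0 <= c * (l - X') by rewrite mulrBr cl; clear -u2; lra.
  by rewrite pmulr_rge0 // in v1; rewrite pmulr_rge0 // subr_ge0 in v2.
Qed.

(** * Symmetries of a digon *)

Definition isometry2 (R : realType) (fx fy : R -> R -> R) :=
  forall x y x' y', (fx x y - fx x' y') ^+ 2 + (fy x y - fy x' y') ^+ 2 =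
                    (x - x') ^+ 2 + (y - y') ^+ 2.

Definition self_map (R : realType) (fx fy : R -> R -> R) (M : R -> R -> Prop) :=
  (forall x y, M x y -> M (fx x y) (fy x y)) /\
  (forall x y, M x y -> exists x' y', [/\ M x' y', fx x' y' = x & fy x' y' = y]).

Definition nontrivially_symmetric (R : realType) (M : R -> R -> Prop) :=
  exists fx fy, [/\ isometry2 fx fy, ~ (forall x y, fx x y = x /\ fy x y = y) &
    self_map fx fy M].

Definition symmetric_meets (R : realType) (A B : R -> R -> Prop) :=
  forall c s u v c' s' u' v', c ^+ 2 + s ^+ 2 = 1 -> c' ^+ 2 + s' ^+ 2 = 1 ->
    let M x y := rigid c s u v A x y /\ rigid c' s' u' v' B x y in
    (exists x y, pinterior M x y) -> nontrivially_symmetric M.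

Definition upper (R : realType) (A : R -> R -> Prop) (l X Y : R) :=
  [/\ 0 <= X, X <= l, 0 <= Y & A X Y].

(** Polarization of three squared distances; the map is not assumed affine. *)
Lemma isometry2_dot (R : realType) (fx fy : R -> R -> R) x y a b a' b' :
  isometry2 fx fy ->
  (fx a b - fx x y) * (fx a' b' - fx x y) + (fy a b - fy x y) * (fy a' b' - fy x y) =
  (a - x) * (a' - x) + (b - y) * (b' - y).
Proof.
move=> iso; have h1 := iso a b x y; have h2 := iso a' b' x y.
have h3 := iso a b a' b'; lra.
Qed.

(** The inner product with (l, 0) recovers the first coordinate, and the image of (0, 1) then
    decides the sign of the second. *)
Lemma isometry2_fix (R : realType) (fx fy : R -> R -> R) l :
  isometry2 fx fy -> l != 0 ->
  fx 0 0 = 0 -> fy 0 0 = 0 -> fx l 0 = l -> fy l 0 = 0 ->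
  exists2 s, s = 1 \/ s = -1 & forall X Y, fx X Y = X /\ fy X Y = s * Y.
Proof.
move=> iso l0 h1 h2 h3 h4.
have fxE X Y : fx X Y = X.
  have := @isometry2_dot _ _ _ 0 0 X Y l 0 iso.
  rewrite h1 h2 h3 h4 !subr0 !mulr0 !addr0; exact: mulIf.
have fy2 X Y : fy X Y ^+ 2 = Y ^+ 2.
  by have := iso X Y 0 0; rewrite !fxE h2 !subr0 => /addrI.
pose s := fy 0 1; have s2 : s ^+ 2 = 1 by rewrite fy2 expr1n.
exists s; first by move/eqP: s2; rewrite sqrf_eq1 => /orP[]/eqP; auto.
move=> X Y; split=> //; have := @isometry2_dot _ _ _ 0 0 X Y 0 1 iso.
rewrite !fxE h2 !subr0 !mulr0 !add0r mulr1 -/s => YE.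
by rewrite -[in RHS]YE mulrCA -expr2 s2 mulr1.
Qed.

Lemma isometry2_swap (R : realType) (fx fy : R -> R -> R) l :
  isometry2 fx fy -> l != 0 ->
  fx 0 0 = l -> fy 0 0 = 0 -> fx l 0 = 0 -> fy l 0 = 0 ->
  exists2 s, s = 1 \/ s = -1 & forall X Y, fx X Y = l - X /\ fy X Y = s * Y.
Proof.
move=> iso l0 h1 h2 h3 h4.
have [|||||s hs H] := @isometry2_fix R (fun x y => l - fx x y) fy l _ l0.
- move=> x y x1 y1; rewrite -(iso x y x1 y1); ring.
- by rewrite h1 subrr.
- by [].
- by rewrite h3 subr0.
- by [].
exists s => // X Y; have [E ?] := H X Y; split=> //.
by rewrite -{2}E subKr.
Qed.

Definition digon_pair (R : realType) (A B : R -> R -> Prop) (l e rho : R) :=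
  [/\ 0 <= e /\ e <= 1 / 4, 0 < l, l <= rho, framed A l e rho & framed B l e rho].

(* B enters through the half-turn exchanging the two ends of the chord. *)
Definition glue (R : realType) (A B : R -> R -> Prop) (l X Y : R) :=
  A X Y /\ B (l - X) (- Y).

(** If neither set rises above its chord, the meet is contained in a line, has empty interior, and
    the symmetry hypothesis says nothing about it. *)
Definition nonflat (R : realType) (A B : R -> R -> Prop) :=
  (exists X Y, A X Y /\ 0 < Y) \/ (exists X Y, B X Y /\ 0 < Y).

Lemma framed_segment (R : realType) (A : R -> R -> Prop) (l e rho X : R) :
  0 <= e -> 0 < l -> l <= rho ->
  framed A l e rho -> 0 <= X -> X <= l -> A X 0.
Proof.
move=> e0 l0 lr [_ h2 _] X0 Xl; have eX : 0 <= e * X by rewrite mulr_ge0.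
have eX' : 0 <= e * (l - X) by rewrite mulr_ge0 // subr_ge0.
by apply: h2 => //; clear -X0 Xl l0 lr; lra.
Qed.

Lemma upper_thin (R : realType) (A : R -> R -> Prop) (l e rho X Y : R) :
  0 <= e -> framed A l e rho -> upper A l X Y ->
  Y <= e * X /\ Y <= e * (l - X).
Proof.
move=> e0 [h1 _ _] [X0 Xl Y0 AXY]; have [Y1|Y1] := le_or_lt Y 0; last first.
  by have [] := h1 X Y AXY Y1.
have -> : Y = 0 by apply: le_anti; rewrite Y0 Y1.
by split; rewrite mulr_ge0 // subr_ge0.
Qed.

(** A cap of slope [e <= 1 / 4] over a chord of length [l <= rho] lies where the other set is
    complete. Hence, above the chord, [glue] is just the cap of [A]. *)
Lemma upper_lower (R : realType) (A B : R -> R -> Prop) (l e rho X Y : R) :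
  digon_pair A B l e rho -> upper A l X Y -> B (l - X) (- Y).
Proof.
move=> [[e0 e1] l0 lr fA [_ h2 _]] U; have [t1 t2] := upper_thin e0 fA U.
have [X0 Xl Y0 _] := U.
have eX : e * X <= 1 / 4 * X by rewrite ler_wpM2r.
have eX' : 0 <= e * X by rewrite mulr_ge0.
have eX'' : 0 <= e * (l - X) by rewrite mulr_ge0 // subr_ge0.
apply: h2; rewrite ?subKr.
- by clear -X0 Xl l0 lr; lra.
- by clear -X0 Xl l0 lr; lra.
- by clear -t1 eX X0 Xl lr l0; lra.
- by rewrite oppr_le0.
- by clear -Y0 eX''; lra.
- by clear -Y0 eX'; lra.
Qed.

Lemma digon_pairC (R : realType) (A B : R -> R -> Prop) (l e rho : R) :
  digon_pair A B l e rho -> digon_pair B A l e rho.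
Proof. by case. Qed.

Lemma nonflatC (R : realType) (A B : R -> R -> Prop) : nonflat A B -> nonflat B A.
Proof. by case; [right|left]. Qed.

Lemma glue_upper (R : realType) (A B : R -> R -> Prop) (l e rho X Y : R) :
  digon_pair A B l e rho -> nonflat A B -> 0 <= Y ->
  glue A B l X Y <-> upper A l X Y.
Proof.
move=> dAB nf Y0; split=> [[AXY BXY]|U]; last first.
  by split; [case: U|exact: (upper_lower dAB U)].
have [_ l0 lr [a1 _ a3] [b1 _ b3]] := dAB.
have [Y1|Y1] := le_or_lt Y 0; last first.
  by have [X0 Xl _ _] := a1 X Y AXY Y1; split=> //; exact: ltW.
have YE : Y = 0 by apply: le_anti; rewrite Y0 Y1.
subst Y; rewrite oppr0 in BXY.
have [X0 Xl] : 0 <= X /\ X <= l.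
  case: nf => -[X' [Y' [C' Y'0]]]; first exact: a3 C' Y'0 AXY.
  by have [h1 h2] := b3 _ _ _ C' Y'0 BXY; clear -h1 h2; split; lra.
by split.
Qed.

Lemma glue_lower (R : realType) (A B : R -> R -> Prop) (l e rho X Y : R) :
  digon_pair A B l e rho -> nonflat A B -> 0 <= Y ->
  glue A B l X (- Y) <-> upper B l (l - X) Y.
Proof.
move=> /digon_pairC dBA /nonflatC nf Y0.
rewrite -(glue_upper (l - X) dBA nf Y0) /glue opprK subKr; tauto.
Qed.

Lemma glue_thin (R : realType) (A B : R -> R -> Prop) (l e rho X Y : R) :
  digon_pair A B l e rho -> nonflat A B -> glue A B l X Y ->
  [/\ 0 <= X, X <= l, `|Y| <= e * X & `|Y| <= e * (l - X)].
Proof.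
move=> dAB nf MXY; have [[e0 e1] l0 lr fA fB] := dAB.
have [Y0|Y0] := le_or_lt 0 Y.
  have U := (glue_upper X dAB nf Y0).1 MXY; have [t1 t2] := upper_thin e0 fA U.
  by case: U => X0 Xl _ _; rewrite ger0_norm.
have nY0 : 0 <= - Y by rewrite oppr_ge0 ltW.
have := (glue_lower X dAB nf nY0).1; rewrite opprK => /(_ MXY) U.
have := upper_thin e0 fB U; rewrite subKr => -[t1 t2].
case: U => X0 Xl _ _; rewrite ltr0_norm //.
by split=> //; clear -X0 Xl; lra.
Qed.

(** For the two ends of the chord the right-angle condition reads [x * (l - x) <= y ^+ 2], while
    thinness gives [y ^+ 2 <= x * (l - x) / 16]. *)
Lemma glue_sharp (R : realType) (A B : R -> R -> Prop) (l e rho x y : R) :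
  digon_pair A B l e rho -> nonflat A B -> glue A B l x y ->
  (forall a b a' b', glue A B l a b -> glue A B l a' b' ->
    0 <= (a - x) * (a' - x) + (b - y) * (b' - y)) ->
  y = 0 /\ (x = 0 \/ x = l).
Proof.
move=> dAB nf Mxy H; have [[e0 e1] l0 lr fA fB] := dAB.
have M0 (X : R) : 0 <= X -> X <= l -> glue A B l X 0.
  move=> X0 Xl; apply/(glue_upper _ dAB) => //; split=> //.
  exact: framed_segment e0 l0 lr fA X0 Xl.
have := H 0 0 l 0 (M0 _ (lexx _) (ltW l0)) (M0 _ (ltW l0) (lexx _)).
have [x0 xl y1 y2] := glue_thin dAB nf Mxy.
have ex : e * x <= 1 / 4 * x by rewrite ler_wpM2r.
have ex' : e * (l - x) <= 1 / 4 * (l - x) by rewrite ler_wpM2r // subr_ge0.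
have yy : y * y = `|y| * `|y| by rewrite -normrM ger0_norm // -expr2 sqr_ge0.
have y3 : `|y| * `|y| <= 1 / 4 * x * (1 / 4 * (l - x)).
  by rewrite ler_pM //; [exact: le_trans ex|exact: le_trans ex'].
have xx : 0 <= x * (l - x) by rewrite mulr_ge0 // subr_ge0.
move=> h.
have x1 : x * (l - x) = 0 by clear -h y3 yy xx; lra.
split.
  apply/eqP; rewrite -normr_eq0 eq_le normr_ge0 andbT.
  move/eqP: x1; rewrite mulf_eq0 => /orP[]/eqP x1.
  - by move: y1; rewrite x1 mulr0.
  - by move: y2; rewrite x1 mulr0.
by move/eqP: x1; rewrite mulf_eq0 subr_eq0 => /orP[]/eqP; auto.
Qed.

Lemma glue_ends_sharp (R : realType) (A B : R -> R -> Prop)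
    (l e rho x a b a' b' : R) :
  digon_pair A B l e rho -> nonflat A B ->
  x = 0 \/ x = l -> glue A B l a b -> glue A B l a' b' ->
  0 <= (a - x) * (a' - x) + (b - 0) * (b' - 0).
Proof.
move=> dAB nf xE /(glue_thin dAB nf)[a0 al b1 b2] /(glue_thin dAB nf)[a0' al' b1' b2'].
have [[e0 e1] _ _ _ _] := dAB.
have P (u v w z : R) : 0 <= u -> 0 <= v -> `|w| <= e * u -> `|z| <= e * v ->
    `|w * z| <= u * v.
  move=> u0 v0 wu zv; rewrite normrM.
  have : `|w| * `|z| <= e * u * (e * v) by rewrite ler_pM.
  have : 0 <= (1 - e * e) * (u * v) by rewrite mulr_ge0 ?mulr_ge0 //; clear -e0 e1; nra.
  by clear; move=> *; lra.
have Q := P _ _ _ _ a0 a0' b1 b1'; rewrite ler_norml in Q.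
have la : 0 <= l - a by rewrite subr_ge0.
have la' : 0 <= l - a' by rewrite subr_ge0.
have Q' := P _ _ _ _ la la' b2 b2'; rewrite ler_norml in Q'.
by case: xE => ->; [clear -Q|clear -Q']; lra.
Qed.

(** The isometry permutes the ends of the chord, which leaves two isometries fixing both and two
    exchanging them. Apart from the identity these are the reflection in the perpendicular bisector,
    the half-turn and the reflection in the chord, in the order of the three alternatives. *)
Lemma digon (R : realType) (A B : R -> R -> Prop) (l e rho : R) :
  digon_pair A B l e rho -> nonflat A B ->
  nontrivially_symmetric (glue A B l) ->
  [\/ (forall X Y, upper A l X Y -> upper A l (l - X) Y) /\
      (forall X Y, upper B l X Y -> upper B l (l - X) Y),
      forall X Y, upper A l X Y <-> upper B l X Y |
      forall X Y, upper A l X Y <-> upper B l (l - X) Y].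
Proof.
move=> dAB nf [fx [fy [iso nid [fM Mf]]]].
have [[e0 e1] l0 lr fA fB] := dAB.
have M0 (X : R) : X = 0 \/ X = l -> glue A B l X 0.
  move=> XE; apply/(glue_upper _ dAB) => //.
  by case: XE => ->; split=> //; rewrite ?(ltW l0) //; apply: framed_segment fA _ _; rewrite ?(ltW l0).
have ends (X : R) : X = 0 \/ X = l -> fy X 0 = 0 /\ (fx X 0 = 0 \/ fx X 0 = l).
  move=> XE; apply: (glue_sharp dAB nf); first exact/fM/M0.
  move=> a b a' b' /Mf[u [v [Muv <- <-]]] /Mf[u' [v' [Muv' <- <-]]].
  by rewrite isometry2_dot //; exact: (glue_ends_sharp dAB).
have [p2 p1] := ends 0 (or_introl erefl); have [q2 q1] := ends l (or_intror erefl).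
have ln : l != 0 by rewrite gt_eqF.
have dpq := iso 0 0 l 0; rewrite p2 q2 !subrr !expr0n !addr0 sub0r sqrrN in dpq.
have upl X Y : upper A l X Y -> glue A B l X Y.
  by move=> U; apply/(glue_upper _ dAB) => //; case: U.
have lol X Y : upper B l X Y -> glue A B l (l - X) (- Y).
  by move=> U; apply/(glue_lower _ dAB); rewrite ?subKr //; case: U.
case: p1 => p1; case: q1 => q1.
- by move: dpq; rewrite p1 q1 subrr expr0n => /esym/eqP; rewrite sqrf_eq0 (negPf ln).
- have [s [] -> H] := isometry2_fix iso ln p1 p2 q1 q2.
    by case: nid => x y; rewrite -[X in _ /\ _ = X]mul1r.
  constructor 3 => X Y; split=> U; have Y0 : 0 <= Y by case: U.
  + by apply/(glue_lower _ dAB) => //; have := fM _ _ (upl _ _ U); have [-> ->] := H X Y; rewrite mulN1r.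
  + apply/(glue_upper _ dAB) => //; have := fM _ _ (lol _ _ U); rewrite subKr.
    by have [-> ->] := H X (- Y); rewrite mulN1r opprK.
- have [s [] -> H] := isometry2_swap iso ln p1 p2 q1 q2.
    constructor 1; split=> X Y U; have Y0 : 0 <= Y by case: U.
    + by apply/(glue_upper _ dAB) => //; have := fM _ _ (upl _ _ U); have [-> ->] := H X Y; rewrite mul1r.
    + apply/(glue_lower _ dAB) => //; have := fM _ _ (lol _ _ U).
      by have [-> ->] := H (l - X) (- Y); rewrite mul1r subKr.
  constructor 2 => X Y; split=> U; have Y0 : 0 <= Y by case: U.
  + have := fM _ _ (upl _ _ U); have [-> ->] := H X Y; rewrite mulN1r => ?.
    have : upper B l (l - (l - X)) Y by exact/(glue_lower _ dAB).
    by rewrite subKr.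
  + apply/(glue_upper _ dAB) => //; have := fM _ _ (lol _ _ U).
    by have [-> ->] := H (l - X) (- Y); rewrite mulN1r opprK subKr.
- by move: dpq; rewrite p1 q1 subrr expr0n => /esym/eqP; rewrite sqrf_eq0 (negPf ln).
Qed.

(** * Arcs in the frame of their chord *)

Definition frame_x (R : realType) (f : R -> R) (s t l u : R) : R :=
  ((t - s) * (u - s) + (f t - f s) * (f u - f s)) / l.

Definition frame_y (R : realType) (f : R -> R) (s t l u : R) : R :=
  ((t - s) * (f u - f s) - (f t - f s) * (u - s)) / l.

Definition arc (R : realType) (f : R -> R) (s t l X Y : R) :=
  exists u, [/\ s <= u, u <= t, X = frame_x f s t l u & Y = frame_y f s t l u].

(** The arc is recovered from the cap as its upper boundary; this turns equalities of regions into
    equalities of curves. *)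
Definition top (R : realType) (A : R -> R -> Prop) (l X Y : R) :=
  upper A l X Y /\ forall Y', Y < Y' -> ~ upper A l X Y'.

Definition chord_length (R : realType) (f : R -> R) (s t l : R) :=
  [/\ s < t, 0 < l & l ^+ 2 = (t - s) ^+ 2 + (f t - f s) ^+ 2].

Definition in_frame (R : realType) (f : R -> R) (s t l : R) (A : R -> R -> Prop) :=
  rigid ((t - s) / l) ((f t - f s) / l) s (f s) A.

Lemma frame_unit (R : realType) (f : R -> R) (s t l : R) :
  chord_length f s t l -> ((t - s) / l) ^+ 2 + ((f t - f s) / l) ^+ 2 = 1.
Proof.
move=> [_ l0 lE]; rewrite !expr_div_n -mulrDl -lE divff // expf_neq0 //.
by rewrite gt_eqF.
Qed.

Lemma convex_vertical (R : realType) (A : R -> R -> Prop) (x y1 y2 y : R) :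
  pconvex A -> A x y1 -> A x y2 -> y1 <= y -> y <= y2 -> A x y.
Proof.
move=> cA A1 A2 h1 h2; have [E|n] := eqVneq y1 y2.
  by have -> : y = y1 by apply: le_anti; rewrite h1 E h2.
have d : 0 < y2 - y1 by rewrite subr_gt0 lt_neqAle n (le_trans h1 h2).
have := cA _ _ _ _ ((y - y1) / (y2 - y1)) _ _ A1 A2.
rewrite divfK ?gt_eqF // subrr mulr0 addr0.
have -> : y1 + (y - y1) = y by ring.
apply.
- by rewrite divr_ge0 ?(ltW d) // subr_ge0.
- by rewrite ler_pdivrMr // mul1r lerB.
Qed.

Lemma convex_segment (R : realType) (A : R -> R -> Prop) (s t ys yt x : R) :
  pconvex A -> A s ys -> A t yt -> s < t -> s <= x -> x <= t ->
  A x (ys + (yt - ys) / (t - s) * (x - s)).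
Proof.
move=> cA As At st sx xt; have d : 0 < t - s by rewrite subr_gt0.
have dn : t - s != 0 by rewrite gt_eqF.
have := cA _ _ _ _ ((x - s) / (t - s)) _ _ As At.
rewrite divfK //.
have -> : s + (x - s) = x by ring.
have -> : (x - s) / (t - s) * (yt - ys) = (yt - ys) / (t - s) * (x - s) by ring.
apply.
- by rewrite divr_ge0 ?(ltW d) // subr_ge0.
- by rewrite ler_pdivrMr // mul1r lerB.
Qed.

(** From an arc point, a further step perpendicular to the chord leaves [A], because every slope of
    the graph makes an angle well below a right angle with the chord. Conversely a cap point
    strictly below the graph can still be raised. *)
Lemma arc_top (R : realType) (A : R -> R -> Prop) (f : R -> R) (a b h m e s t l rho X Y : R) :
  chart A f a b h -> pconvex A -> slopes_in f a b (m - e) (m + e) ->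
  0 <= e -> e <= 1 / 2 -> a <= s -> t <= b -> chord_length f s t l ->
  framed (in_frame f s t l A) l (4 * e) rho ->
  arc f s t l X Y <-> top (in_frame f s t l A) l X Y.
Proof.
move=> ch cA sl e0 e1 as_ tb cl fA; have [st l0 lE] := cl.
have ln : l != 0 by rewrite gt_eqF.
have ts0 : 0 < t - s by rewrite subr_gt0.
pose k := (f t - f s) / (t - s).
have kts : k * (t - s) = f t - f s by rewrite /k divfK // gt_eqF.
have [k1 k2] : m - e <= k /\ k <= m + e.
  by have [] := sl s t as_ (ltW st) tb; rewrite -kts !ler_pM2r.
have [_ hf _] := ch.
pose c := (t - s) / l; pose g := (f t - f s) / l.
have c0 : 0 < c by rewrite divr_gt0.
have gE : g = k * c by rewrite /g -kts /c mulrA.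
have fs u : s <= u -> u <= t ->
    (m - e) * (u - s) <= f u - f s /\ f u - f s <= (m + e) * (u - s).
  by move=> su ut; apply: sl => //; exact: le_trans tb.
have ft u : s <= u -> u <= t ->
    (m - e) * (t - u) <= f t - f u /\ f t - f u <= (m + e) * (t - u).
  by move=> su ut; apply: sl => //; exact: le_trans su.
have cg : c ^+ 2 + g ^+ 2 = 1 by exact: (frame_unit cl).
have km : 3 / 4 <= 1 + k * (m - e).
  by have := @near_slopes_dot R m e k 1 (m - e) e0 e1 k1 k2; clear -e0; lra.
have kp : 3 / 4 <= 1 + k * (m + e).
  by have := @near_slopes_dot R m e k 1 (m + e) e0 e1 k1 k2; clear -e0; lra.
have cl' : c * l = t - s by rewrite /c divfK.
have gl' : g * l = f t - f s by rewrite /g divfK.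
have fxE u : frame_x f s t l u = c * (u - s) + g * (f u - f s).
  by rewrite /frame_x /c /g; field.
have fyE u : frame_y f s t l u = c * (f u - f s) - g * (u - s).
  by rewrite /frame_y /c /g; field.
have base X0 Y0 : in_frame f s t l A X0 Y0 -> forall x y,
    X0 = c * (x - s) + g * (y - f s) -> Y0 = c * (y - f s) - g * (x - s) -> A x y.
  rewrite /in_frame /rigid -/c -/g => AXY x y XE YE.
  have -> : x = c * X0 - g * Y0 + s.
    transitivity ((c ^+ 2 + g ^+ 2) * (x - s) + s); first by rewrite cg; ring.
    by rewrite XE YE; ring.
  have -> // : y = g * X0 + c * Y0 + f s.
  transitivity ((c ^+ 2 + g ^+ 2) * (y - f s) + f s); first by rewrite cg; ring.
  by rewrite XE YE; ring.
have esab x y X0 Y0 : A x y -> X0 = c * (x - s) + g * (y - f s) ->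
    Y0 = c * (y - f s) - g * (x - s) -> in_frame f s t l A X0 Y0.
  move=> Axy -> ->; rewrite /in_frame /rigid -/c -/g.
  have -> : c * (c * (x - s) + g * (y - f s)) -
     g * (c * (y - f s) - g * (x - s)) + s = x.
    by transitivity ((c ^+ 2 + g ^+ 2) * (x - s) + s); [ring|rewrite cg; ring].
  have -> // : g * (c * (x - s) + g * (y - f s)) +
     c * (c * (y - f s) - g * (x - s)) + f s = y.
  by transitivity ((c ^+ 2 + g ^+ 2) * (y - f s) + f s); [ring|rewrite cg; ring].
have cross x y : (y - f s) * (t - s) - (f t - f s) * (x - s) =
    l * (c * (y - f s) - g * (x - s)) by rewrite -cl' -gl'; ring.
have fy0 u : s <= u -> u <= t -> 0 <= frame_y f s t l u.
  move=> su ut; rewrite fyE -(pmulr_rge0 _ l0) -cross subr_ge0.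
  exact: (chart_concave ch cA as_ su ut tb).
have [_ a2 _] := fA.
have up u d : s <= u -> u <= t -> 0 < d ->
    ~ in_frame f s t l A (frame_x f s t l u) (frame_y f s t l u + d).
  move=> su ut d0 AY.
  have Ap : A (u - g * d) (f u + c * d).
    apply: base AY _ _ _ _; rewrite ?fxE ?fyE; first by ring.
    have {1}-> : d = (c ^+ 2 + g ^+ 2) * d by rewrite cg mul1r.
    by ring.
  have [|sx xt yf] := chart_above_chord ch cA as_ st tb Ap.
    rewrite -subr_gt0 cross mulr_gt0 //.
    have -> : c * (f u + c * d - f s) - g * (u - g * d - s) =
      frame_y f s t l u + (c ^+ 2 + g ^+ 2) * d by rewrite fyE; ring.
    by rewrite cg mul1r ltr_wpDl // fy0.
  have cd : 0 < c * d by rewrite mulr_gt0.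
  (* The perpendicular step moves the abscissa by [- g * d]. On either side, staying below the graph
     would contradict the lower bound 3/4 for [1 + k * (m - e)] or for [1 + k * (m + e)]. *)
  have [g0|g0] := le_or_lt 0 g.
    have ux : u - g * d <= u by rewrite lerBlDr lerDl mulr_ge0 // ltW.
    have [u1 _] := sl _ u (le_trans as_ (ltW sx)) ux (le_trans ut tb).
    have : 3 / 4 * (c * d) <= (1 + k * (m - e)) * (c * d) by rewrite ler_pM2r.
    by rewrite gE in u1 yf; clear -u1 yf cd; lra.
  have ux : u <= u - g * d by rewrite lerBrDr gerDl nmulr_rle0 // ltW.
  have [_ u1] := sl u _ (le_trans as_ su) ux (le_trans (ltW xt) tb).
  have : 3 / 4 * (c * d) <= (1 + k * (m + e)) * (c * d) by rewrite ler_pM2r.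
  by rewrite gE in u1 yf; clear -u1 yf cd; lra.
have arc_mem u : s <= u -> u <= t -> upper (in_frame f s t l A) l
    (frame_x f s t l u) (frame_y f s t l u).
  move=> su ut; split; last 1 first.
  - apply: esab (fxE u) (fyE u).
    exact: (chart_on_graph ch (le_trans as_ su) (le_trans ut tb)).
  - have [d1 d2] := fs u su ut.
    have su' : 0 <= u - s by rewrite subr_ge0.
    have H := near_slopes_dot e0 e1 k1 k2 su' d1 d2.
    rewrite fxE gE.
    have -> : c * (u - s) + k * c * (f u - f s) = c * (u - s + k * (f u - f s)) by ring.
    by apply: mulr_ge0; [exact: ltW|clear -su' H; lra].
  - have [d1 d2] := ft u su ut.
    have ut' : 0 <= t - u by rewrite subr_ge0.
    have H := near_slopes_dot e0 e1 k1 k2 ut' d1 d2.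
    rewrite -subr_ge0 fxE.
    have -> : l = c * (t - s) + g * (f t - f s).
      by rewrite -cl' -gl' -[LHS]mul1r -cg; ring.
    rewrite gE.
    have -> : c * (t - s) + k * c * (f t - f s) - (c * (u - s) + k * c * (f u - f s)) =
      c * (t - u + k * (f t - f u)) by ring.
    by apply: mulr_ge0; [exact: ltW|clear -ut' H; lra].
  - exact: fy0.
split=> [[u [su ut -> ->]]|[[X0 Xl Y0 AXY] Htop]].
  split; first exact: arc_mem.
  move=> Y' uY [_ _ _]; have -> : Y' = frame_y f s t l u + (Y' - frame_y f s t l u) by ring.
  by apply: up => //; rewrite subr_gt0.
pose x := c * X - g * Y + s; pose y := g * X + c * Y + f s.
have XE : X = c * (x - s) + g * (y - f s).
  by rewrite -[LHS]mul1r -cg /x /y; ring.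
have YE : Y = c * (y - f s) - g * (x - s).
  by rewrite -[LHS]mul1r -cg /x /y; ring.
have Axy : A x y by exact: base AXY _ _ XE YE.
clearbody x y.
have [sx xt yf] : [/\ s <= x, x <= t & y <= f x].
  have [Y1|Y1] := le_or_lt Y 0; last first.
    have [|h1 h2 h3] := chart_above_chord ch cA as_ st tb Axy.
      by rewrite -subr_gt0 cross -YE mulr_gt0.
    by split=> //; exact: ltW.
  have Y00 : Y = 0 by apply: le_anti; rewrite Y1 Y0.
  have yE : y - f s = k * (x - s).
    apply: (mulfI (lt0r_neq0 c0)); apply/eqP; rewrite -subr_eq0.
    by rewrite mulrA (mulrC c k) -gE -YE Y00.
  have X1 : X = c * (1 + k ^+ 2) * (x - s) by rewrite XE yE gE; ring.
  have l1 : l = c * (1 + k ^+ 2) * (t - s).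
    transitivity ((c ^+ 2 + g ^+ 2) * l); first by rewrite cg mul1r.
    by rewrite gE -cl'; ring.
  have q0 : 0 < c * (1 + k ^+ 2) by rewrite mulr_gt0 // ltr_wpDr // sqr_ge0.
  move: X0 Xl; rewrite {1 2}X1 l1 pmulr_rge0 // ler_pM2l // subr_ge0 lerD2r.
  move=> sx xt; split=> //; apply: hf => //; [exact: le_trans sx|exact: le_trans tb].
have [yE|yn] := eqVneq y (f x).
  by exists x; split=> //; rewrite ?fxE ?fyE -yE.
have ylt : y < f x by rewrite lt_neqAle yn.
have sx' : s < x.
  rewrite lt_neqAle sx andbT; apply/eqP => E; move: Y0 ylt.
  by rewrite YE -E subrr mulr0 subr0 pmulr_rge0 // subr_ge0 => /le_lt_trans H /H; rewrite ltxx.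
have xt' : x < t.
  rewrite lt_neqAle xt andbT; apply/eqP => E; move: Y0 ylt.
  rewrite YE E; have -> : c * (y - f s) - g * (t - s) = c * (y - f t).
    by rewrite gE -[k * c * _]mulrAC kts; ring.
  by rewrite pmulr_rge0 // subr_ge0 => /le_lt_trans H /H; rewrite ltxx.
pose N := `|m| + e + 1.
have N0 : 0 < N by rewrite /N ltr_wpDl // addr_ge0.
have gN : `|g| <= 1 by rewrite ler_norml; clear -cg; nra.
have c1 : c <= 1 by clear -cg; nra.
(* Room for a step of length [d]: the point rises by at most [d], the graph falls by at most
   [(|m| + e) * d], and the abscissa stays in [s, t]. *)
pose d := Num.min ((f x - y) / (N + 1)) (Num.min (x - s) (t - x)).
have [d1 d2 d3 d0] : [/\ d <= (f x - y) / (N + 1), d <= x - s, d <= t - x & 0 < d].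
  rewrite /d !ge_min !lt_min !lexx /= !orbT !subr_gt0 sx' xt' divr_gt0 ?subr_gt0 //.
  by rewrite ltr_wpDl // ltW.
clearbody d.
have gd : `|g * d| <= d by rewrite normrM (gtr0_norm d0) ler_piMl // ltW.
pose x' := x - g * d; pose y' := y + c * d.
have [sx'' xt''] : s <= x' /\ x' <= t.
  by rewrite ler_norml in gd; rewrite /x'; clear -gd d2 d3; lra.
have fx' : y' <= f x'.
  have fl : `|f x - f x'| <= (`|m| + e) * d.
    have me : 0 <= `|m| + e by rewrite addr_ge0.
    rewrite ler_norml in gd.
    have [xx|xx] := le_or_lt x x'.
      rewrite (le_trans (slopes_lipschitz sl (le_trans as_ sx) xx (le_trans xt'' tb))) //.
      by rewrite ler_wpM2l // /x'; clear -gd; lra.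
    rewrite distrC (le_trans (slopes_lipschitz sl (le_trans as_ sx'') (ltW xx) (le_trans xt tb))) //.
    by rewrite ler_wpM2l // /x'; clear -gd; lra.
  rewrite ler_norml in fl; move: d1; rewrite ler_pdivlMr; last by rewrite ltr_wpDl // ltW.
  have : c * d <= 1 * d by rewrite ler_wpM2r // ltW.
  by rewrite /y' /N; clear -fl d0; lra.
have yc' : f s + (f t - f s) / (t - s) * (x' - s) <= y'.
  rewrite -/k; have : 0 <= c * ((y' - f s) - k * (x' - s)).
    have -> : c * ((y' - f s) - k * (x' - s)) = Y + (c ^+ 2 + g ^+ 2) * d.
      by rewrite YE /y' /x' gE; ring.
    by rewrite cg mul1r addr_ge0 // ltW.
  by rewrite pmulr_rge0 // subr_ge0 lerBrDl.
have Axy' : A x' y'.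
  have As := chart_on_graph ch as_ (le_trans (ltW st) tb).
  have At := chart_on_graph ch (le_trans as_ (ltW st)) tb.
  have Ax := chart_on_graph ch (le_trans as_ sx'') (le_trans xt'' tb).
  exact: (convex_vertical cA (convex_segment cA As At st sx'' xt'') Ax yc' fx').
case: (Htop (Y + d)); first by rewrite ltrDl.
split=> //; first by rewrite addr_ge0 // ltW.
apply: (esab _ _ _ _ Axy'); rewrite /x' /y'; first by rewrite XE; ring.
have {1}-> : d = (c ^+ 2 + g ^+ 2) * d by rewrite cg mul1r.
by rewrite YE; ring.
Qed.

(** The centroid is interior. The radius is such that the weight [k] of the apex stays within 1/6 of
    1/3 and the complementary point [p] stays on the base. *)
Lemma convex_triangle_interior (R : realType) (M : R -> R -> Prop) (l X0 Y0 : R) :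
  pconvex M -> 0 < l -> Y0 != 0 -> M 0 0 -> M l 0 -> M X0 Y0 ->
  exists x y, pinterior M x y.
Proof.
move=> cM l0 Yn M0 Ml MXY.
have Yp : 0 < `|Y0| by rewrite normr_gt0.
pose D := `|Y0| + `|X0| + l.
have D0 : 0 < D by rewrite /D ltr_wpDl // addr_ge0.
exists ((X0 + l) / 3), (Y0 / 3), (l * `|Y0| / (6 * D)).
  by rewrite divr_gt0 // mulr_gt0.
set r := l * `|Y0| / (6 * D).
have rD : r * D = l * `|Y0| / 6 by rewrite /r; field; rewrite gt_eqF.
have r0 : 0 < r by rewrite divr_gt0 // mulr_gt0.
move=> x y xr yr; pose k := y / Y0.
have yE : y = k * Y0 by rewrite /k divfK.
pose d := `|k - 1 / 3|.
have dY : d * `|Y0| <= r.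
  by rewrite /d -normrM mulrBl -yE mul1r (mulrC _ Y0).
have d0 : 0 <= d by rewrite normr_ge0.
have D1 : D = `|Y0| + `|X0| + l by [].
clearbody r D.
have rl : r * l <= l * `|Y0| / 6.
  rewrite -rD D1 ler_wpM2l ?(ltW r0) //.
  by rewrite lerDr addr_ge0.
have d6 : d <= 1 / 6.
  rewrite -(ler_pM2r Yp) (le_trans dY) // -(ler_pM2r l0) (le_trans rl) //.
  by clear; lra.
have dX : (r + d * `|X0| + d * l) * `|Y0| <= l / 6 * `|Y0|.
  have : d * `|Y0| * (`|X0| + l) <= r * (`|X0| + l).
    by rewrite ler_wpM2r // addr_ge0 // ltW.
  by move: rD; rewrite D1; clear; lra.
rewrite ler_pM2r // in dX.
have kd : `|k - 1 / 3| <= d by [].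
rewrite ler_norml in kd.
have kX : `|(k - 1 / 3) * X0| <= d * `|X0| by rewrite normrM.
have kl : `|(k - 1 / 3) * l| <= d * l by rewrite normrM (gtr0_norm l0).
rewrite ler_norml in kX; rewrite ler_norml in kl; rewrite ler_norml in xr.
clearbody d k; clear rD rl dY yr D1 D0 D.
have k0 : 0 <= k by clear -kd d6; lra.
have k1 : 0 < 1 - k by clear -kd d6; lra.
pose p := (x - k * X0) / (1 - k).
have pE : p * (1 - k) = x - k * X0 by rewrite divfK // gt_eqF.
have dl0 : 0 <= d * l by rewrite mulr_ge0 // ltW.
have p0 : 0 <= p.
  by rewrite divr_ge0 ?(ltW k1) //; clear -xr kX dX l0 dl0 r0; lra.
have pl : p <= l.
  rewrite ler_pdivrMr //; clear -xr kX dX l0 dl0 kl r0; lra.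
have Mp : M p 0.
  have := cM _ _ _ _ (p / l) _ _ M0 Ml.
  rewrite !subr0 !add0r divfK ?gt_eqF // mulr0; apply.
  - by rewrite divr_ge0 // ltW.
  - by rewrite ler_pdivrMr // mul1r.
have k1' : k <= 1 by rewrite -subr_ge0 ltW.
have := cM _ _ _ _ k k0 k1' Mp MXY.
have -> : p + k * (X0 - p) = x by rewrite -[x](subrK (k * X0)) -pE; ring.
by rewrite subr0 add0r -yE.
Qed.

(** The tolerance 1/16 becomes 1/4 in the frame of a chord, which is the bound demanded by
    [digon_pair]. *)
Definition flat_chart (R : realType) (A : R -> R -> Prop) f (a b h m : R) :=
  [/\ chart A f a b h, pconvex A & slopes_in f a b (m - 1 / 16) (m + 1 / 16)].

(** Margins and depth needed to frame the chord at the scale [rho = l]. *)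
Definition short_chord (R : realType) (f : R -> R) (a b h m s t l : R) :=
  [/\ chord_length f s t l, a + 2 * l <= s, t <= b - 2 * l &
    2 * l * (1 + `|m| + 1 / 16) <= h].

Definition arc_symmetric (R : realType) (f : R -> R) (s t l : R) :=
  forall X Y, arc f s t l X Y -> arc f s t l (l - X) Y.

Lemma flat_chart_framed (R : realType) (A : R -> R -> Prop) f (a b h m s t l : R) :
  flat_chart A f a b h m -> short_chord f a b h m s t l ->
  framed (in_frame f s t l A) l (1 / 4) l.
Proof.
move=> [ch cA sl] [[st l0 lE] sa tb lh].
have -> : 1 / 4 = 4 * (1 / 16) :> R by lra.
by apply: (framed_of_chart ch cA sl); rewrite //; clear -l0; lra.
Qed.

Lemma flat_chart_top (R : realType) (A : R -> R -> Prop) f (a b h m s t l X Y : R) :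
  flat_chart A f a b h m -> short_chord f a b h m s t l ->
  arc f s t l X Y <-> top (in_frame f s t l A) l X Y.
Proof.
move=> fc sc; have := flat_chart_framed fc sc.
have -> : 1 / 4 = 4 * (1 / 16) :> R by lra.
have [ch cA sl] := fc; have [[st l0 lE] sa tb lh] := sc.
apply: (arc_top _ _ ch cA sl); rewrite //; try by clear; lra.
- by clear -sa l0; lra.
- by clear -tb l0; lra.
Qed.

Lemma glue_rigid (R : realType) (A B : R -> R -> Prop) (l : R) :
  glue A B l = fun X Y => rigid 1 0 0 0 A X Y /\ rigid (-1) 0 l 0 B X Y.
Proof.
apply/funext => X; apply/funext => Y; rewrite /glue /rigid.
by congr (A _ _ /\ B _ _); ring.
Qed.

Lemma glue_symmetric (R : realType) (A B : R -> R -> Prop) f g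
    (s t s' t' l : R) :
  symmetric_meets A B -> chord_length f s t l -> chord_length g s' t' l ->
  (exists x y, pinterior (glue (in_frame f s t l A) (in_frame g s' t' l B) l) x y) ->
  nontrivially_symmetric (glue (in_frame f s t l A) (in_frame g s' t' l B) l).
Proof.
move=> sym /frame_unit c1 /frame_unit c2; rewrite glue_rigid /in_frame !rigid_comp.
by apply: sym; rewrite !(mulr0, mulr1, subr0, addr0, mulrN, sqrrN, add0r).
Qed.

Lemma nonflat_interior (R : realType) (A B : R -> R -> Prop) (l e rho : R) :
  pconvex A -> pconvex B -> digon_pair A B l e rho -> nonflat A B ->
  exists x y, pinterior (glue A B l) x y.
Proof.
move=> cA cB dAB nf; have [[e0 e1] l0 lr fA fB] := dAB.
have cM : pconvex (glue A B l).
  move=> x y x' y' t t0 t1 [A1 B1] [A2 B2]; split; first exact: cA.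
  by have := cB _ _ _ _ t t0 t1 B1 B2; congr (B _ _); ring.
have M0 X : 0 <= X -> X <= l -> glue A B l X 0.
  move=> X0 Xl; apply/(glue_upper _ dAB) => //; split=> //.
  exact: (framed_segment e0 l0 lr fA).
have [X [Y [Yn MXY]]] : exists X Y, Y != 0 /\ glue A B l X Y.
  case: nf => -[X [Y [AXY Y0]]].
  - exists X, Y; split; first by rewrite gt_eqF.
    apply/(glue_upper _ dAB); [by left; exists X, Y|exact: ltW|].
    have [h1 _ _] := fA; have [X0 Xl _ _] := h1 X Y AXY Y0.
    by split=> //; exact: ltW.
  - exists (l - X), (- Y); split; first by rewrite oppr_eq0 gt_eqF.
    apply/(glue_lower _ dAB); [by right; exists X, Y|exact: ltW|].
    have [h1 _ _] := fB; have [X0 Xl _ _] := h1 X Y AXY Y0.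
    by rewrite subKr; split=> //; exact: ltW.
exact: (convex_triangle_interior cM l0 Yn (M0 0 (lexx _) (ltW l0))
  (M0 l (ltW l0) (lexx _)) MXY).
Qed.

Lemma flat_upper (R : realType) (A : R -> R -> Prop) (l e rho X Y : R) :
  0 <= e -> 0 < l -> l <= rho -> framed A l e rho ->
  ~ (exists X Y, A X Y /\ 0 < Y) ->
  upper A l X Y <-> [/\ 0 <= X, X <= l & Y = 0].
Proof.
move=> e0 l0 lr fA nf; split=> [[X0 Xl Y0 AXY]|[X0 Xl ->]]; last first.
  by split=> //; exact: (framed_segment e0 l0 lr fA).
split=> //; apply: le_anti; rewrite Y0 andbT leNgt; apply/negP => Y1.
by apply: nf; exists X, Y.
Qed.

(** When both caps are flat there is no digon to exploit, but then both arcs are the chord itself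
    and the second alternative holds. Otherwise the symmetry of the caps passes to their tops. *)
Lemma digon_arcs (R : realType) (A B : R -> R -> Prop) f g
    (a b h m s t a' b' h' m' s' t' l : R) :
  symmetric_meets A B ->
  flat_chart A f a b h m -> short_chord f a b h m s t l ->
  flat_chart B g a' b' h' m' -> short_chord g a' b' h' m' s' t' l ->
  [\/ arc_symmetric f s t l /\ arc_symmetric g s' t' l,
      forall X Y, arc f s t l X Y <-> arc g s' t' l X Y |
      forall X Y, arc f s t l X Y <-> arc g s' t' l (l - X) Y].
Proof.
move=> sym fA cA fB cB.
have frA := flat_chart_framed fA cA; have frB := flat_chart_framed fB cB.
have [[_ cvA _] [lA _ _ _]] := (fA, cA); have [[_ cvB _] [lB _ _ _]] := (fB, cB).
have l0 : 0 < l by case: lA.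
set A' := in_frame f s t l A in frA *; set B' := in_frame g s' t' l B in frB *.
have q0 : 0 <= 1 / 4 :> R by lra.
have dAB : digon_pair A' B' l (1 / 4) l by split.
have H : [\/ (forall X Y, upper A' l X Y -> upper A' l (l - X) Y) /\
      (forall X Y, upper B' l X Y -> upper B' l (l - X) Y),
      forall X Y, upper A' l X Y <-> upper B' l X Y |
      forall X Y, upper A' l X Y <-> upper B' l (l - X) Y].
  have [nf|nf] := pselect (nonflat A' B').
    apply: (digon dAB nf); apply: (glue_symmetric sym lA lB).
    by apply: (nonflat_interior _ _ dAB nf); exact: rigid_convex.
  constructor 2 => X Y.
  rewrite (flat_upper _ _ q0 l0 (lexx _) frA) ?(flat_upper _ _ q0 l0 (lexx _) frB) //.
  - by move=> nB; apply: nf; right.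
  - by move=> nA; apply: nf; left.
case: H => [[HA HB]|H|H].
- constructor 1; split=> X Y.
  + rewrite !(flat_chart_top _ _ fA cA) -/A' => -[U N]; split=> [|Y' YY' /HA]; first exact: HA.
    by rewrite subKr; exact: N.
  + rewrite !(flat_chart_top _ _ fB cB) -/B' => -[U N]; split=> [|Y' YY' /HB]; first exact: HB.
    by rewrite subKr; exact: N.
- constructor 2 => X Y; rewrite (flat_chart_top _ _ fA cA) (flat_chart_top _ _ fB cB).
  rewrite -/A' -/B'; split=> -[/H U N]; split=> // Y' YY' /H; exact: N.
- constructor 3 => X Y; rewrite (flat_chart_top _ _ fA cA) (flat_chart_top _ _ fB cB).
  rewrite -/A' -/B'; split=> -[/H U N]; split=> // Y' YY' /H; exact: N.
Qed.

(** * Curves all of whose short arcs are congruent *)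

Definition sqdist (R : realType) (f : R -> R) (s t : R) : R :=
  (t - s) ^+ 2 + (f t - f s) ^+ 2.

(* All arcs over chords of length l are directly congruent: their points have the
   same distances to the two ends of the chord. *)
Definition homogeneous (R : realType) (f : R -> R) (a b l : R) :=
  forall s t s' t', a <= s -> t <= b -> a <= s' -> t' <= b ->
    chord_length f s t l -> chord_length f s' t' l ->
    forall u, s <= u -> u <= t -> exists u',
      [/\ s' <= u', u' <= t', sqdist f s' u' = sqdist f s u &
        sqdist f u' t' = sqdist f u t].

Lemma slopes_dot (R : realType) (m e dx dy dx' dy' : R) :
  0 <= e -> e <= 1 / 2 -> 0 <= dx -> 0 <= dx' ->
  (m - e) * dx <= dy -> dy <= (m + e) * dx ->
  (m - e) * dx' <= dy' -> dy' <= (m + e) * dx' ->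
  3 / 4 * (dx * dx') <= dx * dx' + dy * dy'.
Proof.
move=> e0 e1 d0 d0' h1 h2 h3 h4; have [dE|dn] := eqVneq dx 0.
  have yE : dy = 0 by apply: le_anti; move: h1 h2; rewrite dE !mulr0 => -> ->.
  by rewrite dE yE; clear; lra.
have dp : 0 < dx by rewrite lt_neqAle eq_sym dn.
have := @near_slopes_dot R m e (dy / dx) dx' dy' e0 e1.
rewrite ler_pdivlMr // ler_pdivrMr // => /(_ h1 h2 d0' h3 h4).
rewrite -(ler_pM2l dp); have -> : dx * (dx' + dy / dx * dy') = dx * dx' + dy * dy'.
  by field.
by clear; lra.
Qed.

(** The cross term is an inner product of two chords with nearly equal slopes, hence nonnegative. So
    the distance from a fixed point increases along the graph, and a point of an arc is determined
    by its distance to one end. *)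
Lemma sqdist_sub (R : realType) (f : R -> R) (a b m e s t t' : R) :
  slopes_in f a b (m - e) (m + e) -> 0 <= e -> e <= 1 / 2 ->
  a <= s -> s <= t -> t <= t' -> t' <= b ->
  (t' - t) ^+ 2 <= sqdist f s t' - sqdist f s t.
Proof.
move=> sl e0 e1 as_ st tt tb.
have [h1 h2] := sl s t as_ st (le_trans tt tb).
have [h3 h4] := sl t t' (le_trans as_ st) tt tb.
have d0 : 0 <= t - s by rewrite subr_ge0.
have d1 : 0 <= t' - t by rewrite subr_ge0.
have := slopes_dot e0 e1 d0 d1 h1 h2 h3 h4.
have : 0 <= (t - s) * (t' - t) by rewrite mulr_ge0.
have : 0 <= (f t' - f t) * (f t' - f t) by rewrite -expr2 sqr_ge0.
by rewrite /sqdist; clear; lra.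
Qed.

Lemma sqdist_le (R : realType) (f : R -> R) (a b m e s t t' : R) :
  slopes_in f a b (m - e) (m + e) -> 0 <= e -> e <= 1 / 2 ->
  a <= s -> s <= t -> s <= t' -> t <= b -> t' <= b ->
  (sqdist f s t <= sqdist f s t') = (t <= t').
Proof.
move=> sl e0 e1 as_ st st' tb tb'; apply/idP/idP => [|tt]; last first.
  by rewrite -subr_ge0 (le_trans _ (sqdist_sub sl e0 e1 as_ st tt tb')) // sqr_ge0.
have [//|tt] := le_or_lt t t'.
have := sqdist_sub sl e0 e1 as_ st' (ltW tt) tb.
have : 0 < (t - t') ^+ 2 by rewrite exprn_even_gt0 //= subr_eq0 gt_eqF.
by clear; lra.
Qed.

Lemma sqdist_inj (R : realType) (f : R -> R) (a b m e s t t' : R) :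
  slopes_in f a b (m - e) (m + e) -> 0 <= e -> e <= 1 / 2 ->
  a <= s -> s <= t -> s <= t' -> t <= b -> t' <= b ->
  sqdist f s t = sqdist f s t' -> t = t'.
Proof.
move=> sl e0 e1 as_ st st' tb tb' E; apply: le_anti.
by rewrite -(sqdist_le sl e0 e1 as_ st st' tb tb') -(sqdist_le sl e0 e1 as_ st' st tb' tb) E lexx.
Qed.

Lemma slopes_in_opp (R : realType) (f : R -> R) (a b m e : R) :
  slopes_in f a b (m - e) (m + e) ->
  slopes_in (fun x => f (- x)) (- b) (- a) (- m - e) (- m + e).
Proof.
move=> sl x y x1 xy y1.
by have [|||] := sl (- y) (- x); clear -x1 xy y1; lra.
Qed.

Lemma sqdistC (R : realType) (f : R -> R) (s t : R) : sqdist f s t = sqdist f t s.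
Proof. by rewrite /sqdist; ring. Qed.

Lemma sqdist_opp (R : realType) (f : R -> R) (s t : R) :
  sqdist (fun x => f (- x)) (- t) (- s) = sqdist f s t.
Proof. by rewrite /sqdist !opprK; ring. Qed.

Lemma sqdist_inj_left (R : realType) (f : R -> R) (a b m e s s' t : R) :
  slopes_in f a b (m - e) (m + e) -> 0 <= e -> e <= 1 / 2 ->
  a <= s -> a <= s' -> s <= t -> s' <= t -> t <= b ->
  sqdist f s t = sqdist f s' t -> s = s'.
Proof.
move=> /slopes_in_opp sl e0 e1 as_ as' st st' tb E; apply: oppr_inj.
by apply: (sqdist_inj sl e0 e1 (s := - t)); rewrite ?lerN2 // !sqdist_opp.
Qed.

Lemma sqdist_le_left (R : realType) (f : R -> R) (a b m e s s' t : R) :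
  slopes_in f a b (m - e) (m + e) -> 0 <= e -> e <= 1 / 2 ->
  a <= s -> a <= s' -> s <= t -> s' <= t -> t <= b ->
  (sqdist f s t <= sqdist f s' t) = (s' <= s).
Proof.
move=> /slopes_in_opp sl e0 e1 as_ as' st st' tb.
by rewrite -!(sqdist_opp f) (sqdist_le sl e0 e1) ?lerN2.
Qed.

Lemma sqdist_lipschitz (R : realType) (f : R -> R) (a b m e s t t' : R) :
  slopes_in f a b (m - e) (m + e) -> 0 <= e -> a <= s -> s <= b ->
  a <= t -> t <= t' -> t' <= b ->
  `|sqdist f s t - sqdist f s t'| <=
    2 * (b - a) * (1 + (`|m| + e) ^+ 2) * (t' - t).
Proof.
move=> sl e0 as_ sb at_ tt tb.
have N0 : 0 <= `|m| + e by rewrite addr_ge0.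
have f1 := slopes_lipschitz sl at_ tt tb.
have lip u v : a <= u -> u <= b -> a <= v -> v <= b ->
    `|f u - f v| <= (`|m| + e) * (b - a).
  move=> au ub av vb; have [uv|vu] := le_or_lt u v.
    rewrite (le_trans (slopes_lipschitz sl au uv vb)) // ler_wpM2l //.
    by clear -vb au; lra.
  rewrite distrC (le_trans (slopes_lipschitz sl av (ltW vu) ub)) // ler_wpM2l //.
  by clear -ub av; lra.
have g1 := lip t s at_ (le_trans tt tb) as_ sb.
have g2 := lip t' s (le_trans at_ tt) tb as_ sb.
have -> : sqdist f s t - sqdist f s t' =
  - ((t' - t) * ((t - s) + (t' - s))) + (f t - f t') * ((f t - f s) + (f t' - f s)).
  by rewrite /sqdist; ring.
rewrite (le_trans (ler_normD _ _)) // normrN !normrM.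
have k1 : `|t' - t| * `|(t - s) + (t' - s)| <= (t' - t) * (2 * (b - a)).
  rewrite ger0_norm ?subr_ge0 // ler_wpM2l ?subr_ge0 // ler_norml.
  by clear -at_ tt tb as_ sb; lra.
have k2 : `|f t - f t'| * `|(f t - f s) + (f t' - f s)| <=
    (`|m| + e) * (t' - t) * (2 * ((`|m| + e) * (b - a))).
  rewrite ler_pM // (le_trans (ler_normD _ _)) //.
  by clear -g1 g2; lra.
by clear -k1 k2; lra.
Qed.

Lemma sqdist_ivt (R : realType) (f : R -> R) (a b m e s q : R) :
  slopes_in f a b (m - e) (m + e) -> 0 <= e -> a <= s -> s <= b ->
  0 <= q -> q <= sqdist f s b ->
  exists t, [/\ s <= t, t <= b & sqdist f s t = q].
Proof.
move=> sl e0 as_ sb q0 qb.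
have [|||t h E] := @lipschitz_ivt R (sqdist f s) (2 * (b - a) * (1 + (`|m| + e) ^+ 2)) s b q sb.
- move=> x y sx xy yb.
  exact: (sqdist_lipschitz sl e0 as_ sb (le_trans as_ sx) xy yb).
- by rewrite /sqdist !subrr !expr0n addr0.
- by [].
by case/andP: h => h1 h2; exists t.
Qed.

Lemma frame_dist (R : realType) (f : R -> R) (s t l u v : R) :
  chord_length f s t l ->
  (frame_x f s t l u - frame_x f s t l v) ^+ 2 +
  (frame_y f s t l u - frame_y f s t l v) ^+ 2 = sqdist f u v.
Proof.
move=> [st l0 lE]; have ln : l != 0 by rewrite gt_eqF.
apply: (mulfI (expf_neq0 2 ln)).
transitivity (((t - s) ^+ 2 + (f t - f s) ^+ 2) * sqdist f u v); last by rewrite lE.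
by rewrite /frame_x /frame_y /sqdist; field.
Qed.

Lemma frame_start (R : realType) (f : R -> R) (s t l : R) :
  frame_x f s t l s = 0 /\ frame_y f s t l s = 0.
Proof. by rewrite /frame_x /frame_y !subrr !mulr0 subrr addr0 mul0r. Qed.

Lemma frame_end (R : realType) (f : R -> R) (s t l : R) :
  chord_length f s t l -> frame_x f s t l t = l /\ frame_y f s t l t = 0.
Proof.
move=> [_ l0 lE]; rewrite /frame_x /frame_y -!expr2 -lE expr2.
by rewrite mulfK ?gt_eqF //; split=> //; ring.
Qed.

(** When a chord of constant length slides to the right, its right end follows at Lipschitz speed.
    Equal squared lengths factor as [D * (t' - t) + V * (f t' - f t) = D * (s' - s) + V * (f s' - f
    s)], where [D] and [V] add up the widths and the heights of the two chords, and the left side is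
    at least [3 / 4 * D * (t' - t)]. *)
Lemma sqdist_transit (R : realType) (f : R -> R) (a b m e s s' t t' : R) :
  slopes_in f a b (m - e) (m + e) -> 0 <= e -> e <= 1 / 2 ->
  a <= s -> s <= s' -> s <= t -> s' <= t' -> t <= b -> t' <= b ->
  sqdist f s t = sqdist f s' t' ->
  t <= t' /\ t' - t <= 4 / 3 * (1 + (`|m| + e) ^+ 2) * (s' - s).
Proof.
move=> sl e0 e1 as_ ss st st' tb tb' E.
have tt : t <= t'.
  have [//|lt] := le_or_lt t t'.
  have s't : s' <= t by rewrite (le_trans st') // ltW.
  have h1 : sqdist f s' t <= sqdist f s t.
    by rewrite (sqdist_le_left sl e0 e1) //; exact: le_trans ss.
  by move: h1; rewrite E (sqdist_le sl e0 e1) //; exact: le_trans ss.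
split=> //.
have [h1 h2] := sl s t as_ st tb.
have [h3 h4] := sl s' t' (le_trans as_ ss) st' tb'.
have [h5 h6] := sl t t' (le_trans as_ st) tt tb'.
have ss1 := slopes_lipschitz sl as_ ss (le_trans st' tb').
have st1 := slopes_lipschitz sl as_ st tb.
have st2 := slopes_lipschitz sl (le_trans as_ ss) st' tb'.
pose D := (t - s) + (t' - s').
have d0 : 0 <= t - s by rewrite subr_ge0.
have d0' : 0 <= t' - s' by rewrite subr_ge0.
have D0 : 0 <= D by rewrite addr_ge0.
pose V := (f t - f s) + (f t' - f s').
have V1 : (m - e) * D <= V by rewrite /D /V; clear -h1 h3; lra.
have V2 : V <= (m + e) * D by rewrite /D /V; clear -h2 h4; lra.
have dt : 0 <= t' - t by rewrite subr_ge0.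
have K := slopes_dot e0 e1 D0 dt V1 V2 h5 h6.
have EE : D * (t' - t) + V * (f t' - f t) = D * (s' - s) + V * (f s' - f s).
  by move: E; rewrite /sqdist /D /V; clear; lra.
have N0 : 0 <= `|m| + e by rewrite addr_ge0.
have VN : `|V| <= (`|m| + e) * D.
  rewrite /V (le_trans (ler_normD _ _)) // distrC (distrC (f t')).
  by rewrite /D; clear -st1 st2; lra.
have : `|V * (f s' - f s)| <= (`|m| + e) * D * ((`|m| + e) * (s' - s)).
  by rewrite normrM ler_pM // distrC.
rewrite ler_norml => /andP[_ VV].
have [DE|Dn] := eqVneq D 0.
  have [-> ->] : t = s /\ t' = s'.
    by move: DE; rewrite /D; clear -d0 d0'; move=> ?; split; lra.
  have : 0 <= (`|m| + e) ^+ 2 * (s' - s) by rewrite mulr_ge0 ?sqr_ge0 // subr_ge0.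
  by clear -ss; lra.
have Dp : 0 < D by rewrite lt_neqAle eq_sym Dn.
clearbody D V; rewrite -(ler_pM2l Dp).
by clear -K EE VV; lra.
Qed.

Lemma arc_reflection (R : realType) (f : R -> R) (s t l v : R) :
  chord_length f s t l -> arc_symmetric f s t l -> s <= v -> v <= t ->
  exists v', [/\ s <= v', v' <= t, sqdist f s v' = sqdist f v t,
    sqdist f v' t = sqdist f s v & forall u, s <= u -> u <= t ->
    exists u', [/\ s <= u', u' <= t, sqdist f s u' = sqdist f u t,
      sqdist f u' t = sqdist f s u & sqdist f u' v' = sqdist f u v]].
Proof.
move=> cl sym sv vt.
have [|v' [sv' vt' XE YE]] := sym (frame_x f s t l v) (frame_y f s t l v).
  by exists v.
have [xs ys] := frame_start f s t l; have [xt yt] := frame_end cl.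
exists v'; split=> //.
- by rewrite -!(frame_dist _ _ cl) xs ys xt yt -XE -YE; ring.
- by rewrite -!(frame_dist _ _ cl) xs ys xt yt -XE -YE; ring.
move=> u su ut.
have [|u' [su' ut' XuE YuE]] := sym (frame_x f s t l u) (frame_y f s t l u).
  by exists u.
exists u'; split=> //.
- by rewrite -!(frame_dist _ _ cl) xs ys xt yt -XuE -YuE; ring.
- by rewrite -!(frame_dist _ _ cl) xs ys xt yt -XuE -YuE; ring.
- by rewrite -!(frame_dist _ _ cl) -XuE -YuE -XE -YE; ring.
Qed.

(** For [s <= s'], the reflection of the arc from [s] to [t'] carries the arc over [s, t] backwards
    onto the one over [s', t']; the reflection of the latter arc restores the order. The auxiliary
    chord has another length, which is why symmetry is assumed for all lengths. *)
Lemma homogeneous_of_symmetric (R : realType) (f : R -> R) (a b m e l : R) :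
  slopes_in f a b (m - e) (m + e) -> 0 <= e -> e <= 1 / 2 ->
  (forall s t l', a <= s -> t <= b -> chord_length f s t l' ->
    arc_symmetric f s t l') ->
  homogeneous f a b l.
Proof.
move=> sl e0 e1 sym s t s' t' as_ tb as' tb' cl cl' u su ut.
have [st l0 lE] := cl; have [st' _ lE'] := cl'.
have Q1 : sqdist f s t = l ^+ 2 by rewrite lE.
have Q2 : sqdist f s' t' = l ^+ 2 by rewrite lE'.
have [u1 [su1 ut1 h1 h2]] : exists u1, [/\ s' <= u1, u1 <= t',
    sqdist f s' u1 = sqdist f u t & sqdist f u1 t' = sqdist f s u].
  have [ss|ss] := le_or_lt s s'.
    have [tt _] := sqdist_transit sl e0 e1 as_ ss (ltW st) (ltW st') tb tb' (etrans Q1 (esym Q2)).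
    pose l' := Num.sqrt (sqdist f s t').
    have stt : s < t' by exact: lt_le_trans tt.
    have q0 : 0 < sqdist f s t'.
      by rewrite /sqdist ltr_pwDl ?sqr_ge0 // exprn_even_gt0 //= subr_eq0 gt_eqF.
    have cl1 : chord_length f s t' l'.
      by split; rewrite ?sqrtr_gt0 // sqr_sqrtr // ltW.
    have [v' [sv' vt' k1 k2 k3]] := arc_reflection cl1 (sym _ _ _ as_ tb' cl1) (ltW st) tt.
    have vE : v' = s'.
      apply: (sqdist_inj_left sl e0 e1 (le_trans as_ sv') as' vt' (ltW st') tb').
      by rewrite k2 Q1.
    have [u1 [su1 ut1 _ j1 j2]] := k3 u su (le_trans ut tt).
    exists u1; split=> //; last by rewrite sqdistC -vE.
    have := sqdist_le_left sl e0 e1 (le_trans as_ su1) as' ut1 (ltW st') tb'.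
    by rewrite j1 Q2 -Q1 (sqdist_le sl e0 e1 as_ su (ltW st) (le_trans ut tb) tb) ut => <-.
  have [tt _] := sqdist_transit sl e0 e1 as' (ltW ss) (ltW st') (ltW st) tb' tb (etrans Q2 (esym Q1)).
  pose l' := Num.sqrt (sqdist f s' t).
  have stt : s' < t by exact: lt_le_trans tt.
  have q0 : 0 < sqdist f s' t.
    by rewrite /sqdist ltr_pwDl ?sqr_ge0 // exprn_even_gt0 //= subr_eq0 gt_eqF.
  have cl1 : chord_length f s' t l'.
    by split; rewrite ?sqrtr_gt0 // sqr_sqrtr // ltW.
  have [v' [sv' vt' k1 k2 k3]] := arc_reflection cl1 (sym _ _ _ as' tb cl1) (ltW ss) (ltW st).
  have vE : v' = t'.
    by apply: (sqdist_inj sl e0 e1 as' sv' (ltW st') (le_trans vt' tb) tb'); rewrite k1 Q1 Q2.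
  have [u1 [su1 ut1 j0 j1 j2]] := k3 u (le_trans (ltW ss) su) ut.
  rewrite vE in j2; exists u1; split=> //; last by rewrite j2 sqdistC.
  have := sqdist_le sl e0 e1 as' su1 (ltW st') (le_trans ut1 tb) tb'.
  rewrite j0 Q2 -Q1 (sqdist_le_left sl e0 e1 (le_trans as_ su) as_ ut (ltW st) tb).
  by rewrite su => <-.
pose cs := sym s' t' l as' tb' cl'.
have [v' [_ _ _ _ k3]] := arc_reflection cl' cs (lexx s') (ltW st').
have [u' [? ? j1 j2 _]] := k3 u1 su1 ut1.
by exists u'; split=> //; rewrite ?j1 ?j2.
Qed.

Definition same_arc (R : realType) (f g : R -> R) (s t s' t' l : R) :=
  (forall X Y, arc f s t l X Y <-> arc g s' t' l X Y) \/
  (forall X Y, arc f s t l X Y <-> arc g s' t' l (l - X) Y).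

Lemma same_arc_profile (R : realType) (f g : R -> R) (a b m e s t s' t' l : R) :
  slopes_in g a b (m - e) (m + e) -> 0 <= e -> e <= 1 / 2 ->
  a <= s' -> t' <= b -> chord_length g s' t' l -> same_arc f g s t s' t' l ->
  chord_length f s t l ->
  exists r : bool, forall u, s <= u -> u <= t -> exists u', [/\ s' <= u', u' <= t' &
    if r then sqdist f s u = sqdist g s' u' /\ sqdist f u t = sqdist g u' t'
    else sqdist f s u = sqdist g u' t' /\ sqdist f u t = sqdist g s' u'].
Proof.
move=> sl e0 e1 as' tb' clg sa clf.
have [xs ys] := frame_start f s t l; have [xt yt] := frame_end clf.
have [xs' ys'] := frame_start g s' t' l; have [xt' yt'] := frame_end clg.
case: sa => H; [exists true|exists false] => u su ut.
- have [|u' [su' ut' XE YE]] := (H (frame_x f s t l u) (frame_y f s t l u)).1.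
    by exists u.
  exists u'; split=> //; rewrite -!(frame_dist _ _ clg) -!(frame_dist _ _ clf).
  by rewrite xs ys xt yt xs' ys' xt' yt' XE YE.
- have [|u' [su' ut' XE YE]] := (H (frame_x f s t l u) (frame_y f s t l u)).1.
    by exists u.
  exists u'; split=> //; rewrite -!(frame_dist _ _ clg) -!(frame_dist _ _ clf).
  by rewrite xs ys xt yt xs' ys' xt' yt' -XE -YE; split; ring.
Qed.

(** Fix the distance from the left end to a point of the arc. The distance [G] from this point to
    the right end depends only on whether the arc is the reference or its mirror image, so it takes
    at most two values. Being Lipschitz in the starting point, it would attain the mean of two
    distinct values as a third one. *)
Lemma homogeneous_of_same_arc (R : realType) (f g : R -> R)
    (a b m e a' b' m' s0 t0 l : R) :
  slopes_in f a b (m - e) (m + e) -> slopes_in g a' b' (m' - e) (m' + e) ->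
  0 <= e -> e <= 1 / 2 -> a' <= s0 -> t0 <= b' -> chord_length g s0 t0 l ->
  (forall s t, a <= s -> t <= b -> chord_length f s t l ->
    same_arc f g s t s0 t0 l) ->
  homogeneous f a b l.
Proof.
move=> sl sl' e0 e1 as0 tb0 clg sa.
have ep s t : a <= s -> t <= b -> chord_length f s t l ->
   exists r : bool, forall u, s <= u -> u <= t -> exists u', [/\ s0 <= u', u' <= t0 &
    if r then sqdist f s u = sqdist g s0 u' /\ sqdist f u t = sqdist g u' t0
    else sqdist f s u = sqdist g u' t0 /\ sqdist f u t = sqdist g s0 u'].
  move=> as_ tb cl.
  exact: (same_arc_profile sl' e0 e1 as0 tb0 clg (sa s t as_ tb cl) cl).
have l0 : 0 < l by case: clg.
have cq s t : chord_length f s t l -> sqdist f s t = l ^+ 2 by case.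
have qc s t : s <= t -> sqdist f s t = l ^+ 2 -> chord_length f s t l.
  move=> st E; split=> //; rewrite lt_neqAle st andbT; apply/eqP => st'.
  move: E; rewrite st' /sqdist !subrr !expr0n addr0 => /esym/eqP.
  by rewrite sqrf_eq0 gt_eqF.
have key s1 t1 s2 t2 p1 p2 : a <= s1 -> s1 <= s2 -> t1 <= b -> t2 <= b ->
    chord_length f s1 t1 l -> chord_length f s2 t2 l ->
    s1 <= p1 -> p1 <= t1 -> s2 <= p2 -> p2 <= t2 ->
    sqdist f s1 p1 = sqdist f s2 p2 -> sqdist f p1 t1 = sqdist f p2 t2.
  move=> as1 ss tb1 tb2 cl1 cl2 sp1 pt1 sp2 pt2 E.
  pose q := sqdist f s1 p1.
  have [st1 _ _] := cl1; have [st2 _ _] := cl2.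
  have q0 : 0 <= q by rewrite addr_ge0 // sqr_ge0.
  have ql : q <= l ^+ 2.
    by rewrite -(cq _ _ cl1) (sqdist_le sl e0 e1 as1 sp1 (ltW st1) (le_trans pt1 tb1) tb1).
  have s2b : s2 <= b by exact: le_trans (ltW st2) tb2.
  have far s : s1 <= s -> s <= s2 -> l ^+ 2 <= sqdist f s b.
    move=> s1s ss2; rewrite (@le_trans _ _ (sqdist f s2 b)) //.
      rewrite -(cq _ _ cl2) (sqdist_le sl e0 e1 (le_trans as1 ss) (ltW st2)) //.
    by rewrite (sqdist_le_left sl e0 e1) //; [exact: le_trans ss|exact: le_trans s1s|exact: le_trans s2b].
  (* [F s] pairs the parameter at squared distance [q] from [s] with the right end of the chord of
     length [l] starting at [s]; outside [s1, s2] it is a dummy. *)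
  have /choice[F FP] : forall s, exists p : R * R, s1 <= s -> s <= s2 ->
      [/\ s <= p.1, p.1 <= p.2, p.2 <= b,
        sqdist f s p.1 = q & sqdist f s p.2 = l ^+ 2].
    move=> s.
    have [[s1s ss2]|n] := pselect (s1 <= s /\ s <= s2); last first.
      by exists (0, 0) => h1 h2; case: n.
    have as_ := le_trans as1 s1s; have sb := le_trans ss2 s2b.
    have lf := far s s1s ss2.
    have [p [h1 h2 h3]] := sqdist_ivt sl e0 as_ sb q0 (le_trans ql lf).
    have [t [h4 h5 h6]] := sqdist_ivt sl e0 as_ sb (sqr_ge0 l) lf.
    exists (p, t) => _ _; split=> //=.
    by rewrite -(sqdist_le sl e0 e1 as_ h1 h4 h2 h5) h3 h6.
  pose G s := sqdist f (F s).1 (F s).2.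
  have G1 : G s1 = sqdist f p1 t1.
    have [h1 h2 h3 h4 h5] := FP s1 (lexx _) ss.
    have -> : p1 = (F s1).1.
      by apply: (sqdist_inj sl e0 e1 as1 sp1 h1 (le_trans pt1 tb1) (le_trans h2 h3)).
    have -> // : t1 = (F s1).2.
    apply: (sqdist_inj sl e0 e1 as1 (ltW st1) (le_trans h1 h2) tb1 h3).
    by rewrite h5 cq.
  have G2 : G s2 = sqdist f p2 t2.
    have [h1 h2 h3 h4 h5] := FP s2 ss (lexx _).
    have -> : p2 = (F s2).1.
      apply: (sqdist_inj sl e0 e1 (le_trans as1 ss) sp2 h1 (le_trans pt2 tb2) (le_trans h2 h3)).
      by rewrite h4 -E.
    have -> // : t2 = (F s2).2.
    apply: (sqdist_inj sl e0 e1 (le_trans as1 ss) (ltW st2) (le_trans h1 h2) tb2 h3).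
    by rewrite h5 cq.
  rewrite -G1 -G2.
  have Gtype s : s1 <= s -> s <= s2 -> exists r : bool, exists u', [/\ s0 <= u', u' <= t0 &
      if r then q = sqdist g s0 u' /\ G s = sqdist g u' t0
      else q = sqdist g u' t0 /\ G s = sqdist g s0 u'].
    move=> s1s ss2; have [h1 h2 h3 h4 h5] := FP s s1s ss2.
    have [r Hr] := ep s (F s).2 (le_trans as1 s1s) h3 (qc _ _ (le_trans h1 h2) h5).
    have [u' [k1 k2 k3]] := Hr _ h1 h2; exists r, u'; split=> //.
    by rewrite h4 in k3.
  have Guniq s s' r u' v' : s0 <= u' -> u' <= t0 -> s0 <= v' -> v' <= t0 ->
     (if r then q = sqdist g s0 u' /\ G s = sqdist g u' t0
      else q = sqdist g u' t0 /\ G s = sqdist g s0 u') ->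
     (if r then q = sqdist g s0 v' /\ G s' = sqdist g v' t0
      else q = sqdist g v' t0 /\ G s' = sqdist g s0 v') -> G s = G s'.
    move=> h1 h2 h3 h4; case: r => -[E1 ->] [E2 ->].
    - suff -> : u' = v' by [].
      apply: (sqdist_inj sl' e0 e1 as0 h1 h3 (le_trans h2 tb0) (le_trans h4 tb0)).
      by rewrite -E1 -E2.
    - suff -> : u' = v' by [].
      apply: (sqdist_inj_left sl' e0 e1 (le_trans as0 h1) (le_trans as0 h3) h2 h4 tb0).
      by rewrite -E1 -E2.
  apply: contrapT => /eqP Gn.
  pose C := 2 * (b - a) * (1 + (`|m| + e) ^+ 2).
  pose K := 4 / 3 * (1 + (`|m| + e) ^+ 2).
  have N0 : 0 <= 1 + (`|m| + e) ^+ 2 by rewrite addr_ge0 // sqr_ge0.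
  have K0 : 0 <= K by rewrite mulr_ge0 // divr_ge0.
  have C0 : 0 <= C.
    rewrite mulr_ge0 // mulr_ge0 // subr_ge0.
    by rewrite (le_trans as1) // (le_trans (ltW st1)).
  have Glip x y : s1 <= x -> x <= y -> y <= s2 -> `|G x - G y| <= (2 * C * K) * (y - x).
    move=> s1x xy ys2.
    have [x1 x2 x3 x4 x5] := FP x s1x (le_trans xy ys2).
    have [y1 y2 y3 y4 y5] := FP y (le_trans s1x xy) ys2.
    have ax := le_trans as1 s1x.
    have [P1 P2] := sqdist_transit sl e0 e1 ax xy x1 y1 (le_trans x2 x3)
      (le_trans y2 y3) (etrans x4 (esym y4)).
    have [T1 T2] := sqdist_transit sl e0 e1 ax xy (le_trans x1 x2) (le_trans y1 y2)
      x3 y3 (etrans x5 (esym y5)).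
    have ap := le_trans ax x1.
    have at1 := le_trans ap x2.
    have L1 := sqdist_lipschitz sl e0 ap (le_trans x2 x3) at1 T1 y3.
    have L2 := sqdist_lipschitz sl e0 (le_trans at1 T1) y3 ap P1 (le_trans y2 y3).
    rewrite -/C in L1 L2; rewrite -/K in P2 T2.
    have -> : G x - G y = (sqdist f (F x).1 (F x).2 - sqdist f (F x).1 (F y).2) +
       (sqdist f (F y).2 (F x).1 - sqdist f (F y).2 (F y).1).
      by rewrite /G (sqdistC f (F y).2) (sqdistC f (F y).2); ring.
    rewrite (le_trans (ler_normD _ _)) // (le_trans (lerD L1 L2)) //.
    have : C * ((F y).2 - (F x).2) <= C * (K * (y - x)) by rewrite ler_wpM2l.
    have : C * ((F y).1 - (F x).1) <= C * (K * (y - x)) by rewrite ler_wpM2l.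
    by clear; lra.
  (* Three distinct values of [G] against two types of arc: two of the three arcs share a type, and
     [Guniq] applies. *)
  have [s3 [h1 h2 E3]] : exists s3, [/\ s1 <= s3, s3 <= s2 & G s3 = (G s1 + G s2) / 2].
    have [gg|gg] := le_or_lt (G s1) (G s2).
      have [||s3 /andP[h1 h2] h3] := lipschitz_ivt ss Glip (v := (G s1 + G s2) / 2).
      - by clear -gg; lra.
      - by clear -gg; lra.
      by exists s3.
    have [||s3 /andP[h1 h2] h3] := lipschitz_ivt_decr ss Glip (v := (G s1 + G s2) / 2).
    - by clear -gg; lra.
    - by clear -gg; lra.
    by exists s3.
  have n12 : G s1 <> G s2 by apply/eqP.
  have n13 : G s1 <> G s3 by rewrite E3 => h; apply: n12; clear -h; lra.
  have n23 : G s2 <> G s3 by rewrite E3 => h; apply: n12; clear -h; lra.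
  have [r1 [u1 [a1 b1 c1]]] := Gtype s1 (lexx _) ss.
  have [r2 [u2 [a2 b2 c2]]] := Gtype s2 ss (lexx _).
  have [r3 [u3 [a3 b3 c3]]] := Gtype s3 h1 h2.
  case: r1 c1 => c1; case: r2 c2 => c2; case: r3 c3 => c3.
  - by apply: n12; exact: (Guniq _ _ true _ _ a1 b1 a2 b2).
  - by apply: n12; exact: (Guniq _ _ true _ _ a1 b1 a2 b2).
  - by apply: n13; exact: (Guniq _ _ true _ _ a1 b1 a3 b3).
  - by apply: n23; exact: (Guniq _ _ false _ _ a2 b2 a3 b3).
  - by apply: n23; exact: (Guniq _ _ true _ _ a2 b2 a3 b3).
  - by apply: n13; exact: (Guniq _ _ false _ _ a1 b1 a3 b3).
  - by apply: n12; exact: (Guniq _ _ false _ _ a1 b1 a2 b2).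
  - by apply: n12; exact: (Guniq _ _ false _ _ a1 b1 a2 b2).
move=> s t s' t' as_ tb as' tb' cl cl' u su ut.
have [st _ _] := cl; have [st' _ _] := cl'.
have q0 : 0 <= sqdist f s u by rewrite addr_ge0 // sqr_ge0.
have ql : sqdist f s u <= l ^+ 2.
  by rewrite -(cq _ _ cl) (sqdist_le sl e0 e1 as_ su (ltW st) (le_trans ut tb) tb).
have s'b := le_trans (ltW st') tb'.
have lb : l ^+ 2 <= sqdist f s' b.
  by rewrite -(cq _ _ cl') (sqdist_le sl e0 e1 as' (ltW st') s'b tb').
have [u' [su' ub' E]] := sqdist_ivt sl e0 as' s'b q0 (le_trans ql lb).
have ut' : u' <= t'.
  rewrite -(sqdist_le sl e0 e1 as' su' (ltW st') ub' tb') E.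
  by rewrite (cq _ _ cl').
exists u'; split=> //; have [ss|ss] := le_or_lt s s'.
- by symmetry; apply: (key s t s' t').
- by apply: (key s' t' s t) => //; exact: ltW.
Qed.

(** * Arcs as complex curves *)

Local Open Scope complex_scope.

Definition graph_point (R : realType) (f : R -> R) (u : R) : R[i] := u +i* f u.

Definition chord_dir (R : realType) (f : R -> R) (s t l : R) : R[i] :=
  ((t - s) / l) +i* ((f t - f s) / l).

Definition sqmod (R : realType) (z : R[i]) : R :=
  complex.Re z ^+ 2 + complex.Im z ^+ 2.

Lemma sqmodM (R : realType) (z w : R[i]) : sqmod (z * w) = sqmod z * sqmod w.
Proof. by case: z => a b; case: w => c d; rewrite /sqmod /=; ring. Qed.

Lemma sqmod_eq0 (R : realType) (z : R[i]) : (sqmod z == 0) = (z == 0).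
Proof.
by case: z => a b; rewrite /sqmod /= eq_complex /= paddr_eq0 ?sqr_ge0 // !sqrf_eq0.
Qed.

Lemma sqmod_graph (R : realType) (f : R -> R) (u v : R) :
  sqmod (graph_point f v - graph_point f u) = sqdist f u v.
Proof. by rewrite /sqmod /sqdist /=; ring. Qed.

Lemma chord_dir_unit (R : realType) (f : R -> R) (s t l : R) :
  chord_length f s t l -> sqmod (chord_dir f s t l) = 1.
Proof. by move=> /frame_unit <-. Qed.

Lemma graph_frame (R : realType) (f : R -> R) (s t l u : R) :
  chord_length f s t l ->
  graph_point f u = graph_point f s +
    chord_dir f s t l * (frame_x f s t l u +i* frame_y f s t l u).
Proof.
move=> [st l0 lE]; have ln : l != 0 by rewrite gt_eqF.
have ln2 : l ^+ 2 != 0 by rewrite expf_neq0.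
apply/eqP; rewrite eq_complex /= /frame_x /frame_y; apply/andP; split; apply/eqP.
- transitivity (s + ((t - s) ^+ 2 + (f t - f s) ^+ 2) / l ^+ 2 * (u - s)).
    by rewrite -lE divff // mul1r addrC subrK.
  by field.
- transitivity (f s + ((t - s) ^+ 2 + (f t - f s) ^+ 2) / l ^+ 2 * (f u - f s)).
    by rewrite -lE divff // mul1r addrC subrK.
  by field.
Qed.

Lemma chord_dir_mull (R : realType) (f : R -> R) (s t l : R) :
  chord_length f s t l ->
  graph_point f t = graph_point f s + chord_dir f s t l * l%:C.
Proof.
by move=> cl; rewrite (graph_frame t cl); have [-> ->] := frame_end cl.
Qed.

(** Subtracting the linear function with the slope between the two left ends makes both left ends
    equally high, and both right ends too. Concavity then leaves no room for variation over the
    first chord. *)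
Lemma parallel_chords_flat (R : realType) (f : R -> R) (a b v v' D u : R) :
  concave f a b -> a <= v -> v < v' -> 0 < D -> v' + D <= b ->
  f (v + D) - f v = f (v' + D) - f v' -> v <= u -> u <= v + D ->
  (f u - f v) * D = (f (v + D) - f v) * (u - v).
Proof.
move=> cf av vv' D0 v'b E vu uD.
have d0 : 0 < v' - v by rewrite subr_gt0.
pose k := (f v' - f v) / (v' - v).
pose h x := f x - k * x.
have hv : h v = h v'.
  rewrite /h; have : k * (v' - v) = f v' - f v by rewrite /k divfK // gt_eqF.
  by clear; lra.
have hD : h (v + D) = h (v' + D).
  by move: hv E; rewrite /h; clear; lra.
have ch x y z : a <= x -> x <= y -> y <= z -> z <= b ->
    (h z - h x) * (y - x) <= (h y - h x) * (z - x).
  by move=> ax xy yz zb; have := cf x y z ax xy yz zb; rewrite /h; clear; lra.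
have hE x : h x = f x - k * x by [].
clearbody h k.
have up x : v <= x -> x <= v + D -> h x <= h (v + D).
  move=> vx xD; have [->//|xn] := eqVneq x (v + D).
  have := ch x (v + D) (v' + D) (le_trans av vx) xD; rewrite -hD => H.
  have H' : (h (v + D) - h x) * (v + D - x) <= (h (v + D) - h x) * (v' + D - x).
    by apply: H => //; rewrite lerD2r ltW.
  have : 0 <= (h (v + D) - h x) * (v' - v) by move: H'; clear; lra.
  by rewrite pmulr_lge0 // subr_ge0.
have dn : h (v + D) <= h v.
  rewrite hD; have := ch v v' (v' + D) av (ltW vv').
  rewrite -hv subrr mul0r lerDl => /(_ (ltW D0) v'b).
  by rewrite pmulr_lle0 // subr_le0.
have vD : v <= v + D by rewrite lerDl ltW.
have e1 : h (v + D) = h v by apply: le_anti; rewrite dn up.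
have uv : h u = h v.
  apply: le_anti; rewrite -{1}e1 up //=.
  have vDb : v + D <= b by rewrite (le_trans _ v'b) // lerD2r ltW.
  have := ch v u (v + D) av vu uD vDb.
  by rewrite e1 subrr mul0r (addrC v) addrK pmulr_lge0 // subr_ge0.
by move: uv e1; rewrite !hE => h1 h2; have -> : f u = f v + k * (u - v);
  [|have -> : f (v + D) = f v + k * D]; move: h1 h2; clear; lra.
Qed.

Definition arc_point (R : realType) (f : R -> R) (s t l : R) (w : R[i]) (u : R) :=
  [/\ s <= u, u <= t & graph_point f u = graph_point f s + chord_dir f s t l * w].

Lemma chord_dir_neq0 (R : realType) (f : R -> R) (s t l : R) :
  chord_length f s t l -> chord_dir f s t l != 0.
Proof. by move=> cl; rewrite -sqmod_eq0 (chord_dir_unit cl) oner_neq0. Qed.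

Lemma arc_point_dist (R : realType) (f : R -> R) (s t l : R) w (u : R) :
  chord_length f s t l -> arc_point f s t l w u -> sqdist f s u = sqmod w.
Proof.
move=> cl [_ _ E]; rewrite -sqmod_graph E.
by rewrite [graph_point f s + _]addrC addrK sqmodM (chord_dir_unit cl) mul1r.
Qed.

Lemma arc_point_frame (R : realType) (f : R -> R) (s t l u : R) w :
  chord_length f s t l -> arc_point f s t l w u ->
  w = frame_x f s t l u +i* frame_y f s t l u.
Proof.
move=> cl [_ _]; rewrite (graph_frame u cl) => /addrI.
by move/(mulfI (chord_dir_neq0 cl)).
Qed.

(** The distances to the two ends determine the frame coordinates up to the sign of the second, and
    concavity puts both arcs above their chords. *)
Lemma arc_point_transfer (R : realType) (f : R -> R) (a b l s t s' t' : R) w (u : R) :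
  concave f a b -> homogeneous f a b l ->
  a <= s -> t <= b -> a <= s' -> t' <= b ->
  chord_length f s t l -> chord_length f s' t' l ->
  arc_point f s t l w u -> exists u', arc_point f s' t' l w u'.
Proof.
move=> cf hom as_ tb as' tb' cl cl' wu; have [su ut _] := wu.
have [u' [su' ut' E1 E2]] := hom s t s' t' as_ tb as' tb' cl cl' u su ut.
exists u'; split=> //; rewrite (arc_point_frame cl wu) (graph_frame u' cl').
have fy0 x y z : a <= x -> y <= b -> chord_length f x y l -> x <= z -> z <= y ->
    0 <= frame_y f x y l z.
  move=> ax yb [xy l0 _] xz zy; rewrite divr_ge0 ?(ltW l0) // subr_ge0.
  by rewrite (mulrC (y - x)); exact: (cf x z y ax xz zy yb).
have [xs ys] := frame_start f s t l; have [xt yt] := frame_end cl.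
have [xs' ys'] := frame_start f s' t' l; have [xt' yt'] := frame_end cl'.
move: E1 E2; rewrite -(frame_dist s u cl) -(frame_dist u t cl) -(frame_dist s' u' cl') -(frame_dist u' t' cl').
rewrite xs ys xt yt xs' ys' xt' yt'.
have := fy0 _ _ _ as_ tb cl su ut; have := fy0 _ _ _ as' tb' cl' su' ut'.
move: (frame_y f s t l u) (frame_y f s' t' l u') (frame_x f s t l u) (frame_x f s' t' l u').
move=> y y' x x' y0 y0' E1 E2.
have [_ l0 _] := cl.
have xE : x' = x.
  have l2 : 2 * l != 0 by rewrite mulf_neq0 // ?gt_eqF.
  by apply: (mulfI l2); move: E1 E2; clear; lra.
have /eqP : y' ^+ 2 = y ^+ 2 by move: E1; rewrite xE; clear; lra.
by rewrite xE eqrXn2 // => /eqP ->.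
Qed.

(* Identify the plane with the complex numbers and let e(u) be the direction of the
   chord of length l starting at u. Writing the points of one arc as s + e(s) w(u),
   congruence of the arcs gives w(u) (e(s) - e(v)) = w(v) (e(s) - e(u)), so that
   w(u) / (e(s) - e(u)) is constant; it locates the centre of the circle. *)
Lemma homogeneous_circle (R : realType) (f : R -> R) (a b m e l s t : R) :
  slopes_in f a b (m - e) (m + e) -> 0 <= e -> e <= 1 / 2 ->
  concave f a b -> homogeneous f a b l -> chord_length f s t l ->
  a <= s -> s + 3 * l <= b ->
  (forall u, s <= u -> u <= t -> frame_y f s t l u = 0) \/
  exists c1 c2 r, 0 < r /\
    forall u, s <= u -> u < t -> (u - c1) ^+ 2 + (f u - c2) ^+ 2 = r.
Proof.
move=> sl e0 e1 cf hom cl as_ sb; have [st l0 lE] := cl.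
(* [T x] is the right end of the chord of length [l] starting at [x], with the default 0 where such
   a chord is not guaranteed to fit. *)
have /choice[T TP] : forall x, exists y, a <= x -> x + l <= b ->
    chord_length f x y l /\ y <= x + l.
  move=> x; have [[ax xb]|n] := pselect (a <= x /\ x + l <= b); last first.
    by exists 0 => h1 h2; case: n.
  have xb' : x <= b by rewrite (le_trans _ xb) // lerDl ltW.
  have lb : l ^+ 2 <= sqdist f x b.
    rewrite /sqdist (@le_trans _ _ ((b - x) ^+ 2)) // ?lerDl ?sqr_ge0 //.
    by rewrite lerXn2r // ?nnegrE ?(ltW l0) ?subr_ge0 // lerBrDl.
  have [y [xy yb E]] := sqdist_ivt sl e0 ax xb' (sqr_ge0 l) lb.
  exists y => _ _; split.
    split=> //; rewrite lt_neqAle xy andbT; apply/eqP => xyE.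
    move: E; rewrite -xyE /sqdist !subrr !expr0n addr0 => /esym/eqP.
    by rewrite sqrf_eq0 gt_eqF.
  rewrite -lerBlDl -ler_sqr ?nnegrE ?subr_ge0 ?(ltW l0) //.
  by rewrite -E lerDl sqr_ge0.
have l3 : 0 <= l by exact: ltW.
have tE : t = T s.
  have [|cT Tl] := TP s as_; first by move: sb l3; clear; lra.
  have [sT _ TE] := cT.
  apply: (sqdist_inj sl e0 e1 as_ (ltW st) (ltW sT)).
  - have : (t - s) ^+ 2 <= l ^+ 2 by rewrite lE lerDl sqr_ge0.
    rewrite ler_sqr ?nnegrE ?subr_ge0 ?(ltW st) //.
    by move: sb l3; clear; lra.
  - by rewrite (le_trans Tl) //; move: sb l3; clear; lra.
  - by rewrite -[LHS]lE.
have lsb : s + l <= b by move: sb l3; clear; lra.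
have cT x : a <= x -> x + l <= b -> chord_length f x (T x) l.
  by move=> ax xb; case: (TP x ax xb).
have Tl x : a <= x -> x + l <= b -> T x <= x + l.
  by move=> ax xb; case: (TP x ax xb).
have xT x : a <= x -> x + l <= b -> x <= T x.
  by move=> ax xb; have [/ltW] := cT x ax xb.
have Tb x : a <= x -> x + l <= b -> T x <= b.
  by move=> ax xb; exact: le_trans (Tl x ax xb) xb.
rewrite tE in cl st lE *; clear tE TP t.
pose e_ x := chord_dir f x (T x) l; pose P x w u := arc_point f x (T x) l w u.
have PE x w u : P x w u -> graph_point f u = graph_point f x + e_ x * w by case.
have e_n x : a <= x -> x + l <= b -> e_ x != 0.
  by move=> ax xb; exact: chord_dir_neq0 (cT x ax xb).
have move1 x y w u : a <= x -> x + l <= b -> a <= y -> y + l <= b ->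
    P x w u -> exists u', P y w u'.
  move=> ax xb ay yb.
  exact: (arc_point_transfer cf hom ax (Tb x ax xb) ay (Tb y ay yb) (cT x ax xb) (cT y ay yb)).
have gp_inj u v : graph_point f u = graph_point f v -> u = v by case.
have TT x u : a <= x -> x + l <= b -> u + l <= b -> x <= u -> u <= T x -> T x <= T u.
  move=> ax xb ub xu ut; have au := le_trans ax xu.
  rewrite -(sqdist_le sl e0 e1 au ut (xT u au ub) (Tb x ax xb) (Tb u au ub)).
  have [_ _ E1] := cT x ax xb; have [_ _ E2] := cT u au ub.
  rewrite -[X in _ <= X]E2 E1 [X in _ <= X](_ : _ = sqdist f x (T x)) //.
  by rewrite (sqdist_le_left sl e0 e1 au ax ut (xT x ax xb) (Tb x ax xb)).
(* The end of the chord from [x], seen in the frame of the chord from [u]: it lies on the arc from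
   [u], which ends at [T u >= T x]. *)
have tail x w u : a <= x -> x + l <= b -> u + l <= b -> P x w u ->
    exists w', P u w' (T x) /\ e_ u * w' = e_ x * (l%:C - w).
  move=> ax xb ub Pu; have [xu uT E] := Pu; have au := le_trans ax xu.
  have G := graph_frame (T x) (cT u au ub).
  exists (frame_x f u (T u) l (T x) +i* frame_y f u (T u) l (T x)); split.
    by split=> //; exact: TT.
  move: G; rewrite (chord_dir_mull (cT x ax xb)) E -addrA => /addrI.
  by rewrite mulrBr => ->; rewrite -/(e_ x) -/(e_ u) addrAC subrr add0r.
(* The positions of [T x] relative to [u] and of [T y] relative to [v] are the same complex number:
   both have the modulus of [l - w], and on an arc the modulus singles out one point. Comparing the
   two tails gives the proportion. *)
have ratio x y w u v : a <= x -> x + l <= b -> a <= y -> y + l <= b ->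
    u + l <= b -> v + l <= b -> P x w u -> P y w v -> w != l%:C ->
    e_ u * e_ y = e_ v * e_ x.
  move=> ax xb ay yb ub vb Pu Pv wl.
  have [w1 [P1 E1]] := tail _ _ _ ax xb ub Pu.
  have [w2 [P2 E2]] := tail _ _ _ ay yb vb Pv.
  have [xu uT _] := Pu; have [yv vT _] := Pv.
  have au := le_trans ax xu; have av := le_trans ay yv.
  have M12 : sqmod w1 = sqmod w2.
    have := congr1 (@sqmod R) E1; have := congr1 (@sqmod R) E2.
    rewrite !sqmodM (chord_dir_unit (cT _ au ub)) (chord_dir_unit (cT _ av vb)).
    by rewrite (chord_dir_unit (cT _ ax xb)) (chord_dir_unit (cT _ ay yb)) !mul1r => -> ->.
  have [z Pz] := move1 u v w1 (T x) au ub av vb P1.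
  have zE : z = T y.
    have [vz zT _] := Pz; have [vy yT _] := P2.
    apply: (sqdist_inj sl e0 e1 av vz vy (le_trans zT (Tb v av vb)) (le_trans yT (Tb v av vb))).
    by rewrite (arc_point_dist (cT v av vb) Pz) (arc_point_dist (cT v av vb) P2).
  have w12 : w1 = w2.
    apply: (mulfI (e_n v av vb)); apply: (@addrI _ (graph_point f v)).
    by rewrite -(PE _ _ _ Pz) -(PE _ _ _ P2) zE.
  have w0 : w1 != 0.
    apply/eqP => w0; move/eqP: E1; rewrite w0 mulr0 eq_sym mulf_eq0 (negPf (e_n x ax xb)) /=.
    by rewrite subr_eq0 eq_sym (negPf wl).
  apply: (mulIf w0); rewrite mulrAC E1.
  transitivity (e_ v * w2 * e_ x); first by rewrite E2; ring.
  by rewrite w12; ring.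
have [flat|nflat] := pselect (forall u, s <= u -> u <= T s -> frame_y f s (T s) l u = 0).
  by left.
right.
(* Two parallel chords of length [l] would make the graph affine over the first one and, by
   congruence, over the chord from [s]. *)
have NP v v' : a <= v -> v < v' -> v' + l <= b -> e_ v <> e_ v'.
  move=> av vv' v'b; have vb : v + l <= b by rewrite (le_trans _ v'b) // lerD2r ltW.
  have av' : a <= v' by rewrite (le_trans av) // ltW.
  have ln : l^-1 != 0 by rewrite invr_eq0 gt_eqF.
  case => /(mulIf ln) D1 /(mulIf ln) D2.
  pose D := T v - v; have D0 : 0 < D by have [h _ _] := cT v av vb; rewrite subr_gt0.
  have Tv : T v = v + D by rewrite /D; ring.
  have Tv' : T v' = v' + D by rewrite /D D1; ring.
  have v'D : v' + D <= b by rewrite -Tv' Tb.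
  apply: nflat => u su ut.
  have Ps : P s (frame_x f s (T s) l u +i* frame_y f s (T s) l u) u.
    by split=> //; exact: graph_frame.
  have [u' Pu'] := move1 s v _ u as_ lsb av vb Ps.
  have [vu' uT' _] := Pu'.
  have := arc_point_frame (cT v av vb) Pu'; case=> _ ->.
  rewrite /frame_y; apply/eqP; rewrite mulf_eq0 subr_eq0; apply/orP; left; apply/eqP.
  rewrite Tv in D2 uT' *; rewrite Tv' in D2.
  rewrite -(parallel_chords_flat cf av vv' D0 v'D D2 vu' uT').
  by ring.
(* The walks by [w1] then [w2] and by [w2] then [w1] end at the same point: by [ratio] the chords
   starting at the two end points are parallel, so by [NP] they agree. Each walk takes up to two
   lengths [l] and the last chord a third one, whence [s + 3 * l <= b]. *)
have comm u1 u2 w1 w2 : P s w1 u1 -> P s w2 u2 -> w1 != l%:C -> w2 != l%:C ->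
    w1 * (e_ s - e_ u2) = w2 * (e_ s - e_ u1).
  move=> P1 P2 n1 n2.
  have [su1 ut1 E1] := P1; have [su2 ut2 E2] := P2.
  have Tsl := Tl s as_ lsb.
  have a1 : a <= u1 by exact: le_trans su1.
  have a2 : a <= u2 by exact: le_trans su2.
  have ub1 : u1 + 2 * l <= b by move: ut1 Tsl sb; clear; lra.
  have ub2 : u2 + 2 * l <= b by move: ut2 Tsl sb; clear; lra.
  have b1 : u1 + l <= b by move: ub1 l3; clear; lra.
  have b2 : u2 + l <= b by move: ub2 l3; clear; lra.
  have [v1 Q1] := move1 s u1 w2 u2 as_ lsb a1 b1 P2.
  have [v2 Q2] := move1 s u2 w1 u1 as_ lsb a2 b2 P1.
  have [uv1 vT1 F1] := Q1; have [uv2 vT2 F2] := Q2.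
  have c1 : v1 + l <= b by move: vT1 (Tl u1 a1 b1) ub1; clear; lra.
  have c2 : v2 + l <= b by move: vT2 (Tl u2 a2 b2) ub2; clear; lra.
  have R1 := ratio _ _ _ _ _ a1 b1 as_ lsb c1 b2 Q1 P2 n2.
  have R2 := ratio _ _ _ _ _ a2 b2 as_ lsb c2 b1 Q2 P1 n1.
  have ee : e_ v1 = e_ v2.
    by apply: (mulIf (e_n s as_ lsb)); rewrite R1 R2 mulrC.
  have vv : v1 = v2.
    have [lt|gt|//] := ltgtP v1 v2.
    - by case: (NP v1 v2 (le_trans a1 uv1) lt c2 ee).
    - by case: (NP v2 v1 (le_trans a2 uv2) gt c1 (esym ee)).
  move: F1 F2; rewrite vv E1 E2 -/(e_ s) -/(e_ u1) -/(e_ u2) => -> H.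
  have : e_ s * w1 + e_ u1 * w2 = e_ s * w2 + e_ u2 * w1.
    by apply: (@addrI _ (graph_point f s)); rewrite !addrA.
  move=> H'; apply/eqP; rewrite -subr_eq0; apply/eqP.
  transitivity (e_ s * w1 + e_ u1 * w2 - (e_ s * w2 + e_ u2 * w1)); first by ring.
  by rewrite H' subrr.
have [u2 [su2 ut2 yn]] : exists u2, [/\ s <= u2, u2 <= T s & frame_y f s (T s) l u2 != 0].
  apply: contrapT => N; apply: nflat => u su ut; apply/eqP; apply: contrapT => /negP H.
  by apply: N; exists u.
pose w2 := frame_x f s (T s) l u2 +i* frame_y f s (T s) l u2.
have P2 : P s w2 u2 by split=> //; exact: graph_frame.
have w2l : w2 != l%:C by rewrite eq_complex /= negb_and yn orbT.
have w20 : w2 != 0 by rewrite eq_complex /= negb_and yn orbT.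
have su2' : s < u2.
  rewrite lt_neqAle su2 andbT; apply/eqP => E; move: yn; rewrite -E.
  by have [_ ->] := frame_start f s (T s) l; rewrite eqxx.
have ub2 : u2 + l <= b.
  by have := Tl s as_ lsb; move: ut2 sb l3; clear; lra.
have en : e_ s - e_ u2 != 0.
  by rewrite subr_eq0; apply/eqP; exact: NP.
have esn := e_n s as_ lsb.
pose c := graph_point f s + e_ s * (e_ s * w2) / (e_ s - e_ u2).
exists (complex.Re c), (complex.Im c), (sqmod (w2 / (e_ s - e_ u2))).
have rn : w2 / (e_ s - e_ u2) != 0 by rewrite mulf_neq0 // invr_eq0.
split.
  by rewrite lt_neqAle eq_sym sqmod_eq0 rn /= addr_ge0 // sqr_ge0.
move=> u su ut.
transitivity (sqmod (graph_point f u - c)).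
  by rewrite /sqmod; case: (c) => x y.
pose w := frame_x f s (T s) l u +i* frame_y f s (T s) l u.
have Pu : P s w u by split=> //; [exact: ltW|exact: graph_frame].
have wl : w != l%:C.
  apply/eqP => wE; move: ut; rewrite (_ : u = T s) ?ltxx //; apply: gp_inj.
  by rewrite (PE _ _ _ Pu) wE -/(e_ s) (chord_dir_mull cl).
have ub : u + l <= b.
  by have := Tl s as_ lsb; move: (ltW ut) sb l3; clear; lra.
have C := comm _ _ _ _ Pu P2 wl w2l.
(* Eliminating [w] by [comm] leaves a constant times a product of unit complex numbers. The end
   [u = T s], where [w = l], is out of reach of [ratio], hence the strict inequality. *)
have -> : graph_point f u - c = - (e_ s * e_ u) * (w2 / (e_ s - e_ u2)).
  rewrite /c (PE _ _ _ Pu).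
  have -> : w = w2 * (e_ s - e_ u) / (e_ s - e_ u2) by rewrite -C mulfK.
  by field.
have au := le_trans as_ su.
rewrite sqmodM; have -> : - (e_ s * e_ u) = (-1) * (e_ s * e_ u) by rewrite mulN1r.
rewrite !sqmodM (chord_dir_unit cl) (chord_dir_unit (cT u au ub)) !mulr1.
have -> : sqmod (-1 : R[i]) = 1 by rewrite /sqmod /= oppr0 expr0n sqrrN expr1n addr0.
by rewrite mul1r.
Qed.

Close Scope complex_scope.

(** * Osculating circles *)

(* Near (x0, y0), A is the disk of curvature k, or the half-plane if k = 0, with
   outer normal (n1, n2). *)
Definition osculated (R : realType) (A : R -> R -> Prop) (x0 y0 n1 n2 k : R) :=
  exists2 d, 0 < d & forall x y, `|x - x0| < d -> `|y - y0| < d ->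
    A x y <-> 2 * (n1 * (x - x0) + n2 * (y - y0)) +
              k * ((x - x0) ^+ 2 + (y - y0) ^+ 2) <= 0.

Lemma chord_exists (R : realType) (f : R -> R) (a b m e s l : R) :
  slopes_in f a b (m - e) (m + e) -> 0 <= e -> a <= s -> s + l <= b -> 0 < l ->
  exists t, [/\ chord_length f s t l, t <= s + l & l <= (t - s) * (1 + `|m| + e)].
Proof.
move=> sl e0 as_ sb l0.
have sb' : s <= b by rewrite (le_trans _ sb) // lerDl ltW.
have lb : l ^+ 2 <= sqdist f s b.
  rewrite /sqdist (@le_trans _ _ ((b - s) ^+ 2)) // ?lerDl ?sqr_ge0 //.
  by rewrite ler_sqr ?nnegrE ?(ltW l0) ?subr_ge0 // lerBrDl.
have [t [st tb E]] := sqdist_ivt sl e0 as_ sb' (sqr_ge0 l) lb.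
have st' : s < t.
  rewrite lt_neqAle st andbT; apply/eqP => stE.
  move: E; rewrite -stE /sqdist !subrr !expr0n addr0 => /esym/eqP.
  by rewrite sqrf_eq0 gt_eqF.
exists t; split=> //.
  by rewrite -lerBlDl -ler_sqr ?nnegrE ?subr_ge0 ?(ltW l0) // -E lerDl sqr_ge0.
have N0 : 0 <= `|m| + e by rewrite addr_ge0.
have ft := slopes_lipschitz sl as_ st tb.
have ts0 : 0 <= t - s by rewrite subr_ge0.
have P0 : 0 <= (t - s) * (1 + `|m| + e).
  by rewrite mulr_ge0 // -addrA addr_ge0.
rewrite -ler_sqr ?nnegrE ?(ltW l0) // -E /sqdist.
have fn : (f t - f s) ^+ 2 <= ((`|m| + e) * (t - s)) ^+ 2.
  rewrite -[(f t - f s) ^+ 2]real_normK ?num_real // distrC.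
  by rewrite ler_sqr ?nnegrE ?mulr_ge0.
have : 0 <= (`|m| + e) * (t - s) ^+ 2 by rewrite mulr_ge0 // sqr_ge0.
by move: fn; clear; lra.
Qed.

Lemma chord_length_le (R : realType) (f : R -> R) (a b m e s t l : R) :
  slopes_in f a b (m - e) (m + e) -> 0 <= e -> a <= s -> t <= b ->
  chord_length f s t l -> l <= (t - s) * (1 + `|m| + e).
Proof.
move=> sl e0 as_ tb [st l0 lE].
have N0 : 0 <= `|m| + e by rewrite addr_ge0.
have ft := slopes_lipschitz sl as_ (ltW st) tb.
have ts0 : 0 <= t - s by rewrite subr_ge0 ltW.
have P0 : 0 <= (t - s) * (1 + `|m| + e).
  by rewrite mulr_ge0 // -addrA addr_ge0.
rewrite -ler_sqr ?nnegrE ?(ltW l0) // lE.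
have fn : (f t - f s) ^+ 2 <= ((`|m| + e) * (t - s)) ^+ 2.
  rewrite -[(f t - f s) ^+ 2]real_normK ?num_real // distrC.
  by rewrite ler_sqr ?nnegrE ?mulr_ge0.
have : 0 <= (`|m| + e) * (t - s) ^+ 2 by rewrite mulr_ge0 // sqr_ge0.
by move: fn; clear; lra.
Qed.

Lemma slopes_in_sub (R : realType) (f : R -> R) (a b lo hi a' b' : R) :
  slopes_in f a b lo hi -> a <= a' -> b' <= b -> slopes_in f a' b' lo hi.
Proof.
by move=> sl aa bb x y ax xy yb; apply: sl => //; [exact: le_trans ax|exact: le_trans bb].
Qed.

Lemma concave_sub (R : realType) (f : R -> R) (a b a' b' : R) :
  concave f a b -> a <= a' -> b' <= b -> concave f a' b'.
Proof.
move=> cf aa bb x y z ax xy yz zb.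
by apply: cf => //; [exact: le_trans ax|exact: le_trans bb].
Qed.

Lemma short_chord_exists (R : realType) (B : R -> R -> Prop) g (a b h m : R) :
  flat_chart B g a b h m -> a < b ->
  exists2 l0, 0 < l0 & forall l, 0 < l -> l <= l0 ->
    exists s t, short_chord g a b h m s t l.
Proof.
move=> [ch cB sl] ab; have [h0 _ _] := ch.
pose N := 1 + `|m| + 1 / 16.
have N0 : 0 < N by rewrite /N -addrA ltr_pwDl // addr_ge0 // divr_ge0.
have m0 : h / (2 * N) > 0 by rewrite divr_gt0 // mulr_gt0.
exists (Num.min ((b - a) / 6) (h / (2 * N))).
  by rewrite lt_min m0 divr_gt0 // subr_gt0.
move=> l l0; rewrite le_min => /andP[l1 l2].
have q0 : 0 <= 1 / 16 :> R by rewrite divr_ge0.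
have [||t [cl tl _]] := chord_exists sl q0 (s := (a + b) / 2) (l := l) _ _ l0.
- by clear -ab; lra.
- by clear -l1 l0; lra.
exists ((a + b) / 2), t; split=> //.
- by clear -l1 ab; lra.
- by clear -tl l1; lra.
- by move: l2; rewrite ler_pdivlMr ?mulr_gt0 // -/N; clear; lra.
Qed.

(** Either all short arcs of [A] are symmetric, or some arc of [A], of length [l] say, is not. In
    the second case the chosen arc of [B] of length [l] is not symmetric either, since every
    alternative of [digon_arcs] would pass the symmetry on to [A]; it then serves as the reference
    for all arcs of [A] of that length. *)
Lemma homogeneous_chart (R : realType) (A B : R -> R -> Prop) f g
    (d h m a' b' h' m' : R) :
  symmetric_meets A B -> flat_chart A f (- d) d h m -> 0 < d ->
  flat_chart B g a' b' h' m' -> a' < b' ->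
  exists r l, [/\ 0 < r, r <= d, 0 < l, 4 * l <= r & homogeneous f (- r) r l].
Proof.
move=> sym fA d0 fB ab.
have [l0 l0p Hl] := short_chord_exists fB ab.
have [ch cA sl] := fA; have [h0 _ _] := ch.
have q0 : 0 <= 1 / 16 :> R by rewrite divr_ge0.
have q1 : 1 / 16 <= 1 / 2 :> R by clear; lra.
pose N := 1 + `|m| + 1 / 16.
have N1 : 1 <= N by rewrite /N -addrA lerDl addr_ge0.
have N0 : 0 < N by exact: lt_le_trans N1.
pose L := Num.min (d / 8) (Num.min l0 (h / (2 * N))).
have L0 : 0 < L by rewrite /L !lt_min l0p !divr_gt0 // mulr_gt0.
have Ld : L <= d / 8 by rewrite /L ge_min lexx.
have Ll : L <= l0 by rewrite /L !ge_min lexx orbT.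
have Lh : L <= h / (2 * N) by rewrite /L !ge_min lexx !orbT.
clearbody L.
have short s t l : - (d / 2) <= s -> t <= d / 2 -> chord_length f s t l ->
    l <= L -> short_chord f (- d) d h m s t l.
  move=> ds td cl lL; split=> //.
  - by clear -ds lL Ld d0; lra.
  - by clear -td lL Ld d0; lra.
  - have := le_trans lL Lh; rewrite ler_pdivlMr ?mulr_gt0 // -/N.
    by clear; lra.
have sl2 : slopes_in f (- (d / 2)) (d / 2) (m - 1 / 16) (m + 1 / 16).
  by apply: slopes_in_sub sl _ _; clear -d0; lra.
(* So small that every chord within [-r, r] has length at most [L], hence is short. *)
pose r := L / (2 * N).
have rN : r * (2 * N) = L by rewrite /r divfK // mulf_neq0 // gt_eqF.
have r0 : 0 < r by rewrite divr_gt0 // mulr_gt0.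
clearbody r.
have rL : 2 * r <= L.
  have : 0 <= r * (N - 1) by rewrite mulr_ge0 ?subr_ge0 // ltW.
  by clear -rN; lra.
have rd : r <= d / 2 by clear -rL Ld d0; lra.
have sl1 : slopes_in f (- r) r (m - 1 / 16) (m + 1 / 16).
  by apply: slopes_in_sub sl2 _ _; clear -rd; lra.
have lenL s t l : - r <= s -> t <= r -> chord_length f s t l -> l <= L.
  move=> rs tr cl; have := chord_length_le sl1 q0 rs tr cl; rewrite -/N.
  have : 0 <= (2 * r - (t - s)) * N by rewrite mulr_ge0 ?(ltW N0) //; clear -rs tr; lra.
  by clear -rN; lra.
have [allsym|] := pselect (forall s t l, - r <= s -> t <= r -> chord_length f s t l ->
    arc_symmetric f s t l).
  (* The length is free here; a quarter of the window leaves room for the three successive chords of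
     [homogeneous_circle]. *)
  exists r, (r / 4); split=> //.
  - by clear -rd d0; lra.
  - by rewrite divr_gt0.
  - by clear; lra.
  exact: (homogeneous_of_symmetric sl1 q0 q1 allsym).
move=> nall.
have [s1 [t1 [l [rs1 tr1 cl1 nsym]]]] : exists s t l, [/\ - r <= s, t <= r,
    chord_length f s t l & ~ arc_symmetric f s t l].
  apply: contrapT => N'; apply: nall => s t l rs tr cl; apply: contrapT => n.
  by apply: N'; exists s, t, l.
have lL := lenL _ _ _ rs1 tr1 cl1.
have lp : 0 < l by case: cl1.
have [s' [t' sc']] := Hl l lp (le_trans lL Ll).
have [cl' as' tb' _] := sc'.
have sc1 : short_chord f (- d) d h m s1 t1 l.
  by apply: short cl1 lL; [clear -rs1 rd|clear -tr1 rd]; lra.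
have nsym' : ~ arc_symmetric g s' t' l.
  move=> sg; apply: nsym => X Y.
  case: (digon_arcs sym fA sc1 fB sc') => [[sf _]|H|H] XY; first exact: sf.
  - by apply/H/sg/H.
  - by apply/H/sg/H.
exists (d / 2), l; split=> //.
- by rewrite divr_gt0.
- by clear -d0; lra.
- by clear -lL Ld; lra.
have slg : slopes_in g a' b' (m' - 1 / 16) (m' + 1 / 16) by case: fB.
have as'' : a' <= s' by clear -as' lp; lra.
have tb'' : t' <= b' by clear -tb' lp; lra.
apply: (homogeneous_of_same_arc sl2 slg q0 q1 as'' tb'' cl').
move=> s t ds td cl.
have [[_ /nsym' //]|H|H] := digon_arcs sym fA (short _ _ _ ds td cl lL) fB sc'.
- by left.
- by right.
Qed.

Lemma osculated_graph (R : realType) (A : R -> R -> Prop) f (d h m e : R) :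
  chart A f (- d) d h -> slopes_in f (- d) d (m - e) (m + e) -> 0 <= e ->
  f 0 = 0 -> 0 < d ->
  exists2 r, 0 < r & forall x y, `|x| < r -> `|y| < r ->
    [/\ A x y <-> y <= f x, `|x| <= d & `|f x| <= (`|m| + e) * `|x|].
Proof.
move=> [h0 hf hA] sl e0 f0 d0.
pose N := 1 + `|m| + e.
have N1 : 1 <= N by rewrite /N -addrA lerDl addr_ge0.
have N0 : 0 < N by exact: lt_le_trans N1.
exists (Num.min d (h / (2 * N))).
  by rewrite lt_min d0 divr_gt0 // mulr_gt0.
move=> x y; rewrite !lt_min => /andP[xd xh] /andP[yd yh].
have xd' := xd; rewrite ltr_norml in xd'; case/andP: xd' => x1 x2.
rewrite ltr_pdivlMr ?mulr_gt0 // in xh.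
rewrite ltr_pdivlMr ?mulr_gt0 // in yh.
have fx : `|f x| <= (`|m| + e) * `|x|.
  have [x0|x0] := le_or_lt 0 x.
    rewrite -[f x]subr0 -f0 distrC [`|x|]ger0_norm // -{2}[x]subr0.
    by apply: (slopes_lipschitz sl _ x0 (ltW x2)); rewrite oppr_le0 ltW.
  rewrite -[f x]subr0 -f0 [`|x|]ltr0_norm // -[- x]add0r.
  by apply: (slopes_lipschitz sl (ltW x1) (ltW x0)); rewrite ltW.
split=> //; last exact: ltW.
split=> [Axy|yf]; first by apply: hf => //; exact: ltW.
apply: hA => //; try exact: ltW.
rewrite ler_norml in fx; case/andP: fx => _ fx.
have yn : - y <= `|y| by rewrite -normrN ler_norm.
have : (`|m| + e) * `|x| <= N * `|x| by rewrite ler_wpM2r // /N -addrA lerDr.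
have : `|y| <= N * `|y| by rewrite -{1}[`|y|]mul1r ler_wpM2r.
by clear -fx yn xh yh; lra.
Qed.

Lemma osculated_of_flat_chart (R : realType) (A B : R -> R -> Prop) f g
    (d h m a' b' h' m' : R) :
  symmetric_meets A B -> flat_chart A f (- d) d h m -> 0 < d -> f 0 = 0 ->
  flat_chart B g a' b' h' m' -> a' < b' ->
  exists n1 n2 k, [/\ n1 ^+ 2 + n2 ^+ 2 = 1, 0 <= k & osculated A 0 0 n1 n2 k].
Proof.
move=> sym fA d0 f0 fB ab.
have [r [l [r0 rd l0 lr hom]]] := homogeneous_chart sym fA d0 fB ab.
have [ch cA sl] := fA.
have q0 : 0 <= 1 / 16 :> R by rewrite divr_ge0.
have q1 : 1 / 16 <= 1 / 2 :> R by clear; lra.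
have dr : - d <= - r by rewrite lerN2.
have sl1 := slopes_in_sub sl dr rd.
have cf := concave_sub (chart_concave ch cA) dr rd.
have [w w0 near] := osculated_graph ch sl q0 f0 d0.
pose N := 1 + `|m| + 1 / 16.
have N1 : 1 <= N by rewrite /N -addrA lerDl addr_ge0.
have N0 : 0 < N by exact: lt_le_trans N1.
(* A chord of length [l] is at least [l / N] wide, so one that starts here has 0 strictly between
   its ends, and both sides of 0 are covered. *)
pose s := - (l / (2 * N)).
have sN : s * (2 * N) = - l by rewrite /s mulNr divfK // mulf_neq0 // gt_eqF.
have s0 : s < 0 by rewrite oppr_lt0 divr_gt0 // mulr_gt0.
clearbody s.
have sl2 : - l <= 2 * s.
  have : 0 <= - s * (N - 1) by rewrite mulr_ge0 ?subr_ge0 // oppr_ge0 ltW.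
  by clear -sN; lra.
have rs : - r <= s by clear -sl2 lr r0 l0; lra.
have slr : s + l <= r by clear -s0 lr r0 l0; lra.
have [t [cl tl lt]] := chord_exists sl1 q0 rs slr l0.
have t0 : 0 < t.
  rewrite -(pmulr_lgt0 _ N0); rewrite -/N in lt.
  by clear -lt sN l0; lra.
have slr3 : s + 3 * l <= r by clear -s0 lr r0 l0; lra.
have [flat|[c1 [c2 [q [q0' circ]]]]] := homogeneous_circle sl1 q0 q1 cf hom cl rs slr3.
- pose k := (f t - f s) / (t - s).
  have ts : 0 < t - s by rewrite subr_gt0; exact: lt_trans t0.
  have fE u : s <= u -> u <= t -> f u = k * u.
    have zero v : s <= v -> v <= t -> f v - f s = k * (v - s).
      move=> sv vt; have := flat v sv vt; rewrite /frame_y => /eqP.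
      rewrite mulf_eq0 invr_eq0 (gt_eqF l0) orbF subr_eq0 => /eqP E.
      by apply: (mulfI (lt0r_neq0 ts)); rewrite E /k; field; rewrite gt_eqF.
    move=> su ut; have := zero u su ut; have := zero 0 (ltW s0) (ltW t0).
    by rewrite f0; clear; lra.
  pose z := Num.sqrt (1 + k ^+ 2).
  have z2 : z ^+ 2 = 1 + k ^+ 2 by rewrite sqr_sqrtr // addr_ge0 // sqr_ge0.
  have z0 : 0 < z by rewrite sqrtr_gt0 ltr_pwDl // sqr_ge0.
  exists (- k / z), (1 / z), 0; split=> //.
    have -> : (- k / z) ^+ 2 + (1 / z) ^+ 2 = (1 + k ^+ 2) / z ^+ 2.
      by field; rewrite gt_eqF.
    by rewrite -z2 divff // expf_neq0 // gt_eqF.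
  exists (Num.min w (Num.min (- s) t)); first by rewrite !lt_min w0 t0 oppr_gt0 s0.
  move=> x y; rewrite !subr0 !lt_min => /and3P[xw xs xt] /andP[yw _].
  have [-> _ _] := near x y xw yw.
  rewrite fE; last 2 first.
  - by rewrite ltr_norml in xs; clear -xs; lra.
  - by rewrite ltr_norml in xt; clear -xt; lra.
  rewrite mul0r addr0; have -> : 2 * (- k / z * x + 1 / z * y) = 2 / z * (y - k * x).
    by field; rewrite gt_eqF.
  by rewrite pmulr_rle0 ?divr_gt0 // subr_le0.
have c0 : c1 ^+ 2 + c2 ^+ 2 = q.
  by rewrite -(circ 0 (ltW s0) t0) f0; ring.
(* The centre is below the origin: with [c2 >= 0], the points over [u] and [- u] could not both be
   on the circle, as concavity gives [f u + f (- u) <= 0]. *)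
have c2n : c2 < 0.
  pose u := Num.min (- s) (t / 2).
  have [u1 u2 u0] : [/\ u <= - s, u <= t / 2 & 0 < u].
    by rewrite /u !ge_min !lexx orbT lt_min oppr_gt0 s0 divr_gt0.
  clearbody u.
  have su : s <= - u by clear -u1; lra.
  have tu : u < t by clear -u2 t0; lra.
  have C1 := circ u ltac:(clear -s0 u0; lra) tu.
  have C2 := circ (- u) su ltac:(clear -t0 u0; lra).
  have C3 := cf (- u) 0 u ltac:(clear -rs su; lra) ltac:(clear -u0; lra) (ltW u0)
    ltac:(clear -tu tl slr; lra).
  rewrite f0 in C3.
  have fu : f u + f (- u) <= 0.
    by rewrite -(pmulr_lle0 _ u0); clear -C3; lra.
  rewrite ltNge; apply/negP => c20.
  have : c2 * (f u + f (- u)) <= 0 by rewrite mulr_ge0_le0.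
  have : 0 <= f u * f u by rewrite -expr2 sqr_ge0.
  have : 0 <= f (- u) * f (- u) by rewrite -expr2 sqr_ge0.
  have : 0 < u * u by rewrite mulr_gt0.
  by move: C1 C2; rewrite -c0; clear; lra.
pose z := Num.sqrt q.
have z2 : z ^+ 2 = q by rewrite sqr_sqrtr // ltW.
have z0 : 0 < z by rewrite sqrtr_gt0.
exists (- c1 / z), (- c2 / z), (1 / z); split.
- have -> : (- c1 / z) ^+ 2 + (- c2 / z) ^+ 2 = (c1 ^+ 2 + c2 ^+ 2) / z ^+ 2.
    by field; rewrite gt_eqF.
  by rewrite c0 z2 divff // gt_eqF.
- by rewrite divr_ge0 // ltW.
have M0 : 0 < `|m| + 1 / 16 by have := normr_ge0 m; clear; lra.
(* Small enough that [y] and [f x] both stay above the height of the centre; there, comparing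
   heights amounts to comparing squared distances to the centre. *)
exists (Num.min w (Num.min (Num.min (- s) t) (Num.min (- c2) (- c2 / (`|m| + 1 / 16))))).
  by rewrite !lt_min w0 t0 !oppr_gt0 s0 c2n divr_gt0 // oppr_gt0.
move=> x y; rewrite !subr0 !lt_min => /and3P[xw /andP[xs xt] /andP[_ xc]].
move=> /and3P[yw _ /andP[yc _]].
have [-> _ fx] := near x y xw yw.
rewrite ltr_pdivlMr // in xc.
have fxc : c2 < f x.
  by rewrite ler_norml in fx; clear -fx xc; lra.
have ycc : c2 < y by rewrite ltr_norml in yc; clear -yc; lra.
have E := circ x ltac:(by rewrite ltr_norml in xs; clear -xs; lra)
  ltac:(by rewrite ltr_norml in xt; clear -xt; lra).
have -> : 2 * (- c1 / z * x + - c2 / z * y) + 1 / z * (x ^+ 2 + y ^+ 2) =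
   ((x - c1) ^+ 2 + (y - c2) ^+ 2 - (c1 ^+ 2 + c2 ^+ 2)) / z.
  by field; rewrite gt_eqF.
rewrite pmulr_lle0 ?invr_gt0 // subr_le0 c0 -E lerD2l.
by rewrite ler_sqr ?nnegrE ?subr_ge0 ?(ltW fxc) ?(ltW ycc) // lerD2r.
Qed.

(** * Corners *)

(* M is seen from (x, y) under an angle larger than pi - arctan mu. *)
Definition blunt (R : realType) (M : R -> R -> Prop) (mu x y : R) :=
  exists x1 y1 x2 y2, [/\ M x1 y1, M x2 y2,
    (x1 - x) * (x2 - x) + (y1 - y) * (y2 - y) < 0 &
    ((x1 - x) * (y2 - y) - (y1 - y) * (x2 - x)) ^+ 2 <
    mu ^+ 2 * ((x1 - x) * (x2 - x) + (y1 - y) * (y2 - y)) ^+ 2].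

(** Lagrange's identity expresses the squared cross product through inner products; squaring also
    accommodates orientation reversing maps. *)
Lemma isometry2_cross (R : realType) (fx fy : R -> R -> R) (x y a b a' b' : R) :
  isometry2 fx fy ->
  ((fx a b - fx x y) * (fy a' b' - fy x y) - (fy a b - fy x y) * (fx a' b' - fx x y)) ^+ 2 =
  ((a - x) * (b' - y) - (b - y) * (a' - x)) ^+ 2.
Proof.
move=> iso.
have lagrange (u v w z : R) : (u * z - v * w) ^+ 2 =
    (u * u + v * v) * (w * w + z * z) - (u * w + v * z) ^+ 2 by ring.
by rewrite !lagrange !(isometry2_dot _ _ _ _ _ _ iso).
Qed.

Lemma isometry2_blunt (R : realType) (fx fy : R -> R -> R) (M : R -> R -> Prop) (mu x y : R) :
  isometry2 fx fy -> self_map fx fy M -> blunt M mu (fx x y) (fy x y) -> blunt M mu x y.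
Proof.
move=> iso [_ Mf] [x1 [y1 [x2 [y2 [/Mf[a [b [Mab <- <-]]] /Mf[a' [b' [Mab' <- <-]]]]]]]].
by rewrite isometry2_cross // isometry2_dot // => h1 h2; exists a, b, a', b'.
Qed.

Lemma isometry2_three_points (R : realType) (fx fy : R -> R -> R) (p1 p2 q1 q2 : R) :
  isometry2 fx fy -> p1 * q2 - p2 * q1 != 0 ->
  fx 0 0 = 0 -> fy 0 0 = 0 -> fx p1 p2 = p1 -> fy p1 p2 = p2 ->
  fx q1 q2 = q1 -> fy q1 q2 = q2 -> forall x y, fx x y = x /\ fy x y = y.
Proof.
move=> iso pq h1 h2 h3 h4 h5 h6 x y.
have E1 := @isometry2_dot _ _ _ 0 0 x y p1 p2 iso.
have E2 := @isometry2_dot _ _ _ 0 0 x y q1 q2 iso.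
rewrite h1 h2 h3 h4 !subr0 in E1; rewrite h1 h2 h5 h6 !subr0 in E2.
move: (fx x y) (fy x y) E1 E2 => u v E1 E2.
split; apply: (mulfI pq).
- have : (u * p1 + v * p2) * q2 - (u * q1 + v * q2) * p2 =
    (x * p1 + y * p2) * q2 - (x * q1 + y * q2) * p2 by rewrite E1 E2.
  by clear; lra.
- have : (u * q1 + v * q2) * p1 - (u * p1 + v * p2) * q1 =
    (x * q1 + y * q2) * p1 - (x * p1 + y * p2) * q1 by rewrite E1 E2.
  by clear; lra.
Qed.

(** An isometry preserving [M] permutes its non-blunt points. These are the vertices of a triangle
    with three distinct side lengths, so the permutation is trivial, and three non-collinear fixed
    points force the identity. *)
Lemma scalene_rigid (R : realType) (M : R -> R -> Prop) (mu p1 p2 q1 q2 : R) :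
  M 0 0 -> M p1 p2 -> M q1 q2 ->
  ~ blunt M mu 0 0 -> ~ blunt M mu p1 p2 -> ~ blunt M mu q1 q2 ->
  (forall x y, M x y -> ~ blunt M mu x y ->
    [\/ x = 0 /\ y = 0, x = p1 /\ y = p2 | x = q1 /\ y = q2]) ->
  p1 * q2 - p2 * q1 != 0 ->
  0 < p1 ^+ 2 + p2 ^+ 2 -> p1 ^+ 2 + p2 ^+ 2 < q1 ^+ 2 + q2 ^+ 2 ->
  p1 ^+ 2 + p2 ^+ 2 < (p1 - q1) ^+ 2 + (p2 - q2) ^+ 2 ->
  q1 ^+ 2 + q2 ^+ 2 != (p1 - q1) ^+ 2 + (p2 - q2) ^+ 2 ->
  ~ nontrivially_symmetric M.
Proof.
move=> M0 Mp Mq b0 bp bq cls pq a0 ab ac bc [fx [fy [iso nid sm]]]; apply: nid.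
have [fM _] := sm.
have vert x y : M x y -> ~ blunt M mu x y ->
    [\/ fx x y = 0 /\ fy x y = 0, fx x y = p1 /\ fy x y = p2 | fx x y = q1 /\ fy x y = q2].
  by move=> Mxy nb; apply: cls; [exact: fM|move=> /(isometry2_blunt iso sm)].
have D1 := iso 0 0 p1 p2; have D2 := iso 0 0 q1 q2; have D3 := iso p1 p2 q1 q2.
rewrite !sub0r !sqrrN in D1 D2.
move/eqP: bc => bc.
(* Of the 27 assignments of images to the vertices, only the trivial one is compatible with the
   three distances. *)
have [E0|E0] : (fx 0 0 = 0 /\ fy 0 0 = 0 /\ fx p1 p2 = p1 /\ fy p1 p2 = p2 /\
    fx q1 q2 = q1 /\ fy q1 q2 = q2) \/ False; last by [].
  case: (vert _ _ M0 b0) => -[e1 e2]; case: (vert _ _ Mp bp) => -[e3 e4];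
  case: (vert _ _ Mq bq) => -[e5 e6];
  rewrite e1 e2 e3 e4 in D1; rewrite e1 e2 e5 e6 in D2; rewrite e3 e4 e5 e6 in D3;
  first [by left|right; apply: bc; move: a0 ab ac D1 D2 D3; clear; lra].
by case: E0 => [e1 [e2 [e3 [e4 [e5 e6]]]]]; exact: (isometry2_three_points iso pq).
Qed.

(** A cone of slope [S] has half-angle arctan S. For [S > 1] the supplement of its full angle has
    tangent [2 * S / (S ^+ 2 - 1) > 2 / S >= mu]; for [S <= 1] no obtuse angle occurs. The sign [sg]
    tells to which side the cone opens. *)
Lemma cone_sharp (R : realType) (M : R -> R -> Prop) (mu S sg x0 y0 : R) :
  sg ^+ 2 = 1 -> 0 < S -> 0 <= mu -> mu * S <= 2 ->
  (forall x y, M x y -> `|y - y0| <= S * (sg * (x - x0))) -> ~ blunt M mu x0 y0.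
Proof.
move=> sg2 S0 mu0 muS cone [x1 [y1 [x2 [y2 [M1 M2]]]]].
move: (cone _ _ M1) (cone _ _ M2).
move: (x1 - x0) (x2 - x0) (y1 - y0) (y2 - y0) => a a' b b'.
have -> : a * a' + b * b' = (sg * a) * (sg * a') + b * b'.
  by rewrite -[a * a']mul1r -sg2; ring.
have -> : (a * b' - b * a') ^+ 2 = ((sg * a) * b' - b * (sg * a')) ^+ 2.
  by rewrite -[LHS]mul1r -sg2; ring.
move: (sg * a) (sg * a') => A A' h1 h2.
have A0 : 0 <= A by rewrite -(pmulr_rge0 _ S0) (le_trans _ h1).
have A0' : 0 <= A' by rewrite -(pmulr_rge0 _ S0) (le_trans _ h2).
move=> dot; rewrite ltNge => /negP; apply.
have bb : `|b * b'| <= S * A * (S * A') by rewrite normrM ler_pM.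
rewrite ler_norml in bb; case/andP: bb => bb _.
set D := - (A * A' + b * b').
have D0 : 0 <= D by rewrite oppr_ge0 ltW.
have DS : D <= S ^+ 2 * (A * A').
  have : 0 <= A * A' by rewrite mulr_ge0.
  by rewrite /D; clear -bb; lra.
have muS2 : (mu * S) ^+ 2 <= 2 ^+ 2 by rewrite ler_sqr ?nnegrE // mulr_ge0 // ltW.
have h3 : mu ^+ 2 * D * D <= mu ^+ 2 * D * (S ^+ 2 * (A * A')).
  by rewrite ler_wpM2l // mulr_ge0 // sqr_ge0.
have h4 : (mu * S) ^+ 2 * (A * A' * D) <= 2 ^+ 2 * (A * A' * D).
  by rewrite ler_wpM2r // !mulr_ge0.
have h5 : 0 <= (A * b' + b * A') ^+ 2 by rewrite sqr_ge0.
have h6 : 0 <= (A * A') ^+ 2 by rewrite sqr_ge0.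
by move: h3 h4 h5 h6; rewrite /D; clear; lra.
Qed.

(** The wedge misses a straight angle by the angle between its sides, whose tangent is
    [(be - al) / (1 + al * be)] when the denominator is positive; otherwise the aperture is at most
    a right angle. The depths [p], [q] below the two sides serve as oblique coordinates. *)
Lemma wedge_sharp (R : realType) (M : R -> R -> Prop) (mu al be : R) :
  al < be -> 0 <= mu -> mu * (1 + al * be) <= be - al ->
  (forall x y, M x y -> y <= al * x /\ y <= be * x) -> ~ blunt M mu 0 0.
Proof.
move=> ab mu0 muab wedge [x1 [y1 [x2 [y2 [/wedge[P1 Q1] /wedge[P2 Q2]]]]]].
rewrite !subr0.
pose D := be - al; have D0 : 0 < D by rewrite subr_gt0.
pose p := al * x1 - y1; pose q := be * x1 - y1.
pose p' := al * x2 - y2; pose q' := be * x2 - y2.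
have [p0 q0] : 0 <= p /\ 0 <= q by rewrite !subr_ge0.
have [p0' q0'] : 0 <= p' /\ 0 <= q' by rewrite !subr_ge0.
have crossE : D * (x1 * y2 - y1 * x2) = p * q' - q * p'.
  by rewrite /D /p /q /p' /q'; ring.
pose W := q * q' * (1 + al ^+ 2) + p * p' * (1 + be ^+ 2).
have dotE : D ^+ 2 * (x1 * x2 + y1 * y2) = W - (q * p' + p * q') * (1 + al * be).
  by rewrite /W /D /p /q /p' /q'; ring.
move=> dot; rewrite ltNge => /negP; apply.
have [k0|k0] := le_or_lt (1 + al * be) 0.
  have H : 0 <= D ^+ 2 * (x1 * x2 + y1 * y2).
    rewrite dotE subr_ge0 (@le_trans _ _ 0) //.
      by rewrite mulr_ge0_le0 // addr_ge0 // mulr_ge0.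
    by rewrite /W !addr_ge0 // !mulr_ge0 // addr_ge0 // sqr_ge0.
  by move: dot; rewrite ltNge -(pmulr_rge0 _ (exprn_gt0 2 D0)) H.
pose a := p * q'; pose b := q * p'.
have [a0 b0] : 0 <= a /\ 0 <= b by split; exact: mulr_ge0.
(* Writing [a + b = |a - b| + 2 * n], the first term is the cross product up to the factor [D], and
   the second is absorbed by [W] through the inequality of arithmetic and geometric means. *)
pose n := Num.min a b.
have n0 : 0 <= n by rewrite /n le_min a0 b0.
have nn : n ^+ 2 <= a * b by rewrite expr2 ler_pM // /n ge_min lexx ?orbT.
have W0 : 0 <= W by rewrite /W addr_ge0 // !mulr_ge0 // addr_ge0 // sqr_ge0.
have Wn : 2 * (1 + al * be) * n <= W.
  rewrite -ler_sqr ?nnegrE //; last by rewrite mulr_ge0 // mulr_ge0 // ltW.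
  have h1 : (1 + al * be) ^+ 2 * n ^+ 2 <= (1 + al * be) ^+ 2 * (a * b).
    by rewrite ler_wpM2l // sqr_ge0.
  have h2 : 0 <= (al - be) ^+ 2 * (a * b) by rewrite mulr_ge0 ?sqr_ge0 // mulr_ge0.
  have h3 : 0 <= (q * q' * (1 + al ^+ 2) - p * p' * (1 + be ^+ 2)) ^+ 2 by rewrite sqr_ge0.
  by move: h1 h2 h3; rewrite /W /a /b; clear; lra.
have key : - (D ^+ 2 * (x1 * x2 + y1 * y2)) <= (1 + al * be) * `|a - b|.
  rewrite dotE -/a -/b.
  suff : (1 + al * be) * (a + b) <= (1 + al * be) * `|a - b| + 2 * (1 + al * be) * n.
    by move: Wn; clear; lra.
  have -> : a + b = `|a - b| + 2 * n.
    rewrite /n; have [ab'|ba'] := le_or_lt a b.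
      by rewrite min_l // ler0_norm ?subr_le0 //; ring.
    by rewrite min_r ?(ltW ba') // ger0_norm ?subr_ge0 ?(ltW ba') //; ring.
  by rewrite mulrDr; clear; lra.
have E : `|a - b| = D * `|x1 * y2 - y1 * x2|.
  by rewrite /a /b -crossE normrM (gtr0_norm D0).
rewrite E in key.
have key2 : D * - (x1 * x2 + y1 * y2) <= (1 + al * be) * `|x1 * y2 - y1 * x2|.
  by rewrite -(ler_pM2l D0); move: key; clear; lra.
have key3 : mu * - (x1 * x2 + y1 * y2) <= `|x1 * y2 - y1 * x2|.
  rewrite -(ler_pM2l k0) (le_trans _ key2) // mulrA ler_wpM2r ?oppr_ge0 ?(ltW dot) //.
  by rewrite mulrC.
rewrite -[X in _ <= X]real_normK ?num_real //.
rewrite -(sqrrN (x1 * x2 + _)) -exprMn ler_sqr ?nnegrE //.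
by rewrite mulr_ge0 // oppr_ge0 ltW.
Qed.

(** In units of the product of the two widths, the cross product is at most [2 * e] and the inner
    product at least 3/4 in absolute value; the quotient [8 * e / 3] is below [mu]. *)
Lemma bulge_blunt (R : realType) (M : R -> R -> Prop) (mu m e x y x1 y1 x2 y2 : R) :
  0 <= e -> e <= 1 / 2 -> 8 * e < 3 * mu -> M x1 y1 -> M x2 y2 -> x1 < x -> x < x2 ->
  (m - e) * (x - x1) <= y - y1 -> y - y1 <= (m + e) * (x - x1) ->
  (m - e) * (x2 - x) <= y2 - y -> y2 - y <= (m + e) * (x2 - x) ->
  blunt M mu x y.
Proof.
move=> e0 e1 emu M1 M2 xx1 xx2 h1 h2 h3 h4.
exists x1, y1, x2, y2.
have d1 : 0 < x - x1 by rewrite subr_gt0.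
have d2 : 0 < x2 - x by rewrite subr_gt0.
have D := slopes_dot e0 e1 (ltW d1) (ltW d2) h1 h2 h3 h4.
move: (x - x1) (x2 - x) (y - y1) (y2 - y) (opprB x x1) (opprB y y1) d1 d2 D h1 h2 h3 h4.
move=> a a' b b' <- <- a0 a0' D h1 h2 h3 h4.
have P0 : 0 < a * a' by rewrite mulr_gt0.
split=> //; first by clear -D P0; lra.
have -> : - a * a' + - b * b' = - (a * a' + b * b') by ring.
rewrite sqrrN -exprMn -[X in X < _]real_normK ?num_real //.
have mu0 : 0 < mu by clear -emu e0; lra.
have c1 : `|- a * b' - - b * a'| <= 2 * e * (a * a').
  have k1 : 0 <= (b' - (m - e) * a') * a by rewrite mulr_ge0 ?subr_ge0 // ltW.
  have k2 : 0 <= ((m + e) * a' - b') * a by rewrite mulr_ge0 ?subr_ge0 // ltW.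
  have k3 : 0 <= (b - (m - e) * a) * a' by rewrite mulr_ge0 ?subr_ge0 // ltW.
  have k4 : 0 <= ((m + e) * a - b) * a' by rewrite mulr_ge0 ?subr_ge0 // ltW.
  by rewrite ler_norml; apply/andP; split; clear -k1 k2 k3 k4; lra.
have c2 : mu * (3 / 4 * (a * a')) <= mu * (a * a' + b * b') by rewrite ler_wpM2l // ltW.
have c3 : 8 * e * (a * a') < 3 * mu * (a * a') by rewrite ltr_pM2r.
have c4 : `|- a * b' - - b * a'| < mu * (a * a' + b * b') by clear -c1 c2 c3; lra.
by rewrite ltr_sqr ?nnegrE // (le_trans _ (ltW c4)).
Qed.

Lemma vertical_blunt (R : realType) (M : R -> R -> Prop) (mu x y y1 y2 : R) :
  0 < mu -> M x y1 -> M x y2 -> y1 < y -> y < y2 -> blunt M mu x y.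
Proof.
move=> mu0 M1 M2 h1 h2; exists x, y1, x, y2.
have d : 0 < (y - y1) * (y2 - y) by rewrite mulr_gt0 // subr_gt0.
split=> //; rewrite subrr !(mulr0, mul0r, oppr0, addr0, add0r).
  by rewrite -(opprB y y1) mulNr oppr_lt0.
rewrite expr0n /= mulr_gt0 //; first exact: exprn_gt0.
by rewrite exprn_even_gt0 //= -(opprB y y1) mulNr oppr_eq0 gt_eqF.
Qed.

(** The base point of the chart may itself be a corner of [B]. Chords are therefore taken to its
    right, from [r / 2] on, where the slopes are close to the right derivative. One [rho] serves all
    short lengths, so that a chord of [B] can be matched to a chord of [A] chosen later. *)
Lemma framed_chord_exists (R : realType) (B : R -> R -> Prop) g (d h e : R) :
  chart B g (- d) d h -> pconvex B -> 0 < d -> g 0 = 0 -> 0 < e -> e <= 1 / 2 ->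
  exists2 rho, 0 < rho & forall l, 0 < l -> l <= rho ->
    exists s t, chord_length g s t l /\ framed (in_frame g s t l B) l (4 * e) rho.
Proof.
move=> ch cB d0 g0 e0 e1.
have [al [be [_ _ _ slopes]]] := concave_slopes d0 (chart_concave ch cB) g0.
have [r [r0 rd sl _]] := slopes e e0.
have sl' : slopes_in g 0 r (al - e) (al + e).
  move=> x y x0 xy yr; have [h1 h2] := sl x y x0 xy yr; split=> //.
  have : 0 <= e * (y - x) by rewrite mulr_ge0 ?subr_ge0 // ltW.
  by clear -h2; lra.
have [h0 hf hB] := ch.
have ch' : chart B g 0 r h.
  by split=> // x y x0 xr; [apply: hf|apply: hB]; clear -x0 xr rd d0; lra.
pose N := 1 + `|al| + e.
have N0 : 0 < N by rewrite /N -addrA ltr_pwDl // addr_ge0 // ltW.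
exists (Num.min (r / 8) (h / (2 * N))).
  by rewrite lt_min !divr_gt0 // mulr_gt0.
set rho := Num.min _ _.
have [rr rh r0'] : [/\ rho <= r / 8, rho <= h / (2 * N) & 0 < rho].
  by rewrite /rho !ge_min !lexx orbT lt_min !divr_gt0 // mulr_gt0.
clearbody rho => l l0 lr.
have [||t [cl tl _]] := chord_exists sl' (ltW e0) (s := r / 2) (l := l) _ _ l0.
- by clear -r0; lra.
- by clear -lr rr r0; lra.
exists (r / 2), t; split=> //; have [st _ lE] := cl.
apply: (framed_of_chart ch' cB sl' (ltW e0) e1 st l0 lE r0').
- by clear -rr r0; lra.
- by clear -rr r0 tl lr; lra.
- by move: rh; rewrite ler_pdivlMr ?mulr_gt0 // -/N; clear; lra.
Qed.

(* Otherwise the bisector of the points at 0 and s would meet the nearly straight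
   right branch twice, at two parameters t and 2t. *)
Lemma corner_scalene (R : realType) (f : R -> R) (al e S s r : R) :
  slopes_in f 0 r (al - e) al -> f 0 = 0 -> 0 < e -> s < 0 ->
  4 * (1 + S) * e < 1 -> 8 * (1 + S) * - s <= r -> 0 <= S ->
  exists t, [/\ 4 * (1 + S) * - s <= t, t <= 8 * (1 + S) * - s &
    sqdist f 0 t != sqdist f s t].
Proof.
move=> sl f0 e0 s0 Se rS S0; set V := 1 + S in Se rS *.
have V0 : 0 < V by rewrite ltr_pwDl.
(* Long compared with [- s], so that the side from 0 to the point at [s] will be the shortest, yet
   short enough that the deviation [t * e] of the branch from a line stays below [- s]. *)
pose t := 4 * V * - s.
have t0 : 0 < t by rewrite !mulr_gt0 // oppr_gt0.
have [E1|] := eqVneq (sqdist f 0 t) (sqdist f s t); last first.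
  move=> n; exists t; split=> //; rewrite -/t.
  by have -> : 8 * V * - s = 2 * t by [rewrite /t; ring]; clear -t0; lra.
have [E2|n] := eqVneq (sqdist f 0 (2 * t)) (sqdist f s (2 * t)); last first.
  by exists (2 * t); split=> //; rewrite /t; [move: t0; rewrite /t; clear; lra|apply/eqP/eqP; clear; lra].
exfalso.
have [h1 h2] := sl 0 t (lexx _) (ltW t0) ltac:(move: rS t0; rewrite /t; clear; lra).
have [h3 h4] := sl t (2 * t) (ltW t0) ltac:(clear -t0; lra) ltac:(move: rS; rewrite /t; clear; lra).
rewrite f0 !subr0 in h1 h2.
have te : t * e < - s.
  have : - s * (4 * V * e) < - s * 1 by rewrite ltr_pM2l // oppr_gt0.
  by rewrite /t; clear; lra.
clearbody t; clear rS Se V0 V.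
move: E1 E2; rewrite /sqdist f0 !subr0 => E1 E2.
(* The bend of the branch between [t] and [2 * t]. The two equidistances force
   [s ^+ 2 + f s ^+ 2 = - (2 * f s * D)], which is incompatible with [|D| < - s]. *)
pose D := f (2 * t) - 2 * f t.
have DE : - (t * e) <= D /\ D <= t * e by rewrite /D; clear -h1 h2 h3 h4; lra.
have K : s ^+ 2 + f s ^+ 2 = - (2 * f s * D).
  by move: E1 E2; rewrite /D; clear; lra.
have B : `|f s * D| <= `|f s| * (t * e).
  by rewrite normrM ler_wpM2l // ler_norml; clear -DE; lra.
have K2 : s ^+ 2 + f s ^+ 2 <= 2 * (`|f s| * (t * e)).
  by rewrite ler_norml in B; rewrite K; clear -B; lra.
have K3 : `|f s| * (t * e) <= `|f s| * - s by rewrite ler_wpM2l // ltW.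
have sq : f s ^+ 2 = `|f s| ^+ 2 by rewrite real_normK ?num_real.
have K4 : 0 <= (`|f s| + s) ^+ 2 by rewrite sqr_ge0.
have K5 : (`|f s| + s) ^+ 2 = 0.
  by apply: le_anti; rewrite K4 andbT; move: K2 K3; rewrite sq; clear; lra.
have K6 : `|f s| = - s.
  by move/eqP: K5; rewrite sqrf_eq0 addr_eq0 => /eqP.
rewrite sq K6 in K2.
have : - s * (t * e) < - s * - s by rewrite ltr_pM2l // oppr_gt0.
by clear -K2; lra.
Qed.

Lemma corner_slopes (R : realType) (f : R -> R) (al be e r s t : R) :
  slopes_in f 0 r (al - e) al -> slopes_in f (- r) 0 be (be + e) -> f 0 = 0 ->
  al < be -> 0 < e -> - r <= s -> s < 0 -> 0 < t -> t <= r ->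
  (forall x, s <= x -> x <= t ->
    f x - f s <= (be + e) * (x - s) /\ (al - e) * (t - x) <= f t - f x) /\
  (f t - f s) * (0 - s) < (0 - f s) * (t - s).
Proof.
move=> slr sll f0 ab e0 rs s0 t0 tr; split.
- move=> x sx xt; have [x0|x0] := le_or_lt x 0.
    have [_ h1] := sll s x rs sx x0.
    have [h2 _] := sll x 0 (le_trans rs sx) x0 (lexx _).
    have [h3 _] := slr 0 t (lexx _) (ltW t0) tr.
    rewrite f0 in h2 h3; split=> //.
    have : 0 <= (be - al + e) * - x by rewrite mulr_ge0 ?oppr_ge0 //; clear -ab e0; lra.
    by clear -h2 h3; lra.
  have [_ h1] := slr 0 x (lexx _) (ltW x0) (le_trans xt tr).
  have [_ h2] := sll s 0 rs (ltW s0) (lexx _).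
  have [h3 _] := slr x t (ltW x0) xt tr.
  rewrite f0 in h1 h2; split=> //.
  have : 0 <= (be - al + e) * x by rewrite mulr_ge0 ?(ltW x0) //; clear -ab e0; lra.
  by clear -h1 h2; lra.
- have [h1 _] := sll s 0 rs (ltW s0) (lexx _).
  have [_ h2] := slr 0 t (lexx _) (ltW t0) tr.
  rewrite f0 in h1 h2.
  have k1 : 0 <= (- f s - be * - s) * t by rewrite mulr_ge0 ?(ltW t0) //; clear -h1; lra.
  have k2 : 0 <= (al * t - f t) * - s by rewrite mulr_ge0 ?oppr_ge0 ?(ltW s0) //; clear -h2; lra.
  have k3 : 0 < (be - al) * (- s * t) by rewrite !mulr_gt0 ?subr_gt0 ?oppr_gt0.
  by clear -k1 k2 k3; lra.
Qed.

(** A steep cap may lean backwards over the end of its chord, so that the progress [c * dx + g * dy]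
    along the chord is negative. The condition [eps * S <= 1 / 2] still keeps it inside the region
    where the other set is complete. *)
Lemma cap_fits (R : realType) (c g k S eps dx dy : R) :
  0 < c -> g = k * c -> c ^+ 2 + g ^+ 2 = 1 -> `|k| <= S -> 0 <= eps ->
  eps * S <= 1 / 2 -> 0 <= dx -> k * dx <= dy -> dy <= S * dx ->
  [/\ 0 <= c * dy - g * dx, - (c * dy - g * dx) <= eps * (c * dx + g * dy),
    `|c * dx + g * dy| <= (1 + S) * dx & `|c * dy - g * dx| <= (1 + S) * dx].
Proof.
move=> c0 gE cg kS eps0 epsS d0 h1 h2.
have S0 : 0 <= S by exact: le_trans kS.
have c1 : `|c| <= 1 by rewrite ler_norml; clear -cg; nra.
have g1 : `|g| <= 1 by rewrite ler_norml; clear -cg; nra.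
have kn := ler_norm k; have kn' := ler_norm (- k); rewrite normrN in kn'.
have Y0 : 0 <= dy - k * dx by rewrite subr_ge0.
have YE : c * dy - g * dx = c * (dy - k * dx) by rewrite gE; ring.
have XE : c * dx + g * dy = c * (dx + k * dy) by rewrite gE; ring.
have dyS : `|dy| <= S * dx.
  rewrite ler_norml h2 andbT.
  have : 0 <= (S + k) * dx by rewrite mulr_ge0 //; clear -kS kn'; lra.
  by clear -h1; lra.
have bound u v w z : `|u| <= 1 -> `|v| <= 1 -> `|w| <= dx -> `|z| <= S * dx ->
    `|u * w + v * z| <= (1 + S) * dx.
  move=> u1 v1 wd zd; rewrite (le_trans (ler_normD _ _)) // !normrM.
  have : `|u| * `|w| <= 1 * dx by rewrite ler_pM.
  have : `|v| * `|z| <= 1 * (S * dx) by rewrite ler_pM.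
  by clear; lra.
split.
- by rewrite YE mulr_ge0 // ltW.
- rewrite XE YE -subr_ge0.
  have -> : eps * (c * (dx + k * dy)) - - (c * (dy - k * dx)) =
     c * ((dy - k * dx) + eps * (dx + k * dy)) by ring.
  rewrite mulr_ge0 ?(ltW c0) //.
  have [X0|X0] := le_or_lt 0 (dx + k * dy); first by rewrite addr_ge0 // mulr_ge0.
  have kd : k * dy < 0 by clear -X0 d0; lra.
  have [k0|k0] := le_or_lt 0 k.
    have dy0 : 0 <= dy by rewrite (le_trans _ h1) // mulr_ge0.
    by move: kd; rewrite ltNge mulr_ge0.
  have dy0 : 0 < dy by rewrite -(nmulr_rlt0 _ k0).
  have e1 : 0 <= eps * (S + k) * dy.
    by rewrite mulr_ge0 ?(ltW dy0) // mulr_ge0 //; clear -kS kn'; lra.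
  have e2 : eps * S * dy <= 1 / 2 * dy by rewrite ler_wpM2r // ltW.
  have e3 : 0 <= eps * dx by rewrite mulr_ge0.
  have e4 : 0 <= - k * dx by rewrite mulr_ge0 // oppr_ge0 ltW.
  by clear -e1 e2 e3 e4 dy0; lra.
- by apply: bound => //; rewrite ger0_norm.
- rewrite addrC -mulNr addrC; rewrite [c * dy + _]addrC.
  by apply: bound; rewrite ?normrN // ger0_norm.
Qed.

(** A cone of slope [eps] around the chord, read in the original axes, is contained in a cone of
    slope [2 * S + 2] with horizontal axis, the form required by [cone_sharp]. *)
Lemma lower_cone (R : realType) (c k S eps X Y : R) :
  0 < c -> `|k| <= S -> 0 <= eps -> eps <= 1 / 2 -> eps * S <= 1 / 2 -> 0 < X ->
  `|Y| <= eps * X ->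
  0 < c * (X - k * Y) /\ `|c * (k * X + Y)| <= (2 * S + 2) * (c * (X - k * Y)).
Proof.
move=> c0 kS eps0 eps1 epsS X0 YX.
have S0 : 0 <= S by exact: le_trans kS.
have kY : `|k * Y| <= S * (eps * X) by rewrite normrM ler_pM.
have h1 : eps * S * X <= 1 / 2 * X by rewrite ler_wpM2r // ltW.
have h2 : eps * X <= 1 / 2 * X by rewrite ler_wpM2r // ltW.
have h3 : 1 / 2 * X <= X - k * Y.
  by rewrite ler_norml in kY; clear -kY h1; lra.
have D0 : 0 < X - k * Y by clear -h3 X0; lra.
split; first by rewrite mulr_gt0.
rewrite normrM (gtr0_norm c0) mulrCA ler_pM2l //.
rewrite (le_trans (ler_normD _ _)) // normrM (gtr0_norm X0).
have h4 : `|k| * X <= S * X by rewrite ler_wpM2r // ltW.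
have h5 : (2 * S + 2) * (1 / 2 * X) <= (2 * S + 2) * (X - k * Y).
  by rewrite ler_wpM2l //; clear -S0; lra.
have h6 : 0 <= S * X by rewrite mulr_ge0 // ltW.
by clear -h2 h4 h5 h6 YX X0; lra.
Qed.

(** The two ends of the chord suffice as witnesses: in the frame of the chord the inner product is
    [- (X * (l - X) - Y ^+ 2)] and the cross product is [l * Y]. *)
Lemma chord_blunt (R : realType) (M : R -> R -> Prop) (mu c g l eps s1 s2 x y : R) :
  c ^+ 2 + g ^+ 2 = 1 -> 0 < l -> 0 <= eps -> eps <= 1 / 4 -> 2 * eps < 3 / 4 * mu ->
  M s1 s2 -> M (s1 + c * l) (s2 + g * l) ->
  let X := c * (x - s1) + g * (y - s2) in
  let Y := c * (y - s2) - g * (x - s1) in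
  0 < X -> X < l -> `|Y| <= eps * X -> `|Y| <= eps * (l - X) ->
  blunt M mu x y.
Proof.
move=> cg l0 eps0 eps1 epsmu Ms Mt X Y X0 Xl YX YlX.
have xE : s1 - x = - (c * X - g * Y).
  by rewrite -[LHS]mul1r -cg /X /Y; ring.
have yE : s2 - y = - (g * X + c * Y).
  by rewrite -[LHS]mul1r -cg /X /Y; ring.
exists s1, s2, (s1 + c * l), (s2 + g * l).
have -> : s1 + c * l - x = c * (l - X) + g * Y.
  by rewrite addrAC xE; ring.
have -> : s2 + g * l - y = g * (l - X) - c * Y.
  by rewrite addrAC yE; ring.
rewrite xE yE; clearbody X Y; clear xE yE.
have -> : - (c * X - g * Y) * (c * (l - X) + g * Y) +
  - (g * X + c * Y) * (g * (l - X) - c * Y) = - (X * (l - X) - Y ^+ 2).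
  by rewrite -[RHS]mul1r -cg; ring.
have -> : - (c * X - g * Y) * (g * (l - X) - c * Y) -
  - (g * X + c * Y) * (c * (l - X) + g * Y) = l * Y.
  by rewrite -[RHS]mul1r -cg; ring.
have lX : 0 < l - X by rewrite subr_gt0.
have P0 : 0 < X * (l - X) by rewrite mulr_gt0.
have Y2 : Y ^+ 2 <= 1 / 4 * (X * (l - X)).
  rewrite -[Y ^+ 2]real_normK ?num_real //.
  have : `|Y| * `|Y| <= eps * X * (eps * (l - X)) by rewrite ler_pM.
  have : eps * eps * (X * (l - X)) <= 1 / 4 * 1 * (X * (l - X)).
    by rewrite ler_wpM2r ?(ltW P0) // ler_pM //; clear -eps1; lra.
  by clear; lra.
split=> //; first by clear -P0 Y2; lra.
rewrite sqrrN -exprMn -[(l * Y) ^+ 2]real_normK ?num_real //.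
have mu0 : 0 < mu by clear -epsmu eps0; lra.
have h1 : `|l * Y| <= 2 * eps * (X * (l - X)).
  rewrite normrM (gtr0_norm l0).
  have k1 : `|Y| * X <= eps * (l - X) * X by rewrite ler_wpM2r // ltW.
  have k2 : `|Y| * (l - X) <= eps * X * (l - X) by rewrite ler_wpM2r // ltW.
  by clear -k1 k2; lra.
have h2 : 2 * eps * (X * (l - X)) < 3 / 4 * mu * (X * (l - X)) by rewrite ltr_pM2r.
have h3 : mu * Y ^+ 2 <= mu * (1 / 4 * (X * (l - X))) by rewrite ler_wpM2l // ltW.
have h4 : `|l * Y| < mu * (X * (l - X) - Y ^+ 2) by clear -h1 h2 h3; lra.
by rewrite ltr_sqr ?nnegrE // (le_trans _ (ltW h4)).
Qed.

(** The meet is the tip of [A] cut off by a chord from the left to the right branch, together with a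
    thin cap below the chord. Its non-blunt points are the corner and the ends of the chord: the two
    branches are nearly straight, and the other points see the ends of the chord or of a vertical
    segment under an almost straight angle. [B0] enters through its thinness below the chord and its
    inclusion of the tip. *)
Lemma corner_asymmetric (R : realType) (A B0 : R -> R -> Prop) f
    (d h al be e r S mu s t l eps : R) :
  let k := (f t - f s) / (t - s) in let c := (t - s) / l in let g := (f t - f s) / l in
  let X x y := c * (x - s) + g * (y - f s) in
  let Y x y := c * (y - f s) - g * (x - s) in
  chart A f (- d) d h -> pconvex A -> f 0 = 0 -> r <= d ->
  slopes_in f 0 r (al - e) al -> slopes_in f (- r) 0 be (be + e) ->
  al < be -> 0 < e -> e <= 1 / 2 -> - r <= s -> s < 0 -> 0 < t -> t <= r ->
  0 < mu -> mu * (1 + al * be) <= be - al -> mu * (2 * S + 2) <= 2 ->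
  8 * e < 3 * mu -> 2 * eps < 3 / 4 * mu -> 0 <= eps -> eps <= 1 / 4 ->
  eps * S <= 1 / 2 -> `|al - e| <= S -> `|al| <= S -> `|be| <= S -> `|be + e| <= S ->
  4 * (1 + S) * - s <= t -> sqdist f 0 t != sqdist f s t ->
  chord_length f s t l ->
  (forall x y, B0 x y -> Y x y < 0 -> [/\ 0 < X x y, X x y < l,
     - Y x y <= eps * X x y & - Y x y <= eps * (l - X x y)]) ->
  (forall x y, s <= x -> x <= t -> 0 <= Y x y -> - Y x y <= eps * X x y ->
     - Y x y <= eps * (l - X x y) -> `|X x y| <= (1 + S) * (x - s) ->
     `|Y x y| <= (1 + S) * (x - s) -> B0 x y) ->
  ~ nontrivially_symmetric (fun x y => A x y /\ B0 x y) /\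
  [/\ A 0 0 /\ B0 0 0, A s (f s) /\ B0 s (f s) & A t (f t) /\ B0 t (f t)].
Proof.
move=> k c g X Y ch cA f0 rd slr sll ab e0 e1 rs s0 t0 tr mu0 muab muS emu epsmu eps0 eps1.
move=> epsS S1 S2 S3 S4 ts sne cl BY Bcap.
have cvx := chart_concave ch cA.
have [_ hf _] := ch.
have [cs above0] := corner_slopes slr sll f0 ab e0 rs s0 t0 tr.
have [st l0 lE] := cl.
have ts0 : 0 < t - s by rewrite subr_gt0.
have tsn : t - s != 0 by rewrite gt_eqF.
have ln : l != 0 by rewrite gt_eqF.
have ds : - d <= s by clear -rs rd; lra.
have td : t <= d by clear -tr rd; lra.
have c0 : 0 < c by rewrite divr_gt0.
have cg : c ^+ 2 + g ^+ 2 = 1 by exact: (frame_unit cl).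
have gE : g = k * c by rewrite /g /k /c; field; rewrite ln tsn.
have cl' : c * l = t - s by rewrite /c divfK.
have gl' : g * l = f t - f s by rewrite /g divfK.
have kE : k * (t - s) = f t - f s by rewrite /k divfK.
have S0 : 0 <= S by exact: le_trans S1.
rewrite !ler_norml in S1 S2 S3 S4.
have fup x : s <= x -> x <= t -> f x - f s <= S * (x - s).
  move=> sx xt; have [h1 _] := cs x sx xt; rewrite (le_trans h1) //.
  by rewrite ler_wpM2r ?subr_ge0 //; case/andP: S4.
have flo x : s <= x -> x <= t -> - (S * (t - x)) <= f t - f x.
  move=> sx xt; have [_ h1] := cs x sx xt; rewrite (le_trans _ h1) // -mulNr.
  by rewrite ler_wpM2r ?subr_ge0 //; case/andP: S1.
have kS : `|k| <= S.
  rewrite ler_norml; apply/andP; split; rewrite -(ler_pM2r ts0) kE ?mulNr.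
  - exact: (flo s (lexx _) (ltW st)).
  - exact: (fup t (ltW st) (lexx _)).
have XE x y : X x y = c * (x - s) + g * (y - f s) by [].
have YE x y : Y x y = c * (y - f s) - g * (x - s) by [].
have YE' x y : Y x y = c * ((y - f s) - k * (x - s)) by rewrite YE gE; ring.
have lX x y : l - X x y = c * (t - x) + g * (f t - y).
  have -> : l = c * (c * l) + g * (g * l) by rewrite -[LHS]mul1r -cg; ring.
  by rewrite cl' gl' XE; ring.
have YE2 x y : Y x y = c * (k * (t - x) - (f t - y)).
  by rewrite YE' -[f t](subrK (f s)) -kE; ring.
clearbody X Y k; clear lE.
have onA x : s <= x -> x <= t -> A x (f x).
  by move=> sx xt; apply: (chart_on_graph ch); [exact: le_trans sx|exact: le_trans td].
pose M x y := A x y /\ B0 x y.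
have capM x y : s <= x -> x <= t -> k * (x - s) <= y - f s -> y <= f x -> M x y.
  move=> sx xt ky yf; split.
    apply: (convex_vertical cA (convex_segment cA (onA s _ _) (onA t _ _) st sx xt) (onA x sx xt) _ yf).
    - by [].
    - exact: ltW.
    - exact: ltW.
    - by [].
    have -> : (f t - f s) / (t - s) = k by rewrite -kE mulfK.
    by rewrite -lerBrDl.
  have yS : y - f s <= S * (x - s).
    by rewrite (le_trans _ (fup x sx xt)) // lerD2r.
  have sx' : 0 <= x - s by rewrite subr_ge0.
  have [y0 y1 y2 y3] := cap_fits c0 gE cg kS eps0 epsS sx' ky yS.
  have xt' : 0 <= t - x by rewrite subr_ge0.
  have ky' : - k * (t - x) <= - (f t - y).
    have : k * (t - s) = k * (t - x) + k * (x - s) by ring.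
    by rewrite kE; clear -ky; lra.
  have yS' : - (f t - y) <= S * (t - x).
    by have := flo x sx xt; clear -yf; lra.
  have cgN : c ^+ 2 + (- g) ^+ 2 = 1 by rewrite sqrrN.
  have gEN : - g = - k * c by rewrite gE mulNr.
  have kSN : `|- k| <= S by rewrite normrN.
  have [z0 z1 _ _] := cap_fits c0 gEN cgN kSN eps0 epsS xt' ky' yS'.
  apply: Bcap => //; rewrite ?XE ?YE -?XE -?YE //.
  - by rewrite YE.
  - by rewrite YE XE.
  - rewrite lX YE2.
    move: z1; rewrite gE; have -> : c * - (f t - y) - - (k * c) * (t - x) =
      c * (k * (t - x) - (f t - y)) by ring.
    by rewrite mulrNN.
  - by rewrite XE.
  - by rewrite YE.
have key0 : - (k * s) < - f s.
  by rewrite -(ltr_pM2r ts0); move: above0; rewrite -kE; clear; lra.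
have M0 : M 0 0.
  by apply: capM; rewrite ?(ltW s0) ?(ltW t0) ?f0 // !sub0r mulrN ltW.
have Ms : M s (f s) by apply: capM; rewrite ?subrr ?mulr0 // ltW.
have Mt : M t (f t) by apply: capM; rewrite ?kE // ltW.
have cls x y : M x y -> 0 <= Y x y -> [/\ s <= x, x <= t, k * (x - s) <= y - f s & y <= f x].
  move=> [Axy _]; rewrite YE' pmulr_rge0 // subr_ge0 => ky.
  have [kE'|kn] := eqVneq (k * (x - s)) (y - f s).
    have E : (f t - f s) * (x - s) = (y - f s) * (t - s) by rewrite -kE -kE'; ring.
    have [h1 h2] := chart_on_chord ch cA ds st td M0.1 above0 Axy E.
    by split=> //; apply: hf => //; [exact: le_trans h1|exact: le_trans td].
  have lt : (f t - f s) * (x - s) < (y - f s) * (t - s).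
    by rewrite -kE mulrAC ltr_pM2r // lt_neqAle kn.
  by have [h1 h2 h3] := chart_above_chord ch cA ds st td Axy lt; split=> //; exact: ltW.
have coneX x y : M x y -> [/\ s <= x, x <= t, `|y - f s| <= (2 * S + 2) * (x - s) &
    `|y - f t| <= (2 * S + 2) * (t - x)].
  move=> Mxy; have [Y0|Y0] := le_or_lt 0 (Y x y).
    have [sx xt ky yf] := cls x y Mxy Y0.
    have sx' : 0 <= x - s by rewrite subr_ge0.
    have xt' : 0 <= t - x by rewrite subr_ge0.
    have h1 := fup x sx xt; have h2 := flo x sx xt.
    have h3 : 0 <= (S + k) * (x - s).
      by rewrite mulr_ge0 // -lerBlDl sub0r; rewrite ler_norml in kS; case/andP: kS.
    have h4 : 0 <= (S - k) * (t - x).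
      by rewrite mulr_ge0 // subr_ge0; rewrite ler_norml in kS; case/andP: kS.
    have h5 : k * (t - s) = k * (t - x) + k * (x - s) by ring.
    have h6 : 0 <= S * (x - s) by rewrite mulr_ge0.
    have h7 : 0 <= S * (t - x) by rewrite mulr_ge0.
    split=> //; rewrite ler_norml; apply/andP; split.
    - by clear -ky h3 h6 sx'; lra.
    - by clear -yf h1 h6 sx'; lra.
    - by clear -kE h5 ky h4 h7 xt'; lra.
    - by clear -yf h2 h7 xt'; lra.
  have [Axy Bxy] := Mxy; have [X0 Xl y1 y2] := BY x y Bxy Y0.
  have eps2 : eps <= 1 / 2 by clear -eps1; lra.
  have lX0 : 0 < l - X x y by rewrite subr_gt0.
  have ny : `|Y x y| = - Y x y by rewrite ltr0_norm.
  have ny1 : `|Y x y| <= eps * X x y by rewrite ny.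
  have ny2 : `|Y x y| <= eps * (l - X x y) by rewrite ny.
  have [d1 d2] := lower_cone c0 kS eps0 eps2 epsS X0 ny1.
  have kSN : `|- k| <= S by rewrite normrN.
  have [d3 d4] := lower_cone c0 kSN eps0 eps2 epsS lX0 ny2.
  have E1 : x - s = c * (X x y - k * Y x y).
    transitivity ((c ^+ 2 + g ^+ 2) * (x - s)); first by rewrite cg mul1r.
    have -> : c * (X x y - k * Y x y) = c * X x y - (k * c) * Y x y by ring.
    by rewrite -gE XE YE; ring.
  have E2 : y - f s = c * (k * X x y + Y x y).
    transitivity ((c ^+ 2 + g ^+ 2) * (y - f s)); first by rewrite cg mul1r.
    have -> : c * (k * X x y + Y x y) = (k * c) * X x y + c * Y x y by ring.
    by rewrite -gE XE YE; ring.
  have E3 : t - x = c * (l - X x y - - k * Y x y).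
    have -> : t - x = (t - s) - (x - s) by ring.
    rewrite E1 -cl'; ring.
  have E4 : y - f t = c * (- k * (l - X x y) + Y x y).
    have -> : y - f t = (y - f s) - (f t - f s) by ring.
    by rewrite E2 -gl' gE; ring.
  by rewrite E1 E2 E3 E4; split=> //; rewrite -subr_ge0 ?E1 ?E3 ltW.
have wedge x y : M x y -> y <= al * x /\ y <= be * x.
  move=> Mxy; have [sx xt _ _] := coneX x y Mxy; have [Axy _] := Mxy.
  have yf : y <= f x by apply: hf => //; [exact: le_trans sx|exact: le_trans td].
  have [x0|x0] := le_or_lt x 0.
    have [h1 _] := sll x 0 (le_trans rs sx) x0 (lexx _); rewrite f0 in h1.
    have : 0 <= (be - al) * - x by rewrite mulr_ge0 ?oppr_ge0 // subr_ge0 ltW.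
    by clear -h1 yf; move=> ?; split; lra.
  have [_ h1] := slr 0 x (lexx _) (ltW x0) (le_trans xt tr); rewrite f0 in h1.
  have : 0 <= (be - al) * x by rewrite mulr_ge0 ?(ltW x0) // subr_ge0 ltW.
  by clear -h1 yf; move=> ?; split; lra.
have Mt' : M (s + c * l) (f s + g * l).
  by rewrite cl' gl' !(addrC _ (_ - _)) !subrK.
have cb x y : 0 < X x y -> X x y < l -> `|Y x y| <= eps * X x y ->
    `|Y x y| <= eps * (l - X x y) -> blunt M mu x y.
  rewrite XE YE; exact: (chord_blunt cg l0 eps0 eps1 epsmu Ms Mt').
split; last by split.
(* The side from the corner to the point at [s] is the shortest, thanks to
   [4 * (1 + S) * - s <= t]. *)
have pt : s ^+ 2 + f s ^+ 2 < t ^+ 2.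
  have [b1 b2] := sll s 0 rs (ltW s0) (lexx _); rewrite f0 !sub0r in b1 b2.
  have ns : 0 < - s by rewrite oppr_gt0.
  have k1 : 0 <= (be + S) * - s.
    by rewrite mulr_ge0 ?(ltW ns) //; case/andP: S3; clear; lra.
  have k2 : 0 <= (S - (be + e)) * - s.
    by rewrite mulr_ge0 ?(ltW ns) // subr_ge0; case/andP: S4.
  have fsS : f s ^+ 2 <= (S * - s) ^+ 2.
    rewrite -[f s ^+ 2]real_normK ?num_real // ler_sqr ?nnegrE //; last first.
      by rewrite mulr_ge0 // ltW.
    by rewrite ler_norml; clear -b1 b2 k1 k2; lra.
  have tt : (4 * (1 + S) * - s) ^+ 2 <= t ^+ 2.
    by rewrite ler_sqr ?nnegrE ?(ltW t0) // !mulr_ge0 ?(ltW ns) ?addr_ge0.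
  have h1 : 0 < s ^+ 2 by rewrite exprn_even_gt0 //= lt_eqF.
  have h2 : 0 <= S * s ^+ 2 by rewrite mulr_ge0 // ltW.
  have h3 : 0 <= (S * s) ^+ 2 by rewrite sqr_ge0.
  by clear -fsS tt h1 h2 h3; lra.
apply: (@scalene_rigid R M mu s (f s) t (f t)) => //.
- exact: (wedge_sharp ab (ltW mu0) muab wedge).
- apply: (@cone_sharp R M mu (2 * S + 2) 1 s (f s)); rewrite ?expr1n ?(ltW mu0) //.
    by clear -S0; lra.
  by move=> x y /coneX[_ _ ? _]; rewrite mul1r.
- apply: (@cone_sharp R M mu (2 * S + 2) (-1) t (f t)); rewrite ?sqrrN ?expr1n ?(ltW mu0) //.
    by clear -S0; lra.
  by move=> x y /coneX[_ _ _ ?]; rewrite mulN1r opprB.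
- move=> x y Mxy nb; have [Y0|Y0] := le_or_lt 0 (Y x y); last first.
    have [_ Bxy] := Mxy; have [X0 Xl y1 y2] := BY x y Bxy Y0.
    by case: nb; apply: cb => //; rewrite ltr0_norm.
  have [sx xt ky yf] := cls x y Mxy Y0.
  have [xs|xs] := eqVneq x s.
    constructor 2; split=> //; apply: le_anti; move: ky yf.
    by rewrite xs subrr mulr0 subr_ge0 => -> ->.
  have [xtE|xtn] := eqVneq x t.
    constructor 3; split=> //; apply: le_anti; move: ky yf.
    by rewrite xtE kE lerD2r => -> ->.
  have sx' : s < x by rewrite lt_neqAle eq_sym xs.
  have xt' : x < t by rewrite lt_neqAle xtn.
  have [Y00|Yn] := eqVneq (Y x y) 0.
    have yE : y - f s = k * (x - s).
      by move/eqP: Y00; rewrite YE' mulf_eq0 (gt_eqF c0) subr_eq0 => /eqP.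
    have q0 : 0 < 1 + k ^+ 2 by rewrite ltr_pwDl // sqr_ge0.
    have XX : X x y = c * (1 + k ^+ 2) * (x - s) by rewrite XE yE gE; ring.
    have lXX : l - X x y = c * (1 + k ^+ 2) * (t - x).
      have -> : l = c * (c * l) + g * (g * l) by rewrite -[LHS]mul1r -cg; ring.
      by rewrite cl' gl' -kE XX gE; ring.
    have X0 : 0 < X x y by rewrite XX; apply: mulr_gt0; [exact: mulr_gt0|rewrite subr_gt0].
    have X1 : 0 < l - X x y by rewrite lXX; apply: mulr_gt0; [exact: mulr_gt0|rewrite subr_gt0].
    case: nb; apply: cb; rewrite ?Y00 ?normr0; [exact: X0|by rewrite -subr_gt0|..].
    - by apply: mulr_ge0 => //; exact: ltW.
    - by apply: mulr_ge0 => //; exact: ltW.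
  have Yp : k * (x - s) < y - f s.
    have : 0 < Y x y by rewrite lt_neqAle eq_sym Yn.
    by rewrite YE' pmulr_rgt0 // subr_gt0.
  have Mlow : M x (f s + k * (x - s)).
    apply: capM => //; first by rewrite addrC addKr addrC addrK || (rewrite addrAC subrr add0r).
    by rewrite (le_trans _ yf) // -lerBrDl ltW.
  have lowy : f s + k * (x - s) < y by rewrite -ltrBrDl.
  have vert y2 : y < y2 -> y2 <= f x -> blunt M mu x y.
    move=> yy2 y2f; apply: (vertical_blunt mu0 Mlow _ lowy yy2).
    by apply: capM => //; rewrite (le_trans (ltW Yp)) // lerD2r ltW.
  have [x0|xn] := eqVneq x 0.
    have [y0|yn] := eqVneq y 0; first by constructor 1.
    have y0 : y < 0 by rewrite lt_neqAle yn -f0 -x0.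
    by case: nb; apply: (vert 0) => //; rewrite x0 f0.
  have m2 : 8 * e < 3 * mu by [].
  have [x0|x0] := le_or_lt x 0.
    have x0' : x < 0 by rewrite lt_neqAle xn.
    (* Height over [x] of the segment from the end of the chord to the corner. Below it a vertical
       segment extends beyond the point; between it and the graph both slopes are close enough to
       [be]. *)
    pose q := f s / s * x.
    have sn : s != 0 by rewrite lt_eqF.
    have qs : f s / s * s = f s by rewrite divfK.
    have [b1 b2] := sll s 0 rs (ltW s0) (lexx _); rewrite f0 !sub0r in b1 b2.
    have ns : 0 < - s by rewrite oppr_gt0.
    have qsn : f s / s * - s = - f s by rewrite mulrN qs.
    have qb : be <= f s / s /\ f s / s <= be + e.
      by split; rewrite -(ler_pM2r ns) qsn.
    have [yq|yq] := le_or_lt q y; last first.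
      case: nb; apply: (vert q) => //.
      have := cvx s x 0 ds sx (ltW x0') ltac:(clear -td t0; lra).
      rewrite f0 !sub0r => H.
      suff : q * - s <= f x * - s by rewrite ler_pM2r.
      by rewrite /q mulrAC qsn; move: H; clear; lra.
    case: nb; apply: (bulge_blunt (ltW e0) e1 m2 Ms M0 sx' x0' (m := be)).
    - have : q - f s = f s / s * (x - s) by rewrite /q mulrBr qs.
      have : 0 <= (f s / s - be) * (x - s) by rewrite mulr_ge0 ?subr_ge0 //; case: qb.
      have : 0 <= e * (x - s) by rewrite mulr_ge0 ?subr_ge0 // ltW.
      by clear -yq; lra.
    - have [_ h1] := sll s x rs sx x0; clear -h1 yf; lra.
    - have [h1 _] := sll x 0 (le_trans rs sx) x0 (lexx _); rewrite f0 in h1.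
      have : 0 <= e * (0 - x) by rewrite mulr_ge0 ?subr_ge0 // ltW.
      by clear -h1 yf; lra.
    - have : 0 <= (be + e - f s / s) * (0 - x) by rewrite mulr_ge0 ?subr_ge0 //; case: qb.
      by rewrite /q in yq; clear -yq; lra.
  pose q := f t / t * x.
  have tn : t != 0 by rewrite gt_eqF.
  have qt : f t / t * t = f t by rewrite divfK.
  have [b1 b2] := slr 0 t (lexx _) (ltW t0) tr; rewrite f0 !subr0 in b1 b2.
  have qb : al - e <= f t / t /\ f t / t <= al.
    by split; rewrite -(ler_pM2r t0) qt.
  have [yq|yq] := le_or_lt q y; last first.
    case: nb; apply: (vert q) => //.
    have := cvx 0 x t ltac:(clear -ds s0; lra) (ltW x0) (ltW xt') td.
    rewrite f0 !subr0 => H.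
    by rewrite -(ler_pM2r t0) /q mulrAC qt.
  case: nb; apply: (bulge_blunt (ltW e0) e1 m2 M0 Mt x0 xt' (m := al)).
  - have : 0 <= (f t / t - (al - e)) * x by rewrite mulr_ge0 ?(ltW x0) // subr_ge0; case: qb.
    by rewrite /q in yq; clear -yq; lra.
  - have [_ h1] := slr 0 x (lexx _) (ltW x0) (le_trans xt tr); rewrite f0 in h1.
    have : 0 <= e * x by rewrite mulr_ge0 // ltW.
    by clear -h1 yf; lra.
  - have [h1 _] := slr x t (ltW x0) (ltW xt') tr; clear -h1 yf; lra.
  - have : f t - q = f t / t * (t - x) by rewrite /q mulrBr qt.
    have : 0 <= (al - f t / t) * (t - x) by rewrite mulr_ge0 ?subr_ge0 //; case: qb.
    have : 0 <= e * (t - x) by rewrite mulr_ge0 ?subr_ge0 // ltW.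
    by clear -yq; lra.
- by rewrite gt_eqF // subr_gt0; move: above0; clear; lra.
- by rewrite ltr_pwDl ?sqr_ge0 // exprn_even_gt0 //= lt_eqF.
- by apply: (lt_le_trans pt); rewrite lerDl sqr_ge0.
- apply: (lt_le_trans pt).
  have : 0 <= (f s - f t) ^+ 2 by rewrite sqr_ge0.
  have : 0 <= - s * t by rewrite mulr_ge0 ?(ltW t0) // oppr_ge0 ltW.
  have : 0 <= s ^+ 2 by rewrite sqr_ge0.
  by clear; lra.
- move: sne; rewrite /sqdist f0 !subr0.
  by have -> : (s - t) ^+ 2 + (f s - f t) ^+ 2 = (t - s) ^+ 2 + (f t - f s) ^+ 2 by ring.
Qed.

(** A chord of [B] is laid across a corner of [A], at a scale at which the whole tip lies where [B]
    is complete. The constants are fixed in the order [S], [mu], [e], [rho], [sg], with [S] bounding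
    all slopes involved. *)
Lemma no_corner (R : realType) (A B : R -> R -> Prop) f g (d h d' h' al be : R) :
  symmetric_meets A B ->
  chart A f (- d) d h -> pconvex A -> 0 < d -> f 0 = 0 ->
  chart B g (- d') d' h' -> pconvex B -> 0 < d' -> g 0 = 0 ->
  (forall e, 0 < e -> exists r, [/\ 0 < r, r <= d,
     slopes_in f 0 r (al - e) al & slopes_in f (- r) 0 be (be + e)]) ->
  be <= al.
Proof.
move=> sym chA cA d0 f0 chB cB d0' g0 slopes.
have [//|ab] := le_or_lt be al; exfalso.
pose S := `|al| + `|be| + 1.
have S1 : 1 <= S by rewrite /S lerDr addr_ge0.
have S0 : 0 < S by exact: lt_le_trans S1.
have alS : `|al| + 1 <= S by rewrite /S -addrA lerD2l lerDr.
have beS : `|be| + 1 <= S by rewrite /S lerD2r lerDr.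
clearbody S.
have S20 : 0 < 1 + S ^+ 2 by rewrite ltr_pwDl // sqr_ge0.
have S10 : 0 < 1 + S by rewrite addr_gt0.
(* The first bound keeps the corner from being blunt, the second the two ends of the chord, which
   see the set in cones of slope [2 * S + 2]. *)
pose mu := Num.min ((be - al) / (1 + S ^+ 2)) (2 / (2 * S + 2)).
have SS0 : 0 < 2 * S + 2 by clear -S0; lra.
have mu0 : 0 < mu by rewrite lt_min !divr_gt0 // subr_gt0.
have mu1 : mu * (1 + S ^+ 2) <= be - al by rewrite -ler_pdivlMr // ge_min lexx.
have mu2 : mu * (2 * S + 2) <= 2 by rewrite -ler_pdivlMr // ge_min lexx orbT.
clearbody mu.
have muab : mu * (1 + al * be) <= be - al.
  rewrite (le_trans _ mu1) // ler_wpM2l ?(ltW mu0) // lerD2l.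
  rewrite (le_trans (ler_norm _)) // normrM expr2 ler_pM //.
  - by clear -alS; lra.
  - by clear -beS; lra.
(* The first bound makes branch points and points near the chord blunt, with [eps = 4 * e]. The
   second gives [4 * (1 + S) * e < 1], [4 * e * S <= 1 / 2] and, as [S >= 1], [e <= 1 / 16]. *)
pose e := Num.min (mu / 16) (1 / (8 * (1 + S))).
have e0 : 0 < e by rewrite lt_min !divr_gt0 // mulr_gt0.
have e1 : e <= mu / 16 by rewrite ge_min lexx.
have e2 : e * (8 * (1 + S)) <= 1 by rewrite -ler_pdivlMr ?mulr_gt0 // ge_min lexx orbT.
clearbody e.
have eS : 0 < e * S by rewrite mulr_gt0.
have e3 : e <= 1 / 16.
  have : 0 <= e * (S - 1) by rewrite mulr_ge0 ?(ltW e0) // subr_ge0.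
  by clear -e2; lra.
have [r [r0 rd slr sll]] := slopes e e0.
have e12 : e <= 1 / 2 by clear -e3; lra.
have [rho rho0 HB] := framed_chord_exists chB cB d0' g0 e0 e12.
(* The first bound puts [t] inside the window. The second yields [(1 + S) * (t - s) <= rho / 2],
   since [t - s <= 9 * (1 + S) * sg]. *)
pose sg := Num.min (r / (8 * (1 + S))) (rho / (18 * (1 + S) ^+ 2)).
have S12 : 0 < (1 + S) ^+ 2 by rewrite exprn_gt0.
have sg0 : 0 < sg by rewrite lt_min !divr_gt0 // mulr_gt0.
have sg1 : 8 * (1 + S) * sg <= r by rewrite mulrC -ler_pdivlMr ?mulr_gt0 // ge_min lexx.
have sg2 : 18 * (1 + S) ^+ 2 * sg <= rho.
  by rewrite mulrC -ler_pdivlMr ?mulr_gt0 // ge_min lexx orbT.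
clearbody sg.
pose s := - sg.
have s0 : s < 0 by rewrite oppr_lt0.
have sgE : sg = - s by rewrite /s opprK.
clearbody s; rewrite sgE in sg0 sg1 sg2; clear sgE sg.
have Ss : 0 <= S * - s by rewrite mulr_ge0 ?ltW.
have Se : 4 * (1 + S) * e < 1 by clear -e2 e0 eS; lra.
have [t [t1 t2 sne]] := corner_scalene slr f0 e0 s0 Se sg1 (ltW S0).
have t0 : 0 < t.
  by rewrite (lt_le_trans _ t1) // !mulr_gt0.
have tr : t <= r by exact: le_trans sg1.
have rs : - r <= s by clear -sg1 s0 Ss; lra.
have st : s < t by exact: lt_trans t0.
have ts0 : 0 < t - s by rewrite subr_gt0.
have [cs above0] := corner_slopes slr sll f0 ab e0 rs s0 t0 tr.
have nS : [/\ `|al - e| <= S, `|al| <= S, `|be| <= S & `|be + e| <= S].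
  have k1 := ler_normD al (- e); have k2 := ler_normD be e.
  rewrite normrN (gtr0_norm e0) in k1; rewrite (gtr0_norm e0) in k2.
  by split; clear -k1 k2 alS beS e3; lra.
have [n1 n2 n3 n4] := nS.
pose l := Num.sqrt (sqdist f s t).
have q0 : 0 < sqdist f s t.
  by rewrite /sqdist ltr_pwDl ?sqr_ge0 // exprn_even_gt0 //= subr_eq0 gt_eqF.
have l2 : l ^+ 2 = sqdist f s t by rewrite sqr_sqrtr // ltW.
have l0 : 0 < l by rewrite sqrtr_gt0.
have cl : chord_length f s t l by [].
clearbody l.
have lr2 : l <= rho / 2.
  have fts : `|f t - f s| <= S * (t - s).
    have [h1 _] := cs t (ltW st) (lexx _); have [_ h2] := cs s (lexx _) (ltW st).
    rewrite !ler_norml in n1 n4; case/andP: n1 => n1 _; case/andP: n4 => _ n4.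
    have k1 : 0 <= (S - (be + e)) * (t - s) by rewrite mulr_ge0 ?(ltW ts0) // subr_ge0.
    have k2 : 0 <= (al - e + S) * (t - s).
      by rewrite mulr_ge0 ?(ltW ts0) //; clear -n1; lra.
    by rewrite ler_norml; clear -h1 h2 k1 k2; lra.
  have : l <= (1 + S) * (t - s).
    have P0 : 0 <= (1 + S) * (t - s) by rewrite mulr_ge0 // ltW.
    rewrite -ler_sqr ?nnegrE ?(ltW l0) // l2 /sqdist.
    have : (f t - f s) ^+ 2 <= (S * (t - s)) ^+ 2.
      by rewrite -[X in X <= _]real_normK ?num_real // ler_sqr ?nnegrE // mulr_ge0 ?ltW.
    have : 0 <= S * (t - s) ^+ 2 by rewrite mulr_ge0 ?sqr_ge0 // ltW.
    by clear; lra.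
  have : (1 + S) * (t - s) <= (1 + S) * (9 * (1 + S) * - s).
    by rewrite ler_wpM2l ?(ltW S10) //; clear -t2 Ss; lra.
  by clear -sg2; lra.
have lr : l <= rho by clear -lr2 rho0; lra.
have [s' [t' [clB frB]]] := HB l l0 lr.
set B' := in_frame g s' t' l B in frB.
pose c := (t - s) / l; pose gg := (f t - f s) / l.
have cg : c ^+ 2 + gg ^+ 2 = 1 by exact: (frame_unit cl).
(* The framed copy of [B], half-turned and carried to the chord of [A]. *)
pose B0 := rigid c (- gg) (- (c * s + gg * f s)) (gg * s - c * f s) (rigid (-1) 0 l 0 B').
pose X x y := c * (x - s) + gg * (y - f s).
pose Y x y := c * (y - f s) - gg * (x - s).
have B0E x y : B0 x y = B' (l - X x y) (- Y x y).
  by rewrite /B0 /rigid /X /Y; congr (B' _ _); ring.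
have eps0 : 0 <= 4 * e by clear -e0; lra.
have eps1 : 4 * e <= 1 / 4 by clear -e3; lra.
have [f1 f2 f3] := frB.
have [] := @corner_asymmetric R A B0 f d h al be e r S mu s t l (4 * e) chA cA f0 rd
  slr sll ab e0 e12 rs s0 t0 tr mu0 muab mu2 ltac:(clear -e1 mu0; lra)
  ltac:(clear -e1 mu0; lra) eps0 eps1 ltac:(clear -e2 e0 eS; lra) n1 n2 n3 n4 t1 sne cl.
- rewrite -/c -/gg => x y; rewrite -/(X x y) -/(Y x y) B0E => BXY Y0.
  have [|h1 h2 h3 h4] := f1 _ _ BXY; first by rewrite oppr_gt0.
  by rewrite subKr in h4; split=> //; clear -h1 h2; lra.
- rewrite -/c -/gg => x y sx xt; rewrite -/(X x y) -/(Y x y) B0E => Y0 h1 h2 h3 h4.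
  have xr : (1 + S) * (x - s) <= rho / 2.
    have : (1 + S) * (x - s) <= (1 + S) * (9 * (1 + S) * - s).
      by rewrite ler_wpM2l ?(ltW S10) //; clear -t2 Ss xt; lra.
    by clear -sg2; lra.
  have {}h3 := le_trans h3 xr; have {}h4 := le_trans h4 xr.
  rewrite !ler_norml in h3 h4; case/andP: h3 => h3 h3'; case/andP: h4 => h4 h4'.
  apply: f2 => //; rewrite ?subKr //.
  - by clear -h3' l0 rho0; lra.
  - by clear -h3 lr2; lra.
  - by clear -h4' rho0; lra.
  - by rewrite oppr_le0.
move=> nsym [[A0 B00] [As Bs] [At Bt]]; apply: nsym.
have B0R : exists c1 s1 u1 v1, c1 ^+ 2 + s1 ^+ 2 = 1 /\ B0 = rigid c1 s1 u1 v1 B.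
  rewrite /B0 /B' /in_frame !rigid_comp.
  have := frame_unit clB; set cb := (t' - s') / l; set gb := (g t' - g s') / l => cgb.
  do 4 eexists; split; last by reflexivity.
  transitivity ((c ^+ 2 + gg ^+ 2) * (cb ^+ 2 + gb ^+ 2)); first by ring.
  by rewrite cg cgb mul1r.
have [c1 [s1 [u1 [v1 [cs1 BE]]]]] := B0R.
have c10 : (1 : R) ^+ 2 + 0 ^+ 2 = 1 by rewrite expr1n expr0n addr0.
have AE : rigid 1 0 0 0 A = A.
  by apply/funext => x; apply/funext => y; rewrite /rigid; congr (A _ _); ring.
have := sym 1 0 0 0 c1 s1 u1 v1 c10 cs1; rewrite AE -BE; apply.
pose M x y := A x y /\ B0 x y; rewrite -/M.
have cM : pconvex M.
  move=> x y x' y' q q0' q1 [Ax Bx] [Ax' Bx']; split; first exact: cA.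
  by rewrite BE in Bx Bx' *; exact: (rigid_convex cB).
have lnn : l != 0 by rewrite gt_eqF.
have cl1 : c * l = t - s by rewrite /c divfK.
have gl1 : gg * l = f t - f s by rewrite /gg divfK.
have [||||x [y iM]] := @convex_triangle_interior R (rigid c gg s (f s) M) l
  (- (c * s + gg * f s)) (gg * s - c * f s) (rigid_convex cM) l0.
- have : 0 < l * (gg * s - c * f s).
    have -> : l * (gg * s - c * f s) = gg * l * s - c * l * f s by ring.
    by rewrite cl1 gl1; move: above0; clear; lra.
  by rewrite pmulr_rgt0 // => h0; rewrite gt_eqF.
- by rewrite /rigid !mulr0 subrr !add0r; split.
- rewrite /rigid !mulr0 subr0 addr0 cl1 gl1.
  by rewrite !subrK; split.
- rewrite /rigid.
  have -> : c * - (c * s + gg * f s) - gg * (gg * s - c * f s) + s = (1 - (c ^+ 2 + gg ^+ 2)) * s by ring.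
  have -> : gg * - (c * s + gg * f s) + c * (gg * s - c * f s) + f s = (1 - (c ^+ 2 + gg ^+ 2)) * f s by ring.
  by rewrite cg subrr !mul0r; split.
by exists (c * x - gg * y + s), (gg * x + c * y + f s); exact: (rigid_interior_inv cg iM).
Qed.

(** * Osculation at every boundary point *)

Lemma symmetric_meets_rigid (R : realType) (A B : R -> R -> Prop) c s u v c' s' u' v' :
  c ^+ 2 + s ^+ 2 = 1 -> c' ^+ 2 + s' ^+ 2 = 1 ->
  symmetric_meets A B -> symmetric_meets (rigid c s u v A) (rigid c' s' u' v' B).
Proof.
move=> cs cs' sym c1 s1 u1 v1 c2 s2 u2 v2 h1 h2; rewrite !rigid_comp.
apply: sym.
- by transitivity ((c ^+ 2 + s ^+ 2) * (c1 ^+ 2 + s1 ^+ 2)); [ring|rewrite cs h1 mulr1].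
- by transitivity ((c' ^+ 2 + s' ^+ 2) * (c2 ^+ 2 + s2 ^+ 2)); [ring|rewrite cs' h2 mulr1].
Qed.

(** The point is found at the supremum of the parameters in [A] on a segment that leaves [A]. *)
Lemma proper_boundary (R : realType) (A : R -> R -> Prop) x y x' y' :
  pclosed A -> A x y -> ~ A x' y' ->
  exists x0 y0, A x0 y0 /\ ~ pinterior A x0 y0.
Proof.
move=> cA Axy nA.
pose P t := [/\ 0 <= t, t <= 1 & A (x + t * (x' - x)) (y + t * (y' - y))].
have P0 : P 0 by split; rewrite // !mul0r !addr0.
have [|w [w1 w2]] := @sup_exists R P 0 1 P0; first by move=> t [].
have w0 : 0 <= w by exact: w1.
have w10 : w <= 1 by rewrite leNgt; apply/negP => /w2[t [_ h _]]; rewrite ltNge h.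
pose N := `|x' - x| + `|y' - y| + 1.
have N0 : 0 < N by rewrite /N ltr_wpDl // addr_ge0.
have step a t e : `|a| <= N -> 0 <= e -> `|t| <= e / N -> `|t * a| <= e.
  move=> aN e0 te; rewrite normrM (le_trans (ler_pM _ _ te aN)) // divfK //.
  by rewrite gt_eqF.
have xN : `|x' - x| <= N by rewrite /N -addrA lerDl addr_ge0.
have yN : `|y' - y| <= N by rewrite /N -addrA addrCA lerDl addr_ge0.
have Aw : A (x + w * (x' - x)) (y + w * (y' - y)).
  apply: cA => e e0; have eN : 0 < e / N by rewrite divr_gt0.
  have [|t Pt wt] := w2 (w - e / N); first by rewrite ltrBlDr ltrDl.
  have tw := w1 t Pt; have [_ _ At] := Pt.
  have tn : `|t - w| <= e / N by rewrite ler_norml; clear -wt tw eN; lra.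
  exists (x + t * (x' - x)), (y + t * (y' - y)); split=> //.
  - by rewrite (_ : _ - _ = (t - w) * (x' - x)); [exact: step xN (ltW e0) tn|ring].
  - by rewrite (_ : _ - _ = (t - w) * (y' - y)); [exact: step yN (ltW e0) tn|ring].
exists (x + w * (x' - x)), (y + w * (y' - y)); split=> // -[r r0 h].
have wn1 : w != 1.
  apply/eqP => E; apply: nA; move: Aw; rewrite E !mul1r.
  by rewrite !(addrC _ (_ - _)) !subrK.
have w1' : w < 1 by rewrite lt_neqAle wn1.
pose t := Num.min 1 (w + r / N).
have rN : 0 < r / N by rewrite divr_gt0.
have [t1 t2 wt] : [/\ t <= 1, t <= w + r / N & w < t].
  by rewrite /t !ge_min !lexx orbT lt_min w1' ltrDl.
clearbody t.
have tn : `|t - w| <= r / N by rewrite ler_norml; clear -t2 wt rN; lra.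
have : P t.
  split=> //; first by rewrite (le_trans w0) // ltW.
  apply: h.
  - by rewrite (_ : _ - _ = (t - w) * (x' - x)); [exact: step xN (ltW r0) tn|ring].
  - by rewrite (_ : _ - _ = (t - w) * (y' - y)); [exact: step yN (ltW r0) tn|ring].
by move/w1; rewrite leNgt wt.
Qed.

Lemma osculated_rigid (R : realType) (A : R -> R -> Prop) c s u v p q n1 n2 k :
  c ^+ 2 + s ^+ 2 = 1 -> osculated (rigid c s u v A) p q n1 n2 k ->
  osculated A (c * p - s * q + u) (s * p + c * q + v)
    (c * n1 - s * n2) (s * n1 + c * n2) k.
Proof.
move=> cs [d d0 H]; exists (d / 3); first by rewrite divr_gt0.
move=> x y; set x0 := c * p - s * q + u; set y0 := s * p + c * q + v => xd yd.
have cs' : c ^+ 2 + (- s) ^+ 2 = 1 by rewrite sqrrN.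
have [h1 h2] := norm_rotation_le cs' (ltW xd) (ltW yd).
have d3 : 2 * (d / 3) < d by clear -d0; lra.
rewrite mulNr opprK in h1; rewrite mulNr in h2.
set a := c * (x - x0) + s * (y - y0) in h1 *.
set b := - (s * (x - x0)) + c * (y - y0) in h2 *.
have := H (p + a) (q + b).
rewrite !(addrC p) !(addrC q) !addrK => /(_ (le_lt_trans h1 d3) (le_lt_trans h2 d3)).
rewrite /rigid.
have -> : c * (a + p) - s * (b + q) + u = x.
  transitivity ((c ^+ 2 + s ^+ 2) * (x - x0) + x0); first by rewrite /a /b /x0; ring.
  by rewrite cs mul1r subrK.
have -> : s * (a + p) + c * (b + q) + v = y.
  transitivity ((c ^+ 2 + s ^+ 2) * (y - y0) + y0); first by rewrite /a /b /y0; ring.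
  by rewrite cs mul1r subrK.
move=> ->.
have -> : a ^+ 2 + b ^+ 2 = (x - x0) ^+ 2 + (y - y0) ^+ 2.
  transitivity ((c ^+ 2 + s ^+ 2) * ((x - x0) ^+ 2 + (y - y0) ^+ 2)); first by rewrite /a /b; ring.
  by rewrite cs mul1r.
have -> // : n1 * a + n2 * b =
  (c * n1 - s * n2) * (x - x0) + (s * n1 + c * n2) * (y - y0) by rewrite /a /b; ring.
Qed.

Lemma slopes_in_widen (R : realType) (f : R -> R) (a b lo hi lo' hi' : R) :
  slopes_in f a b lo hi -> lo' <= lo -> hi <= hi' -> slopes_in f a b lo' hi'.
Proof.
move=> sl ll hh x y ax xy yb; have [h1 h2] := sl x y ax xy yb.
have xy0 : 0 <= y - x by rewrite subr_ge0.
by split; [rewrite (le_trans _ h1)|rewrite (le_trans h2)] => //; rewrite ler_wpM2r.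
Qed.

Lemma slopes_in_glue (R : realType) (f : R -> R) (a b lo hi : R) :
  a <= 0 -> 0 <= b -> slopes_in f a 0 lo hi -> slopes_in f 0 b lo hi ->
  slopes_in f a b lo hi.
Proof.
move=> a0 b0 sl sr x y ax xy yb; have [y0|y0] := le_or_lt y 0; first exact: sl.
have [x0|x0] := le_or_lt x 0; last exact: (sr x y (ltW x0)).
have [h1 h2] := sl x 0 ax x0 (lexx _); have [h3 h4] := sr 0 y (lexx _) (ltW y0) yb.
by split; [clear -h1 h3|clear -h2 h4]; lra.
Qed.

Lemma chart_sub (R : realType) (A : R -> R -> Prop) f (a b h a' b' : R) :
  chart A f a b h -> a <= a' -> b' <= b -> chart A f a' b' h.
Proof.
move=> [h0 hf hA] aa bb; split=> // x y ax xb; [apply: hf|apply: hA];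
  by [exact: le_trans ax|exact: le_trans bb].
Qed.

(** Without a corner the one-sided slopes of [A] agree, so that slopes on both sides are within 1/16
    of one value. For [B] the chords are taken to the right of its boundary point. *)
Lemma boundary_osculated (R : realType) (A B : R -> R -> Prop)
    (x0 y0 xi yi xb yb xj yj : R) :
  symmetric_meets A B -> pclosed A -> pconvex A -> pclosed B -> pconvex B ->
  A x0 y0 -> ~ pinterior A x0 y0 -> pinterior A xi yi ->
  B xb yb -> ~ pinterior B xb yb -> pinterior B xj yj ->
  exists n1 n2 k, [/\ n1 ^+ 2 + n2 ^+ 2 = 1, 0 <= k & osculated A x0 y0 n1 n2 k].
Proof.
move=> sym clA cA clB cB A0 bA iA B0 bB iB.
have [c [s [f [d [h [cs d0 chA f0]]]]]] := boundary_chart clA cA A0 bA iA.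
have [c' [s' [g [d' [h' [cs' d0' chB g0]]]]]] := boundary_chart clB cB B0 bB iB.
have {}sym := symmetric_meets_rigid (u := x0) (v := y0) (u' := xb) (v' := yb) cs cs' sym.
have cA' := rigid_convex (c := c) (s := s) (u := x0) (v := y0) cA.
have cB' := rigid_convex (c := c') (s := s') (u := xb) (v := yb) cB.
have [al [be [ab _ _ slopes]]] := concave_slopes d0 (chart_concave chA cA') f0.
have ba := no_corner sym chA cA' d0 f0 chB cB' d0' g0 slopes.
have E : be = al by apply: le_anti; rewrite ab ba.
subst be.
have q0 : 0 < 1 / 16 :> R by rewrite divr_gt0.
have [r [r0 rd slr sll]] := slopes _ q0.
have [al' [be' [_ _ _ slopes']]] := concave_slopes d0' (chart_concave chB cB') g0.
have [r' [r0' rd' slr' _]] := slopes' _ q0.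
have fA : flat_chart (rigid c s x0 y0 A) f (- r) r h al.
  split=> //; first by apply: (chart_sub chA) => //; rewrite lerN2.
  apply: slopes_in_glue; rewrite ?oppr_le0 ?(ltW r0) //.
  - by apply: (slopes_in_widen sll) => //; rewrite lerBlDr lerDl ltW.
  - by apply: (slopes_in_widen slr) => //; rewrite lerDl ltW.
have fB : flat_chart (rigid c' s' xb yb B) g 0 r' h' al'.
  split=> //; first by apply: (chart_sub chB) => //; rewrite oppr_le0 ltW.
  by apply: (slopes_in_widen slr') => //; rewrite lerDl ltW.
have [n1 [n2 [k [nn k0 osc]]]] := osculated_of_flat_chart sym fA r0 f0 fB r0'.
exists (c * n1 - s * n2), (s * n1 + c * n2), k; split=> //.
- by transitivity ((c ^+ 2 + s ^+ 2) * (n1 ^+ 2 + n2 ^+ 2)); [ring|rewrite cs nn mulr1].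
- have := osculated_rigid cs osc; rewrite !mulr0 subrr !add0r; exact.
Qed.

(** * Propagation of the osculating circle *)

(** If the normals differ, a short step along their difference is inside one region and outside the
    other. If only the curvatures differ, points of the less curved boundary are outside the more
    curved region. *)
Lemma osculated_germ (R : realType) (n1 n2 k m1 m2 k' d : R) :
  n1 ^+ 2 + n2 ^+ 2 = 1 -> m1 ^+ 2 + m2 ^+ 2 = 1 -> 0 <= k -> 0 <= k' -> 0 < d ->
  (forall a b, `|a| < d -> `|b| < d ->
    2 * (n1 * a + n2 * b) + k * (a ^+ 2 + b ^+ 2) <= 0 <->
    2 * (m1 * a + m2 * b) + k' * (a ^+ 2 + b ^+ 2) <= 0) ->
  [/\ n1 = m1, n2 = m2 & k = k'].
Proof.
move=> nn mm k0 k0' d0 H.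
have unit_le (u v : R) : u ^+ 2 + v ^+ 2 = 1 -> `|u| <= 1 /\ `|v| <= 1.
  by move=> uv; split; rewrite ler_norml; clear -uv; nra.
have [nn1 nn2] := unit_le _ _ nn; have [mm1 mm2] := unit_le _ _ mm.
rewrite !ler_norml in nn1 nn2 mm1 mm2.
pose q := 1 - (n1 * m1 + n2 * m2).
have qE : (m1 - n1) ^+ 2 + (m2 - n2) ^+ 2 = 2 * q.
  by rewrite /q; move: nn mm; clear; lra.
have q00 : q = 0.
  apply: contrapT => /eqP qn.
  have q0 : 0 < q.
    have : 0 <= 2 * q by rewrite -qE addr_ge0 // sqr_ge0.
    by rewrite pmulr_rge0 // lt_neqAle eq_sym qn.
  pose t := Num.min (d / 4) (1 / (1 + k)).
  have k1 : 0 < 1 + k by rewrite ltr_pwDl.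
  have t0 : 0 < t by rewrite lt_min !divr_gt0.
  have t1 : t <= d / 4 by rewrite ge_min lexx.
  have t2 : t * (1 + k) <= 1 by rewrite -ler_pdivlMr // ge_min lexx orbT.
  clearbody t.
  have small (u v : R) : `|u| <= 1 -> `|v| <= 1 -> `|t * (u - v)| < d.
    move=> u1 v1; rewrite normrM (gtr0_norm t0).
    have : `|u - v| <= 2 by rewrite (le_trans (ler_normB _ _)) //; clear -u1 v1; lra.
    have : 0 <= `|u - v| by [].
    move=> h1 h2; have : t * `|u - v| <= d / 4 * 2 by rewrite ler_pM // ltW.
    by clear -d0; lra.
  have [h1 _] := H (t * (m1 - n1)) (t * (m2 - n2)) ltac:(apply: small; rewrite ler_norml //)
    ltac:(apply: small; rewrite ler_norml //).
  have E1 : 2 * (n1 * (t * (m1 - n1)) + n2 * (t * (m2 - n2))) +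
     k * ((t * (m1 - n1)) ^+ 2 + (t * (m2 - n2)) ^+ 2) = 2 * (t * q) * (k * t - 1).
    have -> : (t * (m1 - n1)) ^+ 2 + (t * (m2 - n2)) ^+ 2 = t ^+ 2 * (2 * q).
      by rewrite -qE; ring.
    have -> : n1 * (t * (m1 - n1)) + n2 * (t * (m2 - n2)) =
      t * (n1 * m1 + n2 * m2 - (n1 ^+ 2 + n2 ^+ 2)) by ring.
    by rewrite nn /q; ring.
  have E2 : 2 * (m1 * (t * (m1 - n1)) + m2 * (t * (m2 - n2))) +
     k' * ((t * (m1 - n1)) ^+ 2 + (t * (m2 - n2)) ^+ 2) = 2 * (t * q) * (1 + k' * t).
    have -> : (t * (m1 - n1)) ^+ 2 + (t * (m2 - n2)) ^+ 2 = t ^+ 2 * (2 * q).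
      by rewrite -qE; ring.
    have -> : m1 * (t * (m1 - n1)) + m2 * (t * (m2 - n2)) =
      t * (m1 ^+ 2 + m2 ^+ 2 - (n1 * m1 + n2 * m2)) by ring.
    by rewrite mm /q; ring.
  rewrite E1 E2 in h1.
  have tq : 0 < 2 * (t * q) by rewrite !mulr_gt0.
  have := h1 ltac:(rewrite pmulr_rle0 //; clear -t2 t0; lra).
  rewrite pmulr_rle0 //; have : 0 <= k' * t by rewrite mulr_ge0 // ltW.
  by clear; lra.
have [e1 e2] : n1 = m1 /\ n2 = m2.
  move: qE; rewrite q00 mulr0 => /eqP; rewrite paddr_eq0 ?sqr_ge0 //.
  by rewrite !sqrf_eq0 !subr_eq0 => /andP[/eqP -> /eqP ->].
subst m1 m2; split=> //; clear q qE q00 mm mm1 mm2.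
have main (p p' : R) : 0 <= p -> p < p' -> (forall a b, `|a| < d -> `|b| < d ->
    2 * (n1 * a + n2 * b) + p * (a ^+ 2 + b ^+ 2) <= 0 ->
    2 * (n1 * a + n2 * b) + p' * (a ^+ 2 + b ^+ 2) <= 0) -> False.
  move=> p0 pp Hp.
  pose t := Num.min 1 (d / (4 * (1 + p))).
  have p1 : 0 < 1 + p by rewrite ltr_pwDl.
  have t0 : 0 < t by rewrite lt_min ltr01 divr_gt0 // mulr_gt0.
  have t1 : t <= 1 by rewrite ge_min lexx.
  have t2 : t * (4 * (1 + p)) <= d by rewrite -ler_pdivlMr ?mulr_gt0 // ge_min lexx orbT.
  clearbody t.
  have D1 : 1 <= 1 + p ^+ 2 * t ^+ 2 by rewrite lerDl mulr_ge0 // sqr_ge0.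
  have D0 : 0 < 1 + p ^+ 2 * t ^+ 2 by exact: lt_le_trans D1.
  (* Leads to a point on the curve of curvature [p], in its stereographic parametrization, turned so
     that the normal is (n1, n2). *)
  pose s := 2 * t / (1 + p ^+ 2 * t ^+ 2).
  have sE : s * (1 + p ^+ 2 * t ^+ 2) = 2 * t by rewrite /s divfK // gt_eqF.
  have s0 : 0 < s by rewrite divr_gt0 // mulr_gt0.
  have s2 : s <= 2 * t.
    by rewrite /s ler_pdivrMr // ler_peMr // mulr_ge0 // ltW.
  clearbody s.
  have pt : 0 <= p * t by rewrite mulr_ge0 // ltW.
  have small (u v : R) : `|u| <= 1 -> `|v| <= 1 -> `|s * (u - p * t * v)| < d.
    move=> u1 v1; rewrite normrM (gtr0_norm s0).
    have h1 : `|u - p * t * v| <= 1 + p.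
      rewrite (le_trans (ler_normB _ _)) // normrM (ger0_norm pt) lerD //.
      have : p * t * `|v| <= p * t * 1 by rewrite ler_wpM2l.
      have : p * t <= p * 1 by rewrite ler_wpM2l.
      by clear; lra.
    have h2 : s * `|u - p * t * v| <= 2 * t * (1 + p) by rewrite ler_pM // ltW.
    by clear -h2 t2 d0 p1 t0; nra.
  have n1N : `|- n2| <= 1 by rewrite normrN ler_norml.
  have := Hp (s * (- n2 - p * t * n1)) (s * (n1 - p * t * n2)).
  move=> /(_ ltac:(apply: small; rewrite // ler_norml //) ltac:(apply: small; rewrite ler_norml //)).
  have -> : n1 * (s * (- n2 - p * t * n1)) + n2 * (s * (n1 - p * t * n2)) =
    - (s * (p * t)) * (n1 ^+ 2 + n2 ^+ 2) by ring.
  have -> : (s * (- n2 - p * t * n1)) ^+ 2 + (s * (n1 - p * t * n2)) ^+ 2 =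
    s * (s * (1 + p ^+ 2 * t ^+ 2)) * (n1 ^+ 2 + n2 ^+ 2) by ring.
  rewrite nn sE !mulr1.
  have st : 0 < s * t by rewrite mulr_gt0.
  have pst : 0 < (p' - p) * (s * t) by rewrite mulr_gt0 // subr_gt0.
  move=> /(_ ltac:(clear; lra)); clear -pst; lra.
have [lt|gt|//] := ltgtP k k'.
- by case: (main k k' k0 lt) => a b ha hb /(H a b ha hb).
- by case: (main k' k k0' gt) => a b ha hb /(H a b ha hb).
Qed.

Lemma unit_norm_le (R : realType) (u v : R) :
  u ^+ 2 + v ^+ 2 = 1 -> `|u| <= 1 /\ `|v| <= 1.
Proof. by move=> uv; split; rewrite ler_norml; apply/andP; split; nra. Qed.

(** One equation for the circle of radius [1 / k] that touches the axis [y = 0] at the origin from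
    below and, at [k = 0], for this axis itself. *)
Definition conic (R : realType) (k x y : R) : R := 2 * y + k * (x ^+ 2 + y ^+ 2).

(* Stereographic parametrisation from the origin of conic k = 0, which is a circle
   missing only the antipode of the origin if k > 0, and the line y = 0 if k = 0. *)
Definition conic_x (R : realType) (k t : R) : R := 2 * t / (1 + k ^+ 2 * t ^+ 2).

Definition conic_y (R : realType) (k t : R) : R :=
  - (2 * k * t ^+ 2) / (1 + k ^+ 2 * t ^+ 2).

Lemma conic_denominator (R : realType) (k t : R) : 0 < 1 + k ^+ 2 * t ^+ 2.
Proof. by rewrite ltr_pwDl // mulr_ge0 // sqr_ge0. Qed.

Lemma conic_param (R : realType) (k t : R) : conic k (conic_x k t) (conic_y k t) = 0.
Proof.
rewrite /conic /conic_x /conic_y; field.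
by apply: lt0r_neq0; rewrite exprMn; exact: conic_denominator.
Qed.

(** Exact Taylor expansion at a point of the curve. The germ there has the form required by
    [osculated], with the same curvature. *)
Lemma conic_shift (R : realType) (k x y p q : R) : conic k p q = 0 ->
  conic k x y = 2 * (k * p * (x - p) + (1 + k * q) * (y - q)) +
                k * ((x - p) ^+ 2 + (y - q) ^+ 2).
Proof. by move=> E; rewrite -[RHS]addr0 -E /conic; ring. Qed.

Lemma conic_normal (R : realType) (k p q : R) : conic k p q = 0 ->
  (k * p) ^+ 2 + (1 + k * q) ^+ 2 = 1.
Proof.
move=> E; transitivity (1 + k * conic k p q); first by rewrite /conic; ring.
by rewrite E mulr0 addr0.
Qed.

(** Over the common denominator [P], the differences contain the two components of a vector of
    squared length [P >= 1]; this makes the constant independent of [k]. *)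
Lemma conic_param_lipschitz (R : realType) (k t u : R) :
  `|conic_x k t - conic_x k u| <= 2 * `|t - u| /\
  `|conic_y k t - conic_y k u| <= 2 * `|t - u|.
Proof.
have D1 := conic_denominator k t; have D2 := conic_denominator k u.
have n1 : 1 + k ^+ 2 * t ^+ 2 != 0 by rewrite gt_eqF.
have n2 : 1 + k ^+ 2 * u ^+ 2 != 0 by rewrite gt_eqF.
pose P := (1 + k ^+ 2 * t ^+ 2) * (1 + k ^+ 2 * u ^+ 2).
have P1 : 1 <= P.
  rewrite /P mulrDl mul1r -addrA lerDl addr_ge0 //; last rewrite mulr_ge0 //.
  - by rewrite mulr_ge0 // sqr_ge0.
  - by rewrite mulr_ge0 // sqr_ge0.
  - by rewrite ltW.
have P0 : 0 < P by exact: lt_le_trans P1.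
have PE : P = (1 - k ^+ 2 * (t * u)) ^+ 2 + (k * (t + u)) ^+ 2 by rewrite /P; ring.
have bound a : a ^+ 2 <= P -> `|a| <= P.
  move=> aP; rewrite -ler_sqr ?nnegrE ?(ltW P0) // real_normK ?num_real //.
  by rewrite (le_trans aP) // expr2 ler_peMr // ltW.
have b1 : `|1 - k ^+ 2 * (t * u)| <= P by apply: bound; rewrite PE lerDl sqr_ge0.
have b2 : `|k * (t + u)| <= P by apply: bound; rewrite PE lerDr sqr_ge0.
split.
- have -> : conic_x k t - conic_x k u = 2 * (t - u) * (1 - k ^+ 2 * (t * u)) / P.
    by rewrite /conic_x /P; field; rewrite !exprMn n1 n2.
  rewrite !normrM normfV (gtr0_norm P0) (ger0_norm (_ : 0 <= 2)) //.
  by rewrite ler_pdivrMr // ler_wpM2l // mulr_ge0.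
- have -> : conic_y k t - conic_y k u = - (2 * (t - u) * (k * (t + u)) / P).
    by rewrite /conic_y /P; field; rewrite !exprMn n1 n2.
  rewrite normrN normrM normfV (gtr0_norm P0) ler_pdivrMr //.
  rewrite normrM [`|2 * _|]normrM (ger0_norm (_ : 0 <= 2)) //.
  by rewrite ler_wpM2l // mulr_ge0.
Qed.

Definition follows_conic (R : realType) (A : R -> R -> Prop) (k t : R) :=
  exists2 d, 0 < d & forall x y, `|x - conic_x k t| < d -> `|y - conic_y k t| < d ->
    A x y <-> conic k x y <= 0.

Lemma follows_conic_boundary (R : realType) (A : R -> R -> Prop) (k t : R) :
  0 <= k -> follows_conic A k t ->
  A (conic_x k t) (conic_y k t) /\ ~ pinterior A (conic_x k t) (conic_y k t).
Proof.
move=> k0 [d d0 H]; have C := conic_param k t; split.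
  by apply/H; rewrite ?subrr ?normr0 // C.
move=> [r r0 I].
set p := conic_x k t in C H I; set q := conic_y k t in C H I.
have N := conic_normal C.
have [n1 n2] := unit_norm_le N.
pose s := Num.min r (d / 2).
have s0 : 0 < s by rewrite lt_min r0 divr_gt0.
have sr : s <= r by rewrite ge_min lexx.
have sd : s < d by rewrite gt_min ltr_pdivrMr // ltr_pMr // ltr1n orbT.
clearbody s.
have a1 : `|s * (k * p)| <= s by rewrite normrM (gtr0_norm s0) ler_piMr // ltW.
have a2 : `|s * (1 + k * q)| <= s by rewrite normrM (gtr0_norm s0) ler_piMr // ltW.
have Ap : A (p + s * (k * p)) (q + s * (1 + k * q)).
  apply: I; rewrite addrAC subrr add0r; first exact: le_trans sr.
  exact: le_trans sr.
have [] := H (p + s * (k * p)) (q + s * (1 + k * q)).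
- by rewrite addrAC subrr add0r (le_lt_trans a1).
- by rewrite addrAC subrr add0r (le_lt_trans a2).
move=> /(_ Ap) + _; rewrite (conic_shift _ _ C).
rewrite !(addrAC _ (s * _)) !subrr !add0r.
have -> : 2 * (k * p * (s * (k * p)) + (1 + k * q) * (s * (1 + k * q))) +
  k * ((s * (k * p)) ^+ 2 + (s * (1 + k * q)) ^+ 2) =
  (2 * s + k * s ^+ 2) * ((k * p) ^+ 2 + (1 + k * q) ^+ 2) by ring.
rewrite N mulr1 leNgt => /negP; apply.
by rewrite ltr_pwDl // ?mulr_gt0 // mulr_ge0 // sqr_ge0.
Qed.

(* The osculating germ at a limit point of the conic agrees with the conic at nearby
   parameters, hence is the conic: the set of good parameters is closed, and it is
   open by definition. *)
Lemma follows_conic_everywhere (R : realType) (A : R -> R -> Prop) (k : R) :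
  pclosed A -> 0 <= k -> osculated A 0 0 0 1 k ->
  (forall x y, A x y -> ~ pinterior A x y -> exists n1 n2 k',
    [/\ n1 ^+ 2 + n2 ^+ 2 = 1, 0 <= k' & osculated A x y n1 n2 k']) ->
  forall t, follows_conic A k t.
Proof.
move=> cA k0 [d0 d00 H0] osc; apply: real_induction.
- exists d0 => // x y.
  have -> : conic_x k 0 = 0 by rewrite /conic_x mulr0 mul0r.
  have -> : conic_y k 0 = 0 by rewrite /conic_y expr0n !mulr0 oppr0 mul0r.
  by move=> hx hy; rewrite (H0 x y hx hy) !subr0 mul0r add0r mul1r.
- move=> t [d dp H]; exists (d / 4); first by rewrite divr_gt0.
  move=> u ut; exists (d / 2); first by rewrite divr_gt0.
  have [l1 l2] := conic_param_lipschitz k u t.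
  move=> x y hx hy; apply: H.
  - have -> : x - conic_x k t = (x - conic_x k u) + (conic_x k u - conic_x k t) by ring.
    by rewrite (le_lt_trans (ler_normD _ _)) //; clear -ut l1 hx; lra.
  - have -> : y - conic_y k t = (y - conic_y k u) + (conic_y k u - conic_y k t) by ring.
    by rewrite (le_lt_trans (ler_normD _ _)) //; clear -ut l2 hy; lra.
move=> t lim.
pose p := conic_x k t; pose q := conic_y k t.
have Apq : A p q.
  apply: cA => e e0; have [|u ut /(follows_conic_boundary k0)[Au _]] := lim (e / 2).
    by rewrite divr_gt0.
  have [l1 l2] := conic_param_lipschitz k u t.
  exists (conic_x k u), (conic_y k u); split=> //.
  - by rewrite (le_trans l1) //; clear -ut; lra.
  - by rewrite (le_trans l2) //; clear -ut; lra.
have bpq : ~ pinterior A p q.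
  move=> [r r0 I]; have [|u ut /(follows_conic_boundary k0)[_]] := lim (r / 4).
    by rewrite divr_gt0.
  have [l1 l2] := conic_param_lipschitz k u t.
  apply; exists (r / 2); first by rewrite divr_gt0.
  move=> x y hx hy; apply: I.
  - have -> : x - p = (x - conic_x k u) + (conic_x k u - p) by ring.
    by rewrite (le_trans (ler_normD _ _)) //; clear -ut l1 hx; lra.
  - have -> : y - q = (y - conic_y k u) + (conic_y k u - q) by ring.
    by rewrite (le_trans (ler_normD _ _)) //; clear -ut l2 hy; lra.
have [m1 [m2 [k' [mm k0' [d dp H]]]]] := osc p q Apq bpq.
have [|u ut fu] := lim (d / 4); first by rewrite divr_gt0.
have [l1 l2] := conic_param_lipschitz k u t.
have Cu := conic_param k u; have Nu := conic_normal Cu.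
have [e e0 Hu] := fu.
move: l1 l2 Cu Nu Hu; rewrite -/p -/q.
move: (conic_x k u) (conic_y k u) => p' q' l1 l2 Cu Nu Hu.
pose v1 := p' - p; pose v2 := q' - q.
(* [g] and (n1, n2) are the value and half the gradient, at the nearby point (p', q'), of the
   function osculating at the limit point. *)
pose g := 2 * (m1 * v1 + m2 * v2) + k' * (v1 ^+ 2 + v2 ^+ 2).
pose n1 := m1 + k' * v1; pose n2 := m2 + k' * v2.
pose z := Num.min e (d / 2).
have z0 : 0 < z by rewrite lt_min e0 divr_gt0.
have ze : z <= e by rewrite ge_min lexx.
have zd : z <= d / 2 by rewrite ge_min lexx orbT.
clearbody z.
have eqv a b : `|a| < z -> `|b| < z ->
    2 * (k * p' * a + (1 + k * q') * b) + k * (a ^+ 2 + b ^+ 2) <= 0 <->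
    g + (2 * (n1 * a + n2 * b) + k' * (a ^+ 2 + b ^+ 2)) <= 0.
  move=> ha hb.
  have h1 := Hu (p' + a) (q' + b); have h2 := H (p' + a) (q' + b).
  have {}h1 := h1 ltac:(rewrite addrAC subrr add0r; exact: lt_le_trans ze)
                  ltac:(rewrite addrAC subrr add0r; exact: lt_le_trans ze).
  rewrite (conic_shift _ _ Cu) !(addrAC _ a) !(addrAC _ b) !subrr !add0r in h1.
  have {}h2 : A (p' + a) (q' + b) <->
      g + (2 * (n1 * a + n2 * b) + k' * (a ^+ 2 + b ^+ 2)) <= 0.
    have -> : g + (2 * (n1 * a + n2 * b) + k' * (a ^+ 2 + b ^+ 2)) =
      2 * (m1 * (p' + a - p) + m2 * (q' + b - q)) +
      k' * ((p' + a - p) ^+ 2 + (q' + b - q) ^+ 2) by rewrite /g /n1 /n2 /v1 /v2; ring.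
    apply: h2.
    - have -> : p' + a - p = (p' - p) + a by ring.
      by rewrite (le_lt_trans (ler_normD _ _)) //; clear -l1 ut ha zd; lra.
    - have -> : q' + b - q = (q' - q) + b by ring.
      by rewrite (le_lt_trans (ler_normD _ _)) //; clear -l2 ut hb zd; lra.
  by rewrite -h1 h2.
(* The nearby point is on the boundary of [A]: membership gives [g <= 0], and with [g < 0] a small
   step along the outer normal of the conic would stay in [A]. *)
have g0 : g = 0.
  apply: le_anti; apply/andP; split.
    have := (eqv 0 0); rewrite normr0 => /(_ z0 z0)[+ _].
    by rewrite !mulr0 expr0n /= !addr0 !mulr0 !addr0; apply.
  rewrite leNgt; apply/negP => gn.
  have [c1 c2] := unit_norm_le Nu.
  pose W := n1 * (k * p') + n2 * (1 + k * q').
  pose C := 2 * `|W| + k' + 1.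
  have C0 : 0 < C by rewrite /C ltr_wpDl // addr_ge0 // mulr_ge0.
  pose s := Num.min (z / 2) (Num.min 1 (- g / C)).
  have s0 : 0 < s by rewrite !lt_min ltr01 !divr_gt0 // oppr_gt0.
  have s1 : s <= z / 2 by rewrite ge_min lexx.
  have s2 : s <= 1 by rewrite !ge_min lexx orbT.
  have s3 : s * C <= - g by rewrite -ler_pdivlMr // !ge_min lexx !orbT.
  clearbody s.
  have sz : s < z by clear -s1 z0; lra.
  have small w : `|w| <= 1 -> `|s * w| < z.
    by move=> w1; rewrite normrM (gtr0_norm s0) (le_lt_trans _ sz) // ler_piMr // ltW.
  have := eqv (s * (k * p')) (s * (1 + k * q')).
  move=> /(_ (small _ c1) (small _ c2))[_].
  have -> : (s * (k * p')) ^+ 2 + (s * (1 + k * q')) ^+ 2 = s ^+ 2.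
    by transitivity (s ^+ 2 * ((k * p') ^+ 2 + (1 + k * q') ^+ 2)); [ring|rewrite Nu mulr1].
  have -> : k * p' * (s * (k * p')) + (1 + k * q') * (s * (1 + k * q')) = s.
    by transitivity (s * ((k * p') ^+ 2 + (1 + k * q') ^+ 2)); [ring|rewrite Nu mulr1].
  have -> : n1 * (s * (k * p')) + n2 * (s * (1 + k * q')) =
    s * (n1 * (k * p') + n2 * (1 + k * q')) by ring.
  move=> h; have : 2 * s + k * s ^+ 2 <= 0.
    apply: h; rewrite -/W.
    have : s * W <= s * `|W| by rewrite ler_wpM2l ?ler_norm // ltW.
    have : k' * s ^+ 2 <= k' * s.
      by rewrite ler_wpM2l // expr2 ler_piMr // ltW.
    by move: s3; rewrite /C; clear -s0; lra.
  rewrite leNgt => /negP; apply.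
  by rewrite ltr_pwDl // ?mulr_gt0 // mulr_ge0 // sqr_ge0.
have nn : n1 ^+ 2 + n2 ^+ 2 = 1.
  transitivity (m1 ^+ 2 + m2 ^+ 2 + k' * g); last by rewrite g0 mm mulr0 addr0.
  by rewrite /n1 /n2 /g; ring.
have [E1 E2 E3] := @osculated_germ R (k * p') (1 + k * q') k n1 n2 k' z Nu nn k0 k0' z0
  ltac:(by move=> a b ha hb; rewrite (eqv a b ha hb) g0 add0r).
exists d => // x y hx hy; rewrite (H x y hx hy) (conic_shift _ _ Cu) E1 E2 E3.
have -> // : 2 * (n1 * (x - p') + n2 * (y - q')) + k' * ((x - p') ^+ 2 + (y - q') ^+ 2) =
  2 * (m1 * (x - p) + m2 * (y - q)) + k' * ((x - p) ^+ 2 + (y - q) ^+ 2) - g.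
  by rewrite /n1 /n2 /g /v1 /v2; ring.
by rewrite g0 subr0.
Qed.

(** * Disks, half-planes and strips *)

Lemma eq_region (R : realType) (A B : R -> R -> Prop) :
  (forall x y, A x y <-> B x y) -> A = B.
Proof.
by move=> AB; apply/funext => x; apply/funext => y; apply/propext; exact: AB.
Qed.

Definition disk_at (R : realType) (a b r : R) x y : Prop :=
  (x - a) ^+ 2 + (y - b) ^+ 2 <= r ^+ 2.

Definition half_plane_at (R : realType) (n1 n2 c : R) x y : Prop :=
  n1 * x + n2 * y <= c.

Definition strip_at (R : realType) (n1 n2 c d : R) x y : Prop :=
  c <= n1 * x + n2 * y /\ n1 * x + n2 * y <= d.

Definition disk2 (R : realType) (A : R -> R -> Prop) :=
  exists a b r, 0 < r /\ A = disk_at a b r.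

Definition half_plane2 (R : realType) (A : R -> R -> Prop) :=
  exists n1 n2 c, n1 ^+ 2 + n2 ^+ 2 = 1 /\ A = half_plane_at n1 n2 c.

Definition strip2 (R : realType) (A : R -> R -> Prop) :=
  exists n1 n2 c d, [/\ n1 ^+ 2 + n2 ^+ 2 = 1, c < d & A = strip_at n1 n2 c d].

(** The tangent at parameter [t] supports [A]: on the way to a point beyond it, [A] would contain
    points just outside the conic. Multiplication by [1 + k ^+ 2 * t ^+ 2] makes the tangent
    inequality a quadratic polynomial in [t]. *)
Lemma conic_support (R : realType) (A : R -> R -> Prop) (k t x y : R) :
  pconvex A -> 0 <= k -> follows_conic A k t -> A x y ->
  y + 2 * k * x * t - k * (k * y + 2) * t ^+ 2 <= 0.
Proof.
move=> cA k0 fc Axy; have [Aw _] := follows_conic_boundary k0 fc.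
have [d d0 H] := fc; have C := conic_param k t.
have D := conic_denominator k t.
pose D' := 1 + k ^+ 2 * t ^+ 2.
have E : y + 2 * k * x * t - k * (k * y + 2) * t ^+ 2 =
   D' * (k * conic_x k t * (x - conic_x k t) + (1 + k * conic_y k t) * (y - conic_y k t)).
  have -> : k * conic_x k t * (x - conic_x k t) + (1 + k * conic_y k t) * (y - conic_y k t) =
    k * x * conic_x k t + y * (1 + k * conic_y k t) + conic_y k t - conic k (conic_x k t) (conic_y k t).
    by rewrite /conic; ring.
  rewrite C /D' /conic_x /conic_y; field.
  by apply: lt0r_neq0; rewrite exprMn.
rewrite E pmulr_rle0 //.
move: (conic_x k t) (conic_y k t) Aw H C => p q Aw H C; clear E.
rewrite leNgt; apply/negP => s0.
pose N := `|x - p| + `|y - q| + 1.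
have N0 : 0 < N by rewrite /N ltr_wpDl // addr_ge0.
pose z := Num.min 1 (d / (2 * N)).
have z0 : 0 < z by rewrite lt_min ltr01 divr_gt0 // mulr_gt0.
have z1 : z <= 1 by rewrite ge_min lexx.
have z2 : z * (2 * N) <= d by rewrite -ler_pdivlMr ?mulr_gt0 // ge_min lexx orbT.
clearbody z.
have zN : z * N < d by clear -z2 d0; lra.
have small w : `|w| <= N -> `|z * w| < d.
  by move=> wN; rewrite normrM (gtr0_norm z0) (le_lt_trans _ zN) // ler_wpM2l // ltW.
have Az := cA p q x y z (ltW z0) z1 Aw Axy.
have [] := H (p + z * (x - p)) (q + z * (y - q)).
- by rewrite addrAC subrr add0r small // /N -addrA lerDl addr_ge0.
- by rewrite addrAC subrr add0r small // /N -addrA addrCA lerDl addr_ge0.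
move=> /(_ Az) + _; rewrite (conic_shift _ _ C).
rewrite !(addrAC _ (z * _)) !subrr !add0r leNgt => /negP; apply.
have -> : k * p * (z * (x - p)) + (1 + k * q) * (z * (y - q)) =
  z * (k * p * (x - p) + (1 + k * q) * (y - q)) by ring.
by rewrite ltr_pwDl ?mulr_gt0 // mulr_ge0 // addr_ge0 // sqr_ge0.
Qed.

(** A disk is the intersection of its tangent half-planes. For [k * y + 2 > 0] the quadratic is
    largest at [t = x / (k * y + 2)], with value [conic k x y / (k * y + 2)]. A negative [k * y + 2]
    is refuted by large [t], and a vanishing one leaves only the antipode of the origin. *)
Lemma conic_of_support (R : realType) (k x y : R) : 0 < k ->
  (forall t, y + 2 * k * x * t - k * (k * y + 2) * t ^+ 2 <= 0) -> conic k x y <= 0.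
Proof.
move=> k0 H; pose P := k * y + 2.
have [P0|[P0|P0]] : 0 < P \/ (P < 0 \/ P = 0).
  by case: (ltgtP P 0); auto.
- have h := H (x / P); rewrite -/P in h.
  have E : y + 2 * k * x * (x / P) - k * P * (x / P) ^+ 2 = (y * P + k * x ^+ 2) / P.
    by field; rewrite gt_eqF.
  rewrite E pmulr_lle0 ?invr_gt0 // in h.
  by move: h; rewrite /P /conic; clear; lra.
- pose t := `|y| / (k * - P) + 1.
  have kP : 0 < k * - P by rewrite mulr_gt0 // oppr_gt0.
  have t1 : 1 <= t by rewrite lerDr divr_ge0 // ltW.
  have tE : t * (k * - P) = `|y| + k * - P by rewrite /t mulrDl mul1r divfK // gt_eqF.
  have h1 := H t; have h2 := H (- t); rewrite -/P sqrrN in h1 h2.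
  have t2 : t * (k * - P) <= t ^+ 2 * (k * - P).
    by rewrite ler_wpM2r ?(ltW kP) // expr2 ler_peMr // (le_trans _ t1).
  have yn : - y <= `|y| by rewrite -normrN ler_norm.
  by exfalso; clearbody t P; clear -h1 h2 t2 yn tE kP; lra.
- have yE : k * y = -2 by move: P0; rewrite /P; clear; lra.
  have x0 : x = 0.
    apply: contrapT => /eqP xn.
    have := H ((1 - y) / (2 * k * x)); rewrite -/P P0 mulr0 mul0r subr0.
    have d0 : 2 * k * x != 0 by rewrite !mulf_neq0 // gt_eqF.
    by rewrite [2 * k * x * _]mulrC divfK // addrC subrK ler10.
  rewrite /conic x0 expr0n add0r.
  have -> : 2 * y + k * y ^+ 2 = y * (k * y + 2) by ring.
  by rewrite -/P P0 mulr0.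
Qed.

(** The parametrized boundary points belong to [A] and horizontal chords between them fill the disk;
    the antipode, which the parametrization misses, is reached as a limit. *)
Lemma conic_disk (R : realType) (A : R -> R -> Prop) (k : R) :
  pclosed A -> pconvex A -> 0 < k -> (forall t, follows_conic A k t) ->
  forall x y, A x y <-> conic k x y <= 0.
Proof.
move=> clA cA k0 fc x y; split.
  move=> Axy; apply: (conic_of_support k0) => t.
  exact: (conic_support cA (ltW k0) (fc t) Axy).
have inner a b : 0 < k * b + 2 -> conic k a b <= 0 -> A a b.
  move=> P0 F; pose X2 := (- (2 * b) - k * b ^+ 2) / k.
  have X2E : k * X2 = - (2 * b) - k * b ^+ 2 by rewrite /X2 mulrC divfK // gt_eqF.
  have aX : a ^+ 2 <= X2 by rewrite -(ler_pM2l k0) X2E; move: F; rewrite /conic; clear; lra.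
  have X20 : 0 <= X2 by rewrite (le_trans _ aX) // sqr_ge0.
  pose X := Num.sqrt X2; have XX : X ^+ 2 = X2 by rewrite sqr_sqrtr.
  have X0 : 0 <= X by rewrite sqrtr_ge0.
  have aX' : `|a| <= X.
    by rewrite -ler_sqr ?nnegrE // real_normK ?num_real // XX.
  have mem Z : Z ^+ 2 = X2 -> A Z b.
    move=> ZE; pose t := Z / (k * b + 2).
    have P1 : k * b + 2 != 0 by rewrite gt_eqF.
    have D : 1 + k ^+ 2 * t ^+ 2 = 2 / (k * b + 2).
      have -> : 1 + k ^+ 2 * t ^+ 2 = (k * (k * Z ^+ 2) + (k * b + 2) ^+ 2) / (k * b + 2) ^+ 2.
        by rewrite /t; field.
      by rewrite ZE X2E; field.
    have [+ _] := follows_conic_boundary (ltW k0) (fc t).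
    rewrite /conic_x /conic_y D.
    have -> : 2 * t / (2 / (k * b + 2)) = Z by rewrite /t; field.
    have -> // : - (2 * k * t ^+ 2) / (2 / (k * b + 2)) = b.
    have -> : - (2 * k * t ^+ 2) / (2 / (k * b + 2)) = - (k * Z ^+ 2) / (k * b + 2).
      by rewrite /t; field.
    by rewrite ZE X2E; field.
  have A1 := mem X XX; have A2 := mem (- X) ltac:(by rewrite sqrrN).
  rewrite ler_norml in aX'; case/andP: aX' => h1 h2.
  have [Xz|Xn] := eqVneq X 0.
    by have -> : a = X by [apply: le_anti; rewrite h2 Xz; rewrite Xz oppr0 in h1].
  have Xp : 0 < X by rewrite lt_neqAle eq_sym Xn.
  have := cA (- X) b X b ((a + X) / (2 * X)) _ _ A2 A1.
  rewrite subrr mulr0 addr0.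
  have -> : - X + (a + X) / (2 * X) * (X - - X) = a by field.
  apply.
  - by rewrite divr_ge0 ?mulr_ge0 // -lerBlDr sub0r.
  - by rewrite ler_pdivrMr ?mulr_gt0 //; clear -h2; lra.
move=> F; have [P0|P0] := le_or_lt (k * y + 2) 0; last exact: inner.
have ky : k * y <= -2 by clear -P0; lra.
have k2 : 0 <= k * x ^+ 2 by rewrite mulr_ge0 ?sqr_ge0 // ltW.
have yneg : y < 0.
  by rewrite -(pmulr_rlt0 _ k0); clear -ky; lra.
have yP : 0 <= y * (k * y + 2) by rewrite mulr_le0 // ltW.
have x20 : k * x ^+ 2 = 0.
  by apply: le_anti; rewrite k2 andbT; move: F; rewrite /conic; clear -yP; lra.
have x0 : x = 0.
  by move/eqP: x20; rewrite mulf_eq0 (gt_eqF k0) sqrf_eq0 => /eqP.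
have yP0 : y * (k * y + 2) = 0.
  by apply: le_anti; rewrite yP andbT; move: F; rewrite /conic; clear -x20; lra.
have yE : k * y = -2.
  by move/eqP: yP0; rewrite mulf_eq0 (lt_eqF yneg) => /eqP; clear; lra.
apply: clA => e e0.
pose z := Num.min e (1 / k).
have z0 : 0 < z by rewrite lt_min e0 divr_gt0.
have ze : z <= e by rewrite ge_min lexx.
have zk : z * k <= 1 by rewrite -ler_pdivlMr // ge_min lexx orbT.
clearbody z; exists 0, (y + z); split.
- by rewrite x0 subrr normr0 ltW.
- by rewrite addrAC subrr add0r gtr0_norm.
have kz : 0 < k * z by rewrite mulr_gt0.
apply: inner; first by rewrite mulrDr yE; clear -kz; lra.
rewrite /conic expr0n add0r.
have -> : 2 * (y + z) + k * (y + z) ^+ 2 = (y + z) * (2 + k * y + k * z) by ring.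
rewrite yE.
have -> : 2 + -2 + k * z = k * z by ring.
rewrite mulr_le0_ge0 ?(ltW kz) // -(pmulr_rle0 _ k0) mulrDr yE.
by clear -zk; lra.
Qed.

Definition round (R : realType) (A : R -> R -> Prop) :=
  disk2 A \/ half_plane2 A \/ strip2 A.

Lemma disk_rigid (R : realType) (c s u v a b r : R) :
  c ^+ 2 + s ^+ 2 = 1 ->
  rigid c s u v (disk_at a b r) =
  disk_at (c * (a - u) + s * (b - v)) (c * (b - v) - s * (a - u)) r.
Proof.
move=> cs; apply: eq_region => x y; rewrite /rigid /disk_at.
suff -> : (c * x - s * y + u - a) ^+ 2 + (s * x + c * y + v - b) ^+ 2 =
  (x - (c * (a - u) + s * (b - v))) ^+ 2 + (y - (c * (b - v) - s * (a - u))) ^+ 2 by [].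
transitivity ((c ^+ 2 + s ^+ 2) * (x ^+ 2 + y ^+ 2) + (a - u) ^+ 2 + (b - v) ^+ 2 -
  2 * (c * x - s * y) * (a - u) - 2 * (s * x + c * y) * (b - v)); first by ring.
transitivity (x ^+ 2 + y ^+ 2 + (c ^+ 2 + s ^+ 2) * ((a - u) ^+ 2 + (b - v) ^+ 2) -
  2 * (c * x - s * y) * (a - u) - 2 * (s * x + c * y) * (b - v)); last by ring.
by rewrite cs !mul1r !addrA.
Qed.

Lemma half_plane_rigid (R : realType) (c s u v n1 n2 d : R) :
  rigid c s u v (half_plane_at n1 n2 d) =
  half_plane_at (c * n1 + s * n2) (c * n2 - s * n1) (d - n1 * u - n2 * v).
Proof.
by apply: eq_region => x y; rewrite /rigid /half_plane_at; clear; split; lra.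
Qed.

Lemma strip_rigid (R : realType) (c s u v n1 n2 d e : R) :
  rigid c s u v (strip_at n1 n2 d e) =
  strip_at (c * n1 + s * n2) (c * n2 - s * n1)
    (d - n1 * u - n2 * v) (e - n1 * u - n2 * v).
Proof.
apply: eq_region => x y; rewrite /rigid /strip_at.
by clear; split=> -[h1 h2]; split; lra.
Qed.

Lemma unit_rotation (R : realType) (c s n1 n2 : R) :
  c ^+ 2 + s ^+ 2 = 1 -> n1 ^+ 2 + n2 ^+ 2 = 1 ->
  (c * n1 + s * n2) ^+ 2 + (c * n2 - s * n1) ^+ 2 = 1.
Proof.
move=> cs nn.
by transitivity ((c ^+ 2 + s ^+ 2) * (n1 ^+ 2 + n2 ^+ 2)); [ring|rewrite cs nn mulr1].
Qed.

Lemma round_rigid (R : realType) c s u v (A : R -> R -> Prop) :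
  c ^+ 2 + s ^+ 2 = 1 -> round A -> round (rigid c s u v A).
Proof.
move=> cs [[a [b [r [r0 ->]]]]|[[n1 [n2 [d [nn ->]]]]|[n1 [n2 [d [e [nn de ->]]]]]]].
- left; rewrite disk_rigid //.
  by exists (c * (a - u) + s * (b - v)), (c * (b - v) - s * (a - u)), r.
- right; left; rewrite half_plane_rigid.
  exists (c * n1 + s * n2), (c * n2 - s * n1), (d - n1 * u - n2 * v).
  by rewrite unit_rotation.
- right; right; rewrite strip_rigid.
  exists (c * n1 + s * n2), (c * n2 - s * n1), (d - n1 * u - n2 * v), (e - n1 * u - n2 * v).
  by rewrite unit_rotation // !ltrD2r.
Qed.

Lemma osculated_rigid_inv (R : realType) (A : R -> R -> Prop) c s u v x y n1 n2 k :
  c ^+ 2 + s ^+ 2 = 1 ->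
  osculated A (c * x - s * y + u) (s * x + c * y + v) n1 n2 k ->
  osculated (rigid c s u v A) x y (c * n1 + s * n2) (c * n2 - s * n1) k.
Proof.
move=> cs; rewrite -[in X in X -> _](rigid_inv u v A cs) => osc.
have cs' : c ^+ 2 + (- s) ^+ 2 = 1 by rewrite sqrrN.
have := osculated_rigid cs' osc; congr (osculated _ _ _ _ _ _).
- by transitivity ((c ^+ 2 + s ^+ 2) * x); [ring|rewrite cs mul1r].
- by transitivity ((c ^+ 2 + s ^+ 2) * y); [ring|rewrite cs mul1r].
- by ring.
- by ring.
Qed.

(** A closed convex set containing the axis [y = 0] is invariant under horizontal translations, so
    its section by the vertical axis determines it: an unbounded section gives a half-plane, a
    bounded one a strip, whose second edge appears here. *)
Lemma conic_line (R : realType) (A : R -> R -> Prop) (xi yi : R) :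
  pclosed A -> pconvex A -> pinterior A xi yi -> (forall t, follows_conic A 0 t) ->
  round A.
Proof.
move=> clA cA [r r0 iA] fc.
have Ale x y : A x y -> y <= 0.
  move=> Axy; have := conic_support cA (lexx _) (fc 0) Axy.
  by rewrite !mulr0 !mul0r subr0 addr0.
have A0 x : A x 0.
  have [+ _] := follows_conic_boundary (lexx _) (fc (x / 2)).
  have -> : conic_x 0 (x / 2) = x by rewrite /conic_x; field.
  by have -> : conic_y 0 (x / 2) = 0 by rewrite /conic_y; field.
have shift a b x : A a b -> A x b.
  move=> Aab; apply: clA => e e0.
  (* Weight of the point (a, b) against a far point of the axis complements to 1: the combination
     moves to the abscissa [x], while the height changes by [t * b] only. *)
  pose t := Num.min 1 (e / (`|b| + 1)).
  have b1 : 0 < `|b| + 1 by rewrite ltr_wpDl.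
  have t0 : 0 < t by rewrite lt_min ltr01 divr_gt0.
  have t1 : t <= 1 by rewrite ge_min lexx.
  have te : t * (`|b| + 1) <= e by rewrite -ler_pdivlMr // ge_min lexx orbT.
  clearbody t; exists x, (b - t * b); split.
  - by rewrite subrr normr0 ltW.
  - rewrite addrAC subrr sub0r normrN normrM gtr0_norm //.
    by rewrite (le_trans _ te) // ler_wpM2l ?(ltW t0) // lerDl.
  have := cA a b (a + (x - a) / t) 0 t (ltW t0) t1 Aab (A0 _).
  have -> : a + t * (a + (x - a) / t - a) = x by field; rewrite gt_eqF.
  by rewrite sub0r mulrN.
have [all|] := pselect (forall y, y <= 0 -> A 0 y).
  right; left; exists 0, 1, 0; split; first by rewrite expr0n add0r expr1n.
  apply: eq_region => x y; rewrite /half_plane_at mul0r add0r mul1r; split; first exact: Ale.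
  by move=> /all; exact: shift.
move=> nall; right; right.
have [y0 [y0n nA]] : exists y0, y0 <= 0 /\ ~ A 0 y0.
  apply: contrapT => h; apply: nall => y y0; apply: contrapT => nA.
  by apply: h; exists y.
have seg y z : A 0 y -> y <= z -> z <= 0 -> A 0 z.
  move=> Ay yz z0; have [yy|yy] := le_or_lt 0 y.
    have -> : z = 0 by apply: le_anti; rewrite z0 (le_trans yy).
    exact: A0.
  have := cA 0 y 0 0 ((z - y) / - y) _ _ Ay (A0 0).
  have -> : y + (z - y) / - y * (0 - y) = z by field; rewrite lt_eqF.
  rewrite subrr mulr0 addr0; apply.
  - by rewrite divr_ge0 ?subr_ge0 // oppr_ge0 ltW.
  - by rewrite ler_pdivrMr ?oppr_gt0 // mul1r gerDr.
have [|m [m1 m2]] := @inf_exists R (A 0) 0 y0 (A0 0).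
  by move=> y Ay; rewrite leNgt; apply/negP => h; apply: nA; apply: (seg y) => //; apply: ltW.
have h1 : m <= yi - r.
  apply: m1; apply: (shift xi); apply: iA; first by rewrite subrr normr0 ltW.
  by rewrite addrAC subrr sub0r normrN gtr0_norm.
have h2 : yi + r <= 0.
  apply: (Ale xi); apply: iA; first by rewrite subrr normr0 ltW.
  by rewrite addrAC subrr add0r gtr0_norm.
exists 0, 1, m, 0; split; [by rewrite expr0n add0r expr1n|by clear -h1 h2 r0; lra|].
apply: eq_region => x y; rewrite /strip_at mul0r add0r mul1r; split.
  by move=> Axy; split; [apply: m1; exact: (shift x)|exact: Ale Axy].
move=> [my y0']; apply: (shift 0).
move: my; rewrite le_eqVlt => /orP[/eqP <-|my]; last first.
  by have [z Az zy] := m2 y my; apply: (seg z) => //; apply: ltW.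
apply: clA => e e0; have [|z Az zm] := m2 (m + e); first by rewrite ltrDl.
exists 0, z; split=> //; first by rewrite subrr normr0 ltW.
have mz := m1 z Az; rewrite ger0_norm ?subr_ge0 // lerBlDl; exact: ltW.
Qed.

Lemma round_of_symmetric (R : realType) (A B : R -> R -> Prop)
    (xi yi xo yo xj yj xo' yo' : R) :
  symmetric_meets A B -> pclosed A -> pconvex A -> pclosed B -> pconvex B ->
  pinterior A xi yi -> ~ A xo yo -> pinterior B xj yj -> ~ B xo' yo' -> round A.
Proof.
move=> sym clA cA clB cB iA oA iB oB.
have int (C : R -> R -> Prop) x y : pinterior C x y -> C x y.
  by move=> [r r0 h]; apply: h; rewrite subrr normr0 ltW.
have [p [q [Ap bp]]] := proper_boundary clA (int _ _ _ iA) oA.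
have [p' [q' [Bp bp']]] := proper_boundary clB (int _ _ _ iB) oB.
have osc x y : A x y -> ~ pinterior A x y -> exists n1 n2 k,
    [/\ n1 ^+ 2 + n2 ^+ 2 = 1, 0 <= k & osculated A x y n1 n2 k].
  by move=> Axy bxy; exact: (boundary_osculated sym clA cA clB cB Axy bxy iA Bp bp' iB).
have [n1 [n2 [k [nn k0 O]]]] := osc p q Ap bp.
(* This rotation turns the outer normal (n1, n2) at the boundary point into (0, 1). *)
have cs : n2 ^+ 2 + (- n1) ^+ 2 = 1 by rewrite sqrrN addrC.
have cs' : n2 ^+ 2 + (- - n1) ^+ 2 = 1 by rewrite opprK addrC.
rewrite -(rigid_inv p q A cs); apply: round_rigid => //.
have clC := rigid_closed (u := p) (v := q) cs clA.
have cC := rigid_convex (c := n2) (s := - n1) (u := p) (v := q) cA.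
have iC := iA; rewrite -(rigid_inv p q A cs) in iC.
have {}iC := rigid_interior_inv cs' iC.
have fc : forall t, follows_conic (rigid n2 (- n1) p q A) k t.
  apply: follows_conic_everywhere => //.
    have := @osculated_rigid_inv R A n2 (- n1) p q 0 0 n1 n2 k cs.
    rewrite !mulr0 subrr !add0r => /(_ O).
    have -> : n2 * n1 + - n1 * n2 = 0 by ring.
    by have -> : n2 * n2 - - n1 * n1 = 1 by rewrite -nn; ring.
  move=> x y Cxy bxy; have [|m1 [m2 [k' [mm k0' O']]]] := osc _ _ Cxy.
    by move=> ixy; apply: bxy; exact: rigid_interior.
  exists (n2 * m1 + - n1 * m2), (n2 * m2 - - n1 * m1), k'; split=> //.
    by transitivity ((n1 ^+ 2 + n2 ^+ 2) * (m1 ^+ 2 + m2 ^+ 2)); [ring|rewrite nn mm mulr1].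
  exact: osculated_rigid_inv.
move: k0; rewrite le_eqVlt => /orP[/eqP k0|k0].
  by subst k; exact: (conic_line clC cC iC fc).
have CE := conic_disk clC cC k0 fc; left; exists 0, (- k^-1), k^-1.
split; first by rewrite invr_gt0.
apply: eq_region => x y; rewrite CE -(pmulr_rle0 _ (_ : 0 < k^-1)) ?invr_gt0 //.
have -> : k^-1 * conic k x y = (x - 0) ^+ 2 + (y - - k^-1) ^+ 2 - k^-1 ^+ 2.
  by rewrite /conic; field; rewrite gt_eqF.
by rewrite subr_le0.
Qed.

(** * Explicit positions *)

Definition meet (R : realType) (A B : R -> R -> Prop) x y := A x y /\ B x y.

Definition placed (R : realType) (A A' : R -> R -> Prop) :=
  exists c s u v, c ^+ 2 + s ^+ 2 = 1 /\ A' = rigid c s u v A.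

Definition at_all_positions (R : realType) (A B : R -> R -> Prop)
    (P : (R -> R -> Prop) -> Prop) :=
  forall A' B', placed A A' -> placed B B' ->
  (exists x y, pinterior (meet A' B') x y) -> P (meet A' B').

Lemma meetC (R : realType) (A B : R -> R -> Prop) : meet A B = meet B A.
Proof. by apply: eq_region => x y; split=> -[]. Qed.

Lemma at_all_positionsC (R : realType) (A B : R -> R -> Prop) P :
  at_all_positions A B P -> at_all_positions B A P.
Proof. by move=> H B' A' pB pA; rewrite meetC; exact: H. Qed.

Lemma symmetric_meetsP (R : realType) (A B : R -> R -> Prop) :
  at_all_positions A B (@nontrivially_symmetric R) -> symmetric_meets A B.
Proof.
move=> H c s u v c' s' u' v' cs cs' M int; apply: H int; first by exists c, s, u, v.
by exists c', s', u', v'.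
Qed.

Lemma placed_disk (R : realType) (a b r a' b' : R) :
  placed (disk_at a b r) (disk_at a' b' r).
Proof.
exists 1, 0, (a - a'), (b - b'); rewrite expr1n expr0n addr0; split=> //.
rewrite disk_rigid; last by rewrite expr1n expr0n addr0.
by congr disk_at; ring.
Qed.

Lemma placed_strip (R : realType) (n1 n2 m1 m2 c d e : R) :
  n1 ^+ 2 + n2 ^+ 2 = 1 -> m1 ^+ 2 + m2 ^+ 2 = 1 ->
  placed (strip_at n1 n2 c d) (strip_at m1 m2 e (e + (d - c))).
Proof.
move=> nn mm.
exists (n1 * m1 + n2 * m2), (m1 * n2 - m2 * n1), (n1 * (c - e)), (n2 * (c - e)); split.
  by transitivity ((n1 ^+ 2 + n2 ^+ 2) * (m1 ^+ 2 + m2 ^+ 2)); [ring|rewrite nn mm mulr1].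
rewrite strip_rigid; congr strip_at.
- by transitivity ((n1 ^+ 2 + n2 ^+ 2) * m1); [rewrite nn mul1r|ring].
- by transitivity ((n1 ^+ 2 + n2 ^+ 2) * m2); [rewrite nn mul1r|ring].
- transitivity (c - (n1 ^+ 2 + n2 ^+ 2) * (c - e)); last by ring.
  by rewrite nn; ring.
- transitivity (d - (n1 ^+ 2 + n2 ^+ 2) * (c - e)); last by ring.
  by rewrite nn; ring.
Qed.

Lemma placed_half_plane (R : realType) (n1 n2 m1 m2 c e : R) :
  n1 ^+ 2 + n2 ^+ 2 = 1 -> m1 ^+ 2 + m2 ^+ 2 = 1 ->
  placed (half_plane_at n1 n2 c) (half_plane_at m1 m2 e).
Proof.
move=> nn mm.
exists (n1 * m1 + n2 * m2), (m1 * n2 - m2 * n1), (n1 * (c - e)), (n2 * (c - e)); split.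
  by transitivity ((n1 ^+ 2 + n2 ^+ 2) * (m1 ^+ 2 + m2 ^+ 2)); [ring|rewrite nn mm mulr1].
rewrite half_plane_rigid; congr half_plane_at.
- by transitivity ((n1 ^+ 2 + n2 ^+ 2) * m1); [rewrite nn mul1r|ring].
- by transitivity ((n1 ^+ 2 + n2 ^+ 2) * m2); [rewrite nn mul1r|ring].
- transitivity (c - (n1 ^+ 2 + n2 ^+ 2) * (c - e)); last by ring.
  by rewrite nn; ring.
Qed.

Lemma interior_meet (R : realType) (A B : R -> R -> Prop) x y :
  pinterior A x y -> pinterior B x y -> pinterior (meet A B) x y.
Proof.
move=> [r r0 hA] [t t0 hB]; exists (Num.min r t); first by rewrite lt_min r0.
by move=> x' y'; rewrite !le_min => /andP[h1 h2] /andP[h3 h4]; split; [exact: hA|exact: hB].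
Qed.

Lemma interior_half_plane (R : realType) (n1 n2 c x y : R) :
  n1 * x + n2 * y < c -> pinterior (half_plane_at n1 n2 c) x y.
Proof.
move=> h; pose N := `|n1| + `|n2| + 1.
have N0 : 0 < N by rewrite /N ltr_wpDl // addr_ge0.
pose r := (c - (n1 * x + n2 * y)) / N.
have r0 : 0 < r by rewrite divr_gt0 // subr_gt0.
have rN : r * N = c - (n1 * x + n2 * y) by rewrite divfK // gt_eqF.
exists r => // x' y' hx hy; rewrite /half_plane_at.
have h1 : n1 * (x' - x) <= `|n1| * r.
  by rewrite (le_trans (ler_norm _)) // normrM ler_wpM2l.
have h2 : n2 * (y' - y) <= `|n2| * r.
  by rewrite (le_trans (ler_norm _)) // normrM ler_wpM2l.
by rewrite /N in rN; clear -h1 h2 rN r0; clearbody r; lra.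
Qed.

Lemma interior_disk (R : realType) (a b r x y : R) :
  (x - a) ^+ 2 + (y - b) ^+ 2 < r ^+ 2 -> pinterior (disk_at a b r) x y.
Proof.
move=> h; pose N := 2 * `|x - a| + 2 * `|y - b| + 2.
have N0 : 0 < N by rewrite /N ltr_wpDl // addr_ge0 // mulr_ge0.
pose g := r ^+ 2 - ((x - a) ^+ 2 + (y - b) ^+ 2).
have g0 : 0 < g by rewrite subr_gt0.
pose t := Num.min 1 (g / N).
have t0 : 0 < t by rewrite lt_min ltr01 divr_gt0.
have t1 : t <= 1 by rewrite ge_min lexx.
have tN : t * N <= g by rewrite -ler_pdivlMr // ge_min lexx orbT.
exists t => // x' y' hx hy; rewrite /disk_at.
have h1 : (x - a) * (x' - x) <= `|x - a| * t.
  by rewrite (le_trans (ler_norm _)) // normrM ler_wpM2l.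
have h2 : (y - b) * (y' - y) <= `|y - b| * t.
  by rewrite (le_trans (ler_norm _)) // normrM ler_wpM2l.
have sq (z : R) : `|z| <= t -> z ^+ 2 <= t.
  move=> zt; rewrite -real_normK ?num_real // (le_trans (_ : _ <= t ^+ 2)) //.
    by rewrite ler_sqr ?nnegrE // ltW.
  by rewrite expr2 ler_piMr // ltW.
have h3 := sq _ hx; have h4 := sq _ hy.
rewrite /g /N in tN; clear -h1 h2 h3 h4 tN; clearbody t.
by move: `|x - a| `|y - b| h1 h2 tN => p q h1 h2 tN; lra.
Qed.

Lemma strip_meet (R : realType) (n1 n2 c d : R) :
  strip_at n1 n2 c d = meet (half_plane_at n1 n2 d) (half_plane_at (- n1) (- n2) (- c)).
Proof.
apply: eq_region => x y; rewrite /strip_at /meet /half_plane_at.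
by split=> -[h1 h2]; split=> //; clear -h1 h2; lra.
Qed.

Lemma interior_strip (R : realType) (n1 n2 c d x y : R) :
  c < n1 * x + n2 * y -> n1 * x + n2 * y < d -> pinterior (strip_at n1 n2 c d) x y.
Proof.
move=> h1 h2; rewrite strip_meet; apply: interior_meet; apply: interior_half_plane => //.
by clear -h1; lra.
Qed.

Definition central2 (R : realType) (M : R -> R -> Prop) :=
  exists p q, forall x y, M x y -> M (2 * p - x) (2 * q - y).

Definition axial2 (R : realType) (M : R -> R -> Prop) :=
  exists n1 n2 c, n1 ^+ 2 + n2 ^+ 2 = 1 /\ forall x y, M x y ->
    M (x - 2 * (n1 * x + n2 * y - c) * n1) (y - 2 * (n1 * x + n2 * y - c) * n2).

(** An isometry invariant that singles out the corners of angle at most 90 degrees. *)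
Definition sharp (R : realType) (M : R -> R -> Prop) x y :=
  M x y /\ forall a b a' b', M a b -> M a' b' ->
    0 <= (a - x) * (a' - x) + (b - y) * (b' - y).

Lemma sharp_image (R : realType) (M : R -> R -> Prop) fx fy x y :
  isometry2 fx fy -> self_map fx fy M -> sharp M x y -> sharp M (fx x y) (fy x y).
Proof.
move=> iso [f1 f2] [Mxy H]; split; first exact: f1.
move=> a b a' b' /f2[a1 [b1 [M1 <- <-]]] /f2[a2 [b2 [M2 <- <-]]].
by rewrite isometry2_dot //; exact: H.
Qed.

(** The right triangle with sides 3, 4, 5 supplies an oblique direction with rational
    coordinates. *)
Lemma unit_3_4 (R : realType) : (- (4 / 5)) ^+ 2 + (3 / 5) ^+ 2 = 1 :> R.
Proof. by field. Qed.

Lemma unit_0_1 (R : realType) : 0 ^+ 2 + 1 ^+ 2 = 1 :> R.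
Proof. by ring. Qed.

(** The acute corner at the origin is the only sharp point, hence fixed. The horizontal ray from it
    is fixed too, as the set is unbounded in no other direction, and the remaining candidate, the
    reflection in this ray, leaves the set. *)
Lemma wedge_strip_asymmetric (R : realType) (M : R -> R -> Prop) (w : R) : 0 < w ->
  (forall x y, M x y <-> [/\ 0 <= y, y <= w & 3 * y <= 4 * x]) ->
  ~ nontrivially_symmetric M.
Proof.
move=> w0 MP [fx [fy [iso nid sm]]].
have M0 t : 0 <= t -> M t 0.
  by move=> t0; apply/MP; split; rewrite ?(ltW w0) // mulr0 mulr_ge0.
have sh0 : sharp M 0 0.
  split; first exact: M0.
  move=> a b a' b' /MP[h1 _ h2] /MP[h3 _ h4]; rewrite !subr0.
  have ha : 0 <= a by clear -h1 h2; lra.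
  have ha' : 0 <= a' by clear -h3 h4; lra.
  by rewrite addr_ge0 // mulr_ge0.
have [Mf shf] := sharp_image iso sm sh0; have [f1 _] := sm.
have [fx0 fy0] : fx 0 0 = 0 /\ fy 0 0 = 0.
  move: (fx 0 0) (fy 0 0) Mf shf => p q /MP[h1 h2 h3] H.
  have Mp : M (p + 1) q by apply/MP; split=> //; clear -h3; lra.
  have p0 := H _ _ _ _ Mp (M0 0 (lexx _)).
  by split; apply: le_anti; apply/andP; split; clear -p0 h1 h3; lra.
pose p := fx 1 0; pose q := fy 1 0.
have pq : p ^+ 2 + q ^+ 2 = 1.
  by have := iso 1 0 0 0; rewrite fx0 fy0 !subr0 expr1n expr0n addr0.
have ray t : fx t 0 = t * p /\ fy t 0 = t * q.
  have h1 := isometry2_dot 0 0 t 0 1 0 iso; have h2 := iso t 0 0 0.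
  rewrite fx0 fy0 !subr0 -/p -/q !(mulr0, addr0) mulr1 in h1.
  rewrite fx0 fy0 !subr0 expr0n addr0 in h2.
  have : (fx t 0 - t * p) ^+ 2 + (fy t 0 - t * q) ^+ 2 = 0.
    transitivity (fx t 0 ^+ 2 + fy t 0 ^+ 2 - 2 * t * (fx t 0 * p + fy t 0 * q) +
      t ^+ 2 * (p ^+ 2 + q ^+ 2)); first by ring.
    by rewrite h1 h2 pq; ring.
  move/eqP; rewrite paddr_eq0 ?sqr_ge0 // !sqrf_eq0 !subr_eq0.
  by case/andP => /eqP -> /eqP ->.
have /MP[q0 _ qp] := f1 1 0 (M0 _ ler01); rewrite -/q -/p in q0 qp.
have qz : q = 0.
  apply: le_anti; rewrite q0 andbT leNgt; apply/negP => q1.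
  have t0 : 0 <= (w + 1) / q by rewrite divr_ge0 // ltW // addr_gt0.
  have /MP[_ + _] := f1 _ _ (M0 _ t0); have [_ ->] := ray ((w + 1) / q).
  by rewrite divfK ?gt_eqF // leNgt ltrDl ltr01.
have p1 : p = 1.
  move/eqP: pq; rewrite qz expr0n addr0 sqrf_eq1 => /orP[/eqP //|/eqP pE].
  by exfalso; rewrite pE qz in qp; clear -qp; lra.
have [sg [E|E] H] := isometry2_fix iso (oner_neq0 R) fx0 fy0 p1 qz.
  by apply: nid => x y; have [-> ->] := H x y; rewrite E mul1r.
have Mw : M (3 / 4 * w) w by apply/MP; split; rewrite ?(ltW w0) //; clear; lra.
have /MP[+ _ _] := f1 _ _ Mw; have [_ ->] := H (3 / 4 * w) w.
by rewrite E mulN1r oppr_ge0 leNgt w0.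
Qed.

Lemma strip_half_plane_asymmetric (R : realType) (n1 n2 c d m1 m2 e : R) :
  n1 ^+ 2 + n2 ^+ 2 = 1 -> c < d -> m1 ^+ 2 + m2 ^+ 2 = 1 ->
  ~ at_all_positions (strip_at n1 n2 c d) (half_plane_at m1 m2 e)
      (@nontrivially_symmetric R).
Proof.
move=> nn cd mm H; have w0 : 0 < d - c by rewrite subr_gt0.
have := H _ _ (placed_strip c d 0 nn (unit_0_1 R)) (placed_half_plane e 0 mm (unit_3_4 R)).
rewrite add0r; move: (d - c) w0 => w w0 K; apply: (wedge_strip_asymmetric w0 _ (K _)).
  move=> x y; rewrite /meet /strip_at /half_plane_at !(mul0r, add0r, mul1r).
  by clear; split=> [[[h1 h2] h3]|[h1 h2 h3]]; split=> //; lra.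
exists w, (w / 2); apply: interior_meet.
  by apply: interior_strip; clear -w0; lra.
by apply: interior_half_plane; clear -w0; lra.
Qed.

(* The centre of symmetry of M bisects the vertical diameter of the disk. *)
Lemma diameter_not_central (R : realType) (M : R -> R -> Prop) (r x y : R) :
  (forall x y, M x y -> x ^+ 2 + y ^+ 2 <= r ^+ 2) -> M 0 r -> M 0 (- r) ->
  M x y -> ~ M (- x) (- y) -> ~ central2 M.
Proof.
move=> MD M1 M2 M3 nM [p [q H]].
have h1 := MD _ _ (H _ _ M1); have h2 := MD _ _ (H _ _ M2).
have pq : p ^+ 2 + q ^+ 2 = 0.
  apply: le_anti; rewrite addr_ge0 ?sqr_ge0 // andbT.
  by clear -h1 h2; lra.
move/eqP: pq; rewrite paddr_eq0 ?sqr_ge0 // !sqrf_eq0 => /andP[/eqP p0 /eqP q0].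
by apply: nM; have := H _ _ M3; rewrite p0 q0 mulr0 !sub0r.
Qed.

(** With the centres at distance [s], where [s ^+ 2 = r' ^+ 2 - r ^+ 2], the larger circle passes
    through the ends of a diameter of the smaller one. *)
Lemma unequal_disks_not_central (R : realType) (a b r a' b' r' : R) :
  0 < r -> r < r' -> ~ at_all_positions (disk_at a b r) (disk_at a' b' r') (@central2 R).
Proof.
move=> r0 rr H; have r0' : 0 < r' by exact: lt_trans rr.
pose D := r' ^+ 2 - r ^+ 2.
have D0 : 0 < D by rewrite subr_gt0 ltr_sqr // nnegrE ltW.
pose s := Num.sqrt D; have s0 : 0 < s by rewrite sqrtr_gt0.
have sD : s ^+ 2 = r' ^+ 2 - r ^+ 2 by rewrite sqr_sqrtr // ltW.
have rs : 0 < r * s by rewrite mulr_gt0.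
have r2 : 0 < r ^+ 2 by rewrite exprn_gt0.
clearbody s; clear D D0.
have K := H _ _ (placed_disk a b r 0 0) (placed_disk a' b' r' s 0).
apply: (diameter_not_central (r := r) (x := r) (y := 0) _ _ _ _ _ (K _)).
- by move=> x y [+ _]; rewrite /disk_at !subr0.
- by split; rewrite /disk_at; clear -sD; lra.
- by split; rewrite /disk_at; clear -sD; lra.
- by split; rewrite /disk_at; clear -sD rs r2; lra.
- by move=> [_]; rewrite /disk_at; clear -sD rs; lra.
- exists (r / 2), 0; apply: interior_meet; apply: interior_disk.
    by clear -r2; lra.
  by clear -sD rs r2; lra.
Qed.

(** The edge of the half-plane is placed through the centre of the disk. *)
Lemma disk_half_plane_not_central (R : realType) (a b r n1 n2 c : R) :
  0 < r -> n1 ^+ 2 + n2 ^+ 2 = 1 ->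
  ~ at_all_positions (disk_at a b r) (half_plane_at n1 n2 c) (@central2 R).
Proof.
move=> r0 nn H; have u : (-1) ^+ 2 + 0 ^+ 2 = 1 :> R by ring.
have r2 : 0 < r ^+ 2 by rewrite exprn_gt0.
have K := H _ _ (placed_disk a b r 0 0) (placed_half_plane c 0 nn u).
apply: (diameter_not_central (r := r) (x := r) (y := 0) _ _ _ _ _ (K _)).
- by move=> x y [+ _]; rewrite /disk_at !subr0.
- by split; rewrite /disk_at /half_plane_at; clear; lra.
- by split; rewrite /disk_at /half_plane_at; clear; lra.
- by split; rewrite /disk_at /half_plane_at; clear -r0; lra.
- by move=> [_]; rewrite /half_plane_at; clear -r0; lra.
- exists (r / 2), 0; apply: interior_meet.
    by apply: interior_disk; clear -r2; lra.
  by apply: interior_half_plane; clear -r0; lra.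
Qed.

Lemma disk_strip_not_central (R : realType) (a b r n1 n2 c d : R) :
  0 < r -> n1 ^+ 2 + n2 ^+ 2 = 1 -> c < d ->
  ~ at_all_positions (disk_at a b r) (strip_at n1 n2 c d) (@central2 R).
Proof.
move=> r0 nn cd H; have u : 1 ^+ 2 + 0 ^+ 2 = 1 :> R by ring.
have r2 : 0 < r ^+ 2 by rewrite exprn_gt0.
have K := H _ _ (placed_disk a b r 0 0) (placed_strip c d 0 nn u).
(* One edge of the strip passes through the centre of the disk; the point (z, 0) is within both
   sets, its opposite is outside the strip. *)
pose z := Num.min r (d - c).
have z0 : 0 < z by rewrite lt_min r0 subr_gt0.
have zr : z <= r by rewrite ge_min lexx.
have zw : z <= d - c by rewrite ge_min lexx orbT.
have zz : z ^+ 2 <= r ^+ 2 by rewrite ler_sqr // nnegrE ltW.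
clearbody z.
apply: (diameter_not_central (r := r) (x := z) (y := 0) _ _ _ _ _ (K _)).
- by move=> x y [+ _]; rewrite /disk_at !subr0.
- by split; rewrite /disk_at /strip_at; clear -cd; [lra|split; lra].
- by split; rewrite /disk_at /strip_at; clear -cd; [lra|split; lra].
- by split; rewrite /disk_at /strip_at; clear -zz z0 zw; [lra|split; lra].
- by move=> [_]; rewrite /strip_at; clear -z0; lra.
- exists (z / 2), 0; apply: interior_meet.
    by apply: interior_disk; clear -r2 zz; lra.
  by apply: interior_strip; clear -z0 zw; lra.
Qed.

(** Both are moved to the same half-plane, which has no centre of symmetry. *)
Lemma half_planes_not_central (R : realType) (n1 n2 c m1 m2 d : R) :
  n1 ^+ 2 + n2 ^+ 2 = 1 -> m1 ^+ 2 + m2 ^+ 2 = 1 ->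
  ~ at_all_positions (half_plane_at n1 n2 c) (half_plane_at m1 m2 d) (@central2 R).
Proof.
move=> nn mm H.
have K := H _ _ (placed_half_plane c 0 nn (unit_0_1 R)) (placed_half_plane d 0 mm (unit_0_1 R)).
have [|p [q h]] := K.
  by exists 0, (-1); apply: interior_meet; apply: interior_half_plane; clear; lra.
have ME (x y : R) : y <= 0 -> meet (half_plane_at 0 1 0) (half_plane_at 0 1 0) x y.
  by move=> y0; split; rewrite /half_plane_at; clear -y0; lra.
have [q0 _] := h 0 0 (ME 0 0 (lexx 0)); rewrite /half_plane_at in q0.
have T : 2 * q - 1 <= 0 by clear -q0; lra.
have [+ _] := h 0 (2 * q - 1) (ME 0 _ T).
by rewrite /half_plane_at; clear; lra.
Qed.

Lemma reflection_self_map (R : realType) (M : R -> R -> Prop) (n1 n2 c : R) :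
  n1 ^+ 2 + n2 ^+ 2 = 1 ->
  let fx x y := x - 2 * (n1 * x + n2 * y - c) * n1 in
  let fy x y := y - 2 * (n1 * x + n2 * y - c) * n2 in
  (forall x y, M x y -> M (fx x y) (fy x y)) -> isometry2 fx fy /\ self_map fx fy M.
Proof.
move=> nn fx fy H.
have val x y : n1 * fx x y + n2 * fy x y - c = - (n1 * x + n2 * y - c).
  transitivity (n1 * x + n2 * y - c - 2 * (n1 * x + n2 * y - c) * (n1 ^+ 2 + n2 ^+ 2)).
    by rewrite /fx /fy; ring.
  by rewrite nn; ring.
split; last split=> //.
  move=> x y x' y'.
  transitivity ((x - x') ^+ 2 + (y - y') ^+ 2 + 4 * (n1 * (x - x') + n2 * (y - y')) ^+ 2 *
    (n1 ^+ 2 + n2 ^+ 2 - 1)); first by rewrite /fx /fy; ring.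
  by rewrite nn; ring.
move=> x y Mxy; exists (fx x y), (fy x y); split; first exact: H.
- by rewrite {1}/fx val /fx; ring.
- by rewrite {1}/fy val /fy; ring.
Qed.

(* The acute vertices O and Q are the only sharp points, and the obtuse
   vertices maximise the distance to the diagonal OQ on its two sides; a
   reflection preserving M makes all four sides equally long. *)
Lemma parallelogram_axial (R : realType) (M : R -> R -> Prop) (w z : R) :
  0 < w -> 0 < z ->
  (forall x y, M x y <-> [/\ 0 <= y, y <= w, 0 <= 4 * x - 3 * y & 4 * x - 3 * y <= 5 * z]) ->
  axial2 M -> w = z.
Proof.
move=> w0 z0 MP [n1 [n2 [c [nn H]]]].
have [iso sm] := reflection_self_map nn H.
(* [a] is the horizontal side, the other side has length [5 / 4 * w], and (qx, w) is the corner [Q]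
   opposite to the origin. *)
pose a := 5 / 4 * z; pose qx := a + 3 / 4 * w.
have a0 : 0 < a by rewrite mulr_gt0 // divr_gt0.
have aE : 4 * a = 5 * z by rewrite /a; field.
clearbody a.
have Mp y t : 0 <= y -> y <= w -> 0 <= t -> t <= a -> M (3 / 4 * y + t) y.
  by move=> y0 yw t0 ta; apply/MP; split=> //; clear -t0 ta aE; lra.
have an : a != 0 by rewrite gt_eqF.
have wn : w != 0 by rewrite gt_eqF.
have M00 : M 0 0 by have := Mp 0 0; rewrite mulr0 addr0; apply; rewrite ?lexx ?(ltW w0) ?(ltW a0).
have Ma0 : M a 0 by have := Mp 0 a; rewrite mulr0 add0r; apply; rewrite ?lexx ?(ltW w0) ?(ltW a0).
have Mq : M qx w by rewrite /qx addrC; apply: Mp; rewrite ?lexx ?(ltW w0) ?(ltW a0).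
have Mb : M (3 / 4 * w) w by have := Mp w 0; rewrite addr0; apply; rewrite ?lexx ?(ltW w0) ?(ltW a0).
have shO : sharp M 0 0.
  split=> // x y x' y' /MP[h1 _ h2 _] /MP[h3 _ h4 _]; rewrite !subr0.
  have hx : 0 <= x by clear -h1 h2; lra.
  have hx' : 0 <= x' by clear -h3 h4; lra.
  by rewrite addr_ge0 // mulr_ge0.
have shQ : sharp M qx w.
  split=> // x y x' y' /MP[_ h1 _ h2] /MP[_ h3 _ h4].
  have hx : x <= qx by rewrite /qx; clear -h1 h2 aE; lra.
  have hx' : x' <= qx by rewrite /qx; clear -h3 h4 aE; lra.
  rewrite -subr_le0 in hx; rewrite -subr_le0 in hx'.
  rewrite -subr_le0 in h1; rewrite -subr_le0 in h3.
  by rewrite addr_ge0 // mulr_le0.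
have sharpE x y : sharp M x y -> (x = 0 /\ y = 0) \/ (x = qx /\ y = w).
  move=> [/MP[y0 yw h1 h2] S].
  have t1 : 0 <= x - 3 / 4 * y by clear -h1; lra.
  have t2 : 0 <= a + 3 / 4 * y - x by clear -h2 aE; lra.
  have Ml : M (3 / 4 * y) y by have := Mp y 0; rewrite addr0; apply; rewrite // ltW.
  have Mr : M (3 / 4 * y + a) y by apply: Mp; rewrite // ltW.
  have s1 := S _ _ _ _ Ml Mr.
  have : (x - 3 / 4 * y) * (a + 3 / 4 * y - x) = 0.
    by apply: le_anti; rewrite (mulr_ge0 t1 t2) andbT; clear -s1; lra.
  move/eqP; rewrite mulf_eq0 => /orP[] /eqP xE; [left|right].
    have {xE}xE : x = 3 / 4 * y by clear -xE; lra.
    have s2 := S _ _ _ _ M00 Mr; rewrite xE in s2.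
    have ay : a * y <= 0 by clear -s2; lra.
    have yz : y = 0 by apply: le_anti; rewrite y0 andbT -(pmulr_rle0 _ a0).
    by rewrite xE yz mulr0.
  have {xE}xE : x = 3 / 4 * y + a by clear -xE; lra.
  have s2 := S _ _ _ _ Mq Ml; rewrite xE in s2.
  have ay : a * (w - y) <= 0 by move: s2; rewrite /qx; clear; lra.
  rewrite pmulr_rle0 // subr_le0 in ay.
  have yE : y = w by apply: le_anti; rewrite yw ay.
  by rewrite xE yE /qx addrC.
(* [area] is twice the signed area of the triangle with side OQ. *)
pose area x y := qx * y - w * x.
have bound x y : M x y -> - (w * a) <= area x y /\ area x y <= w * a.
  move=> /MP[y0 yw h1 h2]; rewrite /area /qx.
  have ay : 0 <= a * y by rewrite mulr_ge0 // ltW.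
  have ay' : a * y <= a * w by rewrite ler_wpM2l // ltW.
  have h1' : 0 <= w * (4 * x - 3 * y) by rewrite mulr_ge0 // ltW.
  have h2' : w * (4 * x - 3 * y) <= w * (5 * z) by rewrite ler_wpM2l // ltW.
  by rewrite -aE in h2'; clear -ay ay' h1' h2'; split; lra.
have maxE x y : M x y -> area x y = w * a -> x = 3 / 4 * w /\ y = w.
  move=> /MP[y0 yw h1 h2]; rewrite /area /qx => E.
  have ay' : a * y <= a * w by rewrite ler_wpM2l // ltW.
  have h1' : 0 <= w * (4 * x - 3 * y) by rewrite mulr_ge0 // ltW.
  have E1 : a * y = a * w by apply: le_anti; rewrite ay'; clear -E h1'; lra.
  have E2 : w * (4 * x - 3 * y) = 0 by clear -E E1; lra.
  have yE : y = w by apply: (mulfI an).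
  by move/eqP: E2; rewrite mulf_eq0 gt_eqF //= yE => /eqP; clear; split=> //; lra.
have minE x y : M x y -> area x y = - (w * a) -> x = a /\ y = 0.
  move=> /MP[y0 yw h1 h2]; rewrite /area /qx => E.
  have ay : 0 <= a * y by rewrite mulr_ge0 // ltW.
  have h2' : w * (4 * x - 3 * y) <= w * (5 * z) by rewrite ler_wpM2l // ltW.
  rewrite -aE in h2'.
  have E1 : a * y = 0 by apply: le_anti; rewrite ay andbT; clear -E h2'; lra.
  have yE : y = 0 by move/eqP: E1; rewrite mulf_eq0 gt_eqF //= => /eqP.
  split=> //; apply: (mulfI wn).
  by move: E; rewrite yE; clear; lra.
have sideE : a ^+ 2 = (3 / 4 * w) ^+ 2 + w ^+ 2 -> w = z.
  move=> E; have : (4 * a) ^+ 2 = (5 * w) ^+ 2.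
    by rewrite exprMn E; field.
  have h1 : 0 <= 4 * a by rewrite mulr_ge0 // ltW.
  have h2 : 0 <= 5 * w by rewrite mulr_ge0 // ltW.
  by move/eqP; rewrite eqrXn2 // => /eqP; rewrite aE; clear; lra.
have areaP1 : area a 0 = - (w * a) by rewrite /area mulr0 sub0r.
have [f1 _] := sm; have MP1 := f1 _ _ Ma0.
have areaf x y : area (x - 2 * (n1 * x + n2 * y - c) * n1) (y - 2 * (n1 * x + n2 * y - c) * n2) =
    area x y - 2 * (n1 * x + n2 * y - c) * (qx * n2 - w * n1) by rewrite /area; ring.
have dO := iso a 0 0 0.
have O1 : 0 - 2 * (n1 * 0 + n2 * 0 - c) * n1 = 2 * c * n1 by ring.
have O2 : 0 - 2 * (n1 * 0 + n2 * 0 - c) * n2 = 2 * c * n2 by ring.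
have := sharpE _ _ (sharp_image iso sm shO); rewrite O1 O2 in dO *.
(* Either the origin is fixed and the axis is the diagonal, which exchanges the obtuse corners, or
   the origin goes to [Q]; then displacements are parallel to the diagonal, [area] is preserved and
   the obtuse corner (a, 0) is fixed. *)
case=> -[E1 E2]; rewrite E1 E2 in dO.
  have c0 : c = 0.
    transitivity (c * (n1 ^+ 2 + n2 ^+ 2)); first by rewrite nn mulr1.
    transitivity ((2 * c * n1) * n1 / 2 + (2 * c * n2) * n2 / 2); first by field.
    by rewrite E1 E2 !mul0r addr0.
  have dQ := iso qx w 0 0; rewrite O1 O2 E1 E2 in dQ.
  have nQ : n1 * qx + n2 * w = 0.
    have [[F1 F2]|[F1 F2]] := sharpE _ _ (sharp_image iso sm shQ).
      exfalso; rewrite F1 F2 in dQ; have := exprn_gt0 2 w0; have := sqr_ge0 qx.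
      by clear -dQ; lra.
    rewrite c0 subr0 in F1 F2.
    transitivity ((n1 * qx + n2 * w) * (n1 ^+ 2 + n2 ^+ 2)); first by rewrite nn mulr1.
    move: (n1 * qx + n2 * w) F1 F2 => N F1 F2.
    transitivity ((qx - (qx - 2 * N * n1)) * n1 / 2 + (w - (w - 2 * N * n2)) * n2 / 2).
      by field.
    by rewrite F1 F2 !subrr !mul0r addr0.
  have flip x y : (n1 * x + n2 * y) * (qx * n2 - w * n1) = area x y.
    transitivity (area x y * (n1 ^+ 2 + n2 ^+ 2) + (n1 * qx + n2 * w) * (n2 * x - n1 * y)).
      by rewrite /area; ring.
    by rewrite nn nQ mulr1 mul0r addr0.
  have [|F1 F2] := maxE _ _ MP1.
    by rewrite areaf c0 subr0 -mulrA flip areaP1; ring.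
  rewrite F1 F2 in dO; apply: sideE; clear -dO; lra.
have [|F1 F2] := minE _ _ MP1.
  have Z : qx * n2 - w * n1 = 0 by rewrite -E1 -E2; ring.
  by rewrite areaf areaP1 Z mulr0 subr0.
rewrite F1 F2 in dO; apply: sideE; move: dO; rewrite /qx; clear; lra.
Qed.

Lemma strips_axial_width (R : realType) (n1 n2 c d m1 m2 c' d' : R) :
  n1 ^+ 2 + n2 ^+ 2 = 1 -> c < d -> m1 ^+ 2 + m2 ^+ 2 = 1 -> c' < d' ->
  at_all_positions (strip_at n1 n2 c d) (strip_at m1 m2 c' d') (@axial2 R) ->
  d - c = d' - c'.
Proof.
move=> nn cd mm cd' H.
have w0 : 0 < d - c by rewrite subr_gt0.
have z0 : 0 < d' - c' by rewrite subr_gt0.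
have u : (4 / 5) ^+ 2 + (- (3 / 5)) ^+ 2 = 1 :> R by field.
have := H _ _ (placed_strip c d 0 nn (unit_0_1 R)) (placed_strip c' d' 0 mm u).
rewrite !add0r; move: (d - c) (d' - c') w0 z0 => w z w0 z0 K.
apply: (parallelogram_axial w0 z0 _ (K _)).
  move=> x y; rewrite /meet /strip_at !(mul0r, add0r, mul1r).
  by clear; split=> [[[h1 h2] [h3 h4]]|[h1 h2 h3 h4]]; split; try split; lra.
exists (5 / 8 * z + 3 / 8 * w), (w / 2).
by apply: interior_meet; apply: interior_strip; clear -w0 z0; lra.
Qed.

(** * Symmetries present in the special pairs *)

Lemma central_disks (R : realType) (a b a' b' r : R) :
  central2 (meet (disk_at a b r) (disk_at a' b' r)).
Proof.
exists ((a + a') / 2), ((b + b') / 2) => x y [h1 h2]; rewrite /disk_at in h1 h2.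
have E (p q z : R) : (2 * ((p + q) / 2) - z - p) ^+ 2 = (z - q) ^+ 2 by field.
have E' (p q z : R) : (2 * ((p + q) / 2) - z - q) ^+ 2 = (z - p) ^+ 2 by field.
by split; rewrite /disk_at ?E ?E'.
Qed.

Lemma central_parallel_strips (R : realType) (n1 n2 c d c' d' : R) :
  n1 ^+ 2 + n2 ^+ 2 = 1 ->
  central2 (meet (strip_at n1 n2 c d) (strip_at n1 n2 c' d')).
Proof.
move=> nn; pose lo := Num.max c c'; pose hi := Num.min d d'.
exists (n1 * ((lo + hi) / 2)), (n2 * ((lo + hi) / 2)) => x y.
have E : n1 * (2 * (n1 * ((lo + hi) / 2)) - x) + n2 * (2 * (n2 * ((lo + hi) / 2)) - y) =
    lo + hi - (n1 * x + n2 * y).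
  transitivity ((n1 ^+ 2 + n2 ^+ 2) * (lo + hi) - (n1 * x + n2 * y)); first by field.
  by rewrite nn mul1r.
rewrite /meet /strip_at E => -[[h1 h2] [h3 h4]].
have lot : lo <= n1 * x + n2 * y by rewrite ge_max h1.
have thi : n1 * x + n2 * y <= hi by rewrite le_min h2.
have lc : c <= lo by rewrite le_max lexx.
have lc' : c' <= lo by rewrite le_max lexx orbT.
have hd : hi <= d by rewrite ge_min lexx.
have hd' : hi <= d' by rewrite ge_min lexx orbT.
by clearbody lo hi; clear -lot thi lc lc' hd hd'; split; split; lra.
Qed.

(** Crossing strips are symmetric about the common point of their midlines. For [D = 0] the second
    normal is plus or minus the first, and the strips are parallel. *)
Lemma central_strips (R : realType) (n1 n2 c d m1 m2 c' d' : R) :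
  n1 ^+ 2 + n2 ^+ 2 = 1 -> m1 ^+ 2 + m2 ^+ 2 = 1 ->
  central2 (meet (strip_at n1 n2 c d) (strip_at m1 m2 c' d')).
Proof.
move=> nn mm; pose D := n1 * m2 - n2 * m1.
have [D0|D0] := eqVneq D 0; last first.
  pose e := (c + d) / 2; pose e' := (c' + d') / 2.
  exists ((e * m2 - e' * n2) / D), ((e' * n1 - e * m1) / D) => x y.
  have E1 : n1 * (2 * ((e * m2 - e' * n2) / D) - x) + n2 * (2 * ((e' * n1 - e * m1) / D) - y) =
    c + d - (n1 * x + n2 * y) by rewrite /e /e'; move: D0; rewrite /D => D0; field.
  have E2 : m1 * (2 * ((e * m2 - e' * n2) / D) - x) + m2 * (2 * ((e' * n1 - e * m1) / D) - y) =
    c' + d' - (m1 * x + m2 * y) by rewrite /e /e'; move: D0; rewrite /D => D0; field.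
  rewrite /meet /strip_at E1 E2 => -[[h1 h2] [h3 h4]].
  by clear -h1 h2 h3 h4; split; split; lra.
pose s := n1 * m1 + n2 * m2.
have s2 : s ^+ 2 = 1.
  transitivity ((n1 ^+ 2 + n2 ^+ 2) * (m1 ^+ 2 + m2 ^+ 2) - D ^+ 2); first by rewrite /s /D; ring.
  by rewrite nn mm D0 expr0n subr0 mulr1.
have mE1 : m1 = s * n1.
  transitivity (m1 * (n1 ^+ 2 + n2 ^+ 2)); first by rewrite nn mulr1.
  transitivity (s * n1 - D * n2); first by rewrite /s /D; ring.
  by rewrite D0 mul0r subr0.
have mE2 : m2 = s * n2.
  transitivity (m2 * (n1 ^+ 2 + n2 ^+ 2)); first by rewrite nn mulr1.
  transitivity (s * n2 + D * n1); first by rewrite /s /D; ring.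
  by rewrite D0 mul0r addr0.
move/eqP: s2; rewrite sqrf_eq1 mE1 mE2 => /orP[] /eqP ->.
  by rewrite !mul1r; exact: central_parallel_strips.
rewrite !mulN1r.
have -> : strip_at (- n1) (- n2) c' d' = strip_at n1 n2 (- d') (- c').
  by apply: eq_region => x y; rewrite /strip_at; clear; split=> -[h1 h2]; split; lra.
exact: central_parallel_strips.
Qed.

Lemma unit_direction (R : realType) (a b : R) : a ^+ 2 + b ^+ 2 != 0 ->
  exists n1 n2 l, [/\ n1 ^+ 2 + n2 ^+ 2 = 1, 0 < l, a = l * n1 & b = l * n2].
Proof.
move=> ab; have D0 : 0 < a ^+ 2 + b ^+ 2 by rewrite lt0r ab addr_ge0 ?sqr_ge0.
pose l := Num.sqrt (a ^+ 2 + b ^+ 2).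
have l0 : 0 < l by rewrite sqrtr_gt0.
have l2 : l ^+ 2 = a ^+ 2 + b ^+ 2 by rewrite sqr_sqrtr // ltW.
have ln : l != 0 by rewrite gt_eqF.
exists (a / l), (b / l), l; split=> //; last 2 first.
- by rewrite mulrC divfK.
- by rewrite mulrC divfK.
by rewrite !exprMn -mulrDl -l2 -exprMn divff // expr1n.
Qed.

(** The points may coincide, as the two disks may be concentric. *)
Lemma line_through (R : realType) (a b a' b' : R) :
  exists n1 n2 c, [/\ n1 ^+ 2 + n2 ^+ 2 = 1, n1 * a + n2 * b = c & n1 * a' + n2 * b' = c].
Proof.
have [E|E] := eqVneq ((b - b') ^+ 2 + (a' - a) ^+ 2) 0.
  move/eqP: E; rewrite paddr_eq0 ?sqr_ge0 // !sqrf_eq0 !subr_eq0 => /andP[/eqP -> /eqP ->].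
  by exists 1, 0, a; rewrite expr1n expr0n addr0 mul1r mul0r addr0.
have [n1 [n2 [l [nn l0 E1 E2]]]] := unit_direction E.
exists n1, n2, (n1 * a + n2 * b); split=> //.
apply: (mulfI (_ : l != 0)); first by rewrite gt_eqF.
rewrite !mulrDr !mulrA -E1 -E2; ring.
Qed.

Lemma reflection_disk (R : realType) (n1 n2 c a b r x y : R) :
  n1 ^+ 2 + n2 ^+ 2 = 1 -> n1 * a + n2 * b = c -> disk_at a b r x y ->
  disk_at a b r (x - 2 * (n1 * x + n2 * y - c) * n1) (y - 2 * (n1 * x + n2 * y - c) * n2).
Proof.
move=> nn <-; rewrite /disk_at => h; apply: (le_trans _ h); rewrite le_eqVlt; apply/orP; left.
apply/eqP.
transitivity ((x - a) ^+ 2 + (y - b) ^+ 2 +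
  4 * (n1 * (x - a) + n2 * (y - b)) ^+ 2 * (n1 ^+ 2 + n2 ^+ 2 - 1)); first by ring.
by rewrite nn subrr mulr0 addr0.
Qed.

Lemma axial_disks (R : realType) (a b r a' b' r' : R) :
  axial2 (meet (disk_at a b r) (disk_at a' b' r')).
Proof.
have [n1 [n2 [c [nn E E']]]] := line_through a b a' b'.
by exists n1, n2, c; split=> // x y [h1 h2]; split; exact: reflection_disk.
Qed.

(** A reflection whose axis is perpendicular to the edge of a strip or half-plane moves points along
    that edge. *)
Lemma along_reflection (R : realType) (m1 m2 e x y : R) :
  m1 * (x - e * - m2) + m2 * (y - e * m1) = m1 * x + m2 * y.
Proof. by ring. Qed.

Lemma axial_disk_strip (R : realType) (a b r m1 m2 c d : R) :
  m1 ^+ 2 + m2 ^+ 2 = 1 -> axial2 (meet (disk_at a b r) (strip_at m1 m2 c d)).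
Proof.
move=> mm; exists (- m2), m1, (- m2 * a + m1 * b); have nn : (- m2) ^+ 2 + m1 ^+ 2 = 1.
  by rewrite sqrrN addrC.
split=> // x y [h1 h2]; split; first exact: reflection_disk.
by rewrite /strip_at along_reflection.
Qed.

Lemma axial_disk_half_plane (R : realType) (a b r m1 m2 c : R) :
  m1 ^+ 2 + m2 ^+ 2 = 1 -> axial2 (meet (disk_at a b r) (half_plane_at m1 m2 c)).
Proof.
move=> mm; exists (- m2), m1, (- m2 * a + m1 * b); have nn : (- m2) ^+ 2 + m1 ^+ 2 = 1.
  by rewrite sqrrN addrC.
split=> // x y [h1 h2]; split; first exact: reflection_disk.
by rewrite /half_plane_at along_reflection.
Qed.

(* Reflection in the bisector of the lines m.x = c and m'.x = c'. *)
Lemma swapping_reflection (R : realType) (m1 m2 m1' m2' c c' : R) :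
  m1 ^+ 2 + m2 ^+ 2 = 1 -> m1' ^+ 2 + m2' ^+ 2 = 1 ->
  (m1 = m1' /\ m2 = m2') \/
  exists n1 n2 e, n1 ^+ 2 + n2 ^+ 2 = 1 /\ forall x y,
    let x' := x - 2 * (n1 * x + n2 * y - e) * n1 in
    let y' := y - 2 * (n1 * x + n2 * y - e) * n2 in
    m1 * x' + m2 * y' - c = m1' * x + m2' * y - c' /\
    m1' * x' + m2' * y' - c' = m1 * x + m2 * y - c.
Proof.
move=> mm mm'; have [E|E] := eqVneq ((m1 - m1') ^+ 2 + (m2 - m2') ^+ 2) 0.
  left; move/eqP: E; rewrite paddr_eq0 ?sqr_ge0 // !sqrf_eq0 !subr_eq0.
  by case/andP => /eqP -> /eqP ->.
have [n1 [n2 [l [nn l0 E1 E2]]]] := unit_direction E; right.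
have ln : l != 0 by rewrite gt_eqF.
have h1 : 2 * (m1 * n1 + m2 * n2) = l.
  apply: (mulfI ln).
  transitivity (2 * (m1 * (l * n1) + m2 * (l * n2))); first by ring.
  rewrite -E1 -E2.
  transitivity ((m1 - m1') ^+ 2 + (m2 - m2') ^+ 2 + (m1 ^+ 2 + m2 ^+ 2) - (m1' ^+ 2 + m2' ^+ 2)).
    by ring.
  by rewrite mm mm' E1 E2 !exprMn -mulrDr nn mulr1 addrK expr2.
have h2 : 2 * (m1' * n1 + m2' * n2) = - l.
  have -> : m1' = m1 - l * n1 by rewrite -E1; ring.
  have -> : m2' = m2 - l * n2 by rewrite -E2; ring.
  transitivity (2 * (m1 * n1 + m2 * n2) - 2 * l * (n1 ^+ 2 + n2 ^+ 2)); first by ring.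
  by rewrite h1 nn; ring.
exists n1, n2, ((c - c') / l); split=> // x y x' y'.
have e : l * (n1 * x + n2 * y - (c - c') / l) = (m1 - m1') * x + (m2 - m2') * y - (c - c').
  by rewrite E1 E2; field.
split.
  transitivity (m1 * x + m2 * y - c -
    (n1 * x + n2 * y - (c - c') / l) * (2 * (m1 * n1 + m2 * n2))).
    by rewrite /x' /y'; ring.
  by rewrite h1 [_ * l]mulrC e; ring.
transitivity (m1' * x + m2' * y - c' -
  (n1 * x + n2 * y - (c - c') / l) * (2 * (m1' * n1 + m2' * n2))).
  by rewrite /x' /y'; ring.
by rewrite h2 mulrN [_ * l]mulrC e; ring.
Qed.

Lemma axial_half_planes (R : realType) (m1 m2 c m1' m2' c' : R) :
  m1 ^+ 2 + m2 ^+ 2 = 1 -> m1' ^+ 2 + m2' ^+ 2 = 1 ->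
  axial2 (meet (half_plane_at m1 m2 c) (half_plane_at m1' m2' c')).
Proof.
move=> mm mm'; have [[<- <-]|[n1 [n2 [e [nn H]]]]] := swapping_reflection c c' mm mm'.
  exists (- m2), m1, 0; rewrite sqrrN addrC; split=> // x y h.
  by rewrite /meet /half_plane_at !along_reflection.
exists n1, n2, e; split=> // x y; have [] := H x y; rewrite /meet /half_plane_at => e1 e2 [h1 h2].
by clear -e1 e2 h1 h2; split; lra.
Qed.

(** A reflection that swaps the first edges of both strips swaps the second edges as well, because
    the widths agree. Strips with the same normal are symmetric in any common perpendicular. *)
Lemma axial_strips (R : realType) (m1 m2 c m1' m2' c' w : R) :
  m1 ^+ 2 + m2 ^+ 2 = 1 -> m1' ^+ 2 + m2' ^+ 2 = 1 ->
  axial2 (meet (strip_at m1 m2 c (c + w)) (strip_at m1' m2' c' (c' + w))).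
Proof.
move=> mm mm'; have [[<- <-]|[n1 [n2 [e [nn H]]]]] := swapping_reflection c c' mm mm'.
  exists (- m2), m1, 0; rewrite sqrrN addrC; split=> // x y h.
  by rewrite /meet /strip_at !along_reflection.
exists n1, n2, e; split=> // x y; have [] := H x y.
rewrite /meet /strip_at => e1 e2 [[h1 h2] [h3 h4]].
by clear -e1 e2 h1 h2 h3 h4; split; split; lra.
Qed.

(** A congruence invariant based on mere inclusion: [congruent] allows isometries that come without
    a formula, and the disks contained in a set still reveal the radius of a disk and the width of a
    strip. *)
Definition contains_disk (R : realType) (A : R -> R -> Prop) (r : R) :=
  exists a b, forall x y, disk_at a b r x y -> A x y.

Lemma contains_disk_disk (R : realType) (a b r t : R) :
  0 < r -> 0 < t -> contains_disk (disk_at a b r) t -> t <= r.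
Proof.
move=> r0 t0 [p [q H]].
have h1 := H (p + t) q; have h2 := H (p - t) q; rewrite /disk_at in h1 h2.
have {}h1 : (p + t - a) ^+ 2 + (q - b) ^+ 2 <= r ^+ 2 by apply: h1; clear; lra.
have {}h2 : (p - t - a) ^+ 2 + (q - b) ^+ 2 <= r ^+ 2 by apply: h2; clear; lra.
rewrite -(ler_sqr (x := t)) ?nnegrE ?(ltW t0) ?(ltW r0) //.
have := sqr_ge0 (p - a); have := sqr_ge0 (q - b).
by clear -h1 h2; lra.
Qed.

Lemma contains_disk_strip (R : realType) (n1 n2 c d t : R) :
  n1 ^+ 2 + n2 ^+ 2 = 1 -> 0 < t -> contains_disk (strip_at n1 n2 c d) t -> 2 * t <= d - c.
Proof.
move=> nn t0 [p [q H]].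
have D s : s ^+ 2 = 1 -> disk_at p q t (p + s * t * n1) (q + s * t * n2).
  move=> s1; rewrite /disk_at.
  have -> // : (p + s * t * n1 - p) ^+ 2 + (q + s * t * n2 - q) ^+ 2 = t ^+ 2.
  transitivity (s ^+ 2 * t ^+ 2 * (n1 ^+ 2 + n2 ^+ 2)); first by ring.
  by rewrite s1 nn mul1r mulr1.
have E s : n1 * (p + s * t * n1) + n2 * (q + s * t * n2) = n1 * p + n2 * q + s * t.
  transitivity (n1 * p + n2 * q + s * t * (n1 ^+ 2 + n2 ^+ 2)); first by ring.
  by rewrite nn mulr1.
have [_ +] := H _ _ (D 1 (expr1n _ _)).
have [|+ _] := H _ _ (D (-1) _); first by rewrite sqrrN expr1n.
by rewrite !E; clear; lra.
Qed.

Lemma strip_contains_disk (R : realType) (n1 n2 c d : R) :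
  n1 ^+ 2 + n2 ^+ 2 = 1 -> c < d -> contains_disk (strip_at n1 n2 c d) ((d - c) / 2).
Proof.
move=> nn cd; exists (n1 * ((c + d) / 2)), (n2 * ((c + d) / 2)) => x y; rewrite /disk_at.
set e := (c + d) / 2; set t := (d - c) / 2 => h.
have t0 : 0 <= t by rewrite divr_ge0 // subr_ge0 ltW.
have N : `|n1 * (x - n1 * e) + n2 * (y - n2 * e)| <= t.
  rewrite -(ler_sqr (x := `|_|)) ?nnegrE // real_normK ?num_real // (le_trans _ h) //.
  rewrite -subr_ge0; have -> : (x - n1 * e) ^+ 2 + (y - n2 * e) ^+ 2 -
    (n1 * (x - n1 * e) + n2 * (y - n2 * e)) ^+ 2 =
    (1 - (n1 ^+ 2 + n2 ^+ 2)) * ((x - n1 * e) ^+ 2 + (y - n2 * e) ^+ 2) +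
    (n1 * (y - n2 * e) - n2 * (x - n1 * e)) ^+ 2 by ring.
  by rewrite nn subrr mul0r add0r sqr_ge0.
have E : n1 * (x - n1 * e) + n2 * (y - n2 * e) = n1 * x + n2 * y - e.
  transitivity (n1 * x + n2 * y - e * (n1 ^+ 2 + n2 ^+ 2)); first by ring.
  by rewrite nn mulr1.
rewrite E ler_norml /e /t in N; move/andP: N => [N1 N2].
by rewrite /strip_at; clear -N1 N2; split; lra.
Qed.

(** * Matching pairs of shapes with symmetries *)

Definition special2 (R : realType) (A B : R -> R -> Prop) :=
  [\/ disk2 A /\ disk2 B,
      (disk2 A /\ (strip2 B \/ half_plane2 B)) \/
      (disk2 B /\ (strip2 A \/ half_plane2 A)),
      strip2 A /\ strip2 B
    | half_plane2 A /\ half_plane2 B].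

Definition same_size (R : realType) (A B : R -> R -> Prop) :=
  forall r, contains_disk A r <-> contains_disk B r.

Lemma at_all_positions_imp (R : realType) (A B : R -> R -> Prop) (P Q : _ -> Prop) :
  (forall M, P M -> Q M) -> at_all_positions A B P -> at_all_positions A B Q.
Proof. by move=> PQ H A' B' pA pB int; apply: PQ; exact: H. Qed.

Lemma central_nontrivial (R : realType) (M : R -> R -> Prop) :
  central2 M -> nontrivially_symmetric M.
Proof.
move=> [p [q H]]; exists (fun x _ => 2 * p - x), (fun _ y => 2 * q - y); split.
- by move=> x y x' y'; ring.
- move=> /(_ (p + 1) q) []; clear; lra.
split=> // x y Mxy; exists (2 * p - x), (2 * q - y); rewrite !subKr; split=> //; exact: H.
Qed.

Lemma axial_nontrivial (R : realType) (M : R -> R -> Prop) :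
  axial2 M -> nontrivially_symmetric M.
Proof.
move=> [n1 [n2 [c [nn H]]]]; have [iso sm] := reflection_self_map nn H.
do 2 eexists; split; [exact: iso| |exact: sm].
move=> /(_ (n1 * (c + 1)) (n2 * (c + 1))).
have -> : n1 * (n1 * (c + 1)) + n2 * (n2 * (c + 1)) - c = 1.
  transitivity ((n1 ^+ 2 + n2 ^+ 2) * (c + 1) - c); first by ring.
  by rewrite nn; ring.
move=> [e1 e2]; have : n1 ^+ 2 + n2 ^+ 2 = 0.
  have -> : n1 = 0 by clear -e1; lra.
  have -> : n2 = 0 by clear -e2; lra.
  by rewrite expr0n addr0.
by rewrite nn; apply/eqP; rewrite oner_eq0.
Qed.

(** Of the nine combinations of shapes, only a strip with a half-plane has to be excluded. *)
Lemma round_pair (R : realType) (A B : R -> R -> Prop) :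
  at_all_positions A B (@nontrivially_symmetric R) -> round A -> round B -> special2 A B.
Proof.
move=> H [dA|[hA|sA]] [dB|[hB|sB]].
- by constructor 1.
- by constructor 2; left; split=> //; right.
- by constructor 2; left; split=> //; left.
- by constructor 2; right; split=> //; right.
- by constructor 4.
- case: hA sB H => [n1 [n2 [c [nn ->]]]] [m1 [m2 [d [e [mm de ->]]]]] /at_all_positionsC H.
  by case: (strip_half_plane_asymmetric mm de nn H).
- by constructor 2; right; split=> //; left.
- case: sA hB H => [m1 [m2 [d [e [mm de ->]]]]] [n1 [n2 [c [nn ->]]]] H.
  by case: (strip_half_plane_asymmetric mm de nn H).
- by constructor 3.
Qed.

Lemma central_pair (R : realType) (A B : R -> R -> Prop) :
  at_all_positions A B (@central2 R) -> special2 A B ->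
  [/\ disk2 A, disk2 B & placed A B] \/ (strip2 A /\ strip2 B).
Proof.
move=> H [[dA dB]|[[dA [sB|hB]]|[dB [sA|hA]]]|sAB|[hA hB]].
- left; split=> //; case: dA dB H => [a [b [r [r0 ->]]]] [a' [b' [r' [r0' ->]]]] H.
  have [rr|[rr|<-]] : r < r' \/ (r' < r \/ r = r') by case: (ltgtP r r'); auto.
  + by case: (unequal_disks_not_central r0 rr H).
  + by case: (unequal_disks_not_central r0' rr (at_all_positionsC H)).
  + exact: placed_disk.
- case: dA sB H => [a [b [r [r0 ->]]]] [m1 [m2 [d [e [mm de ->]]]]] H.
  by case: (disk_strip_not_central r0 mm de H).
- case: dA hB H => [a [b [r [r0 ->]]]] [m1 [m2 [d [mm ->]]]] H.
  by case: (disk_half_plane_not_central r0 mm H).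
- case: dB sA H => [a [b [r [r0 ->]]]] [m1 [m2 [d [e [mm de ->]]]]] /at_all_positionsC H.
  by case: (disk_strip_not_central r0 mm de H).
- case: dB hA H => [a [b [r [r0 ->]]]] [m1 [m2 [d [mm ->]]]] /at_all_positionsC H.
  by case: (disk_half_plane_not_central r0 mm H).
- by right.
- case: hA hB H => [n1 [n2 [c [nn ->]]]] [m1 [m2 [d [mm ->]]]] H.
  by case: (half_planes_not_central nn mm H).
Qed.

Lemma axial_pair (R : realType) (A B : R -> R -> Prop) :
  at_all_positions A B (@axial2 R) -> strip2 A -> strip2 B -> placed A B.
Proof.
move=> + [n1 [n2 [c [d [nn cd AE]]]]] [m1 [m2 [c' [d' [mm cd' BE]]]]].
rewrite AE BE => /(strips_axial_width nn cd mm cd') E.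
by have := placed_strip c d c' nn mm; rewrite E addrC subrK.
Qed.

Lemma disk2_placed (R : realType) (A A' : R -> R -> Prop) a b r :
  A = disk_at a b r -> placed A A' -> exists a' b', A' = disk_at a' b' r.
Proof.
move=> -> [c [s [u [v [cs ->]]]]]; rewrite disk_rigid //.
by exists (c * (a - u) + s * (b - v)), (c * (b - v) - s * (a - u)).
Qed.

Lemma half_plane2_placed (R : realType) (A A' : R -> R -> Prop) :
  half_plane2 A -> placed A A' -> half_plane2 A'.
Proof.
move=> [n1 [n2 [d [nn ->]]]] [c [s [u [v [cs ->]]]]]; rewrite half_plane_rigid.
exists (c * n1 + s * n2), (c * n2 - s * n1), (d - n1 * u - n2 * v).
by rewrite unit_rotation.
Qed.

Lemma strip_placed (R : realType) (A A' : R -> R -> Prop) n1 n2 d w :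
  n1 ^+ 2 + n2 ^+ 2 = 1 -> A = strip_at n1 n2 d (d + w) -> placed A A' ->
  exists m1 m2 e, m1 ^+ 2 + m2 ^+ 2 = 1 /\ A' = strip_at m1 m2 e (e + w).
Proof.
move=> nn -> [c [s [u [v [cs ->]]]]]; rewrite strip_rigid.
exists (c * n1 + s * n2), (c * n2 - s * n1), (d - n1 * u - n2 * v).
by rewrite unit_rotation //; split=> //; congr strip_at; ring.
Qed.

(** Recording a strip by one edge and its width isolates the quantity that motions preserve. *)
Lemma strip2_width (R : realType) (A : R -> R -> Prop) :
  strip2 A -> exists n1 n2 d w,
    [/\ n1 ^+ 2 + n2 ^+ 2 = 1, 0 < w & A = strip_at n1 n2 d (d + w)].
Proof.
move=> [n1 [n2 [c [d [nn cd ->]]]]]; exists n1, n2, c, (d - c).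
by rewrite subr_gt0 (addrC c) subrK.
Qed.

Lemma strips_positions (R : realType) (A B : R -> R -> Prop) :
  strip2 A -> strip2 B -> at_all_positions A B (@central2 R).
Proof.
move=> /strip2_width[n1 [n2 [d [w [nn w0 AE]]]]] /strip2_width[m1 [m2 [e [z [mm z0 BE]]]]].
move=> A' B' /(strip_placed nn AE)[p1 [p2 [d' [pp ->]]]] /(strip_placed mm BE).
move=> [q1 [q2 [e' [qq ->]]]] _; exact: central_strips.
Qed.

Lemma central_positions (R : realType) (A B : R -> R -> Prop) :
  [/\ disk2 A, disk2 B & same_size A B] \/ (strip2 A /\ strip2 B) ->
  at_all_positions A B (@central2 R).
Proof.
case=> [[[a [b [r [r0 AE]]]] [a' [b' [r' [r0' BE]]]] S]|[sA sB]]; last exact: strips_positions.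
have self (p q t : R) : contains_disk (disk_at p q t) t by exists p, q.
have rr : r' = r.
  apply: le_anti; apply/andP; split.
  - apply: (contains_disk_disk (a := a) (b := b)) => //.
    by rewrite -AE; apply/S; rewrite BE.
  - apply: (contains_disk_disk (a := a') (b := b')) => //.
    by rewrite -BE; apply/S; rewrite AE.
rewrite rr in BE; move=> A' B' /(disk2_placed AE)[p [q ->]] /(disk2_placed BE)[p' [q' ->]] _.
exact: central_disks.
Qed.

Lemma strips_same_width (R : realType) (n1 n2 c d m1 m2 c' d' : R) :
  n1 ^+ 2 + n2 ^+ 2 = 1 -> m1 ^+ 2 + m2 ^+ 2 = 1 -> c < d ->
  same_size (strip_at n1 n2 c d) (strip_at m1 m2 c' d') -> d - c <= d' - c'.
Proof.
move=> nn mm cd S; have w0 : 0 < (d - c) / 2 by rewrite divr_gt0 // subr_gt0.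
have := contains_disk_strip mm w0 (proj1 (S _) (strip_contains_disk nn cd)).
by clear; lra.
Qed.

Lemma axial_strips_positions (R : realType) (A B : R -> R -> Prop) :
  strip2 A -> strip2 B -> same_size A B -> at_all_positions A B (@axial2 R).
Proof.
move=> /strip2_width[n1 [n2 [d [w [nn w0 AE]]]]] /strip2_width[m1 [m2 [e [z [mm z0 BE]]]]] S.
have wz : z = w.
  have S' : same_size B A by move=> t; rewrite S.
  rewrite AE BE in S; rewrite AE BE in S'.
  have h1 := strips_same_width nn mm (_ : d < d + w) S.
  have h2 := strips_same_width mm nn (_ : e < e + z) S'.
  rewrite !ltrDl !(addrAC _ _ (- _)) !subrr !add0r in h1 h2.
  by apply: le_anti; rewrite h1 // h2.
rewrite wz in BE => A' B' /(strip_placed nn AE)[p1 [p2 [d' [pp ->]]]] /(strip_placed mm BE).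
by move=> [q1 [q2 [e' [qq ->]]]] _; exact: axial_strips.
Qed.

Lemma axial_positions (R : realType) (A B : R -> R -> Prop) :
  special2 A B -> at_all_positions A B (@axial2 R) \/ (strip2 A /\ strip2 B).
Proof.
have half (C D : R -> R -> Prop) : disk2 C -> strip2 D \/ half_plane2 D ->
    at_all_positions C D (@axial2 R).
  move=> [a [b [r [r0 CE]]]] [/strip2_width|] sD C' D' /(disk2_placed CE)[p [q ->]].
    case: sD => n1 [n2 [d [w [nn w0 DE]]]] /(strip_placed nn DE)[m1 [m2 [e [mm ->]]]] _.
    exact: axial_disk_strip.
  by move=> /(half_plane2_placed sD)[m1 [m2 [e [mm ->]]]] _; exact: axial_disk_half_plane.
case=> [[[a [b [r [r0 AE]]]] [a' [b' [r' [r0' BE]]]]]|[[dA hB]|[dB hA]]|sAB|[hA hB]].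
- left=> A' B' /(disk2_placed AE)[p [q ->]] /(disk2_placed BE)[p' [q' ->]] _.
  exact: axial_disks.
- by left; exact: half.
- by left; apply: at_all_positionsC; exact: half.
- by right.
- left=> A' B' /(half_plane2_placed hA)[m1 [m2 [e [mm ->]]]].
  by move=> /(half_plane2_placed hB)[n1 [n2 [d [nn ->]]]] _; exact: axial_half_planes.
Qed.

(** * Coordinates *)

Definition vec (R : realType) (x y : R) : 'rV[R]_2 := \row_(i < 2) if i == 0 then x else y.

Definition coords (R : realType) (K : set 'rV[R]_2) (x y : R) : Prop := K (vec x y).

Lemma vec_x (R : realType) (x y : R) : vec x y 0 0 = x.
Proof. by rewrite mxE. Qed.

Lemma vec_y (R : realType) (x y : R) : vec x y 0 1 = y.
Proof. by rewrite mxE. Qed.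

Lemma row2P (R : realType) (v w : 'rV[R]_2) : v 0 0 = w 0 0 -> v 0 1 = w 0 1 -> v = w.
Proof.
move=> h0 h1; apply/rowP => i; case: i => -[|[|//]] lt.
  by rewrite (_ : Ordinal lt = 0) //; apply/val_inj.
by rewrite (_ : Ordinal lt = 1) //; apply/val_inj.
Qed.

Lemma vecK (R : realType) (v : 'rV[R]_2) : vec (v 0 0) (v 0 1) = v.
Proof. by apply: row2P; rewrite ?vec_x ?vec_y. Qed.

Lemma coords_inj (R : realType) (K L : set 'rV[R]_2) : coords K = coords L -> K = L.
Proof.
move=> E; apply/funext => v; rewrite -(vecK v).
exact: (congr1 (fun A => A (v 0 0) (v 0 1)) E).
Qed.

Lemma dotE (R : realType) (u v : 'rV[R]_2) :
  dot u v = u 0 0 * v 0 0 + u 0 1 * v 0 1.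
Proof.
rewrite /dot !big_ord_recl big_ord0 addr0; congr (_ + u _ _ * v _ _); exact/val_inj.
Qed.

Lemma edistE (R : realType) (u v : 'rV[R]_2) :
  Defs.edist u v = Num.sqrt ((u 0 0 - v 0 0) ^+ 2 + (u 0 1 - v 0 1) ^+ 2).
Proof. by rewrite /Defs.edist dotE !mxE !expr2. Qed.

Lemma edist_eq (R : realType) (u v u' v' : 'rV[R]_2) :
  Defs.edist u v = Defs.edist u' v' <->
  (u 0 0 - v 0 0) ^+ 2 + (u 0 1 - v 0 1) ^+ 2 =
  (u' 0 0 - v' 0 0) ^+ 2 + (u' 0 1 - v' 0 1) ^+ 2.
Proof.
rewrite !edistE; split=> [h|-> //].
by rewrite -[LHS]sqr_sqrtr ?h ?sqr_sqrtr // addr_ge0 // sqr_ge0.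
Qed.

Definition motion (R : realType) (c s u v : R) (z : 'rV[R]_2) : 'rV[R]_2 :=
  vec (c * z 0 0 - s * z 0 1 + u) (s * z 0 0 + c * z 0 1 + v).

Lemma motion_congruence (R : realType) (c s u v : R) :
  c ^+ 2 + s ^+ 2 = 1 -> congruence (motion c s u v).
Proof.
move=> cs; split=> [x y|y].
  apply/edist_eq; rewrite /motion !vec_x !vec_y.
  transitivity ((c ^+ 2 + s ^+ 2) * ((x 0 0 - y 0 0) ^+ 2 + (x 0 1 - y 0 1) ^+ 2)).
    by ring.
  by rewrite cs mul1r.
exists (motion c (- s) (- (c * u + s * v)) (s * u - c * v) y).
apply: row2P; rewrite /motion !(vec_x, vec_y).
  transitivity ((c ^+ 2 + s ^+ 2) * (y 0 0 - u) + u); first by ring.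
  by rewrite cs mul1r subrK.
transitivity ((c ^+ 2 + s ^+ 2) * (y 0 1 - v) + v); first by ring.
by rewrite cs mul1r subrK.
Qed.

Lemma det2 (R : realType) (A : 'M[R]_2) : \det A = A 0 0 * A 1 1 - A 0 1 * A 1 0.
Proof.
rewrite (expand_det_row _ 0) !big_ord_recl big_ord0 addr0 /cofactor !det_mx11 !mxE /=.
transitivity (A 0 0 * (1 * A 1 1) + A 0 1 * (-1 * A 1 0)); last by ring.
by congr (A _ _ * (_ * A _ _) + A _ _ * (_ * A _ _)); exact/val_inj.
Qed.

(** Since [rigid] is a preimage, the image under a motion is [rigid] for the inverse motion. *)
Lemma motion_image (R : realType) (c s u v : R) (K : set 'rV[R]_2) :
  c ^+ 2 + s ^+ 2 = 1 ->
  coords (motion c s u v @` K) =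
  rigid c (- s) (- (c * u + s * v)) (s * u - c * v) (coords K).
Proof.
move=> cs; apply: eq_region => x y; rewrite /coords /rigid; split.
  move=> [z Kz E].
  have Ex := congr1 (fun w : 'rV[R]_2 => w 0 0) E; have Ey := congr1 (fun w : 'rV[R]_2 => w 0 1) E.
  rewrite /motion /= !(vec_x, vec_y) in Ex Ey.
  suff -> : vec (c * x - - s * y - (c * u + s * v)) (- s * x + c * y + (s * u - c * v)) = z by [].
  apply: row2P; rewrite !(vec_x, vec_y) -Ex -Ey.
    transitivity ((c ^+ 2 + s ^+ 2) * z 0 0); first by ring.
    by rewrite cs mul1r.
  transitivity ((c ^+ 2 + s ^+ 2) * z 0 1); first by ring.
  by rewrite cs mul1r.
move=> H; exists (vec (c * x - - s * y - (c * u + s * v)) (- s * x + c * y + (s * u - c * v))) => //.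
apply: row2P; rewrite /motion !(vec_x, vec_y).
  transitivity ((c ^+ 2 + s ^+ 2) * (x - u) + u); first by ring.
  by rewrite cs mul1r subrK.
transitivity ((c ^+ 2 + s ^+ 2) * (y - v) + v); first by ring.
by rewrite cs mul1r subrK.
Qed.

(** Balls of row vectors are boxes, which matches the boxes in [pinterior] and [pclosed]. *)
Lemma ball_vec (R : realType) (v w : 'rV[R]_2) (e : R) : 0 < e ->
  ball v e w <-> `|w 0 0 - v 0 0| < e /\ `|w 0 1 - v 0 1| < e.
Proof.
move=> e0; rewrite !(distrC (w _ _)); split=> [[_ h]|[h0 h1]].
  by split; [exact: (h 0 0)|exact: (h 0 1)].
split=> // i j; rewrite (ord1 i); have [->|->] : j = 0 \/ j = 1.
- by case: j => -[|[|//]] lt; [left|right]; apply/val_inj.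
- exact: h0.
- exact: h1.
Qed.

Lemma coords_closed (R : realType) (K : set 'rV[R]_2) : closed K -> pclosed (coords K).
Proof.
move=> clK x y H; apply: clK => B; rewrite -filter_from_ballE => -[e e0 Be].
have [x' [y' [h1 h2 h]]] := H (e / 2) (divr_gt0 e0 (ltr0n _ 2)).
exists (vec x' y'); split=> //; apply: Be; apply/(ball_vec _ _ e0).
have e2 : e / 2 < e by rewrite ltr_pdivrMr // ltr_pMr // ltr1n.
by rewrite !(vec_x, vec_y); split; exact: le_lt_trans e2.
Qed.

Lemma coords_interior (R : realType) (K : set 'rV[R]_2) (v : 'rV[R]_2) :
  K° v <-> pinterior (coords K) (v 0 0) (v 0 1).
Proof.
rewrite /interior -filter_from_ballE; split.
  move=> [e e0 Be]; exists (e / 2); first exact: divr_gt0.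
  move=> x y hx hy; apply: Be; apply/(ball_vec _ _ e0).
  have e2 : e / 2 < e by rewrite ltr_pdivrMr // ltr_pMr // ltr1n.
  by rewrite !(vec_x, vec_y); split; exact: le_lt_trans e2.
move=> [r r0 H]; exists r => // w /(ball_vec _ _ r0) [h0 h1]; rewrite -(vecK w).
by apply: H; exact: ltW.
Qed.

Lemma coords_convex (R : realType) (K : set 'rV[R]_2) : convex_set K -> pconvex (coords K).
Proof.
move=> cK x y x' y' t t0 t1 h h'; rewrite /coords.
have := cK (vec x' y') (vec x y) (Itv01 t0 t1); rewrite !inE => /(_ h' h).
congr K; apply: row2P; rewrite !mxE /= /unstable.onem; ring.
Qed.

(** The matrix is orthogonal, so its determinant is 1 or -1, and positivity leaves 1. Then
    [(a11 - a22) ^+ 2 + (a12 + a21) ^+ 2 = 0], which makes it a rotation. *)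
Lemma congruence_motion (R : realType) (f : 'rV[R]_2 -> 'rV[R]_2) :
  congruence f -> orientation_preserving f ->
  exists c s u v, c ^+ 2 + s ^+ 2 = 1 /\ f = motion c s u v.
Proof.
move=> [iso _] [A [b [detA fE]]].
have f0 z : f z 0 0 = z 0 0 * A 0 0 + z 0 1 * A 1 0 + b 0 0.
  rewrite fE !mxE !big_ord_recl big_ord0 addr0; congr (_ + z _ _ * A _ _ + _); exact/val_inj.
have f1 z : f z 0 1 = z 0 0 * A 0 1 + z 0 1 * A 1 1 + b 0 1.
  rewrite fE !mxE !big_ord_recl big_ord0 addr0; congr (_ + z _ _ * A _ _ + _); exact/val_inj.
have form x y : (x * A 0 0 + y * A 1 0) ^+ 2 + (x * A 0 1 + y * A 1 1) ^+ 2 = x ^+ 2 + y ^+ 2.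
  have /edist_eq := iso (vec x y) (vec 0 0).
  rewrite !f0 !f1 !(vec_x, vec_y) !mul0r !add0r !subr0 !addrK; exact.
rewrite det2 in detA.
move: (A 0 0) (A 0 1) (A 1 0) (A 1 1) (b 0 0) (b 0 1) f0 f1 form detA => a11 a12 a21 a22 u v.
move=> f0 f1 form detA.
have h1 := form 1 0; have h2 := form 0 1; have h3 := form 1 1.
have h4 : a11 * a21 + a12 * a22 = 0 by clear -h1 h2 h3; lra.
have {}h1 : a11 ^+ 2 + a12 ^+ 2 = 1 by clear -h1; lra.
have {}h2 : a21 ^+ 2 + a22 ^+ 2 = 1 by clear -h2; lra.
have det1 : a11 * a22 - a12 * a21 = 1.
  have : (a11 * a22 - a12 * a21) ^+ 2 = 1.
    transitivity ((a11 ^+ 2 + a12 ^+ 2) * (a21 ^+ 2 + a22 ^+ 2) - (a11 * a21 + a12 * a22) ^+ 2).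
      by ring.
    by rewrite h1 h2 h4 expr0n subr0 mulr1.
  by move/eqP; rewrite sqrf_eq1 => /orP[/eqP //|/eqP h]; rewrite h oppr_gt0 ltr10 in detA.
have : (a11 - a22) ^+ 2 + (a12 + a21) ^+ 2 = 0 by clear -h1 h2 det1; lra.
move/eqP; rewrite paddr_eq0 ?sqr_ge0 // !sqrf_eq0 subr_eq0 addr_eq0 => /andP[/eqP e1 /eqP e2].
exists a11, a12, u, v; split=> //; apply/funext => z; apply: row2P.
  by rewrite f0 /motion vec_x e2; ring.
by rewrite f1 /motion vec_y e1; ring.
Qed.

Lemma motion_orientation (R : realType) (c s u v : R) :
  c ^+ 2 + s ^+ 2 = 1 -> orientation_preserving (motion c s u v).
Proof.
move=> cs.
pose A : 'M[R]_2 := \matrix_(i, j) if i == j then c else if i == 0 then s else - s.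
exists A, (vec u v); split; first by rewrite det2 !mxE /= mulrN opprK -!expr2 cs ltr01.
move=> z; rewrite /motion; apply: row2P; rewrite !mxE !big_ord_recl big_ord0 !mxE /=.
  rewrite (_ : lift _ _ = 1 :> 'I_2); last exact/val_inj.
  by rewrite /=; ring.
rewrite (_ : lift _ _ = 1 :> 'I_2); last exact/val_inj.
by rewrite /=; ring.
Qed.

Lemma placed_image (R : realType) (f : 'rV[R]_2 -> 'rV[R]_2) (K : set 'rV[R]_2) :
  congruence f -> orientation_preserving f -> placed (coords K) (coords (f @` K)).
Proof.
move=> cf of_; have [c [s [u [v [cs ->]]]]] := congruence_motion cf of_.
rewrite motion_image //; exists c, (- s), (- (c * u + s * v)), (s * u - c * v).
by rewrite sqrrN.
Qed.

Lemma image_of_placed (R : realType) (K : set 'rV[R]_2) (A : R -> R -> Prop) :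
  placed (coords K) A ->
  exists f, [/\ congruence f, orientation_preserving f & coords (f @` K) = A].
Proof.
move=> [c [s [u [v [cs ->]]]]].
have cs' : c ^+ 2 + (- s) ^+ 2 = 1 by rewrite sqrrN.
exists (motion c (- s) (- (c * u + s * v)) (s * u - c * v)); split.
- exact: motion_congruence.
- exact: motion_orientation.
rewrite motion_image // opprK; f_equal.
- by transitivity ((c ^+ 2 + s ^+ 2) * u); [ring|rewrite cs mul1r].
- by transitivity ((c ^+ 2 + s ^+ 2) * v); [ring|rewrite cs mul1r].
Qed.

Lemma at_all_positions_coords (R : realType) (K L : set 'rV[R]_2) P Q :
  (forall M, Q M -> P (coords M)) -> for_all_positions K L Q ->
  at_all_positions (coords K) (coords L) P.
Proof.
move=> QP H A' B' /image_of_placed[f [cf of_ <-]] /image_of_placed[g [cg og <-]] [x [y int]].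
apply: (QP ((f @` K) `&` (g @` L))); apply: H => //.
by exists (vec x y); apply/coords_interior; rewrite vec_x vec_y.
Qed.

Lemma for_all_positions_coords (R : realType) (K L : set 'rV[R]_2) P Q :
  (forall M, P (coords M) -> Q M) -> at_all_positions (coords K) (coords L) P ->
  for_all_positions K L Q.
Proof.
move=> PQ H f g cf of_ cg og [z /coords_interior int]; apply: PQ.
by apply: H (placed_image K cf of_) (placed_image L cg og) _; exists (z 0 0), (z 0 1).
Qed.

Lemma admits_coords (R : realType) (M : set 'rV[R]_2) :
  admits_nontrivial_congruence M -> nontrivially_symmetric (coords M).
Proof.
move=> [f [[iso sur] nid fM]].
exists (fun x y => f (vec x y) 0 0), (fun x y => f (vec x y) 0 1); split.
- move=> x y x' y'; have /edist_eq := iso (vec x y) (vec x' y').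
  by rewrite !(vec_x, vec_y).
- move=> id; apply: nid; apply/funext => z; rewrite -(vecK z).
  by have [e1 e2] := id (z 0 0) (z 0 1); apply: row2P; rewrite ?(e1, e2) ?(vec_x, vec_y).
split=> x y Mxy; rewrite /coords.
  by rewrite vecK -fM; exists (vec x y).
have [z Mz zE] : (f @` M) (vec x y) by rewrite fM.
exists (z 0 0), (z 0 1); by rewrite /coords vecK zE vec_x vec_y.
Qed.

Lemma admits_involution (R : realType) (M : set 'rV[R]_2) (f : 'rV[R]_2 -> 'rV[R]_2) :
  involutive f -> (admits M f <-> forall z, M z -> M (f z)).
Proof.
move=> ff; split=> [E z Mz|H]; first by rewrite -E; exists z.
apply/seteqP; split=> [_ [z Mz <-]|z Mz]; first exact: H.
by exists (f z); [exact: H|rewrite ff].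
Qed.

Lemma admits_nontrivialP (R : realType) (M : set 'rV[R]_2) (f : 'rV[R]_2 -> 'rV[R]_2) :
  involutive f -> (forall x y, Defs.edist (f x) (f y) = Defs.edist x y) -> f <> id ->
  admits M f -> admits_nontrivial_congruence M.
Proof.
by move=> ff iso nid adm; exists f; split=> //; split=> // y; exists (f y); rewrite ff.
Qed.

Lemma point_symmetry_vec (R : realType) (p q x y : R) :
  point_symmetry (vec p q) (vec x y) = vec (2 * p - x) (2 * q - y).
Proof. by apply: row2P; rewrite /point_symmetry !mxE. Qed.

Lemma point_symmetryK (R : realType) (p : 'rV[R]_2) : involutive (point_symmetry p).
Proof. by move=> z; rewrite /point_symmetry subKr. Qed.

Lemma centrally_symmetricP (R : realType) (M : set 'rV[R]_2) :
  centrally_symmetric M <-> central2 (coords M).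
Proof.
split=> [[p /(admits_involution _ (point_symmetryK p)) H]|[p [q H]]].
  exists (p 0 0), (p 0 1) => x y /H.
  by rewrite -(vecK p) point_symmetry_vec !(vec_x, vec_y).
exists (vec p q); apply/(admits_involution _ (point_symmetryK _)) => z Mz.
by rewrite -(vecK z) point_symmetry_vec; apply: H; rewrite /coords vecK.
Qed.

Lemma central_admits (R : realType) (M : set 'rV[R]_2) :
  centrally_symmetric M -> admits_nontrivial_congruence M.
Proof.
move=> [p]; apply: admits_nontrivialP.
- exact: point_symmetryK.
- by move=> x y; apply/edist_eq; rewrite /point_symmetry !mxE; ring.
move=> /(congr1 (fun f : 'rV[R]_2 -> 'rV[R]_2 => f (vec (p 0 0 + 1) 0) 0 0)); rewrite /point_symmetry !mxE /=.
by clear; lra.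
Qed.

(** Normals in [line_reflection] are arbitrary nonzero vectors; the scaling by [l] reduces them to
    unit normals. *)
Lemma line_reflection_vec (R : realType) (n1 n2 c x y l : R) :
  n1 ^+ 2 + n2 ^+ 2 = 1 -> l != 0 ->
  line_reflection (vec (l * n1) (l * n2)) (l * c) (vec x y) =
  vec (x - 2 * (n1 * x + n2 * y - c) * n1) (y - 2 * (n1 * x + n2 * y - c) * n2).
Proof.
move=> nn l0; rewrite /line_reflection !dotE !(vec_x, vec_y).
have -> : l * n1 * (l * n1) + l * n2 * (l * n2) = l ^+ 2.
  by transitivity (l ^+ 2 * (n1 ^+ 2 + n2 ^+ 2)); [ring|rewrite nn mulr1].
by apply: row2P; rewrite !mxE /=; field.
Qed.

Lemma unit_normal (R : realType) (n : 'rV[R]_2) : n != 0 ->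
  exists n1 n2 l, [/\ n1 ^+ 2 + n2 ^+ 2 = 1, 0 < l & n = vec (l * n1) (l * n2)].
Proof.
move=> n0; have [|n1 [n2 [l [nn l0 E1 E2]]]] := @unit_direction R (n 0 0) (n 0 1).
  apply: contra n0; rewrite paddr_eq0 ?sqr_ge0 // !sqrf_eq0 => /andP[/eqP h1 /eqP h2].
  by apply/eqP/row2P; rewrite mxE.
by exists n1, n2, l; split=> //; rewrite -E1 -E2 vecK.
Qed.

Lemma unit_vec_neq0 (R : realType) (n1 n2 : R) : n1 ^+ 2 + n2 ^+ 2 = 1 -> vec n1 n2 != 0.
Proof.
move=> nn; apply/eqP => E.
have e1 := congr1 (fun w : 'rV[R]_2 => w 0 0) E; have e2 := congr1 (fun w : 'rV[R]_2 => w 0 1) E.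
rewrite /= !(vec_x, vec_y) !mxE in e1 e2.
by move/eqP: nn; rewrite e1 e2 expr0n addr0 eq_sym oner_eq0.
Qed.

Lemma line_reflection_isometry (R : realType) (n : 'rV[R]_2) c : n != 0 ->
  [/\ involutive (line_reflection n c),
      forall x y, Defs.edist (line_reflection n c x) (line_reflection n c y) = Defs.edist x y &
      line_reflection n c <> id].
Proof.
move=> n0; have [n1 [n2 [l [nn l0 ->]]]] := unit_normal n0.
have ln : l != 0 by rewrite gt_eqF.
rewrite -[c](divfK ln) (mulrC _ l); move: (c / l) => {}c.
have E z : line_reflection (vec (l * n1) (l * n2)) (l * c) z = 
    vec (z 0 0 - 2 * (n1 * z 0 0 + n2 * z 0 1 - c) * n1)
        (z 0 1 - 2 * (n1 * z 0 0 + n2 * z 0 1 - c) * n2).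
  by rewrite -{1}(vecK z) line_reflection_vec.
have val z : n1 * line_reflection (vec (l * n1) (l * n2)) (l * c) z 0 0 +
    n2 * line_reflection (vec (l * n1) (l * n2)) (l * c) z 0 1 - c =
    - (n1 * z 0 0 + n2 * z 0 1 - c).
  rewrite E !(vec_x, vec_y).
  transitivity (n1 * z 0 0 + n2 * z 0 1 - c -
    2 * (n1 * z 0 0 + n2 * z 0 1 - c) * (n1 ^+ 2 + n2 ^+ 2)); first by ring.
  by rewrite nn; ring.
split.
- move=> z; rewrite E val !E !(vec_x, vec_y); apply: row2P; rewrite !(vec_x, vec_y); ring.
- move=> x y; apply/edist_eq; rewrite !E !(vec_x, vec_y).
  have [iso _] := @reflection_self_map R (fun _ _ => True) n1 n2 c nn (fun _ _ h => h).
  exact: iso.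
move=> /(congr1 (fun f : 'rV[R]_2 -> 'rV[R]_2 => n1 * f (vec (n1 * (c + 1)) (n2 * (c + 1))) 0 0 +
  n2 * f (vec (n1 * (c + 1)) (n2 * (c + 1))) 0 1 - c)); rewrite val /= !(vec_x, vec_y).
have -> : n1 * (n1 * (c + 1)) + n2 * (n2 * (c + 1)) = c + 1.
  by transitivity ((n1 ^+ 2 + n2 ^+ 2) * (c + 1)); [ring|rewrite nn mul1r].
by clear; lra.
Qed.

Lemma axially_symmetricP (R : realType) (M : set 'rV[R]_2) :
  axially_symmetric M <-> axial2 (coords M).
Proof.
split=> [[n [c [n0]]]|[n1 [n2 [c [nn H]]]]].
  have [inv _ _] := line_reflection_isometry c n0.
  move=> /(admits_involution _ inv) {inv}; have [n1 [n2 [l [nn l0 ->]]]] := unit_normal n0.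
  have ln : l != 0 by rewrite gt_eqF.
  rewrite -[c](divfK ln) (mulrC _ l); move: (c / l) => {}c H.
  by exists n1, n2, c; split=> // x y /H; rewrite line_reflection_vec.
have n0 := unit_vec_neq0 nn; exists (vec n1 n2), c; split=> //.
have [inv _ _] := line_reflection_isometry c n0.
apply/(admits_involution _ inv) => z Mz.
have := line_reflection_vec c (z 0 0) (z 0 1) nn (oner_neq0 R).
by rewrite !mul1r vecK => ->; apply: H; rewrite /coords vecK.
Qed.

Lemma axial_admits (R : realType) (M : set 'rV[R]_2) :
  axially_symmetric M -> admits_nontrivial_congruence M.
Proof.
move=> [n [c [n0]]]; have [inv iso nid] := line_reflection_isometry c n0.
exact: admits_nontrivialP.
Qed.

Lemma edist_le (R : realType) (u v : 'rV[R]_2) (r : R) : 0 < r ->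
  Defs.edist u v <= r <-> disk_at (u 0 0) (u 0 1) r (v 0 0) (v 0 1).
Proof.
move=> r0; rewrite edistE /disk_at.
have -> : (u 0 0 - v 0 0) ^+ 2 + (u 0 1 - v 0 1) ^+ 2 =
  (v 0 0 - u 0 0) ^+ 2 + (v 0 1 - u 0 1) ^+ 2 by ring.
rewrite -[X in _ <= X <-> _](gtr0_norm r0) -(sqrtr_sqr r) ler_psqrt // nnegrE ?sqr_ge0 //.
by rewrite addr_ge0 // sqr_ge0.
Qed.

Lemma is_diskP (R : realType) (K : set 'rV[R]_2) : is_disk K <-> disk2 (coords K).
Proof.
split=> [[a [r [r0 ->]]]|[a [b [r [r0 E]]]]].
  exists (a 0 0), (a 0 1), r; split=> //; apply: eq_region => x y.
  by rewrite /coords /= edist_le // vec_x vec_y.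
exists (vec a b), r; split=> //; apply: coords_inj; rewrite E.
by apply: eq_region => x y; rewrite /coords /= edist_le // !(vec_x, vec_y).
Qed.

Lemma is_half_planeP (R : realType) (K : set 'rV[R]_2) :
  is_half_plane K <-> half_plane2 (coords K).
Proof.
split=> [[n [c [n0 ->]]]|[n1 [n2 [c [nn E]]]]].
  have [n1 [n2 [l [nn l0 ->]]]] := unit_normal n0.
  exists n1, n2, (c / l); split=> //; apply: eq_region => x y.
  rewrite /coords /= dotE !(vec_x, vec_y) /half_plane_at ler_pdivlMr //.
  by have -> : l * n1 * x + l * n2 * y = (n1 * x + n2 * y) * l by ring.
exists (vec n1 n2), c; split; first exact: unit_vec_neq0.
apply: coords_inj; rewrite E; apply: eq_region => x y.
by rewrite /coords /= dotE !(vec_x, vec_y).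
Qed.

Lemma is_stripP (R : realType) (K : set 'rV[R]_2) : is_strip K <-> strip2 (coords K).
Proof.
split=> [[n [c [d [n0 cd ->]]]]|[n1 [n2 [c [d [nn cd E]]]]]].
  have [n1 [n2 [l [nn l0 ->]]]] := unit_normal n0.
  exists n1, n2, (c / l), (d / l); split=> //; first by rewrite ltr_pM2r ?invr_gt0.
  apply: eq_region => x y.
  rewrite /coords /= dotE !(vec_x, vec_y) /strip_at ler_pdivlMr // ler_pdivrMr //.
  have -> : l * n1 * x + l * n2 * y = (n1 * x + n2 * y) * l by ring.
  by split=> [/andP[]|[-> ->]].
exists (vec n1 n2), c, d; split=> //; first exact: unit_vec_neq0.
apply: coords_inj; rewrite E; apply: eq_region => x y.
by rewrite /coords /= dotE !(vec_x, vec_y) /strip_at; split=> [[-> ->]|/andP[]].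
Qed.

Lemma special_pairP (R : realType) (K L : set 'rV[R]_2) :
  special_pair K L <-> special2 (coords K) (coords L).
Proof.
rewrite /special_pair /special2 !(propext (is_diskP _)) !(propext (is_stripP _)).
by rewrite !(propext (is_half_planeP _)).
Qed.

Lemma placed_congruent (R : realType) (K L : set 'rV[R]_2) :
  placed (coords K) (coords L) -> congruent K L.
Proof. by move=> /image_of_placed[f [cf _ /coords_inj E]]; exists f. Qed.

Lemma congruent_same_size (R : realType) (K L : set 'rV[R]_2) :
  congruent K L -> same_size (coords K) (coords L).
Proof.
move=> [f [[iso sur] E]] r.
have inj x y : f x = f y -> x = y.
  move=> h; have /edist_eq := iso x y; rewrite h !subrr expr0n addr0 => /esym/eqP.
  rewrite paddr_eq0 ?sqr_ge0 // !sqrf_eq0 !subr_eq0 => /andP[/eqP h0 /eqP h1].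
  exact: row2P.
have memE z : L (f z) <-> K z.
  rewrite -E; split=> [[w Kw /inj <- //]|Kz]; by exists z.
have diskE x y : disk_at (f x 0 0) (f x 0 1) r (f y 0 0) (f y 0 1) <->
    disk_at (x 0 0) (x 0 1) r (y 0 0) (y 0 1).
  by have /edist_eq := iso y x; rewrite /disk_at => ->.
split=> -[a [b H]].
  exists (f (vec a b) 0 0), (f (vec a b) 0 1) => x y; have [z zE] := sur (vec x y).
  have -> : x = f z 0 0 by rewrite zE vec_x.
  have -> : y = f z 0 1 by rewrite zE vec_y.
  move=> /diskE; rewrite /coords vecK memE !(vec_x, vec_y) => /H.
  by rewrite /coords vecK.
have [w wE] := sur (vec a b); exists (w 0 0), (w 0 1) => x y h.
rewrite /coords -memE -(vecK (f _)); apply: H.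
have -> : a = f w 0 0 by rewrite wE vec_x.
have -> : b = f w 0 1 by rewrite wE vec_y.
by apply/diskE; rewrite vec_x vec_y.
Qed.

Theorem theorem3 (R : realType) (K L : set 'rV[R]_2)
    (K_closed : closed K) (K_convex : convex_set K)
    (K_proper : K <> setT) (K_int : K° !=set0)
    (L_closed : closed L) (L_convex : convex_set L)
    (L_proper : L <> setT) (L_int : L° !=set0) :
  [/\ for_all_positions K L (@admits_nontrivial_congruence R)
        <-> special_pair K L,
      for_all_positions K L (@centrally_symmetric R)
        <-> ([/\ is_disk K, is_disk L & congruent K L] \/
             (is_strip K /\ is_strip L))
    & for_all_positions K L (@axially_symmetric R)
        <-> (special_pair K L /\
             (is_strip K -> is_strip L -> congruent K L))].
Proof.
have outside (M : set 'rV[R]_2) : M <> setT -> exists x y, ~ coords M x y.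
  move=> nM; apply: contrapT => h; apply: nM; apply/seteqP; split=> // z _.
  apply: contrapT => nz; apply: h; exists (z 0 0), (z 0 1); by rewrite /coords vecK.
have [xK [yK oK]] := outside K K_proper; have [xL [yL oL]] := outside L L_proper.
have [zK /coords_interior iK] := K_int; have [zL /coords_interior iL] := L_int.
have clK := coords_closed K_closed; have clL := coords_closed L_closed.
have cK := coords_convex K_convex; have cL := coords_convex L_convex.
(* The hypothesis is symmetric in the two sets, so the classification applies to each of them in
   turn. *)
have special : at_all_positions (coords K) (coords L) (@nontrivially_symmetric R) ->
    special_pair K L.
  move=> H; apply/special_pairP; apply: round_pair => //.
    exact: (round_of_symmetric (symmetric_meetsP H) clK cK clL cL iK oK iL oL).
  have H' := at_all_positionsC H.
  exact: (round_of_symmetric (symmetric_meetsP H') clL cL clK cK iL oL iK oK).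
split; split.
- by move=> /(at_all_positions_coords (@admits_coords R)).
(* Special pairs are axially symmetric in all positions, except that two strips may differ in width;
   these are centrally symmetric instead. *)
- move=> /special_pairP/axial_positions[H|[sK sL]].
    apply: (for_all_positions_coords _ H) => M /axially_symmetricP; exact: axial_admits.
  apply: (for_all_positions_coords _ (strips_positions sK sL)) => M /centrally_symmetricP.
  exact: central_admits.
- move=> /(at_all_positions_coords (fun M => proj1 (centrally_symmetricP M))) H.
  have S := special (at_all_positions_imp (@central_nontrivial R) H).
  have [[dK dL p]|[sK sL]] := central_pair H (proj1 (special_pairP K L) S).
    by left; split; [exact/is_diskP|exact/is_diskP|exact: placed_congruent].
  by right; split; exact/is_stripP.
- move=> h; apply: (for_all_positions_coords (fun M => proj2 (centrally_symmetricP M))).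
  apply: central_positions; case: h => [[dK dL cKL]|[sK sL]]; [left|right].
    by split; [exact/is_diskP|exact/is_diskP|exact: congruent_same_size].
  by split; exact/is_stripP.
- move=> /(at_all_positions_coords (fun M => proj1 (axially_symmetricP M))) H.
  split; first exact: special (at_all_positions_imp (@axial_nontrivial R) H).
  move=> /is_stripP sK /is_stripP sL; apply: placed_congruent; exact: axial_pair H sK sL.
- move=> [/special_pairP S same].
  apply: (for_all_positions_coords (fun M => proj2 (axially_symmetricP M))).
  have [//|[sK sL]] := axial_positions S; apply: axial_strips_positions => //.
  by apply: congruent_same_size; apply: same; exact/is_stripP.
Qed.
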